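(* Let $A\to B$ be a surjective map of commutative noetherian local rings with common residue field $k$, whose kernel is generated by an $A$-regular sequence, and let $M$ be a finitely generated $B$-module whose projective dimension over $A$ is finite. If $A$ is Gorenstein, then the leading terms of the quasi-polynomials eventually modeling the Betti numbers $\beta_i^B(M)=\mathrm{rank}_k\mathrm{Ext}_B^i(M,k)$ and the Bass numbers $\mu^i_B(M)=\mathrm{rank}_k\mathrm{Ext}_B^i(k,M)$ of $M$ are the same.
   Context: In this setting each of the sequences $\beta_i^B(M)$ and $\mu_B^i(M)$ is eventually given by a quasi-polynomial of period two: there are polynomials $q_{\mathrm{ev}},q_{\mathrm{odd}}$ with the same degree and leading coefficient (or both zero) such that for all $i\gg0$ the $i$-th term is $q_{\mathrm{ev}}(i)$ for $i$ even and $q_{\mathrm{odd}}(i)$ for $i$ odd. The leading term of the quasi-polynomial is the common leading term of $q_{\mathrm{ev}}$ and $q_{\mathrm{odd}}$. *)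

(* Defs.v *)
From HB Require Import structures.
From mathcomp Require Import all_boot all_algebra.
From mathcomp Require Import boolp classical_sets.

Set Implicit Arguments.
Unset Strict Implicit.
Unset Printing Implicit Defensive.

Import GRing.Theory.
Local Open Scope ring_scope.

Definition surjective (T U : Type) (f : T -> U) : Prop :=
  forall y, exists x, f x = y.

Definition in_ideal_gen (R : comNzRingType) (s : seq R) (x : R) : Prop :=
  exists c : 'I_(size s) -> R, x = \sum_i c i * s`_i.

(* Submodules of [R^o] are exactly the ideals of [R], the unit ideal included;
   [idealr_closed] below describes the proper ideals only. *)
Definition noetherian (R : comNzRingType) : Prop :=
  forall I : {pred R^o}, submod_closed I ->
  exists s : seq R, forall x : R, x \in I <-> in_ideal_gen s x.

Definition maximal_ideal (R : comNzRingType) (I : {pred R}) : Prop :=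
  idealr_closed I /\
  forall J : {pred R}, idealr_closed J -> {subset I <= J} -> J =i I.

Definition local_ring (R : comNzRingType) : Prop :=
  exists I : {pred R}, maximal_ideal I /\
    forall J : {pred R}, maximal_ideal J -> J =i I.

(* Each [s`_i] is a nonzerodivisor on [R / (s`_0, ..., s`_(i-1))], and
   [R / (s)] is nonzero.  The empty sequence is regular. *)
Definition regular_sequence (R : comNzRingType) (s : seq R) : Prop :=
  (forall i, (i < size s)%N -> forall x : R,
     in_ideal_gen (take i s) (s`_i * x) -> in_ideal_gen (take i s) x) /\
  ~ in_ideal_gen s 1.

Definition restr (R S : nzRingType) (f : {rmorphism R -> S}) (V : lmodType S)
  : Type := V.

Section Restriction.
Variables (R S : nzRingType) (f : {rmorphism R -> S}) (V : lmodType S).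

HB.instance Definition _ := GRing.Zmodule.copy (restr f V) V.

Let scale (a : R) (v : restr f V) : restr f V := f a *: (v : V).

Let scaleA a b v : scale a (scale b v) = scale (a * b) v.
Proof. by rewrite /scale scalerA rmorphM. Qed.

Let scale1 : left_id 1 scale.
Proof. by move=> v; rewrite /scale rmorph1 scale1r. Qed.

Let scaleDr : right_distributive scale +%R.
Proof. by move=> a u v; rewrite /scale scalerDr. Qed.

Let scaleDl v : {morph scale^~ v : a b / a + b}.
Proof. by move=> a b; rewrite /scale rmorphD scalerDl. Qed.

HB.instance Definition _ := GRing.Zmodule_isLmodule.Build R (restr f V)
  scaleA scale1 scaleDr scaleDl.

End Restriction.

Definition finitely_generated (R : nzRingType) (M : lmodType R) : Prop :=
  exists (n : nat) (g : 'I_n -> M),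
    forall x, exists c : 'I_n -> R, x = \sum_i c i *: g i.

Definition projective (R : nzRingType) (P : lmodType R) : Prop :=
  forall (U V : lmodType R) (g : {linear U -> V}) (f : {linear P -> V}),
    surjective g -> exists h : {linear P -> U}, forall x, g (h x) = f x.

Definition injective_module (R : nzRingType) (E : lmodType R) : Prop :=
  forall (U V : lmodType R) (g : {linear U -> V}) (f : {linear U -> E}),
    injective g -> exists h : {linear V -> E}, forall x, h (g x) = f x.

(* ... -> P_1 -> P_0 -> M -> 0 *)
Record proj_resolution (R : nzRingType) (M : lmodType R) := ProjResolution {
  pres_obj : nat -> lmodType R;
  pres_diff : forall n, {linear pres_obj n.+1 -> pres_obj n};
  pres_aug : {linear pres_obj 0 -> M};
  pres_projective : forall n, projective (pres_obj n);
  pres_aug_surj : surjective pres_aug;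
  pres_exact0 : forall x : pres_obj 0,
    pres_aug x = 0 <-> exists y, pres_diff 0 y = x;
  pres_exactS : forall n (x : pres_obj n.+1),
    pres_diff n x = 0 <-> exists y, pres_diff n.+1 y = x
}.

(* 0 -> M -> E_0 -> E_1 -> ... *)
Record inj_resolution (R : nzRingType) (M : lmodType R) := InjResolution {
  ires_obj : nat -> lmodType R;
  ires_diff : forall n, {linear ires_obj n -> ires_obj n.+1};
  ires_coaug : {linear M -> ires_obj 0};
  ires_injective : forall n, injective_module (ires_obj n);
  ires_coaug_inj : injective ires_coaug;
  ires_exact0 : forall x : ires_obj 0,
    ires_diff 0 x = 0 <-> exists y, ires_coaug y = x;
  ires_exactS : forall n (x : ires_obj n.+1),
    ires_diff n.+1 x = 0 <-> exists y, ires_diff n y = x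
}.

Definition finite_proj_dim (R : nzRingType) (M : lmodType R) : Prop :=
  exists (P : proj_resolution M) (d : nat),
    forall n, (d < n)%N -> forall x : pres_obj P n, x = 0.

Definition finite_inj_dim (R : nzRingType) (M : lmodType R) : Prop :=
  exists (E : inj_resolution M) (d : nat),
    forall n, (d < n)%N -> forall x : ires_obj E n, x = 0.

Definition gorenstein_local (R : comNzRingType) : Prop :=
  [/\ noetherian R, local_ring R & finite_inj_dim (R^o : lmodType R)].

(* Ext^i(U, V) is the cohomology of Hom(P, V), for P a projective resolution
   of U. *)

Definition cocycle (R : nzRingType) (U V : lmodType R)
    (P : proj_resolution U) (i : nat) (f : pres_obj P i -> V) : Prop :=
  forall x, f (pres_diff P i x) = 0.

Definition coboundary (R : nzRingType) (U V : lmodType R)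
    (P : proj_resolution U) (i : nat) : (pres_obj P i -> V) -> Prop :=
  match i return (pres_obj P i -> V) -> Prop with
  | 0 => fun f => forall x, f x = 0
  | j.+1 => fun f => exists g : {linear pres_obj P j -> V},
                       forall x, f x = g (pres_diff P j x)
  end.

(* [pi : R -> k] is the residue map of a local ring [R] and [U] or [V] is a
   [k]-vector space, so that Ext^i_R(U, V) is an [R]-module killed by [ker pi],
   i.e. a [k]-vector space.  The cocycles [z j] represent a [k]-basis of it;
   scalars in [k] are written as images of elements of [R]. *)
Definition has_ext_rank (R : comNzRingType) (k : fieldType)
    (pi : {rmorphism R -> k}) (U V : lmodType R) (P : proj_resolution U)
    (i n : nat) : Prop :=
  exists z : 'I_n -> {linear pres_obj P i -> V},
  [/\ forall j, cocycle (z j),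
      forall f : {linear pres_obj P i -> V}, cocycle f ->
        exists c : 'I_n -> R, coboundary (fun x => f x - \sum_j c j *: z j x)
    & forall c : 'I_n -> R, coboundary (fun x => \sum_j c j *: z j x) ->
        forall j, pi (c j) = 0].

(* The rank does not depend on the resolution.  The default value 0 is only
   used when the rank is infinite, which does not happen for finitely generated
   modules over a noetherian local ring. *)
Definition ext_rank (R : comNzRingType) (k : fieldType)
    (pi : {rmorphism R -> k}) (i : nat) (U V : lmodType R) : nat :=
  xget 0%N (fun n => exists P : proj_resolution U, has_ext_rank pi V P i n).

Definition betti (R : comNzRingType) (k : fieldType) (pi : {rmorphism R -> k})
    (M : lmodType R) (i : nat) : nat :=
  ext_rank pi i M (restr pi k^o).

Definition bass (R : comNzRingType) (k : fieldType) (pi : {rmorphism R -> k})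
    (M : lmodType R) (i : nat) : nat :=
  ext_rank pi i (restr pi k^o) M.

(* Equal sizes means equal degrees, or both polynomials zero. *)
Record quasi_poly2 := QuasiPoly2 {
  qp_ev : {poly rat};
  qp_odd : {poly rat};
  qp_size : size qp_ev = size qp_odd;
  qp_lead : lead_coef qp_ev = lead_coef qp_odd
}.

Definition leading_term (q : quasi_poly2) : {poly rat} :=
  lead_coef (qp_ev q) *: 'X^((size (qp_ev q)).-1).

Definition eventually_modeled (b : nat -> nat) (q : quasi_poly2) : Prop :=
  exists N : nat, forall i, (N <= i)%N ->
    (b i)%:R = (if odd i then qp_odd q else qp_ev q).[i%:R].

(* Main.v *)
(* A minimal resolution of M over B = A/(f_0, ..., f_(c-1)), cut far to the left
   and continued to the right by duality, is a complex T of free modules indexed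
   by Z; since A is Gorenstein, T and its transpose are exact.  The ranks of T
   near -oo are the Betti numbers of M; near +oo they are the Bass numbers,
   because factoring out a maximal regular sequence (Rees) leads to the case where
   Hom(k, -) is computed by a one-dimensional socle.

   Each f_j yields an operator of degree 2 on T (x) k.  The cone of the last
   operator is a complex of free modules over A/(f_0, ..., f_(c-2)); after c steps
   one reaches a complex over A whose cohomology after tensoring with k vanishes
   far to the left, M having finite projective dimension over A, hence everywhere,
   A having finite injective dimension.  By Hilbert's basis theorem
   H(T (x) k) is therefore noetherian over k[X_0, ..., X_(c-1)] at both ends, and
   the Hilbert-Serre theorem provides quasi-polynomials.  Localizing at a minimal
   prime of B, the lengths of consecutive syzygies add up to a constant multiple of
   the rank, which forces equal leading terms in even and odd degrees.

   The two ends are compared by induction on the degree of the quasi-polynomial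
   at +oo.  Prime avoidance gives a form g in the operators which acts injectively
   far away on both sides, and passing to the cone of g replaces the ranks by
   their differences.  In degree 0 the cone vanishes far to the right, hence
   everywhere by Nakayama's lemma, and the ranks of T are periodic on all of Z. *)

Require Import Defs.
From HB Require Import structures.
From mathcomp Require Import all_boot all_order all_algebra.
From mathcomp Require Import boolp classical_sets.
From mathcomp Require Import zify ring lra.

Set Implicit Arguments.
Unset Strict Implicit.
Unset Printing Implicit Defensive.
Import Order.TTheory GRing.Theory Num.Theory.
Local Open Scope ring_scope.

(** * Ideals, regular sequences and noetherian rings *)

(** No quotient ring is ever formed: a complex over [A/(f_0, ..., f_(i-1))] is a family of matrices
    over [A] whose consecutive products have entries in [Id f i], and exactness is stated modulo
    this ideal. All rings between [A] and a quotient of depth zero then share one type, and the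
    operators are the coefficients of the [f j] in the product of two consecutive matrices. Finite
    injective dimension acts through [ext_vanish], which turns exact rows into exact columns with a
    delay of [del] degrees; a complex exact in all degrees does not notice the delay, which is why
    the resolution is continued to an unbounded complex. In the comparison of the two ends, a cone
    measures a cokernel on the right and a kernel on the left, and the latter sits one degree off,
    so the parities at the two ends drift apart during the induction. Hence sums of two consecutive
    ranks are compared, and the equality of even and odd leading terms separates the summands at the
    very end. *)

Section Ideals.
Variable A : comNzRingType.

Definition ideal (I : A -> Prop) : Prop :=
  [/\ I 0, forall x y, I x -> I y -> I (x + y) & forall a x, I x -> I (a * x)].

Definition inI (I : A -> Prop) (p q : nat) (M : 'M[A]_(p, q)) : Prop :=
  forall i j, I (M i j).

Section OneIdeal.
Variables (I : A -> Prop) (idI : ideal I).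

Lemma ideal0 : I 0. Proof. by case: idI. Qed.
Lemma idealD x y : I x -> I y -> I (x + y). Proof. by case: idI => _ + _; apply. Qed.
Lemma idealM a x : I x -> I (a * x). Proof. by case: idI => _ _; apply. Qed.
Lemma ideal_mulr a x : I x -> I (x * a). Proof. by rewrite mulrC; apply: idealM. Qed.
Lemma idealN x : I x -> I (- x). Proof. by rewrite -mulN1r; apply: idealM. Qed.
Lemma idealB x y : I x -> I y -> I (x - y).
Proof. by move=> Ix Iy; apply: idealD => //; apply: idealN. Qed.

Lemma ideal_sum (T : Type) (r : seq T) (P : pred T) (F : T -> A) :
  (forall i, P i -> I (F i)) -> I (\sum_(i <- r | P i) F i).
Proof. by move=> IF; elim/big_ind: _ => //; [apply: ideal0|apply: idealD]. Qed.

Lemma inI0 p q : inI I (0 : 'M_(p, q)).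
Proof. by move=> i j; rewrite mxE; apply: ideal0. Qed.
Lemma inID p q (M N : 'M_(p, q)) : inI I M -> inI I N -> inI I (M + N).
Proof. by move=> IM IN i j; rewrite mxE; apply: idealD. Qed.
Lemma inIN p q (M : 'M_(p, q)) : inI I M -> inI I (- M).
Proof. by move=> IM i j; rewrite mxE; apply: idealN. Qed.
Lemma inIB p q (M N : 'M_(p, q)) : inI I M -> inI I N -> inI I (M - N).
Proof. by move=> IM IN; apply: inID => //; apply: inIN. Qed.
Lemma inIZ p q a (M : 'M_(p, q)) : inI I M -> inI I (a *: M).
Proof. by move=> IM i j; rewrite mxE; apply: idealM. Qed.
Lemma inIMl p q r (M : 'M_(p, q)) (N : 'M_(q, r)) : inI I M -> inI I (M *m N).
Proof. by move=> IM i j; rewrite mxE; apply: ideal_sum => l _; apply: ideal_mulr. Qed.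
Lemma inIMr p q r (M : 'M_(p, q)) (N : 'M_(q, r)) : inI I N -> inI I (M *m N).
Proof. by move=> IM i j; rewrite mxE; apply: ideal_sum => l _; apply: idealM. Qed.
Lemma inIBC p q (M N : 'M_(p, q)) : inI I (M - N) -> inI I (N - M).
Proof. by move=> /inIN; rewrite opprB. Qed.
Lemma inI_trans p q (M N P : 'M_(p, q)) :
  inI I (M - N) -> inI I (N - P) -> inI I (M - P).
Proof. by move=> MN /(inID MN); rewrite addrA subrK. Qed.
Lemma inI_addl p q (M N : 'M_(p, q)) : inI I (M - N) -> inI I N -> inI I M.
Proof. by move=> MN /(inID MN); rewrite subrK. Qed.

Lemma inI_tr p q (M : 'M_(p, q)) : inI I M -> inI I M^T.
Proof. by move=> IM i j; rewrite mxE. Qed.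
Lemma inI_trE p q (M : 'M_(p, q)) : inI I M^T <-> inI I M.
Proof. by split=> [/inI_tr|/inI_tr] //; rewrite trmxK. Qed.

Lemma inI_row p q (M : 'M_(p, q)) : (forall i, inI I (row i M)) <-> inI I M.
Proof.
split=> IM i; first by move=> j; have := IM i 0 j; rewrite mxE.
by move=> a j; rewrite mxE.
Qed.

Lemma inI_row_mx p q1 q2 (M : 'M_(p, q1)) (N : 'M_(p, q2)) :
  inI I (row_mx M N) <-> inI I M /\ inI I N.
Proof.
split=> [H|[H1 H2] i j].
  by split=> i j; [have := H i (lshift _ j); rewrite row_mxEl
                  |have := H i (rshift _ j); rewrite row_mxEr].
by rewrite mxE; case: splitP.
Qed.

Lemma inI_col_mx p1 p2 q (M : 'M_(p1, q)) (N : 'M_(p2, q)) :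
  inI I (col_mx M N) <-> inI I M /\ inI I N.
Proof. by rewrite -inI_trE tr_col_mx inI_row_mx !inI_trE. Qed.

End OneIdeal.

Lemma inI_sub (I J : A -> Prop) p q (M : 'M_(p, q)) :
  (forall x, I x -> J x) -> inI I M -> inI J M.
Proof. by move=> IJ IM i j; apply: IJ. Qed.

End Ideals.

Section Regular.
Variables (A : comNzRingType) (f : nat -> A).

Definition Id (i : nat) (x : A) : Prop :=
  exists C : nat -> A, x = \sum_(j < i) f j * C j.

Lemma Id_ideal i : ideal (Id i).
Proof.
split=> [|x y [C ->] [C' ->]|a x [C ->]].
- by exists (fun=> 0); rewrite big1 // => j _; rewrite mulr0.
- exists (fun j => C j + C' j); rewrite -big_split /=.
  by apply: eq_bigr => j _; rewrite mulrDr.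
- exists (fun j => a * C j); rewrite mulr_sumr.
  by apply: eq_bigr => j _; rewrite mulrCA.
Qed.

Lemma Id_mx i p q (M : 'M_(p, q)) :
  inI (Id i) M <-> exists C : nat -> 'M_(p, q), M = \sum_(j < i) f j *: C j.
Proof.
split=> [IM|[C ->] a b].
  have [C CE] := choice (fun ab : 'I_p * 'I_q => IM ab.1 ab.2).
  exists (fun j => \matrix_(a, b) C (a, b) j).
  apply/matrixP => a b; rewrite (CE (a, b)) summxE.
  by apply: eq_bigr => j _; rewrite !mxE.
exists (fun j => C j a b); rewrite summxE.
by apply: eq_bigr => j _; rewrite mxE.
Qed.

Lemma IdS i p q (M : 'M_(p, q)) :
  inI (Id i.+1) M <-> exists C, inI (Id i) (M - f i *: C).
Proof.
rewrite Id_mx; split=> [[C ->]|[C /Id_mx[D]]].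
  by exists (C i); apply/Id_mx; exists C; rewrite big_ord_recr /= addrK.
move/(canRL (subrK _)) => ->.
exists (fun j => if j == i then C else D j).
rewrite big_ord_recr /= eqxx; congr (_ + _).
by apply: eq_bigr => j _; rewrite (ltn_eqF (ltn_ord j)).
Qed.

Lemma Id_gen i j : (j < i)%N -> Id i (f j).
Proof.
move=> ji; exists (fun l => (l == j)%:R).
rewrite (bigD1 (Ordinal ji)) //= eqxx mulr1 big1 ?addr0 // => l lj.
by rewrite -val_eqE /= in lj; rewrite (negbTE lj) mulr0.
Qed.

Lemma Id_leq i i' x : (i <= i')%N -> Id i x -> Id i' x.
Proof.
move=> ii' [C ->]; apply: ideal_sum; first exact: Id_ideal.
move=> j _; apply: ideal_mulr; first exact: Id_ideal.
by apply: Id_gen; apply: leq_trans ii'.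
Qed.

Lemma inId_leq i i' p q (M : 'M_(p, q)) :
  (i <= i')%N -> inI (Id i) M -> inI (Id i') M.
Proof. by move=> ii'; apply: inI_sub => x; apply: Id_leq. Qed.

Lemma Id0 p q (M : 'M_(p, q)) : inI (Id 0) M <-> M = 0.
Proof.
rewrite Id_mx; split=> [[C ->]|->]; first by rewrite big_ord0.
by exists (fun=> 0); rewrite big_ord0.
Qed.

Definition regular (mm : nat) : Prop :=
  forall i x, (i < mm)%N -> Id i (f i * x) -> Id i x.

Variables (mm : nat) (reg : regular mm).

Lemma reg_mx i p q (M : 'M_(p, q)) :
  (i < mm)%N -> inI (Id i) (f i *: M) -> inI (Id i) M.
Proof. by move=> im IM a b; apply: reg => //; have := IM a b; rewrite mxE. Qed.

(** The relations of a regular sequence are generated by the Koszul relations, whose coefficients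
    lie in the ideal. This makes the coefficients of the [f j] in a matrix unique modulo [Id i]. *)
Lemma first_syzygies i p q (C : nat -> 'M_(p, q)) :
  (i <= mm)%N -> inI (Id 0) (\sum_(j < i) f j *: C j) ->
  forall j, (j < i)%N -> inI (Id i) (C j).
Proof.
move=> + /Id0; elim: i C => // i IHi C im.
rewrite big_ord_recr /= => S0 j.
have Ci : inI (Id i) (C i).
  apply: reg_mx => //; apply/Id_mx; exists (fun j => - C j).
  move/eqP: S0; rewrite addrC addr_eq0 => /eqP ->.
  by rewrite -sumrN; apply: eq_bigr => l _; rewrite scalerN.
case/Id_mx: (Ci) => D DE.
have idi := Id_ideal i.+1.
rewrite ltnS leq_eqVlt => /orP[/eqP ->|ji].
  exact: inId_leq Ci.
(* Substituting the expansion [D] of [C i] absorbs the last term and leaves a shorter relation. *)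
have : inI (Id i) (C j + f i *: D j).
  apply: (IHi (fun j => C j + f i *: D j)) => //; first exact: ltnW.
  under eq_bigr => l _ do rewrite scalerDr scalerA [f l * _]mulrC -scalerA.
  by rewrite big_split /= -scaler_sumr -DE.
move=> /(@inId_leq _ i.+1 _ _ _ (leqnSn _)) H.
rewrite -[C j](addrK (f i *: D j)); apply: inIB => //.
by move=> a b; rewrite mxE; apply: ideal_mulr => //; apply: Id_gen.
Qed.

End Regular.

Section Local.
Variables (A : comNzRingType) (k : fieldType) (pi : {rmorphism A -> k}).

Definition kerI (x : A) : Prop := pi x = 0.

Lemma kerI_ideal : ideal kerI.
Proof.
rewrite /kerI; split=> [|x y x0 y0|a x x0]; first by rewrite rmorph0.
  by rewrite rmorphD x0 y0 addr0.
by rewrite rmorphM x0 mulr0.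
Qed.

Hypothesis unitP : forall x, pi x != 0 -> exists y, x * y = 1.

Lemma inv_mx n (E : 'M[A]_n) : map_mx pi E = 1%:M ->
  exists F, F *m E = 1%:M /\ E *m F = 1%:M.
Proof.
move=> E1.
have /unitP[y yE] : pi (\det E) != 0 by rewrite -det_map_mx E1 det1 oner_eq0.
exists (y *: \adj E).
by rewrite -scalemxAl -scalemxAr mul_adj_mx mul_mx_adj scale_scalar_mx
   mulrC yE.
Qed.

Hypothesis piS : surjective pi.

Definition lft (x : k) : A := projT1 (cid (piS x)).
Lemma lftK x : pi (lft x) = x. Proof. by rewrite /lft; case: cid. Qed.
Lemma lft_mx p q (M : 'M[k]_(p, q)) : map_mx pi (map_mx lft M) = M.
Proof. by apply/matrixP => i j; rewrite !mxE lftK. Qed.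

End Local.

(** * Submodules of free modules over a noetherian ring *)

Definition submod (R : nzRingType) (V : lmodType R) (X : V -> Prop) : Prop :=
  X 0 /\ forall a x y, X x -> X y -> X (a *: x + y).

Section Submod.
Variables (R : nzRingType) (V : lmodType R) (X : V -> Prop) (sX : submod X).

Lemma submod0 : X 0. Proof. by case: sX. Qed.
Lemma submodP a x y : X x -> X y -> X (a *: x + y).
Proof. by case: sX => _; apply. Qed.
Lemma submodD x y : X x -> X y -> X (x + y).
Proof. by move=> Xx Xy; rewrite -[x]scale1r; apply: submodP. Qed.
Lemma submodZ a x : X x -> X (a *: x).
Proof. by move=> Xx; rewrite -[_ *: _]addr0; apply: submodP => //; apply: submod0. Qed.
Lemma submodN x : X x -> X (- x).
Proof. by rewrite -scaleN1r; apply: submodZ. Qed.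
Lemma submodB x y : X x -> X y -> X (x - y).
Proof. by move=> Xx Xy; apply: submodD => //; apply: submodN. Qed.
Lemma submod_sum (T : Type) (r : seq T) (P : pred T) (F : T -> V) :
  (forall i, P i -> X (F i)) -> X (\sum_(i <- r | P i) F i).
Proof. by move=> XF; elim/big_ind: _ => //; [apply: submod0|apply: submodD]. Qed.
Lemma submod_addl x y : X (x - y) -> X y -> X x.
Proof. by move=> Xxy /(submodD Xxy); rewrite subrK. Qed.
End Submod.

Section Noetherian.
Variable A : comNzRingType.
Hypothesis nA : noetherian A.

Lemma ideal_fg (I : A -> Prop) : ideal I ->
  exists s : seq A, forall x, I x <-> in_ideal_gen s x.
Proof.
move=> idI.
have sI : submod_closed ([pred x : A^o | `[< I x >]] : {pred A^o}).
  split=> [|a x y]; rewrite !inE.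
    exact: (ideal0 idI).
  move=> Ix Iy.
  exact: (idealD idI (idealM idI a Ix) Iy).
have [s Hs] := nA sI; exists s => x.
by rewrite -Hs inE.
Qed.

Lemma gen_ideal (s : seq A) : ideal (in_ideal_gen s).
Proof.
split=> [|x y [c ->] [c' ->]|a x [c ->]].
- by exists (fun=> 0); rewrite big1 // => i _; rewrite mul0r.
- by exists (fun i => c i + c' i); rewrite -big_split; apply: eq_bigr => i _; rewrite mulrDl.
- by exists (fun i => a * c i); rewrite mulr_sumr; apply: eq_bigr => i _; rewrite mulrA.
Qed.

Lemma mem_gen (s : seq A) i : (i < size s)%N -> in_ideal_gen s s`_i.
Proof.
move=> si; exists (fun j => (j == Ordinal si)%:R).
rewrite (bigD1 (Ordinal si)) //= eqxx mul1r big1 ?addr0 // => j /negbTE ->.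
by rewrite mul0r.
Qed.

(** Without a maximal member there would be a strictly increasing chain; its union is finitely
    generated, hence reached at a finite stage. *)
Lemma ideal_max (S : (A -> Prop) -> Prop) :
  (forall I, S I -> ideal I) -> (exists I, S I) ->
  exists I, S I /\ forall J, S J -> (forall x, I x -> J x) -> forall x, J x -> I x.
Proof.
move=> idS [I0 SI0]; apply: contrapT => /forallNP nomax.
have step (I : {I | S I}) : exists J : {I | S I},
    (forall x, sval I x -> sval J x) /\ exists x, sval J x /\ ~ sval I x.
  case: I => I SI /=; apply: contrapT => nJ; apply: (nomax I); split=> // J SJ IJ x Jx.
  apply: contrapT => nIx; apply: nJ; exists (exist _ J SJ); split=> //=.
  by exists x.
have [nx nxP] := choice step.
pose ch n := iter n nx (exist _ I0 SI0).
have chS n m x : (n <= m)%N -> sval (ch n) x -> sval (ch m) x.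
  move=> /subnK <-; elim: (m - n)%N => // d IHd /IHd.
  by rewrite addSn; have [H _] := nxP (ch (d + n)%N); apply: H.
pose U x := exists n, sval (ch n) x.
have idU : ideal U.
  split=> [|x y [n xn] [m ym]|a x [n xn]].
  - by exists 0%N; apply: ideal0; apply: idS; apply: svalP.
  - exists (maxn n m); apply: idealD; first exact: idS (svalP _).
      exact: chS (leq_maxl _ _) _.
    exact: chS (leq_maxr _ _) _.
  - by exists n; apply: idealM => //; apply: idS; apply: svalP.
have [s Hs] := ideal_fg idU.
have [N HN] : exists N, forall i, (i < size s)%N -> sval (ch N) s`_i.
  have /choice[F HF] (i : nat) : exists n, (i < size s)%N -> sval (ch n) s`_i.
    have [si|] := boolP (i < size s)%N; last by exists 0%N.
    by have [n Hn] := (Hs s`_i).2 (mem_gen si); exists n.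
  exists (\max_(i < size s) F i) => i si; apply: chS (HF i si).
  exact: (leq_bigmax (Ordinal si)).
have [_ [x [Hx]]] := nxP (ch N); apply.
have [c ->] := (Hs x).1 (ex_intro _ N.+1 Hx).
apply: ideal_sum => [|i _]; first exact: idS (svalP _).
by apply: idealM; [apply: idS; apply: svalP|apply: HN].
Qed.

(** Induction on [p]: the first entries of elements of [X] form an ideal, and the elements with
    first entry zero form a submodule of a smaller free module. *)
Lemma submod_fg p (X : 'rV[A]_p -> Prop) : submod X ->
  exists (w : nat) (K : 'M[A]_(w, p)), forall y, X y <-> exists z, y = z *m K.
Proof.
elim: p X => [|p IHp] X sX.
  exists 0%N, 0 => y; split=> [_|_]; first by exists 0; apply/matrixP=> i [].
  by rewrite (_ : y = 0); [apply: submod0|apply/matrixP=> i []].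
change (submod (X : 'rV[A]_(1 + p) -> Prop)) in sX.
pose I a := exists y : 'rV[A]_p, X (row_mx a%:M y).
have idI : ideal I.
  split=> [|a b [y Xy] [z Xz]|a b [y Xy]].
  - by exists 0; rewrite raddf0 row_mx0; apply: submod0.
  - by exists (y + z); rewrite raddfD -add_row_mx; apply: submodD.
  - by exists (a *: y); rewrite -scale_scalar_mx -scale_row_mx; apply: submodZ.
have [s Hs] := ideal_fg idI.
have /choice[F HF] (i : 'I_(size s)) : exists y : 'rV[A]_p, X (row_mx (s`_i)%:M y).
  exact: (Hs _).2 (mem_gen (ltn_ord i)).
pose Y (y : 'rV_p) := X (row_mx (0 : 'rV_1) y).
have sY : submod Y.
  split; rewrite /Y ?row_mx0; first exact: submod0.
  move=> a x y Xx Xy; have := submodP sX a Xx Xy.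
  by rewrite scale_row_mx add_row_mx scaler0 addr0.
have [w [K HK]] := IHp Y sY.
pose K1 : 'M[A]_(size s, 1 + p) := \matrix_i row_mx (s`_i)%:M (F i).
have XK1 z : X (z *m K1).
  rewrite mulmx_sum_row; apply: submod_sum => // i _; apply: submodZ => //.
  by rewrite rowK; apply: HF.
exists (size s + w)%N, (col_mx K1 (row_mx 0 K)) => y; split=> [Xy|[z ->]]; last first.
  rewrite -[z]hsubmxK mul_row_col; apply: (submodD sX (XK1 _)).
  have -> : rsubmx z *m row_mx 0 K = row_mx 0 (rsubmx z *m K) :> 'rV_(1 + p).
    by rewrite mul_mx_row mulmx0.
  by apply/HK; exists (rsubmx z).
have Iy : I (y 0 0).
  exists (rsubmx (y : 'rV_(1 + p))).
  rewrite (_ : (y 0 0)%:M = lsubmx (y : 'rV_(1 + p))) ?hsubmxK //.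
  apply/matrixP => i j; rewrite !ord1 !mxE /=; congr (y _ _).
  by apply: val_inj.
have [c cE] := (Hs _).1 Iy.
pose z1 : 'rV[A]_(size s) := \row_i c i.
pose v := (y : 'rV_(1 + p)) - z1 *m K1.
have lv : lsubmx v = 0.
  apply/matrixP => i j; rewrite !ord1 !mxE.
  rewrite (_ : lshift p 0 = 0); last exact: val_inj.
  rewrite cE; apply/eqP; rewrite subr_eq0; apply/eqP; apply: eq_bigr => l _.
  by rewrite !mxE; case: splitP => // j' _; rewrite ord1 mxE eqxx mulr1n.
have vE : row_mx 0 (rsubmx v) = v by rewrite -lv hsubmxK.
have : Y (rsubmx v) by rewrite /Y vE; apply: submodB.
move=> /HK[z2 z2E]; exists (row_mx z1 z2); rewrite mul_row_col.
have -> : z2 *m row_mx 0 K = row_mx 0 (z2 *m K) :> 'rV_(1 + p).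
  by rewrite mul_mx_row mulmx0.
by rewrite -z2E vE addrC subrK.
Qed.

Variables (k : fieldType) (pi : {rmorphism A -> k}).
Hypothesis unitP : forall x, pi x != 0 -> exists y, x * y = 1.

Lemma min_gen (I : A -> Prop) p (X : 'rV[A]_p -> Prop) : ideal I -> submod X ->
  exists (w : nat) (K : 'M[A]_(w, p)),
    [/\ forall z, X (z *m K), forall x, X x -> exists z, inI I (x - z *m K)
      & forall z : 'rV_w, inI I (z *m K) -> map_mx pi z = 0].
Proof.
move=> idI sX.
pose G w := exists K : 'M[A]_(w, p),
  (forall z, X (z *m K)) /\ forall x, X x -> exists z, inI I (x - z *m K).
have exG : exists w, `[< G w >].
  have [w [K HK]] := submod_fg sX; exists w; apply/asboolP; exists K; split=> [z|x].
    by apply/HK; exists z.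
  by move=> /HK[z ->]; exists z; rewrite subrr; apply: inI0.
case: (ex_minnP exG) => w /asboolP[K [XK genK]] minw.
exists w, K; split=> // z zK; apply/matrixP => i j; rewrite ord1 !mxE {i}.
apply/eqP; apply: contraT => /unitP[y yE].
case: w K XK genK minw z zK j yE => [|w] K XK genK minw z zK j; first by case: j.
move=> yE; suff : (w < w)%N by rewrite ltnn.
apply: minw; apply/asboolP; exists (row' j K); split=> [v|x Xx].
  rewrite mulmx_sum_row; apply: submod_sum => // i _; apply: submodZ => //.
  have -> : row i (row' j K) = delta_mx 0 (lift j i) *m K.
    by rewrite -rowE; apply/rowP => l; rewrite !mxE.
  exact: XK.
have [v vK] := genK x Xx.
(* Subtracting a multiple of the relation [z] clears the coefficient of row [j]. *)
pose v' := v - (v 0 j * y) *: z.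
have v'j : v' 0 j = 0 by rewrite !mxE -mulrA [y * _]mulrC yE mulr1 subrr.
exists (col' j v').
have -> : col' j v' *m row' j K = v' *m K.
  rewrite !mulmx_sum_row (bigD1_ord j) //= v'j scale0r add0r.
  apply: eq_bigr => i _; rewrite mxE; congr (_ *: _).
  by apply/rowP => l; rewrite !mxE.
rewrite /v' mulmxBl -scalemxAl opprB addrCA; apply: inID => //.
exact: inIZ.
Qed.

End Noetherian.

(** * Prime avoidance and prime filtrations *)

Fixpoint all_prop (T : Type) (Q : T -> Prop) (s : seq T) : Prop :=
  if s is x :: s' then Q x /\ all_prop Q s' else True.

Lemma all_prop_imp (T : Type) (Q Q' : T -> Prop) (s : seq T) :
  (forall x, Q x -> Q' x) -> all_prop Q s -> all_prop Q' s.
Proof. by move=> QQ'; elim: s => //= x s IHs [/QQ' ? /IHs]. Qed.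

Lemma all_prop_and (T : Type) (Q Q' : T -> Prop) (s : seq T) :
  all_prop (fun x => Q x /\ Q' x) s <-> all_prop Q s /\ all_prop Q' s.
Proof. by elim: s => //= x s ->; tauto. Qed.

Lemma all_prop_filter (T : Type) (a : pred T) (Q : T -> Prop) (s : seq T) :
  all_prop Q (filter a s) <-> all_prop (fun x => a x -> Q x) s.
Proof. by elim: s => //= x s IHs; case: (a x) => /=; rewrite IHs; intuition. Qed.

Lemma all_prop_cat (T : Type) (Q : T -> Prop) (s1 s2 : seq T) :
  all_prop Q (s1 ++ s2) <-> all_prop Q s1 /\ all_prop Q s2.
Proof. by elim: s1 => //= [|x s ->]; tauto. Qed.

Section PrimeAvoidance.
Variables (H : Type) (mul mix : H -> H -> H) (good : H -> Prop).
Hypotheses (good_mul : forall a b, good a -> good b -> good (mul a b))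
  (good_mix : forall a b, good a -> good b -> good (mix a b)).

(** [mix] stands for the sum of two elements, which in a graded setting makes sense only in equal
    degrees; the axioms keep what the avoidance argument uses of it. They serve for elements of [A]
    and for words in the operators alike. *)
Definition hprime (P : H -> Prop) : Prop :=
  [/\ forall a b, good a -> good b -> P (mul a b) <-> P a \/ P b,
      forall a b, good a -> good b -> P a -> ~ P b -> ~ P (mix a b),
      forall a b, good a -> good b -> ~ P a -> P b -> ~ P (mix a b)
    & exists2 a, good a & ~ P a].

(** Members contained in [P] are avoided together with [P]. If the [g] avoiding the others lies in
    [P], it is mixed with some [h] outside [P] that belongs to every member not contained in [P]. *)
Lemma prime_avoidance (L : seq (H -> Prop)) : (exists a, good a) ->
  all_prop hprime L -> exists2 g, good g & all_prop (fun P => ~ P g) L.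
Proof.
move=> exg; have [n] := ubnP (size L); elim: n L => // n IHn [|P L] /= sL.
  by case: exg => a ga _; exists a.
case=> PP PL; pose inc Q := `[< forall a, good a -> Q a -> P a >].
have [||g gg gL] := IHn [seq Q <- L | ~~ inc Q].
- by rewrite size_filter; apply: leq_ltn_trans (count_size _ _) _.
- by apply/all_prop_filter; apply: all_prop_imp PL.
move/all_prop_filter: gL => gL.
have ext g' : ~ P g' -> good g' -> all_prop (fun Q => ~~ inc Q -> ~ Q g') L ->
    all_prop (fun Q => ~ Q g') L.
  move=> nPg' gg'; apply: all_prop_imp => Q; case: (boolP (inc Q)) => [/asboolP QP _|_].
    by move=> /(QP _ gg').
  exact.
have [Pg|nPg] := pselect (P g); last by exists g => //=; split=> //; apply: ext.
have [PM PL1 PR1 [a0 ga0 nPa0]] := PP.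
have [h [gh nPh hL]] : exists h, [/\ good h, ~ P h &
    all_prop (fun Q => ~~ inc Q -> Q h) L].
  elim: L PL {sL gL ext} => [_|Q L IHL /= [PQ PL]]; first by exists a0.
  have [h [gh nPh hL]] := IHL PL.
  have [_|/asboolP] := boolP (inc Q); first by exists h.
  move=> /existsNP[a] /not_implyP[ga] /not_implyP[Qa nPa].
  exists (mul h a); split; first exact: good_mul.
    by move=> /(PM _ _ gh ga)[].
  split; first by move=> _; case: PQ => QM _ _ _; apply/QM => //; right.
  move/all_prop_and: (conj PL hL); apply: all_prop_imp => Q' [[QM _ _ _] Q'h nQ'].
  by apply/QM => //; left; apply: Q'h.
have nPgh : ~ P (mix g h) by apply: PL1.
exists (mix g h); first exact: good_mix.
split=> //; apply: ext => //; first exact: good_mix.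
move/all_prop_and: (conj PL hL) => /(conj gL)/all_prop_and.
apply: all_prop_imp => Q [nQg [[_ _ QR _] Qh]] nQ.
by apply: QR => //; [apply: nQg|apply: Qh].
Qed.
End PrimeAvoidance.

Section PrimeFiltration.
Variable A : comNzRingType.
Hypothesis nA : noetherian A.

Definition prime_ideal (p : A -> Prop) : Prop :=
  [/\ ideal p, ~ p 1 & forall x y, p (x * y) -> p x \/ p y].

Definition add_gen (J : A -> Prop) (u : A) : A -> Prop :=
  fun x => exists a, J (x - a * u).

(** Each step adjoins one generator [u] with [add_gen J u / J] isomorphic to [A / p]; the list has
    the topmost factor first. *)
Inductive pfilt (I : A -> Prop) : (A -> Prop) -> seq (A -> Prop) -> Prop :=
| pfilt0 : pfilt I I [::]
| pfiltS J ps u p : pfilt I J ps -> prime_ideal p -> (forall a, p a <-> J (a * u)) ->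
    pfilt I (add_gen J u) (p :: ps).

Lemma add_gen_ideal J u : ideal J -> ideal (add_gen J u).
Proof.
move=> idJ; split=> [|x y [a Ja] [b Jb]|b x [a Ja]].
- by exists 0; rewrite mul0r subr0; apply: ideal0.
- by exists (a + b); rewrite mulrDl opprD addrACA; apply: idealD.
- by exists (b * a); rewrite -mulrA -mulrBr; apply: idealM.
Qed.

Lemma add_genl J u x : J x -> add_gen J u x.
Proof. by exists 0; rewrite mul0r subr0. Qed.

Lemma add_genr J u : ideal J -> add_gen J u u.
Proof. by move=> idJ; exists 1; rewrite mul1r subrr; apply: ideal0. Qed.

Lemma pfilt_ideal I J ps : ideal I -> pfilt I J ps -> ideal J.
Proof. by move=> idI; elim=> // *; apply: add_gen_ideal. Qed.

Lemma pfilt_sub I J ps x : pfilt I J ps -> I x -> J x.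
Proof. by move=> H; elim: H x => // {}J {}ps u p _ IH _ _ x /IH; apply: add_genl. Qed.

Lemma pfilt_prime I J ps : pfilt I J ps -> all_prop prime_ideal ps.
Proof. by elim. Qed.

(** Let [J] be maximal among the ideals reached from [I]. If it were proper, a maximal annihilator
    of a nonzero element of [A / J] would be prime and give one more step. *)
Lemma prime_filtration I : ideal I -> exists2 ps, pfilt I (fun=> True) ps & True.
Proof.
move=> idI.
have [||J [[ps fJ] Jmax]] := ideal_max nA (S := fun J => exists ps, pfilt I J ps).
- by move=> J [ps fJ]; apply: pfilt_ideal fJ.
- by exists I, [::]; constructor.
have idJ := pfilt_ideal idI fJ.
suff JT : J = (fun=> True) by rewrite JT in fJ; exists ps.
apply/predeqP => x; split=> // _; apply: contrapT => nJx.
have [||K [[u [nJu KE]] Kmax]] := ideal_max nA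
  (S := fun K => exists u, ~ J u /\ K = (fun a => J (a * u))).
- move=> _ [u [_ ->]]; split=> [|a b Ja Jb|a b Jb].
  + by rewrite mul0r; apply: ideal0.
  + by rewrite mulrDl; apply: idealD.
  + by rewrite -mulrA; apply: idealM.
- by exists (fun a => J (a * x)), x.
have pK : prime_ideal K.
  rewrite KE; split; first split=> [|a b Ja Jb|a b Jb].
  + by rewrite mul0r; apply: ideal0.
  + by rewrite mulrDl; apply: idealD.
  + by rewrite -mulrA; apply: idealM.
  + by rewrite mul1r.
  move=> a b Jabu; have [|nJb] := pselect (J (b * u)); [by right|left].
  have := Kmax (fun c => J (c * (b * u))); rewrite KE; apply.
  - by exists (b * u).
  - by move=> c Jcu; rewrite mulrCA; apply: idealM.
  - by rewrite mulrA.
apply: nJu; apply: (Jmax (add_gen J u)).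
- by exists (K :: ps); apply: pfiltS; rewrite ?KE //; rewrite -KE.
- by move=> y; apply: add_genl.
- exact: add_genr.
Qed.

End PrimeFiltration.

(** * Local rings, depth zero and maximal regular sequences *)

Section LocalRing.
Variables (A : comNzRingType) (k : fieldType) (pi : {rmorphism A -> k}).
Hypotheses (nA : noetherian A) (lA : local_ring A) (piS : surjective pi).

(** A nonunit lies in an ideal that is maximal among the proper ones; the kernel of [pi] is maximal
    too, and there is only one maximal ideal. *)
Lemma local_unit x : pi x != 0 -> exists y, x * y = 1.
Proof.
move=> pix; apply: contrapT => /forallNP nux.
have [m [_ mU]] := lA.
have maxE (J : A -> Prop) : ideal J -> ~ J 1 ->
    (forall K, ideal K -> ~ K 1 -> (forall x, J x -> K x) -> forall x, K x -> J x) ->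
    maximal_ideal ([pred x | `[< J x >]] : {pred A}).
  move=> idJ J1 Jmax; split.
    split=> [||a u v]; rewrite !inE; first exact: (ideal0 idJ).
      by apply/asboolPn.
    move=> Ju Jv; exact: (idealD idJ (idealM idJ a Ju) Jv).
  move=> K [K0 K1 KS] JK y; apply/idP/idP; last exact: JK.
  move=> Ky; rewrite inE; apply: (Jmax (fun x => x \in K)) => //.
  - split=> // [a b Ka Kb|a b Kb].
      by rewrite -[a]mul1r; apply: KS.
    by rewrite -[_ * _]addr0; apply: KS.
  - by apply/negP.
  - by move=> z Jz; apply: JK; rewrite inE.
have idx : ideal (fun y => exists a, y = a * x).
  split=> [|_ _ [a ->] [b ->]|b _ [a ->]].
  - by exists 0; rewrite mul0r.
  - by exists (a + b); rewrite mulrDl.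
  - by exists (b * a); rewrite mulrA.
have [||J [[idJ [J1 Jx]] Jmax]] :=
    ideal_max nA (S := fun J => ideal J /\ ~ J 1 /\ J x).
- by move=> J [].
- exists (fun y => exists a, y = a * x); split=> //; split.
    by move=> [a /esym]; rewrite mulrC; apply: nux.
  by exists 1; rewrite mul1r.
have mJ := maxE J idJ J1 _.
have {}mJ : maximal_ideal ([pred x | `[< J x >]] : {pred A}).
  by apply: mJ => K idK K1 JK; apply: Jmax => //; split=> //; split=> //; apply: JK.
have mK : maximal_ideal ([pred x | `[< kerI pi x >]] : {pred A}).
  apply: maxE; first exact: kerI_ideal.
    by rewrite /kerI rmorph1 => /eqP; rewrite oner_eq0.
  move=> K idK K1 kK y Ky; apply: contrapT => /eqP piy; apply: K1.
  have [z piz] := piS (pi y)^-1.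
  rewrite -(subrK (y * z) 1); apply: idealD => //; last by rewrite mulrC; apply: idealM.
  by apply: kK; rewrite /kerI rmorphB rmorph1 rmorphM piz divff ?subrr.
have := mU _ mJ x; rewrite -(mU _ mK x) !inE.
have -> : `[< J x >] = true by apply/asboolP.
by move/esym/asboolP => /eqP; rewrite (negbTE pix).
Qed.

End LocalRing.

Section MaximalRegular.
Variables (A : comNzRingType) (k : fieldType) (pi : {rmorphism A -> k}).
Hypotheses (nA : noetherian A) (lA : local_ring A) (piS : surjective pi).

(** If the socle of [A / I] were zero, an element [x] of the maximal ideal outside all other primes
    of a filtration would be a nonzerodivisor modulo [I]. *)
Lemma depth_zero (I : A -> Prop) : ideal I -> (forall x, I x -> pi x = 0) ->
  (forall x, pi x = 0 -> exists2 y, I (x * y) & ~ I y) ->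
  exists2 u, ~ I u & forall a, pi a = 0 -> I (a * u).
Proof.
move=> idI Im zd; apply: contrapT => nsoc.
have soc u : (forall a, pi a = 0 -> I (a * u)) -> I u.
  by move=> mu; apply: contrapT => nIu; apply: nsoc; exists u.
have [ps fT _] := prime_filtration nA idI.
pose rel (p : A -> Prop) := `[< exists2 a, pi a = 0 & ~ p a >].
have [||||x pix xL] := @prime_avoidance A *%R +%R (fun a => pi a = 0) _ _
    [seq p <- ps | rel p].
- by move=> a b a0 _; rewrite rmorphM a0 mul0r.
- by move=> a b a0 b0; rewrite rmorphD a0 b0 addr0.
- by exists 0; rewrite rmorph0.
- apply/all_prop_filter; apply: all_prop_imp (pfilt_prime fT) => p [idp p1 pM].
  move/asboolP => [a a0 pa]; split=> [b c _ _|b c _ _ pb pc|b c _ _ pb pc|]; last by exists a.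
  + split=> [/pM //|[pb|pc]]; first exact: (ideal_mulr idp).
    exact: (idealM idp).
  + by move=> /(idealB idp)/(_ pb); rewrite addrC addKr.
  + by move=> /(idealB idp)/(_ pc); rewrite addrK.
have [y Ixy []] := zd x pix.
suff : forall J ps, pfilt I J ps -> all_prop (fun p => rel p -> ~ p x) ps ->
    forall y, J y -> I (x * y) -> I y.
  by move=> /(_ _ _ fT); apply=> //; apply/all_prop_filter.
move=> J qs; elim=> // {fT}{}J {}qs u p fJ IH pp pE [px /IH{}IH] z [b Jz] Ixz.
have idJ := pfilt_ideal idI fJ.
have [[a a0 pa]|nrel] := pselect (exists2 a, pi a = 0 & ~ p a).
  have npx : ~ p x by apply: px; apply/asboolP; exists a.
  apply: IH => //.
  suff : J (b * u) by move=> /(idealD idJ Jz); rewrite subrK.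
  apply/pE; case: pp => _ _ /(_ x b) [] //.
  apply/pE; rewrite -mulrA.
  have := idealB idJ (pfilt_sub fJ Ixz) (idealM idJ x Jz).
  by rewrite -mulrBr opprB addrC subrK.
(* Here [p] contains the whole maximal ideal, which therefore carries [z] into [J]; the induction
   hypothesis carries it further into [I], so [z] is a socle element. *)
apply: soc => a a0; apply: IH.
  rewrite -(subrK (a * (b * u)) (a * z)) -mulrBr; apply: idealD => //.
    exact: idealM.
  rewrite mulrCA; apply: idealM => //; apply/pE.
  by apply: contrapT => npa; apply: nrel; exists a.
by rewrite mulrCA; apply: idealM.
Qed.

Lemma in_ideal_genE (s : seq A) x : in_ideal_gen s x <-> Id (nth 0 s) (size s) x.
Proof.
split=> [[c ->]|[C ->]].
  exists (fun i => if insub i is Some j then c j else 0).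
  by apply: eq_bigr => i _; rewrite valK mulrC.
by exists (fun i => C i); apply: eq_bigr => i _; rewrite mulrC.
Qed.

Lemma in_ideal_gen_take (s : seq A) i x : (i <= size s)%N ->
  in_ideal_gen (take i s) x <-> Id (nth 0 s) i x.
Proof.
move=> si; rewrite in_ideal_genE size_takel //.
by split=> -[C ->]; exists C; apply: eq_bigr => j _; rewrite nth_take.
Qed.

Lemma Id_ext (f g : nat -> A) i x : (forall j, (j < i)%N -> f j = g j) ->
  Id f i x -> Id g i x.
Proof. by move=> fg [C ->]; exists C; apply: eq_bigr => j _; rewrite fg. Qed.

(** Among the ideals generated by regular sequences extending [s] there is a maximal one. A further
    nonzerodivisor in the maximal ideal would enlarge it, so [depth_zero] applies. *)
Lemma maximal_regular (s : seq A) : regular_sequence s ->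
  exists (f : nat -> A) (mm : nat), [/\ (size s <= mm)%N,
    forall i, (i < size s)%N -> f i = s`_i, regular f mm,
    forall i, (i < mm)%N -> pi (f i) = 0
  & exists2 u, ~ Id f mm u & forall a, pi a = 0 -> Id f mm (a * u)].
Proof.
move=> [regs s1].
pose good (t : seq A) := [/\ regular (nth 0 t) (size t),
  forall i, (i < size t)%N -> pi t`_i = 0 & take (size s) t = s].
have gs : good s.
  split; last by rewrite take_size.
    move=> i x si /(in_ideal_gen_take _ (ltnW si)) /(regs _ si).
    by move/(in_ideal_gen_take _ (ltnW si)).
  move=> i si; apply/eqP; apply: contraT => /(local_unit nA lA piS)[y yE].
  case: s1; rewrite -yE; apply: ideal_mulr; first exact: gen_ideal.
  exact: mem_gen.
have [||I [[t [[regt pit ts] IE]] Imax]] := ideal_max nA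
    (S := fun I => exists t, good t /\ I = Id (nth 0 t) (size t)).
- by move=> _ [t [_ ->]]; apply: Id_ideal.
- by exists (Id (nth 0 s) (size s)), s.
have st : (size s <= size t)%N by rewrite -ts size_take; case: ltnP => // /ltnW.
have idI : ideal I by rewrite IE; apply: Id_ideal.
have Im x : I x -> pi x = 0.
  rewrite IE => -[C ->]; rewrite rmorph_sum big1 // => i _.
  by rewrite rmorphM pit // mul0r.
exists (nth 0 t), (size t); split=> //.
  by move=> i si; rewrite -[in RHS]ts nth_take.
rewrite -IE; apply: depth_zero => // x pix; apply: contrapT => nzd.
have nthE i : (i <= size t)%N -> forall y, Id (nth 0 (rcons t x)) i y <-> Id (nth 0 t) i y.
  move=> it y; split; apply: Id_ext => j ji; rewrite nth_rcons;
  by rewrite (leq_trans ji it).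
have gtx : good (rcons t x).
  split; rewrite ?size_rcons.
  - move=> i y; rewrite ltnS => it /(nthE _ it); rewrite nth_rcons => H; apply/nthE => //.
    move: it H; rewrite leq_eqVlt => /orP[/eqP -> |it].
      rewrite ltnn eqxx -IE => Ixy; apply: contrapT => nIy; apply: nzd.
      by exists y.
    by rewrite it; apply: regt.
  - move=> i; rewrite ltnS leq_eqVlt nth_rcons => /orP[/eqP ->|it].
      by rewrite ltnn eqxx.
    by rewrite it pit.
  - by rewrite -cats1 takel_cat.
have : I x.
  apply: (Imax (Id (nth 0 (rcons t x)) (size (rcons t x)))).
  - by exists (rcons t x).
  - move=> y; rewrite IE => Iy; apply: (@Id_leq _ _ (size t)); first by rewrite size_rcons.
    exact/nthE.
  - rewrite -[x in Id _ _ x](_ : (rcons t x)`_(size t) = x).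
      by apply: Id_gen; rewrite size_rcons.
    by rewrite nth_rcons ltnn eqxx.
move=> Ix; apply: nzd; exists 1; rewrite ?mulr1 // => /Im /eqP.
by rewrite rmorph1 oner_eq0.
Qed.

End MaximalRegular.

(** * Length at a minimal prime *)

Section Length.
Variables (A : comNzRingType) (p : A -> Prop) (pp : prime_ideal p).

Definition tor (V : lmodType A) (Y X : V -> Prop) : Prop :=
  forall x, X x -> exists2 s, ~ p s & Y (s *: x).

(** The [n] steps from [Y] to [X] have to stay proper after localization at [p]; the greatest such
    [n] is the length of [(X/Y)_p], obtained without forming the localization. *)
Fixpoint chain (V : lmodType A) (n : nat) (Y X : V -> Prop) : Prop :=
  if n is n'.+1 then
    exists Z, [/\ submod Z, chain n' Y Z, forall v, Z v -> X v & ~ tor Z X]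
  else forall v, Y v -> X v.

Lemma chainS (V : lmodType A) n (Y X : V -> Prop) : chain n.+1 Y X ->
  exists Z, [/\ submod Z, chain n Y Z, forall v, Z v -> X v & ~ tor Z X].
Proof. by []. Qed.

Lemma chain_sub (V : lmodType A) n (Y X : V -> Prop) v : chain n Y X -> Y v -> X v.
Proof.
elim: n X => [|n IHn] X /=; first exact.
by move=> [Z [_ /IHn YZ ZX _]] /YZ /ZX.
Qed.

Lemma chain_widen (V : lmodType A) n (Y X X' : V -> Prop) :
  (forall v, X v -> X' v) -> chain n Y X -> chain n Y X'.
Proof.
case: n => [|n] /= XX'; first by move=> YX v /YX /XX'.
move=> [Z [sZ cZ ZX nt]]; exists Z; split=> // [v /ZX /XX' //|ZX'].
by apply: nt => x /XX' /ZX'.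
Qed.

Lemma chain_cat (V : lmodType A) m n (Y W X : V -> Prop) :
  chain m Y W -> chain n W X -> chain (n + m) Y X.
Proof.
move=> cm; elim: n X => [|n IHn] X /=; first by move=> WX; apply: chain_widen cm.
by move=> [Z [sZ /IHn cZ ZX nt]]; exists Z.
Qed.

Definition addm (V : lmodType A) (W X : V -> Prop) v := exists2 x, X x & W (v - x).

Lemma notpM s t : ~ p s -> ~ p t -> ~ p (s * t).
Proof. by case: pp => _ _ pM ns nt /pM[]. Qed.

(** Every step of the chain has a trace on [W] and an image modulo [W]; if both became trivial at
    [p], so would the step. *)
Lemma chain_split (V : lmodType A) n (Y W X : V -> Prop) : submod W -> submod Y ->
  submod X ->
  (forall v, Y v -> W v) -> chain n Y X ->
  exists a b, [/\ (n <= a + b)%N, chain a Y (fun v => W v /\ X v) & chain b W (addm W X)].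
Proof.
move=> sW sY sX YW; elim: n X sX => [|n IHn] X sX.
  move=> /= YX; exists 0%N, 0%N; split=> //= v.
    by move=> Yv; split; [apply: YW|apply: YX].
  by move=> Wv; exists 0; [apply: submod0|rewrite subr0].
move=> [Z [sZ cZ ZX nt]].
have [a [b [ab ca cb]]] := IHn Z sZ cZ.
have sWZ : submod (fun v => W v /\ Z v).
  split; first by split; apply: submod0.
  by move=> c x y [Wx Zx] [Wy Zy]; split; apply: submodP.
have sWZ' : submod (addm W Z).
  split; first by exists 0; [apply: submod0|rewrite subr0; apply: submod0].
  move=> c x y [x' Zx Wx] [y' Zy Wy]; exists (c *: x' + y'); first exact: submodP.
  by rewrite opprD addrACA -scalerBr; apply: submodP.
have [t1|nt1] := pselect (tor (fun v => W v /\ Z v) (fun v => W v /\ X v)); last first.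
  exists a.+1, b; split=> //; last by apply: chain_widen cb => v [x /ZX]; exists x.
  by exists (fun v => W v /\ Z v); split=> // v [Wv /ZX].
have [t2|nt2] := pselect (tor (addm W Z) (addm W X)); last first.
  exists a, b.+1; split; first by rewrite addnS ltnS.
    by apply: chain_widen ca => v [Wv /ZX].
  by exists (addm W Z); split=> // v [x /ZX]; exists x.
case: nt => x Xx.
have [|s ns [z Zz Wz]] := t2 x.
  by exists x => //; rewrite subrr; apply: submod0.
have [|t nt [_ Zt]] := t1 (s *: x - z).
  by split=> //; apply: submodB => //; [apply: submodZ|apply: ZX].
exists (t * s); first exact: notpM.
rewrite -scalerA; move: Zt; rewrite scalerBr => /(submodD sZ)/(_ (submodZ sZ t Zz)).
by rewrite subrK.
Qed.

Definition bounded (V : lmodType A) (Y X : V -> Prop) N := forall n, chain n Y X -> (n <= N)%N.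
Definition has_len (V : lmodType A) (Y X : V -> Prop) n := chain n Y X /\ bounded Y X n.

Lemma has_len_ex (V : lmodType A) (Y X : V -> Prop) N : (forall v, Y v -> X v) ->
  bounded Y X N -> exists2 n, has_len Y X n & (n <= N)%N.
Proof.
move=> YX bN.
have ex0 : exists n, `[< chain n Y X >] by exists 0%N; apply/asboolP.
have bN' n : `[< chain n Y X >] -> (n <= N)%N by move/asboolP/bN.
case: (ex_maxnP ex0 bN') => n /asboolP cn mx; exists n; last exact: bN.
by split=> // m /asboolP/mx.
Qed.

Lemma has_len_uniq (V : lmodType A) (Y X : V -> Prop) m n :
  has_len Y X m -> has_len Y X n -> m = n.
Proof. by move=> [cm bm] [cn bn]; apply/eqP; rewrite eqn_leq bn ?bm. Qed.

Lemma has_len_cat (V : lmodType A) (Y W X : V -> Prop) m n :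
  submod Y -> submod W -> submod X -> (forall v, Y v -> W v) -> (forall v, W v -> X v) ->
  has_len Y W m -> has_len W X n -> has_len Y X (m + n).
Proof.
move=> sY sW sX YW WX [cm bm] [cn bn]; split; first by rewrite addnC; apply: chain_cat cn.
move=> l /(chain_split sW sY sX YW)[a [b [ab ca cb]]].
apply: leq_trans ab _; apply: leq_add.
  by apply: bm; apply: chain_widen ca => v [].
apply: bn; apply: chain_widen cb => v [x Xx Wvx].
by rewrite -(subrK x v); apply: submodD => //; apply: WX.
Qed.

Section Map.
Variables (V V' : lmodType A) (h : {linear V -> V'}) (Y : V' -> Prop) (sY : submod Y).

Let im (X : V -> Prop) v' := exists2 x, X x & Y (v' - h x).

Lemma chain_im n (X : V -> Prop) : submod X -> chain n (Y \o h) X -> chain n Y (im X).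
Proof.
elim: n X => [|n IHn] X sX /=.
  by move=> YX v Yv; exists 0; [apply: submod0|rewrite raddf0 subr0].
move=> [Z [sZ cZ ZX nt]]; exists (im Z); split.
- split; first by exists 0; [apply: submod0|rewrite raddf0 subr0; apply: submod0].
  move=> a x y [x' Zx Yx] [y' Zy Yy]; exists (a *: x' + y'); first exact: submodP.
  by rewrite linearP opprD addrACA -scalerBr; apply: submodP.
- exact: IHn.
- by move=> v [x /ZX]; exists x.
- move=> t; apply: nt => x Xx.
  have [|s ns [z Zz]] := t (h x); first by exists x => //; rewrite subrr; apply: submod0.
  rewrite -linearZ -raddfB => Yxz; exists s => //.
  rewrite -(subrK z (s *: x)); apply: submodD => //.
  exact: chain_sub cZ Yxz.
Qed.

Lemma chain_preim n (X : V' -> Prop) : submod X -> (forall v, X v -> im (fun=> True) v) ->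
  chain n Y X -> chain n (Y \o h) (X \o h).
Proof.
move=> sX Xim; elim: n X sX Xim => [|n IHn] X sX Xim /=; first by move=> YX v; apply: YX.
move=> [Z [sZ cZ ZX nt]]; exists (Z \o h); split.
- split; rewrite /= ?raddf0; first exact: submod0.
  by move=> a x y Zx Zy; rewrite linearP; apply: submodP.
- by apply: IHn => // v /ZX /Xim.
- by move=> v /ZX.
- move=> t; apply: nt => x Xx.
  have [y _ Yxy] := Xim x Xx.
  have [|s ns Zy] := t y.
    rewrite /= -[h y](subKr x); apply: submodB => //; apply: ZX.
    exact: chain_sub cZ Yxy.
  exists s => //; rewrite -(subrK (h y) x) scalerDr -linearZ; apply: submodD => //.
  by apply: submodZ => //; apply: chain_sub cZ Yxy.
Qed.

(** [h] induces an isomorphism of quotients, since [X] is the preimage of [Y] and [W] is [Y] plus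
    the image of [h]. *)
Lemma has_len_map (X : V -> Prop) (W : V' -> Prop) n : (forall x, X x <-> Y (h x)) ->
  (forall v, W v <-> exists x, Y (v - h x)) ->
  has_len X (fun=> True) n <-> has_len Y W n.
Proof.
move=> /predeqP XE WE; rewrite {X}XE; have {}WE : W = im (fun=> True).
  by apply/predeqP => v; apply: (iff_trans (WE v)); split=> [[x Yx]|[x _ Yx]]; exists x.
rewrite {W}WE.
have sT : submod (fun=> True : Prop) by split.
have sim : submod (im (fun=> True)).
  split; first by exists 0 => //; rewrite raddf0 subr0; apply: submod0.
  move=> a x y [x' _ Yx] [y' _ Yy]; exists (a *: x' + y') => //.
  by rewrite linearP opprD addrACA -scalerBr; apply: submodP.
have E m : chain m (Y \o h) (fun=> True) <-> chain m Y (im (fun=> True)).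
  split; first exact: chain_im.
  move=> /(chain_preim sim); move=> /(_ (fun v H => H)).
  exact: chain_widen.
by split=> -[/E c b]; split=> // m /E; apply: b.
Qed.

End Map.

End Length.

Section RankFunction.
Variables (A : comNzRingType) (nA : noetherian A) (I : A -> Prop).
Hypotheses (idI : ideal I) (I1 : ~ I 1).

Lemma min_prime : exists ps p, [/\ pfilt I (fun=> True) ps, prime_ideal p,
    forall x, I x -> p x &
    all_prop (fun q => (forall x, q x -> p x) -> forall x, p x -> q x) ps].
Proof.
have [ps fT _] := prime_filtration nA idI.
have Iq J qs : pfilt I J qs -> all_prop (fun q => forall x, I x -> q x) qs.
  elim=> //= {}J {}qs u p fJ IH pp pE; split=> // x Ix; apply/pE.
  by apply: ideal_mulr; [apply: pfilt_ideal fJ|apply: pfilt_sub fJ Ix].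
have ps0 : ps <> [::].
  move=> ps0; move: fT; rewrite ps0 => fT.
  have : forall J qs, pfilt I J qs -> qs = [::] -> J = I by move=> J qs [].
  by move=> /(_ _ _ fT erefl) IT; apply: I1; rewrite -IT.
have : all_prop (@prime_ideal A) ps /\ all_prop (fun q => forall x, I x -> q x) ps.
  by split; [apply: pfilt_prime fT|apply: Iq fT].
move/all_prop_and => psP; exists ps.
suff [p [[pp Ip] pmin]] : exists p, (prime_ideal p /\ forall x, I x -> p x) /\
    all_prop (fun q => (forall x, q x -> p x) -> forall x, p x -> q x) ps by exists p.
elim: ps ps0 psP {fT Iq} => // q ps IHps _ /= [qP psP].
case: ps IHps psP => [|q' ps] IHps psP; first by exists q.
have [p [pP pmin]] := IHps ltac:(by []) psP.
have [qp|nqp] := pselect (forall x, q x -> p x); last first.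
  by exists p; split=> //; split.
exists q; split=> //; split=> //.
apply: all_prop_imp pmin => r rmin rq x /qp; apply: rmin => y /rq; exact: qp.
Qed.

Definition modI (b : nat) : 'rV[A]_b -> Prop := fun y => inI I y.

Lemma modI_submod b : submod (@modI b).
Proof. by split; [apply: inI0|move=> a x y Ix Iy; apply: inID => //; apply: inIZ]. Qed.

(** A factor [A / q] of the filtration contributes nothing at [p] unless [q] is contained in [p].
    Then [q = p] by minimality, and every nonzero submodule of [A / q] is everything at [p]. *)
Lemma len_cyclic p J ps : prime_ideal p -> (forall x, I x -> p x) -> pfilt I J ps ->
  all_prop (fun q => (forall x, q x -> p x) -> forall x, p x -> q x) ps ->
  exists n, has_len p (I : A^o -> Prop) J n.
Proof.
move=> pp Ip; elim=> [_|{}J {}ps u q fJ IH qp qE [qmin /IH[n Hn]]].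
  exists 0%N; split=> // m; case: m => // m /chainS[Z [sZ cZ ZX []]] x Ix.
  exists 1; first by case: pp.
  by rewrite scale1r; exact: (chain_sub cZ Ix).
have idJ := pfilt_ideal idI fJ.
have sid (K : A -> Prop) : ideal K -> submod (K : A^o -> Prop).
  move=> idK; split; first exact: (ideal0 idK).
  by move=> a x y Kx Ky; apply: (idealD idK (idealM idK a Kx) Ky).
have bq : exists m, has_len p (q : A^o -> Prop) (fun=> True) m.
  have sq : submod (q : A^o -> Prop) by case: qp => idq _ _; apply: sid.
  suff [N bN] : exists N, bounded p (q : A^o -> Prop) (fun=> True) N.
    by have [//|m Hm _] := has_len_ex _ bN; exists m.
  have [qsp|/existsNP[s /not_implyP[qs nps]]] := pselect (forall x, q x -> p x); last first.
    exists 0%N => -[//|m] /chainS[Z [sZ cZ ZX []]] x _; exists s => //.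
    apply: chain_sub cZ _; rewrite /= /GRing.scale /= mulrC.
    by case: qp => idq _ _; apply: (idealM idq).
  exists 1%N => -[|[|m]] // /chainS[Z [sZ /chainS[Z' [sZ' cZ' ZZ' nt']] _ []]] x _.
  have /existsNP[z] : ~ forall z, Z z -> p z.
    move=> Zp; apply: nt' => z /Zp /(qmin qsp) qz; exists 1; first by case: pp.
    by rewrite scale1r; apply: chain_sub cZ' qz.
  move=> /not_implyP[Zz npz]; exists z => //.
  by rewrite /= /GRing.scale /= mulrC; apply: (submodZ sZ).
case: bq => m Hm; exists (n + m)%N.
apply: (has_len_cat pp) Hn _ => //; try exact: sid.
- exact/sid/add_gen_ideal.
- by move=> v; apply: pfilt_sub fJ.
- by move=> v; apply: add_genl.
pose h : A^o -> A^o := fun a => a * u.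
have lin_h : linear h by move=> a x y; rewrite /h mulrDl -mulrA.
pose hL : {linear A^o -> A^o} := HB.pack h (GRing.isLinear.Build _ _ _ _ h lin_h).
exact: (has_len_map p (h := hL) (sid J idJ) m qE (fun=> conj id id)).1 Hm.
Qed.

(** [l] is the length of [(A/I)_p], positive because [I] lies in [p]; splitting off one coordinate
    at a time multiplies it by [b]. *)
Lemma len_free p : prime_ideal p -> (forall x, I x -> p x) ->
  (exists n, has_len p (I : A^o -> Prop) (fun=> True) n) ->
  exists2 l, (0 < l)%N &
    forall b, has_len p (@modI b) (fun=> True) (l * b).
Proof.
move=> pp Ip [l Hl]; exists l.
  case: l Hl => // -[_ b0].
  have : chain p 1 (I : A^o -> Prop) (fun=> True).
    exists I; split=> //; first split; first exact: (ideal0 idI).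
      by move=> a x y Ix Iy; apply: (idealD idI (idealM idI a Ix) Iy).
    move=> /(_ 1 Logic.I)[s nps]; rewrite /GRing.scale /= mulr1 => /Ip.
    exact: nps.
  by move/b0.
elim=> [|b IHb].
  rewrite muln0; split=> [v _ //|m]; case: m => // m /chainS[Z [sZ cZ ZX []]] x _.
  exists 1; first by case: pp.
  by rewrite scale1r; apply: (chain_sub cZ) => i [].
have e : 'rV[A]_b.+1 = 'rV[A]_(1 + b) by [].
pose Y : 'rV[A]_(1 + b) -> Prop := @modI (1 + b).
have sY : submod Y by apply: modI_submod.
pose W (v : 'rV[A]_(1 + b)) := modI (rsubmx v).
have sW : submod W.
  split; rewrite /W ?raddf0; first exact: (submod0 (modI_submod b)).
  by move=> a x y Wx Wy; rewrite linearP; apply: (submodP (modI_submod b)).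
pose h1 (a : A^o) : 'rV[A]_(1 + b) := row_mx a%:M 0.
have lin1 : linear h1.
  by move=> a x y; rewrite /h1 scale_row_mx add_row_mx scaler0 addr0 scale_scalar_mx -raddfD.
pose L1 : {linear A^o -> 'rV[A]_(1 + b)} := HB.pack h1 (GRing.isLinear.Build _ _ _ _ h1 lin1).
pose L2 : {linear 'rV[A]_(1 + b) -> 'rV[A]_b} := rsubmx.
rewrite mulnS; apply: (has_len_cat pp (W := W)) => //.
- move=> v Yv i j; rewrite mxE; exact: Yv.
- have YE (a : A^o) : I a <-> Y (h1 a).
    rewrite /Y /modI /h1 inI_row_mx; split=> [Ia|[/(_ 0 0) + _]].
      split; last exact: inI0.
      by move=> i j; rewrite !ord1 mxE eqxx mulr1n.
    by rewrite mxE eqxx mulr1n.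
  have WE v : W v <-> exists a, Y (v - h1 a).
    rewrite /W /Y /modI /h1; split=> [Wv|[a]].
      exists (v 0 0); have -> : v - row_mx (v 0 0)%:M 0 = row_mx 0 (rsubmx v).
        have lv : lsubmx v = (v 0 0)%:M.
          apply/matrixP => i j; rewrite !ord1 !mxE eqxx mulr1n; congr (v _ _).
          exact: val_inj.
        by rewrite -{1}[v]hsubmxK lv opp_row_mx add_row_mx subrr subr0.
      by rewrite inI_row_mx; split=> //; apply: inI0.
    by rewrite -{1}[v]hsubmxK opp_row_mx add_row_mx inI_row_mx subr0 => -[].
  exact: (has_len_map p (h := L1) sY l YE WE).1 Hl.
- apply: (has_len_map p (h := L2) (modI_submod b) (l * b) (fun=> conj id id) _).2 IHb.
  move=> v; split=> // _; exists (row_mx 0 v) => //.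
  by rewrite /L2 /= row_mxKr subrr; apply: inI0.
Qed.

(** [lam q Y] is the length of [A^q / Y] at a prime. The first term is the length of the image of
    [D], the second that of its cokernel modulo [I]. *)
Lemma rank_function : exists2 l, (0 < l)%N &
  exists lam : forall q, ('rV[A]_q -> Prop) -> nat,
  forall q r (D : 'M[A]_(q, r)),
    (lam _ (fun y : 'rV_q => inI I (y *m D)) +
     lam _ (fun z : 'rV_r => exists y, inI I (z - y *m D)) = l * r)%N.
Proof.
have [ps [p [fT pp Ip pmin]]] := min_prime.
have [l l0 Hl] := len_free pp Ip (len_cyclic pp Ip fT pmin).
exists l => //.
(* The default [0] stands for infinite length; the lengths taken below are bounded by [l * r]. *)
pose lam q (Y : 'rV[A]_q -> Prop) := xget 0%N (has_len p Y (fun=> True)).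
have lamE q (Y : 'rV[A]_q -> Prop) n : has_len p Y (fun=> True) n -> lam q Y = n.
  move=> Hn; rewrite /lam; case: xgetP => [m _ Hm|/(_ n)//].
  exact: has_len_uniq Hm Hn.
exists lam => q r D.
pose L : {linear 'rV[A]_q -> 'rV[A]_r} := mulmxr D.
have sI := modI_submod r.
pose W (z : 'rV[A]_r) := exists y, inI I (z - y *m D).
have sW : submod W.
  split; first by exists 0; rewrite mul0mx subr0; apply: inI0.
  move=> a x y [x' Ix] [y' Iy]; exists (a *: x' + y').
  rewrite mulmxDl -scalemxAl opprD addrACA -scalerBr.
  by apply: inID => //; apply: inIZ.
have IW v : modI v -> W v by exists 0; rewrite mul0mx subr0.
have bW : bounded p (@modI r) W (l * r).
  by move=> n cn; apply: (Hl r).2; apply: chain_widen cn.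
have bW' : bounded p W (fun=> True) (l * r).
  move=> n cn; apply: (Hl r).2; have := chain_cat (m := 0) IW cn.
  by rewrite addn0.
have [m Hm _] := has_len_ex IW bW.
have [n Hn _] := has_len_ex (fun _ _ => Logic.I) bW'.
rewrite (lamE _ _ n Hn) (lamE _ _ m).
  have := has_len_cat pp sI sW (conj Logic.I (fun _ _ _ _ _ => Logic.I)) IW (fun _ _ => Logic.I) Hm Hn.
  by move/(has_len_uniq (Hl r)).
exact: (has_len_map p (h := L) sI m (fun=> conj id id) (fun=> conj id id)).2 Hm.
Qed.

End RankFunction.

(** * Maps out of images and of free modules *)

Section ImageModule.
Variables (R : nzRingType) (U V : lmodType R) (D : {linear U -> V}).

Definition in_im : {pred V} := [pred v | `[< exists u, v = D u >]].

Lemma in_imP v : reflect (exists u, v = D u) (v \in in_im).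
Proof. by rewrite inE; apply: asboolP. Qed.

Lemma in_im_closed : submod_closed in_im.
Proof.
split=> [|a x y /in_imP[x' ->] /in_imP[y' ->]]; apply/in_imP; first by exists 0; rewrite raddf0.
by exists (a *: x' + y'); rewrite linearP.
Qed.

HB.instance Definition _ := GRing.isSubmodClosed.Build R V in_im in_im_closed.

(** Injectivity and projectivity quantify over module types, so the image of [D] has to become
    one. *)
Record linear_image := LinearImage { im_val : V; _ : im_val \in in_im }.
HB.instance Definition _ := [isSub for im_val].
HB.instance Definition _ := [Choice of linear_image by <:].
HB.instance Definition _ := [SubChoice_isSubLmodule of linear_image by <:].

Lemma injective_extension (E : lmodType R) (h : {linear U -> E}) :
  injective_module E -> (forall u, D u = 0 -> h u = 0) ->
  exists g : {linear V -> E}, forall u, g (D u) = h u.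
Proof.
move=> injE kD.
have /choice[s sE] (w : linear_image) : exists u, im_val w = D u by case: w => v /= /in_imP.
have hD u u' : D u = D u' -> h u = h u'.
  by move=> /eqP; rewrite -subr_eq0 -raddfB => /eqP/kD/eqP; rewrite raddfB subr_eq0 => /eqP.
have lin_hs : linear (h \o s).
  move=> a x y /=; rewrite -linearP; apply: hD.
  by rewrite linearP -!sE.
pose hs : {linear linear_image -> E} := HB.pack (h \o s) (GRing.isLinear.Build _ _ _ _ (h \o s) lin_hs).
have [g gE] := injE _ _ (val : {linear linear_image -> V}) hs val_inj.
exists g => u.
have Du : D u \in in_im by apply/in_imP; exists u.
rewrite -[D u]/(val (LinearImage Du)) gE; apply: hD.
by rewrite -sE.
Qed.

End ImageModule.

Section FreeMaps.
Variables (R : comNzRingType) (V : lmodType R) (p : nat).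

Definition row_map (x : 'I_p -> V) (y : 'rV[R]_p) : V := \sum_i y 0 i *: x i.

Lemma row_map_linear x : linear (row_map x).
Proof.
move=> a y z; rewrite /row_map scaler_sumr -big_split; apply: eq_bigr => i _.
by rewrite !mxE scalerDl scalerA.
Qed.

HB.instance Definition _ x := GRing.isLinear.Build _ _ _ _ (row_map x) (row_map_linear x).

Lemma row_map_delta x i : row_map x (delta_mx 0 i) = x i.
Proof.
rewrite /row_map (bigD1 i) //= !mxE !eqxx scale1r big1 ?addr0 // => j ji.
by rewrite !mxE (negbTE ji) andbF scale0r.
Qed.

Lemma linear_row_map (h : {linear 'rV[R]_p -> V}) y :
  h y = row_map (fun i => h (delta_mx 0 i)) y.
Proof.
rewrite {1}(row_sum_delta y) linear_sum; apply: eq_bigr => i _.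
by rewrite linearZ.
Qed.

End FreeMaps.

Lemma row_ext (R : comNzRingType) (V : lmodType R) p (g h : {linear 'rV[R]_p -> V}) :
  (forall i, g (delta_mx 0 i) = h (delta_mx 0 i)) -> g =1 h.
Proof.
by move=> gh y; rewrite (linear_row_map g) (linear_row_map h); apply: eq_bigr => i _; rewrite gh.
Qed.

Record mx (R : Type) := Mx { mr : nat; mc : nat; mm : 'M[R]_(mr, mc) }.
Arguments Mx {R mr mc}.

(** * Complexes of matrices and finite injective dimension *)

Section Complex.
Variables (A : comNzRingType).

(* The component of degree [n] of a complex is the free module of rank
   [mr (c n)], and row vectors are mapped to degree [n + 1]; [diff c n m] is
   used for [m = n + 1] only, the second index being there to avoid casts. *)
Definition cpx := int -> mx A.

Definition diff (c : cpx) n m : 'M[A]_(mr (c n), mr (c m)) := conform_mx 0 (mm (c n)).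

Definition complex (I : A -> Prop) (c : cpx) :=
  forall m, inI I (diff c m (m + 1) *m diff c (m + 1) (m + 1 + 1)).

(** The three degrees are independent arguments, so that equal degrees written differently can be
    substituted without casts. *)
Definition exr3 (I : A -> Prop) (c : cpx) l m n := forall y : 'rV_(mr (c m)),
  inI I (y *m diff c m n) -> exists z, inI I (y - z *m diff c l m).
Definition exc3 (I : A -> Prop) (c : cpx) l m n := forall w : 'cV_(mr (c m)),
  inI I (diff c l m *m w) -> exists u, inI I (w - diff c m n *m u).

(* Exactness in degree [m + 1]. *)
Definition exr I c m := exr3 I c m (m + 1) (m + 1 + 1).
Definition exc I c m := exc3 I c m (m + 1) (m + 1 + 1).

(** The dual complex; degrees are negated to keep differentials of degree one, and [exr] and [exc]
    are exchanged. *)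
Definition tc (c : cpx) : cpx := fun n => Mx (diff c (- (n + 1)) (- n))^T.

Lemma diff_tc c n m : m = n + 1 -> diff (tc c) n m = (diff c (- m) (- n))^T.
Proof. by move=> ->; rewrite /diff /= conform_mx_id. Qed.

Lemma exr3_tc I c l m n : m = l + 1 -> n = m + 1 ->
  exr3 I (tc c) l m n <-> exc3 I c (- n) (- m) (- l).
Proof.
move=> ml nm; rewrite /exr3 /exc3 !diff_tc //; split=> H y yI.
  have [|z] := H y^T; first by rewrite -trmx_mul inI_trE.
  rewrite -inI_trE linearB /= trmxK trmx_mul trmxK => Iz.
  by exists z^T.
have [|z] := H y^T; first by rewrite -inI_trE trmx_mul trmxK.
rewrite -inI_trE linearB /= trmxK trmx_mul => Iz.
by exists z^T.
Qed.

Lemma exr_tc I c m : exr I (tc c) m <-> exc I c (- (m + 1 + 1)).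
Proof.
rewrite /exr /exc exr3_tc // (_ : - (m + 1 + 1) + 1 = - (m + 1)); last lia.
by rewrite (_ : - (m + 1) + 1 = - m) //; lia.
Qed.

Lemma exc3_tc I c l m n : m = l + 1 -> n = m + 1 ->
  exc3 I (tc c) l m n <-> exr3 I c (- n) (- m) (- l).
Proof.
move=> ml nm; rewrite /exr3 /exc3 !diff_tc //; split=> H y yI.
  have [|z] := H y^T; first by rewrite -trmx_mul inI_trE.
  rewrite -inI_trE linearB /= trmxK trmx_mul trmxK => Iz.
  by exists z^T.
have [|z] := H y^T; first by rewrite -inI_trE trmx_mul trmxK.
rewrite -inI_trE linearB /= trmxK trmx_mul => Iz.
by exists z^T.
Qed.

Lemma exc_tc I c m : exc I (tc c) m <-> exr I c (- (m + 1 + 1)).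
Proof.
rewrite /exr /exc exc3_tc // (_ : - (m + 1 + 1) + 1 = - (m + 1)); last lia.
by rewrite (_ : - (m + 1) + 1 = - m) //; lia.
Qed.

Lemma complex_tc I c : complex I c -> complex I (tc c).
Proof.
move=> cc m; rewrite !diff_tc // -trmx_mul inI_trE.
have := cc (- (m + 1 + 1)); rewrite (_ : - (m + 1 + 1) + 1 = - (m + 1)); last lia.
by rewrite (_ : - (m + 1) + 1 = - m) //; lia.
Qed.

Lemma exc_mx I c m q (w : 'M_(mr (c (m + 1)), q)) : exc I c m ->
  inI I (diff c m (m + 1) *m w) -> exists u, inI I (w - diff c (m + 1) (m + 1 + 1) *m u).
Proof.
move=> ex Iw.
have /choice[u uE] (j : 'I_q) : exists u, inI I (col j w - diff c (m + 1) (m + 1 + 1) *m u).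
  by apply: ex => a b; rewrite colE mulmxA -colE mxE; apply: Iw.
exists (\matrix_(a, b) u b a 0) => a b.
have := uE b a 0; rewrite !mxE; congr (I (_ - _)).
by apply: eq_bigr => l _; rewrite !mxE.
Qed.

(* Vanishing of Ext^i(-, A/I) for i > del. *)
Definition ext_vanish (I : A -> Prop) (del : nat) := forall c, complex I c -> forall m,
  (forall n, n <= m + del%:Z -> exr I c n) -> exc I c m.

Section InjDim.
Variables (E : inj_resolution (A^o : lmodType A)) (del : nat).
Hypothesis E0 : forall n, (del < n)%N -> forall x : ires_obj E n, x = 0.

(** Dimension shifting in the double complex of maps from [c] to [E], by descending induction on
    [j]. Injectivity extends [h] to some [g0], and the defect [ires_diff E j \o g0] is treated one
    step further in both directions. *)
Lemma cocycle_extension c : complex (Id (fun=> 0) 0) c ->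
  forall j m (h : {linear 'rV[A]_(mr (c (m + 1))) -> ires_obj E j}),
  (forall l : nat, (l + j <= del)%N -> exr (Id (fun=> 0) 0) c (m + l%:Z)) ->
  (forall y, ires_diff E j (h y) = 0) -> (forall z, h (z *m diff c m (m + 1)) = 0) ->
  exists g : {linear 'rV[A]_(mr (c (m + 1 + 1))) -> ires_obj E j},
    (forall y, ires_diff E j (g y) = 0) /\
    forall y, h y = g (y *m diff c (m + 1) (m + 1 + 1)).
Proof.
move=> cc j; have [d dj] := ubnP (del.+1 - j); elim: d j dj => // d IHd j dj m h exm dh hk.
have [jd|dj'] := ltnP del j.
  exists \0; split=> y; first by rewrite raddf0.
  by apply: (etrans (E0 jd _)).
have [y Dy0|g0 g0E] := injective_extension (D := mulmxr (diff c (m + 1) (m + 1 + 1)))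
    (h := h) (@ires_injective _ _ E j).
  have := exm 0%N; rewrite addr0 => /(_ dj') /(_ y) [].
    by apply/Id0; apply: Dy0.
  by move=> z /Id0/eqP; rewrite subr_eq0 => /eqP ->; apply: hk.
have [|l lj|y|z|g' [dg' g'E]] := IHd j.+1 _ (m + 1) (ires_diff E j \o g0).
- by lia.
- have := exm l.+1; rewrite addSnnS => /(_ lj).
  by rewrite (_ : m + l.+1%:Z = m + 1 + l%:Z) //; lia.
- by apply/ires_exactS; exists (g0 y).
- by rewrite /= -[_ *m _]/(mulmxr _ z) g0E dh.
(* [g'] takes values in cycles of [E] and its source is free, so it lifts through [ires_diff E j];
   the lift corrects [g0]. *)
have /choice[x xE] (i : 'I_(mr (c (m + 1 + 1 + 1)))) :
    exists x, ires_diff E j x = g' (delta_mx 0 i).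
  by apply/ires_exactS.
have dx y : ires_diff E j (row_map x y) = g' y.
  apply: (@row_ext _ _ _ (ires_diff E j \o row_map x) g') => i /=.
  by rewrite row_map_delta.
pose G : {linear 'rV[A]_(mr (c (m + 1 + 1))) -> ires_obj E j} :=
  row_map x \o mulmxr (diff c (m + 1 + 1) (m + 1 + 1 + 1)).
exists (g0 \- G); split=> y /=.
  by rewrite raddfB /= dx -g'E subrr.
rewrite -[y *m _]/(mulmxr (diff c (m + 1) (m + 1 + 1)) y) g0E /= -mulmxA.
have /Id0 -> := cc (m + 1).
by rewrite mulmx0 raddf0 subr0.
Qed.

(** A column is a functional into [A]. Composed with the coaugmentation it extends over the next
    degree as a cocycle of [E 0], and such a cocycle comes back into [A]. *)
Lemma ext_vanish_injdim : ext_vanish (Id (fun=> 0) 0) del.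
Proof.
move=> c cc m exm w /Id0 Dw.
pose h : {linear 'rV[A]_(mr (c (m + 1))) -> ires_obj E 0} :=
  ires_coaug E \o (row_map (fun i => w i 0 : A^o)).
have rmE p (v : 'cV[A]_p) y : row_map (fun i => v i 0 : A^o) y = (y *m v) 0 0.
  by rewrite mxE.
have [l ld|y|z|g [dg gE]] := @cocycle_extension c cc 0 m h.
- by apply: exm; lia.
- by apply/ires_exact0; exists (row_map (fun i => w i 0 : A^o) y).
- by rewrite /h /= rmE -mulmxA Dw mulmx0 mxE raddf0.
have /choice[u uE] (i : 'I_(mr (c (m + 1 + 1)))) :
    exists u, ires_coaug E u = g (delta_mx 0 i) by apply/ires_exact0.
exists (\col_i u i); apply/Id0/eqP; rewrite subr_eq0; apply/eqP.
have gE' y : g y = ires_coaug E (row_map u y).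
  by apply: (@row_ext _ _ _ g (ires_coaug E \o row_map u)) => i /=; rewrite row_map_delta.
apply/matrixP => i j; rewrite ord1; apply: (ires_coaug_inj (i := E)).
have := gE (delta_mx 0 i); rewrite /h /= gE' row_map_delta => ->.
congr (ires_coaug E _); rewrite mxE; apply: eq_bigr => l _.
by rewrite -rowE !mxE.
Qed.

End InjDim.
End Complex.

Ltac mxabel :=
  repeat match goal with
  | |- context [@mulmx ?R ?m ?n ?p ?X ?Y] =>
      let a := fresh in set a := (@mulmx R m n p X Y); move: a => ?
  end;
  apply/matrixP => ? ?; rewrite !mxE; ring.

Lemma inI_eq (A : comNzRingType) (I : A -> Prop) p q (M N : 'M[A]_(p, q)) :
  inI I M -> M = N -> inI I N.
Proof. by move=> + <-. Qed.

(** * Change of rings along a regular element *)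

Section ChangeOfRings.
Variables (A : comNzRingType) (f : nat -> A) (mm : nat).
Hypothesis reg : regular f mm.
Local Notation Id := (Id f).
Local Notation idI := (Id_ideal f _).

Definition coeffs i p q (M : 'M[A]_(p, q)) : nat -> 'M[A]_(p, q) :=
  if pselect (exists C : nat -> 'M_(p, q), M = \sum_(j < i) f j *: C j) is left e
  then projT1 (cid e) else fun=> 0.

Lemma coeffsP i p q (M : 'M[A]_(p, q)) : inI (Id i) M ->
  M = \sum_(j < i) f j *: coeffs i M j.
Proof. by move=> /Id_mx e; rewrite /coeffs; case: pselect => // e'; case: (cid e'). Qed.

(* Eisenbud's operators: the square of the differential, computed over [A], is
   \sum_j f j *: eis j, and eis j is a chain map of degree 2 up to homotopy. *)
Definition eis i (c : cpx A) n (j : nat) : 'M[A]_(mr (c n), mr (c (n + 1 + 1))) :=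
  coeffs i (diff c n (n + 1) *m diff c (n + 1) (n + 1 + 1)) j.

Lemma eisP i c n : complex (Id i) c ->
  diff c n (n + 1) *m diff c (n + 1) (n + 1 + 1) = \sum_(j < i) f j *: eis i c n j.
Proof. by move=> cc; apply: coeffsP. Qed.

Lemma eis_top i c n : complex (Id i.+1) c ->
  inI (Id i) (diff c n (n + 1) *m diff c (n + 1) (n + 1 + 1) - f i *: eis i.+1 c n i).
Proof.
move=> cc; rewrite (eisP n cc) big_ord_recr /= addrK; apply/Id_mx.
by exists (eis i.+1 c n).
Qed.

(** Modulo [Id i] the differential squares to [f i] times the last operator, and these two factors
    fill the off-diagonal blocks so that the block matrix squares to zero. If [c] resolves a module
    over [A/(f_0, ..., f_i)], this resolves the same module over [A/(f_0, ..., f_(i-1))]. *)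
Definition Gc i (c : cpx A) : cpx A := fun n =>
  Mx (block_mx (diff c n (n + 1)) (- eis i.+1 c n i)
               (f i)%:M (- diff c (n + 1) (n + 1 + 1))).

Lemma diff_Gc i c n : diff (Gc i c) n (n + 1) =
  block_mx (diff c n (n + 1)) (- eis i.+1 c n i)
           (f i)%:M (- diff c (n + 1) (n + 1 + 1)).
Proof. by rewrite /diff /= conform_mx_id. Qed.

(** Associativity of a triple product of differentials gives the claim multiplied by [f i], and
    regularity cancels the factor. *)
Lemma eis_top_comm i c n : (i < mm)%N -> complex (Id i.+1) c ->
  inI (Id i) (diff c n (n + 1) *m eis i.+1 c (n + 1) i
              - eis i.+1 c n i *m diff c (n + 1 + 1) (n + 1 + 1 + 1)).
Proof.
move=> im cc; apply: (reg_mx reg) => //.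
have r0 := eis_top (n := n) cc; have r1 := eis_top (n := n + 1) cc.
have /(inIB idI)/(_ (inIMr idI (diff c n (n + 1)) r1)) := inIMl idI (diff c (n + 1 + 1) (n + 1 + 1 + 1)) r0.
rewrite mulmxBl mulmxBr mulmxA -scalemxAl -scalemxAr; move/inI_eq; apply.
mxabel.
Qed.

Lemma Gc_sq i c n : diff (Gc i c) n (n + 1) *m diff (Gc i c) (n + 1) (n + 1 + 1) =
  block_mx
    (diff c n (n + 1) *m diff c (n + 1) (n + 1 + 1) - f i *: eis i.+1 c n i)
    (- (diff c n (n + 1) *m eis i.+1 c (n + 1) i
        - eis i.+1 c n i *m diff c (n + 1 + 1) (n + 1 + 1 + 1)))
    0
    (diff c (n + 1) (n + 1 + 1) *m diff c (n + 1 + 1) (n + 1 + 1 + 1)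
      - f i *: eis i.+1 c (n + 1) i).
Proof.
rewrite !diff_Gc mulmx_block; congr block_mx.
- by rewrite mulNmx mul_mx_scalar.
- rewrite mulmxN mulNmx mulmxN; mxabel.
- by rewrite mulNmx mul_scalar_mx mul_mx_scalar subrr.
- rewrite !mulmxN mulNmx mul_scalar_mx; mxabel.
Qed.

Lemma inI_block (I : A -> Prop) p1 p2 q1 q2 (M1 : 'M[A]_(p1, q1)) (M2 : 'M_(p1, q2))
    (M3 : 'M_(p2, q1)) (M4 : 'M_(p2, q2)) :
  inI I (block_mx M1 M2 M3 M4) <-> (inI I M1 /\ inI I M2) /\ (inI I M3 /\ inI I M4).
Proof. by rewrite /block_mx inI_col_mx !inI_row_mx. Qed.

Lemma Gc_complex i c : (i < mm)%N -> complex (Id i.+1) c -> complex (Id i) (Gc i c).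
Proof.
move=> im cc n; rewrite Gc_sq inI_block; do !split; try exact: eis_top.
  by apply: (inIN idI); apply: eis_top_comm.
exact: (inI0 idI).
Qed.

(** The first half of a cycle is a cycle of [c] modulo [Id i.+1]. Writing it as a boundary produces
    [z1] and a coefficient [w] of [f i], the two halves of the preimage; the second equation holds
    after multiplication by [f i]. *)
Lemma Gc_exr i c m : (i < mm)%N -> complex (Id i.+1) c ->
  exr (Id i.+1) c m -> exr (Id i) (Gc i c) m.
Proof.
move=> im cc ex y; rewrite diff_Gc -[y]hsubmxK mul_row_block inI_row_mx.
set y1 := lsubmx y; set y2 := rsubmx y => -[Iy1 Iy2].
have [|z1 /IdS[w Iw]] := ex y1.
  apply/IdS; exists (- y2); apply: inI_eq Iy1 _.
  by rewrite scalerN opprK mul_mx_scalar.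
exists (row_mx z1 w); rewrite diff_Gc mul_row_block opp_row_mx add_row_mx inI_row_mx.
have I1 : inI (Id i) (y1 - (z1 *m diff c m (m + 1) + w *m (f i)%:M)).
  by rewrite opprD addrA mul_mx_scalar.
split=> //; rewrite mulmxN mulmxN opprD !opprK.
apply: (reg_mx reg) => //.
set X := _ + _.
have : inI (Id i) ((y1 - (z1 *m diff c m (m + 1) + w *m (f i)%:M)) *m
   diff c (m + 1) (m + 1 + 1)) by apply: (inIMl idI).
have := inIMr idI z1 (eis_top (n := m) cc).
rewrite mulmxBl mulmxDl mulmxBr !mulmxA => J1 J2.
have := inIB idI Iy1 (inID idI J1 J2); move/inI_eq; apply.
rewrite /X !mul_mx_scalar -!scalemxAl -!scalemxAr; mxabel.
Qed.

(** A column [w] with [D w = f i v] modulo [Id i] gives the column [(v, w)] killed by [Gc], and half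
    of a preimage of that column solves the problem for [w]. The bound [del] is thus kept. *)
Lemma Gc_ext_vanish i del : (i < mm)%N ->
  ext_vanish (Id i) del -> ext_vanish (Id i.+1) del.
Proof.
move=> im van c cc m exm w Iw.
have [l ml] : exists l, m = l + 1 by exists (m - 1); rewrite subrK.
subst m.
have [v Iv] := (IdS _ _ _).1 Iw.
have Iv1 : inI (Id i) (f i *: v - diff c (l + 1) (l + 1 + 1) *m w).
  by apply: (inIBC idI).
have [||u] := @van (Gc i c) (Gc_complex im cc) l _ (col_mx v w).
- by move=> n nl; apply: Gc_exr => //; apply: exm; lia.
- rewrite diff_Gc mul_block_col inI_col_mx; split; last first.
    by rewrite mulNmx mul_scalar_mx.
  apply: (reg_mx reg) => //; rewrite mulNmx scalerDr scalerN.
  have := inIMl idI w (eis_top (n := l) cc); rewrite mulmxBl -scalemxAl => J.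
  have := inID idI J (inIMr idI (diff c l (l + 1)) Iv1).
  move/inI_eq; apply; rewrite mulmxBr -!scalemxAr mulmxA.
  mxabel.
- rewrite diff_Gc -[u]vsubmxK mul_block_col opp_col_mx add_col_mx inI_col_mx => -[_ J].
  exists (- dsubmx u); apply/IdS; exists (usubmx u).
  apply: inI_eq J _.
  rewrite mulNmx mul_scalar_mx mulmxN; mxabel.
Qed.

Lemma ext_vanish_Id i del : (i <= mm)%N ->
  ext_vanish (Id 0) del -> ext_vanish (Id i) del.
Proof.
by move=> + van; elim: i => // i IHi im; apply: Gc_ext_vanish => //; apply: IHi; apply: ltnW.
Qed.

End ChangeOfRings.

(** * Minimal complexes, their continuation to the right, and depth zero *)

Section Build.
Variables (A : comNzRingType) (k : fieldType) (pi : {rmorphism A -> k}).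
Hypothesis (nA : noetherian A) (piS : surjective pi).
Hypothesis unitP : forall x, pi x != 0 -> exists y, x * y = 1.
Variables (I : A -> Prop) (idI : ideal I).
Local Notation cpx := (cpx A).

(** The generators are chosen by [cid], which turns [lnext] and [rnext] into functions that can be
    iterated. *)
Lemma ker_gen p q (M : 'M[A]_(p, q)) : {K : {w : nat & 'M[A]_(w, p)} |
  [/\ inI I (projT2 K *m M),
     forall y : 'rV_p, inI I (y *m M) -> exists z, inI I (y - z *m projT2 K)
   & forall z : 'rV_(projT1 K), inI I (z *m projT2 K) -> map_mx pi z = 0]}.
Proof.
apply: cid.
have sX : submod (fun y : 'rV[A]_p => inI I (y *m M)).
  split; first by rewrite mul0mx; apply: inI0.
  move=> a x y Ix Iy; rewrite mulmxDl -scalemxAl.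
  by apply: inID => //; apply: inIZ.
have [w [K [XK genK minK]]] := min_gen nA unitP idI sX.
exists (existT _ w K); split=> //=.
by apply/inI_row => i; rewrite rowE mulmxA; apply: XK.
Qed.

Definition lnext (M : mx A) : mx A := Mx (projT2 (sval (ker_gen (mm M)))).
Definition rnext (M : mx A) : mx A := Mx (projT2 (sval (ker_gen (mm M)^T)))^T.

Lemma lnextP (M : mx A) : [/\ inI I (mm (lnext M) *m mm M),
     forall y : 'rV_(mr M), inI I (y *m mm M) -> exists z, inI I (y - z *m mm (lnext M))
   & forall z : 'rV_(mr (lnext M)), inI I (z *m mm (lnext M)) -> map_mx pi z = 0].
Proof. by rewrite /lnext /=; case: ker_gen. Qed.

Lemma rnextP (M : mx A) : [/\ inI I (mm M *m mm (rnext M)),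
     forall w : 'cV_(mc M), inI I (mm M *m w) -> exists u, inI I (w - mm (rnext M) *m u)
   & forall u : 'cV_(mc (rnext M)), inI I (mm (rnext M) *m u) -> map_mx pi u = 0].
Proof.
rewrite /rnext /=; case: ker_gen => -[w K] /= [K1 K2 K3]; split.
- by rewrite -inI_trE trmx_mul trmxK.
- move=> v Iv; have [|z Iz] := K2 v^T; first by rewrite -trmx_mul inI_trE.
  by exists z^T; rewrite -trmx_mul -inI_trE linearB /= trmxK.
- move=> u Iu; have := K3 u^T; rewrite -inI_trE trmx_mul trmxK => /(_ Iu).
  by rewrite -map_trmx => /(congr1 trmx); rewrite trmxK trmx0.
Qed.

Lemma exc_local (c c' : cpx) m : c m = c' m -> c (m + 1) = c' (m + 1) ->
  mr (c (m + 1 + 1)) = mr (c' (m + 1 + 1)) -> exc I c m -> exc I c' m.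
Proof. by rewrite /exc /exc3 /diff => -> -> ->. Qed.

Definition cx_at (c : cpx) m := inI I (diff c m (m + 1) *m diff c (m + 1) (m + 1 + 1)).

Lemma cx_local (c c' : cpx) m : c m = c' m -> c (m + 1) = c' (m + 1) ->
  mr (c (m + 1 + 1)) = mr (c' (m + 1 + 1)) -> cx_at c m -> cx_at c' m.
Proof. by rewrite /cx_at /diff => -> -> ->. Qed.

Lemma exr_lnext (c : cpx) z : c z = lnext (c (z + 1)) ->
  mr (c (z + 1 + 1)) = mc (c (z + 1)) -> exr I c z.
Proof.
rewrite /exr /exr3 /diff => -> ->; rewrite !conform_mx_id => y.
by have [_ + _] := lnextP (c (z + 1)); apply.
Qed.

Lemma cx_lnext (c : cpx) z : c z = lnext (c (z + 1)) ->
  mr (c (z + 1 + 1)) = mc (c (z + 1)) -> cx_at c z.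
Proof.
by rewrite /cx_at /diff => -> ->; rewrite !conform_mx_id; have [] := lnextP (c (z + 1)).
Qed.

Lemma exc_rnext (c : cpx) z : c (z + 1) = rnext (c z) ->
  c (z + 1 + 1) = rnext (c (z + 1)) -> exc I c z.
Proof.
rewrite /exc /exc3 /diff => e1 ->; rewrite e1 !conform_mx_id => w.
by have [_ + _] := rnextP (c z); apply.
Qed.

Lemma cx_rnext (c : cpx) z : c (z + 1) = rnext (c z) ->
  c (z + 1 + 1) = rnext (c (z + 1)) -> cx_at c z.
Proof.
by rewrite /cx_at /diff => e1 ->; rewrite e1 !conform_mx_id; have [] := rnextP (c z).
Qed.

Lemma inI_cols p q (M : 'M[A]_(p, q)) : (forall j, map_mx pi (col j M) = 0) ->
  map_mx pi M = 0.
Proof.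
by move=> H; apply/matrixP => i j; have /matrixP/(_ i 0) := H j; rewrite !mxE.
Qed.

(** The columns of the new matrix are relations between generators chosen minimally one step
    earlier, so they vanish over [k]. *)
Lemma min_rnext (c : cpx) z : c (z + 1) = rnext (c z) ->
  c (z + 1 + 1) = rnext (c (z + 1)) -> c (z + 1 + 1 + 1) = rnext (c (z + 1 + 1)) ->
  map_mx pi (diff c (z + 1 + 1) (z + 1 + 1 + 1)) = 0.
Proof.
rewrite /diff => e1 e2 ->; rewrite e2 conform_mx_id e1; apply: inI_cols => j.
have [I2 _ _] := rnextP (rnext (c z)); have [_ _ mn] := rnextP (c z).
by apply: mn => a b; rewrite colE mulmxA -colE mxE; apply: I2.
Qed.

Lemma min_lnext (c : cpx) z : c z = lnext (c (z + 1)) ->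
  c (z + 1) = lnext (c (z + 1 + 1)) ->
  mr (c (z + 1)) = mc (c z) -> map_mx pi (diff c z (z + 1)) = 0.
Proof.
move=> e0 e1; rewrite /diff => ->; rewrite conform_mx_id e0 e1.
apply/row_matrixP => i; rewrite row0 -map_row.
have [I2 _ _] := lnextP (lnext (c (z + 1 + 1))); have [_ _ mn] := lnextP (c (z + 1 + 1)).
by apply: mn; rewrite rowE -mulmxA; apply: inIMr.
Qed.

(* The complex [c] up to degree [n0], continued by successive kernels of
   transposed maps, so as to make all columns exact from there on. *)
Definition rightc (c : cpx) (n0 : int) : cpx := fun z =>
  if z < n0 then c z else iter `|z - n0|.+1 rnext (c (n0 - 1)).

Lemma rightc_lt c n0 z : z < n0 -> rightc c n0 z = c z.
Proof. by rewrite /rightc => ->. Qed.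

Lemma rightcS c n0 z : n0 <= z + 1 -> rightc c n0 (z + 1) = rnext (rightc c n0 z).
Proof.
rewrite /rightc => nz; rewrite ltNge nz /=.
case: ifPn => zn.
  have -> : z = n0 - 1 by lia.
  by rewrite subrK subrr.
by have -> : `|(z + 1 - n0)%R|%N = (`|(z - n0)%R|%N).+1 by lia.
Qed.

Definition wf (c : cpx) := forall z, mc (c z) = mr (c (z + 1)).

Lemma rightc_mr c n0 z : wf c -> z <= n0 -> mr (rightc c n0 z) = mr (c z).
Proof.
move=> wfc; rewrite le_eqVlt => /orP[/eqP ->|zn]; last by rewrite rightc_lt.
have := @rightcS c n0 (n0 - 1); rewrite subrK => -> //.
by rewrite rightc_lt ?ltrBlDr ?ltrDl //= wfc subrK.
Qed.

Lemma rightc_exc c n0 m : wf c -> (forall n, n + 1 < n0 -> exc I c n) ->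
  exc I (rightc c n0) m.
Proof.
move=> wfc ex; have [nm|mn] := leP n0 (m + 1); first by apply: exc_rnext; rewrite rightcS //; lia.
apply: exc_local (ex m mn); rewrite ?rightc_mr ?rightc_lt //; lia.
Qed.

Lemma rightc_complex c n0 : wf c -> complex I c -> complex I (rightc c n0).
Proof.
move=> wfc cc m; have [nm|mn] := leP n0 (m + 1); first by apply: cx_rnext; rewrite rightcS //; lia.
apply: cx_local (cc m); rewrite ?rightc_mr ?rightc_lt //; lia.
Qed.

Variables (del : nat) (van : ext_vanish I del).

Lemma exr_exc c m : complex I c -> (forall n, exr I c n) -> exc I c m.
Proof. by move=> cc ex; apply: van. Qed.

(** The rows of the transposed complex are the columns of [c], so the same vanishing also works
    backwards. *)
Lemma exc_exr c m : complex I c -> (forall n, exc I c n) -> exr I c m.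
Proof.
move=> cc ex; rewrite (_ : m = - (- (m + 1 + 1) + 1 + 1)); last lia.
rewrite -exc_tc; apply: exr_exc; first exact: complex_tc.
by move=> n; apply/exr_tc.
Qed.

Section Socle.
Variable u : A.
Hypotheses (Im : forall x, I x -> pi x = 0) (nIu : ~ I u)
  (mu : forall a, pi a = 0 -> I (a * u)).

Lemma socle_coef a : I (u * a) -> pi a = 0.
Proof.
move=> Iua; apply/eqP; apply: contraT => /unitP[b ab]; case: nIu.
by rewrite -[u]mulr1 -ab mulrA; apply: ideal_mulr.
Qed.

(* [W] generates the cocycles and [W'] the relations of [W]; a functional on
   cocycles modulo coboundaries with values in the socle [A u] would be a row
   vector killed by [W'] but not coming from a row vector [y W]. *)
Lemma depth_zero_core b0 b1 b2 q q' (D0 : 'M[A]_(b0, b1)) (D1 : 'M_(b1, b2))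
    (W : 'M_(b1, q)) (W' : 'M_(q, q')) :
  (forall y : 'rV_b1, inI I (y *m D1) -> exists z, inI I (y - z *m D0)) ->
  inI I (D0 *m D1) -> inI I (D0 *m W) -> inI I (W *m W') ->
  (forall w : 'cV_b1, inI I (D0 *m w) -> exists u, inI I (w - W *m u)) ->
  (forall h : 'rV_q, inI I (h *m W') -> exists y, inI I (h - y *m W)) ->
  forall w : 'cV_b1, inI I (D0 *m w) -> exists u, inI I (w - D1 *m u).
Proof.
move=> R1 DD DW WW' genW exq w Dw.
have [C CE] : exists C, inI I (D1 - W *m C).
  have /choice[v vE] (j : 'I_b2) : exists v, inI I (col j D1 - W *m v).
    by apply: genW => a b; rewrite colE mulmxA -colE mxE; apply: DD.
  exists (\matrix_(a, b) v b a 0) => a b.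
  have := vE b a 0; rewrite !mxE; congr (I (_ - _)).
  by apply: eq_bigr => l _; rewrite !mxE.
(* Row freeness over [k] makes [W] a combination of [D1] and of products [W W']. A kernel vector
   [hb] would give the socle-valued row [u *: h0], which comes from some [y W]; then [y] kills [D1],
   is a boundary, and [u *: h0] vanishes. *)
have free : row_free (row_mx (map_mx pi C) (map_mx pi W')).
  rewrite -kermx_eq0; apply/eqP/row_matrixP => i; rewrite row0.
  set hb := row i _.
  have : hb *m row_mx (map_mx pi C) (map_mx pi W') = 0.
    by apply/eqP; rewrite -sub_kermx row_sub.
  rewrite mul_mx_row => /eqP; rewrite row_mx_eq0 => /andP[/eqP hC /eqP hW'].
  pose h0 := map_mx (lft piS) hb; pose h := u *: h0.
  have uI q0 (X : 'M_(q, q0)) : hb *m map_mx pi X = 0 -> inI I (h *m X).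
    move=> hX a b; rewrite -scalemxAl mxE mulrC; apply: mu.
    have /matrixP/(_ a b) : map_mx pi (h0 *m X) = 0 by rewrite map_mxM lft_mx.
    by rewrite !mxE.
  have [y yE] := exq h (uI _ _ hW').
  have yD1 : inI I (y *m D1).
    have := inIB idI (uI _ _ hC) (inIMl idI C yE).
    move/(inID idI)/(_ (inIMr idI y CE)); move/inI_eq; apply.
    by rewrite mulmxBl mulmxBr !mulmxA; mxabel.
  have [z zE] := R1 y yD1.
  have hI : inI I h.
    have := inID idI yE (inIMl idI W zE).
    move/(inID idI)/(_ (inIMr idI z DW)); move/inI_eq; apply.
    by rewrite mulmxBl !mulmxA; mxabel.
  apply/matrixP => a b; rewrite [RHS]mxE -[hb](lft_mx piS) mxE.
  by apply: socle_coef; have := hI a b; rewrite mxE.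
have [X XE] : exists X, row_mx C W' *m X = 1%:M.
  pose X0 := map_mx (lft piS) (pinvmx (row_mx (map_mx pi C) (map_mx pi W'))).
  have [|F [_ FE]] := inv_mx unitP (E := row_mx C W' *m X0).
    by rewrite map_mxM map_row_mx lft_mx mulmxVp.
  by exists (X0 *m F); rewrite mulmxA.
have [v vE] := genW w Dw.
exists (usubmx X *m v).
move: XE; rewrite -[X]vsubmxK mul_row_col => XE.
have : inI I (W *m (C *m usubmx X + W' *m dsubmx X) *m v - D1 *m (usubmx X *m v)).
  have := inIB idI (inIMl idI (dsubmx X *m v) WW') (inIMl idI (usubmx X *m v) CE).
  by move/inI_eq; apply; rewrite !mulmxDr !mulmxDl !mulNmx !mulmxA; mxabel.
rewrite XE mulmx1 col_mxKu => J; exact: inI_trans vE J.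
Qed.

(** [c'] agrees with [c] up to degree [m] and has exact columns everywhere, hence exact rows. Its
    next two matrices are the generators [W] and relations [W'] of [depth_zero_core]. *)
Lemma exc_step c m : wf c -> complex I c -> (forall n, n <= m -> exr I c n) ->
  (forall n, n < m -> exc I c n) -> exc I c m.
Proof.
move=> wfc cc exm exm'; pose c' := rightc c (m + 1).
have cc' : complex I c' by apply: rightc_complex.
have ex' n : exc I c' n by apply: rightc_exc => // l; rewrite ltrD2r; apply: exm'.
have er' : exr I c' (m + 1) by apply: exc_exr.
have e0 : c' m = c m by rewrite /c' rightc_lt //; lia.
have e1 : c' (m + 1) = rnext (c m) by rewrite /c' rightcS // -/c' e0.
have e2 : c' (m + 1 + 1) = rnext (c' (m + 1)) by rewrite /c' rightcS //; lia.
have e3 : c' (m + 1 + 1 + 1) = rnext (c' (m + 1 + 1)) by rewrite /c' rightcS //; lia.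
move: er' (cc' (m + 1)); rewrite /exr /exr3 /diff e3 e2 e1 !conform_mx_id.
have [DW genW _] := rnextP (c m).
move=> er' WW'.
move: (exm m (lexx _)) (cc m); rewrite /exc /exc3 /exr /exr3.
move: (diff c (m + 1) (m + 1 + 1)); rewrite /diff.
case: _ / (wfc m) => D1; rewrite conform_mx_id => R1 DD.
exact: (depth_zero_core R1 DD DW WW' genW er').
Qed.

(** In depth zero the delay [del] disappears: [van] gives exact columns up to [m - del], and
    [exc_step] climbs from there one degree at a time. *)
Lemma self_injective c m : wf c -> complex I c -> (forall n, n <= m -> exr I c n) ->
  forall n, n <= m -> exc I c n.
Proof.
move=> wfc cc exm.
have H (d : nat) : forall n, n <= m -> n <= m - del%:Z + d%:Z -> exc I c n.
  elim: d => [|d IHd] n nm nd; first by apply: van => // l ln; apply: exm; lia.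
  have [nd'|nd'] := leP n (m - del%:Z + d%:Z); first exact: IHd.
  apply: exc_step => // l ln; first by apply: exm; lia.
  by apply: IHd; lia.
by move=> n nm; apply: (H (absz (n - (m - del%:Z))%R) n nm); lia.
Qed.

End Socle.
End Build.

(** * Resolutions of cokernels and the socle *)

Section OneSided.
Variables (A : comNzRingType) (k : fieldType) (pi : {rmorphism A -> k}).
Hypothesis (nA : noetherian A) (piS : surjective pi).
Hypothesis unitP : forall x, pi x != 0 -> exists y, x * y = 1.
Variables (I : A -> Prop) (idI : ideal I).
Local Notation cpx := (cpx A).
Local Notation lnext := (lnext nA unitP idI).
Local Notation rnext := (rnext nA unitP idI).
Local Notation rightc := (rightc nA unitP idI).

(* A minimal free resolution over [A / I] of the cokernel of [M], placed in
   degrees [<= 0]. *)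
Definition onec (M : mx A) : cpx := fun z =>
  match z with
  | Posz 0 => Mx (mr := mc M) (mc := 0) 0
  | Posz _ => Mx (mr := 0) (mc := 0) 0
  | Negz i => iter i lnext M
  end.

Lemma onec_lnext M z : z <= -2 -> onec M z = lnext (onec M (z + 1)).
Proof.
case: z => // -[//|i] _.
by rewrite (_ : Negz i.+1 + 1 = Negz i) //; lia.
Qed.

Lemma onec_pos M z : 0 < z -> onec M z = Mx (mr := 0) (mc := 0) 0.
Proof. by case: z => // -[]. Qed.

Lemma onec_wf M : wf (onec M).
Proof.
move=> z; have [z2|z2] := leP z (-2); first by rewrite onec_lnext.
have [->|[->|z1]] : z = -1 \/ z = 0 \/ 0 < z by lia.
- by [].
- by [].
- by rewrite !onec_pos //; lia.
Qed.

Lemma onec_exr M z : z <= -2 -> exr I (onec M) z.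
Proof. by move=> z2; apply: exr_lnext (onec_lnext M z2) _; rewrite onec_wf. Qed.

Lemma onec_complex M : complex I (onec M).
Proof.
move=> z; have [z2|z2] := leP z (-2).
  by apply: cx_lnext (onec_lnext M z2) _; rewrite onec_wf.
have E : mr (onec M (z + 1 + 1)) = 0%N by rewrite onec_pos //; lia.
by move=> i j; have : (j < 0)%N by rewrite -[X in (_ < X)%N]E; apply: ltn_ord.
Qed.

Lemma onec_min M z : z <= -3 -> map_mx pi (diff (onec M) z (z + 1)) = 0.
Proof.
by move=> z3; apply: min_lnext (onec_lnext M _) (onec_lnext M _) _; rewrite -?onec_wf //; lia.
Qed.

Lemma res_field_ex : exists w (M0 : 'M[A]_(w, 1)),
  map_mx pi M0 = 0 /\ forall x, pi x = 0 -> exists y : 'rV_w, I (x - (y *m M0) 0 0).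
Proof.
have sX : submod (fun y : 'rV[A]_1 => map_mx pi y = 0).
  split; first by rewrite map_mx0.
  by move=> a x y x0 y0; rewrite map_mxD map_mxZ x0 y0 scaler0 addr0.
have [w [K HK]] := submod_fg nA sX; exists w, K; split.
  apply/row_matrixP => i; rewrite row0 -map_row; apply/HK; exists (delta_mx 0 i).
  by rewrite rowE.
move=> x x0; have /HK[y yE] : map_mx pi (x%:M : 'rV[A]_1) = 0.
  by rewrite map_scalar_mx x0 raddf0.
exists y; rewrite -yE mxE eqxx mulr1n subrr; exact: ideal0.
Qed.

Section Socle.
Variables (del : nat) (van : ext_vanish I del) (u : A).
Hypotheses (nIu : ~ I u) (mu : forall a, pi a = 0 -> I (a * u)).

(** The matrix [W] that continues a resolution of the residue field to the right lists generators of
    the socle. Two of them would give a row [W 0 i *: delta_mx 0 j] killed by [W'] but not a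
    multiple of [W]; so there is one, and it differs from [u] by a unit. *)
Lemma socle_gen x : (forall a, pi a = 0 -> I (a * x)) -> exists b, I (x - b * u).
Proof.
have [w [M0 [M00 genM]]] := res_field_ex.
pose c := onec (Mx M0).
have cc : complex I c by apply: onec_complex.
have wfc : wf c by apply: onec_wf.
have excc n : n <= -2 -> exc I c n.
  by apply: (self_injective nA piS unitP idI van nIu mu wfc cc (m := -2)) => // l ln; apply: onec_exr.
pose c' := rightc c 0.
have cc' : complex I c' by apply: rightc_complex.
have ex' n : exc I c' n by apply: rightc_exc => // l l0; apply: excc; lia.
have er' : exr I c' 0 by exact: (exc_exr van cc' ex').
have e1 : c' (- 1 + 1) = rnext (Mx M0) by rewrite /c' rightcS; [rewrite rightc_lt|lia].
rewrite (_ : - 1 + 1 = 0) // in e1.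
have e2 : c' (0 + 1) = rnext (rnext (Mx M0)) by rewrite /c' rightcS // -/c' e1.
have e3 : c' (0 + 1 + 1) = rnext (rnext (rnext (Mx M0))) by rewrite /c' rightcS // -/c' e2.
move: er'; rewrite /exr /exr3 /diff e3 e2 e1 !conform_mx_id => er.
have [DW genW minW] := rnextP nA unitP idI (Mx M0).
have [WW _ _] := rnextP nA unitP idI (rnext (Mx M0)).
have W'0 : map_mx pi (mm (rnext (rnext (Mx M0)))) = 0.
  apply: inI_cols => j; apply: minW.
  by move=> a b; rewrite colE mulmxA -colE mxE; apply: WW.
have {c c' cc wfc excc cc' ex' e1 e2 e3 er DW genW minW WW W'0}
    [q [q' [W [W' [[er DW] [genW minW W'0]]]]]] : exists q q' (W : 'M[A]_(1, q)) (W' : 'M[A]_(q, q')),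
    ((forall h : 'rV_q, inI I (h *m W') -> exists y, inI I (h - y *m W)) /\ inI I (M0 *m W)) /\
    [/\ forall w : 'cV_1, inI I (M0 *m w) -> exists u, inI I (w - W *m u),
      forall u : 'cV_q, inI I (W *m u) -> map_mx pi u = 0 & map_mx pi W' = 0].
  by exists (mc (rnext (Mx M0))), (mc (rnext (rnext (Mx M0)))), (mm (rnext (Mx M0))),
    (mm (rnext (rnext (Mx M0)))).
have socW j a : pi a = 0 -> I (a * W 0 j).
  move=> /genM[y Iy]; rewrite -(subrK ((y *m M0) 0 0) a) mulrDl; apply: idealD => //.
    exact: ideal_mulr.
  have := inIMr idI y DW => /(_ 0 j); rewrite mulmxA mxE.
  by rewrite big_ord_recl big_ord0 addr0 ord1.
have nW j : ~ I (W 0 j).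
  move=> IW; have /matrixP/(_ j 0) : map_mx pi (delta_mx j 0 : 'cV[A]_q) = 0.
    by apply: minW => a b; rewrite -colE !mxE ord1.
  by rewrite !mxE !eqxx rmorph1 => /eqP; rewrite oner_eq0.
have Wij (i j : 'I_q) : i = j.
  apply: contrapT => /eqP ij.
  pose h : 'rV[A]_q := W 0 i *: delta_mx 0 j.
  have [|y yE] := er h.
    move=> a b; rewrite -scalemxAl mxE mulrC; apply: socW.
    by rewrite -rowE mxE; have /matrixP/(_ j b) := W'0; rewrite !mxE.
  have yWE l : I (h 0 l - y 0 0 * W 0 l).
    have := yE 0 l; rewrite !mxE big_ord_recl big_ord0 addr0.
    by congr (I (_ - _ * _)); congr (W _ _); apply: ord1.
  have := yWE i; rewrite !mxE eqxx (negbTE ij) mulr0 add0r => /(idealN idI); rewrite opprK => Ii.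
  have := yWE j; rewrite !mxE !eqxx mulr1 => Ij.
  (* In [h = y W], entry [j] puts [W 0 i] into [I] if [y] is in the maximal ideal, and entry [i]
     does so if [y] is a unit. *)
  have [y0|/unitP[v yv]] := eqVneq (pi (y 0 0)) 0.
    by apply: (nW i); rewrite -(subrK (y 0 0 * W 0 j) (W 0 i)); apply: idealD => //; apply: socW.
  by apply: (nW i); rewrite -[W 0 i]mul1r -yv mulrAC; apply: ideal_mulr.
have gen z : (forall a, pi a = 0 -> I (a * z)) -> exists v : 'cV_q, I (z - (W *m v) 0 0).
  move=> mz; have [|v vE] := genW z%:M.
    move=> a b; rewrite mul_mx_scalar mxE mulrC; apply: mz.
    by have /matrixP/(_ a b) := M00; rewrite !mxE.
  by exists v; have := vE 0 0; rewrite !mxE eqxx mulr1n.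
move=> /gen[v Iv]; have [v0 Iv0] := gen u mu.
case: q W' W v v0 Iv Iv0 er DW genW minW W'0 socW nW Wij {gen} => [|q] W' W v v0.
  by move=> _; rewrite mxE big_ord0 subr0 => /nIu.
move=> Iv Iv0 _ _ _ _ _ socW nW Wij.
have q0 : q = 0%N.
  by case: q {W W' v v0 Iv Iv0 socW nW} Wij => // q /(_ 0 1).
subst q; move: Iv Iv0; rewrite !mxE !big_ord_recl !big_ord0 !addr0.
set w0 := W _ _ => Iv Iv0.
have [v00|/unitP[t tE]] := eqVneq (pi (v0 0 0)) 0.
  case: nIu; rewrite -(subrK (w0 * v0 0 0) u); apply: idealD => //.
  by rewrite mulrC; apply: socW.
exists (v 0 0 * t).
have := idealB idI Iv (idealM idI (v 0 0 * t) Iv0).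
have -> : x - w0 * v 0 0 - v 0 0 * t * (u - w0 * v0 0 0) =
  x - v 0 0 * t * u + w0 * v 0 0 * (v0 0 0 * t - 1) by ring.
by rewrite tE subrr mulr0 addr0.
Qed.

End Socle.
End OneSided.

(** * Ranks of Ext over the residue field *)

Section QuotientRank.
Variables (A : comNzRingType) (k : fieldType) (pi : {rmorphism A -> k}).

Definition qrank (V : lmodType A) (Z B : V -> Prop) (n : nat) : Prop :=
  exists z : 'I_n -> V, [/\ forall j, Z (z j),
    forall x, Z x -> exists c : 'I_n -> A, B (x - \sum_j c j *: z j)
  & forall c : 'I_n -> A, B (\sum_j c j *: z j) -> forall j, pi (c j) = 0].

(** The isomorphisms met below depend on choices of lifts; a linear relation transports a basis
    without turning the choices into a map. *)
Lemma qrank_transport (V1 V2 : lmodType A) (Z1 B1 : V1 -> Prop) (Z2 B2 : V2 -> Prop)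
    (rel : V1 -> V2 -> Prop) n :
  submod Z1 -> submod Z2 -> rel 0 0 ->
  (forall a x y x' y', rel x x' -> rel y y' -> rel (a *: x + y) (a *: x' + y')) ->
  (forall x, Z1 x -> exists2 y, Z2 y & rel x y) ->
  (forall y, Z2 y -> exists2 x, Z1 x & rel x y) ->
  (forall x y, Z1 x -> Z2 y -> rel x y -> B1 x <-> B2 y) ->
  qrank Z1 B1 n -> qrank Z2 B2 n.
Proof.
move=> sZ1 sZ2 rel0 relP rel12 rel21 relB [z [Zz gen ind]].
have /choice[z' z'P] j : exists y, Z2 y /\ rel (z j) y.
  by have [y Zy zy] := rel12 _ (Zz j); exists y.
have relS (c : 'I_n -> A) : rel (\sum_j c j *: z j) (\sum_j c j *: z' j).
  elim/big_rec2: _ => // j x y _ xy; apply: relP => //; by have [] := z'P j.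
have ZS (c : 'I_n -> A) : Z1 (\sum_j c j *: z j) /\ Z2 (\sum_j c j *: z' j).
  split; apply: submod_sum => // j _; apply: submodZ => //.
  by have [] := z'P j.
exists z'; split=> [j|y Zy|c Bc]; first by have [] := z'P j.
  have [x Zx xy] := rel21 y Zy; have [c Bc] := gen x Zx; exists c.
  have [S1 S2] := ZS c.
  apply/(relB (x - \sum_j c j *: z j)) => //; try exact: submodB.
  rewrite [x - _]addrC [y - _]addrC -!scaleN1r; exact: relP.
by have [S1 S2] := ZS c; have := (relB _ _ S1 S2 (relS c)).2 Bc; apply: ind.
Qed.

Lemma qrank_free n : qrank (fun=> True) (fun y : 'rV[A]_n => map_mx pi y = 0) n.
Proof.
exists (fun j => delta_mx 0 j); split=> // [x _|c].
  exists (fun j => x 0 j); rewrite {1}(row_sum_delta x) subrr; exact: map_mx0.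
move=> + j => /matrixP/(_ 0 j); rewrite !mxE summxE (bigD1 j) //= big1 => [|l lj].
  by rewrite !mxE !eqxx mulr1 addr0.
by rewrite !mxE eq_sym (negbTE lj) andbF mulr0.
Qed.

End QuotientRank.

Section Ext.
Variables (A : comNzRingType) (k : fieldType) (pi : {rmorphism A -> k}).
Local Notation cpx := (cpx A).

Definition inS p (Y : 'rV[A]_p -> Prop) q (w : 'M[A]_(q, p)) := forall i, Y (row i w).

Section InS.
Variables (p : nat) (Y : 'rV[A]_p -> Prop) (sY : submod Y).

Lemma inS0 q : inS Y (0 : 'M_(q, p)).
Proof. by move=> i; rewrite row0; apply: submod0. Qed.
Lemma inSP q a (w v : 'M_(q, p)) : inS Y w -> inS Y v -> inS Y (a *: w + v).
Proof. by move=> Yw Yv i; rewrite linearD linearZ /=; exact: (submodP sY a (Yw i) (Yv i)). Qed.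
Lemma inSD q (w v : 'M_(q, p)) : inS Y w -> inS Y v -> inS Y (w + v).
Proof. by move=> Yw Yv i; rewrite linearD; exact: (submodD sY (Yw i) (Yv i)). Qed.
Lemma inSN q (w : 'M_(q, p)) : inS Y w -> inS Y (- w).
Proof. by move=> Yw i; rewrite linearN; exact: (submodN sY (Yw i)). Qed.
Lemma inSM q r (M : 'M_(r, q)) (w : 'M_(q, p)) : inS Y w -> inS Y (M *m w).
Proof.
move=> Yw i; rewrite row_mul mulmx_sum_row; apply: submod_sum => // j _.
by apply: submodZ.
Qed.
Lemma inS_eq q (w v : 'M_(q, p)) : inS Y w -> w = v -> inS Y v.
Proof. by move=> + <-. Qed.
Lemma inS_col q1 q2 (w : 'M_(q1, p)) (v : 'M_(q2, p)) :
  inS Y (col_mx w v) <-> inS Y w /\ inS Y v.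
Proof.
split=> [Y12|[Y1 Y2] i].
  by split=> i; [have := Y12 (lshift q2 i); rewrite rowKu
                |have := Y12 (rshift q1 i); rewrite rowKd].
by case: (split_ordP i) => j ->; rewrite ?rowKu ?rowKd.
Qed.
End InS.

Definition extZ (c : cpx) m p (Y : 'rV[A]_p -> Prop) (w : 'M_(mr (c (m + 1)), p)) :=
  inS Y (diff c m (m + 1) *m w).
Definition extB (c : cpx) m p (Y : 'rV[A]_p -> Prop) (w : 'M_(mr (c (m + 1)), p)) :=
  exists u, inS Y (w - diff c (m + 1) (m + 1 + 1) *m u).

(* [c] is a free resolution in degrees [<= 0]: the module Ext^n(-, A^p/Y) of
   its cokernel is read off in degree [m + 1 = - n]. *)
Definition extr (c : cpx) m p (Y : 'rV[A]_p -> Prop) n :=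
  qrank pi (extZ (c := c) (m := m) Y) (extB (c := c) (m := m) Y) n.

Lemma extZ_submod c m p (Y : 'rV[A]_p -> Prop) : submod Y -> submod (extZ (c := c) (m := m) Y).
Proof.
move=> sY; split; rewrite /extZ; first by rewrite mulmx0; apply: inS0.
by move=> a x y Zx Zy; rewrite mulmxDr -scalemxAr; apply: inSP.
Qed.

Section Shift.
Variables (I : A -> Prop) (idI : ideal I) (c : cpx) (cc : complex I c).

Definition kerD p q (D : 'M[A]_(p, q)) := fun y : 'rV_p => inI I (y *m D).
Definition imD p q (D : 'M[A]_(p, q)) := fun z : 'rV_q => exists y, inI I (z - y *m D).

Lemma kerD_submod p q (D : 'M[A]_(p, q)) : submod (kerD D).
Proof.
split; first by rewrite /kerD mul0mx; apply: inI0.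
move=> a x y Ix Iy; rewrite /kerD mulmxDl -scalemxAl.
by apply: inID => //; apply: inIZ.
Qed.

Lemma imD_submod p q (D : 'M[A]_(p, q)) : submod (imD D).
Proof.
split; first by exists 0; rewrite mul0mx subr0; apply: inI0.
move=> a x y [x' Ix] [y' Iy]; exists (a *: x' + y').
rewrite mulmxDl -scalemxAl opprD addrACA -scalerBr.
by apply: inID => //; apply: inIZ.
Qed.

Lemma inS_kerD p q (D : 'M[A]_(p, q)) r (w : 'M_(r, p)) :
  inS (kerD D) w <-> inI I (w *m D).
Proof. by rewrite /inS /kerD -inI_row; split=> H i; have := H i; rewrite row_mul. Qed.

Lemma inS_imD p q (D : 'M[A]_(p, q)) r (w : 'M_(r, q)) :
  inS (imD D) w <-> exists u, inI I (w - u *m D).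
Proof.
split=> [/choice[u uE]|[u uE] i].
  exists (\matrix_i u i); apply/inI_row => i.
  by rewrite linearB /= row_mul rowK.
exists (row i u); rewrite -row_mul -linearB /=.
by apply: (inI_row _ _).2; apply: uE.
Qed.

(** The long exact sequence of [0 -> im D -> A^q -> A^q / im D -> 0] modulo [I]: [im D] is
    [A^p / ker D], and exact columns say that Ext into a free module vanishes in the two degrees
    involved. *)
Lemma ext_shift m p q (D : 'M[A]_(p, q)) n : exc I c m -> exc I c (m + 1) ->
  extr c (m + 1) (imD D) n <-> extr c m (kerD D) n.
Proof.
move=> ex0 ex1.
have sZ2 := extZ_submod (c) (m + 1) (imD_submod D).
have sZ1 := extZ_submod (c) (m) (kerD_submod D).
pose rel (w : 'M_(mr (c (m + 1 + 1)), q)) (u : 'M_(mr (c (m + 1)), p)) :=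
  inI I (diff c (m + 1) (m + 1 + 1) *m w - u *m D).
have rel0 : rel 0 0 by rewrite /rel mulmx0 mul0mx subrr; apply: inI0.
have relP a x y x' y' : rel x x' -> rel y y' -> rel (a *: x + y) (a *: x' + y').
  rewrite /rel => rx ry; have := inID idI (inIZ idI a rx) ry; move/inI_eq; apply.
  by rewrite mulmxDr mulmxDl -scalemxAr -scalemxAl; mxabel.
have r12 x : extZ (imD D) x -> exists2 y, extZ (kerD D) y & rel x y.
  move=> /inS_imD[y Ixy]; exists y => //; apply/inS_kerD; rewrite -mulmxA.
  have := inIB idI (inIMl idI x (@cc m)) (inIMr idI (diff c m (m + 1)) Ixy).
  by move/inI_eq; apply; rewrite mulmxBr !mulmxA; mxabel.
have r21 y : extZ (kerD D) y -> exists2 x, extZ (imD D) x & rel x y.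
  move=> /inS_kerD; rewrite -mulmxA => /(exc_mx ex0)[x Ix]; exists x.
    by apply/inS_imD; exists y; apply: inIBC.
  exact: inIBC.
have rB x y : extZ (imD D) x -> extZ (kerD D) y -> rel x y ->
    extB (imD D) x <-> extB (kerD D) y.
  move=> _ _ rxy; split=> [[v /inS_imD[z Iz]]|[z /inS_kerD Iz]].
    exists z; apply/inS_kerD.
    have := inIB idI (inIMr idI (diff c (m + 1) (m + 1 + 1)) Iz) rxy.
    move/(inID idI)/(_ (inIMl idI v (@cc (m + 1)))); move/inI_eq; apply.
    by rewrite !mulmxBl !mulmxBr !mulmxA; mxabel.
  have /(exc_mx ex1)[v Iv] : inI I (diff c (m + 1) (m + 1 + 1) *m (x - z *m D)).
    have := inID idI rxy Iz; move/inI_eq; apply.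
    by rewrite !mulmxBl !mulmxBr !mulmxA; mxabel.
  exists v; apply/inS_imD; exists z; apply: inI_eq Iv _; mxabel.
split; first exact: qrank_transport relP r12 r21 rB.
apply: (qrank_transport (rel := fun y x => rel x y)) => //.
- by move=> *; apply: relP.
- by move=> x y Zx Zy xy; apply: iff_sym; apply: rB.
Qed.

End Shift.

(** * The shift of Ext along a regular element *)

Section Rees.
Variables (f : nat -> A) (mm : nat) (reg : regular f mm).
Local Notation Id := (Id f).

Definition addS p (x : A) (Y : 'rV[A]_p -> Prop) := fun y => exists v, Y (y - x *: v).

Lemma addS_submod p x (Y : 'rV[A]_p -> Prop) : submod Y -> submod (addS x Y).
Proof.
move=> sY; split; first by exists 0; rewrite scaler0 subr0; apply: submod0.
move=> a y z [v Yv] [w Yw]; exists (a *: v + w).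
rewrite scalerDr scalerA mulrC -scalerA opprD addrACA -scalerBr.
exact: submodP.
Qed.

Lemma inS_addS p x (Y : 'rV[A]_p -> Prop) r (w : 'M_(r, p)) :
  inS (addS x Y) w <-> exists u, inS Y (w - x *: u).
Proof.
split=> [/choice[u uE]|[u uE] i].
  by exists (\matrix_i u i) => i; rewrite linearB linearZ /= rowK.
by exists (row i u); have := uE i; rewrite linearB linearZ.
Qed.

(** Rees: for [f i] regular on [V = A^p / Y], Ext into [V] over the larger ring is Ext into
    [V / f i V] over the quotient, one degree lower. A cocycle of [Gc] is a cocycle of [c] modulo
    [f i] together with the coefficient of [f i] that witnesses it. *)
Lemma ext_rees i (c : cpx) m p (Y : 'rV[A]_p -> Prop) n :
  (i < mm)%N -> complex (Id i.+1) c -> submod Y -> (forall y, inI (Id i) y -> Y y) ->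
  (forall y, Y (f i *: y) -> Y y) ->
  extr c (m + 1) (addS (f i) Y) n <-> extr (Gc f i c) m Y n.
Proof.
move=> im cc sY IY regY.
have sYx := addS_submod (f i) sY.
have inIY r (w : 'M_(r, p)) : inI (Id i) w -> inS Y w.
  by move=> /inI_row Iw j; apply: IY.
have regS r (w : 'M_(r, p)) : inS Y (f i *: w) -> inS Y w.
  by move=> Yw j; have := Yw j; rewrite linearZ => /regY.
have sZ1 := extZ_submod (c) (m + 1) sYx.
have sZ2 := extZ_submod (Gc f i c) (m) sY.
have idI := Id_ideal f i.
pose rel (w : 'M[A]_(mr (c (m + 1 + 1)), p)) (v : 'M_(mr (Gc f i c (m + 1)), p)) :=
  dsubmx v = w.
have rel0 : rel 0 0 by rewrite /rel raddf0.
have relP a x y x' y' : rel x x' -> rel y y' -> rel (a *: x + y) (a *: x' + y').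
  by rewrite /rel => <- <-; rewrite linearP.
have r12 x : extZ (addS (f i) Y) x -> exists2 y, extZ Y y & rel x y.
  move=> /inS_addS[v Yv]; exists (col_mx v x); last by rewrite /rel col_mxKd.
  rewrite /extZ diff_Gc mul_block_col inS_col.
  have Y2 : inS Y ((f i)%:M *m v + - diff c (m + 1) (m + 1 + 1) *m x).
    by apply: inS_eq (inSN sY Yv) _; rewrite mulNmx mul_scalar_mx; mxabel.
  split=> //; apply: regS.
  have := inSD sY (inSM sY (diff c m (m + 1)) Y2) (inIY _ _ (inIMl idI x (eis_top (n := m) cc))).
  move/inS_eq; apply; rewrite mulmxDr mulNmx mulmxN mulmxBl mul_scalar_mx -!scalemxAl.
  by rewrite -!scalemxAr !mulmxA mulNmx; mxabel.
have r21 y : extZ Y y -> exists2 x, extZ (addS (f i) Y) x & rel x y.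
  rewrite /extZ -[y]vsubmxK diff_Gc mul_block_col inS_col => -[_ Y2].
  exists (dsubmx y); last by rewrite /rel col_mxKd.
  apply/inS_addS; exists (usubmx y); apply: inS_eq (inSN sY Y2) _.
  by rewrite mulNmx mul_scalar_mx; mxabel.
have rB x y : extZ (addS (f i) Y) x -> extZ Y y -> rel x y ->
    extB (addS (f i) Y) x <-> extB Y y.
  move=> _ Zy <-; split=> [[v /inS_addS[w Yw]]|[u]].
    exists (col_mx w (- v)); rewrite diff_Gc -[y]vsubmxK mul_block_col opp_col_mx add_col_mx.
    rewrite inS_col; set y1 := usubmx y; set y2 := dsubmx y.
    have Y2 : inS Y (y2 - ((f i)%:M *m w + - diff c (m + 1 + 1) (m + 1 + 1 + 1) *m - v)).
      apply: inS_eq Yw _; rewrite mulNmx mulmxN mul_scalar_mx; mxabel.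
    split=> //; apply: regS.
    move: Zy; rewrite /extZ -[y]vsubmxK diff_Gc mul_block_col inS_col -/y1 -/y2 => -[_ Z2].
    have := inSD sY Z2 (inSM sY (diff c (m + 1) (m + 1 + 1)) Y2).
    have J := inIY _ _ (inIMl idI v (eis_top (n := m + 1) cc)).
    move/(inSD sY)/(_ J); move/inS_eq; apply.
    rewrite !mulNmx !mulmxN !opprK !mulmxBr !mulmxDr mulmxBl !mul_scalar_mx -!scalemxAl.
    by rewrite -!scalemxAr !mulmxA; mxabel.
  rewrite diff_Gc -[u]vsubmxK -[y]vsubmxK mul_block_col opp_col_mx add_col_mx inS_col.
  rewrite col_mxKd => -[_ Y2]; exists (- dsubmx u); apply/inS_addS; exists (usubmx u).
  by apply: inS_eq Y2 _; rewrite mulNmx mul_scalar_mx mulmxN; mxabel.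
split; first exact: qrank_transport relP r12 r21 rB.
apply: (qrank_transport (rel := fun y x => rel x y)) => //.
- by move=> *; apply: relP.
- by move=> x y Zx Zy xy; apply: iff_sym; apply: rB.
Qed.

End Rees.

Section LastStep.
Variables (I : A -> Prop) (idI : ideal I) (u : A).
Hypotheses (Im : forall x, I x -> pi x = 0) (uu : forall a, I (a * u) -> pi a = 0)
  (mu : forall a, pi a = 0 -> I (a * u))
  (soc : forall x, (forall a, pi a = 0 -> I (a * x)) -> exists b, I (x - b * u)).

(** The coefficients are the image of [D1], so this Ext is the socle of the image of [D2] modulo the
    image of the socle of [A^p2]. Minimality makes [D2] and [D3] kill socles, which leaves the whole
    socle of [A^p3], a copy of [k^p3]. *)
Lemma ext1_minimal a2 a1 p1 p2 p3 p4 (M1 : 'M[A]_(a2, a1)) (M0 : 'M[A]_(a1, 1))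
    (D1 : 'M[A]_(p1, p2)) (D2 : 'M[A]_(p2, p3)) (D3 : 'M[A]_(p3, p4)) :
  inI I (M1 *m M0) -> (forall w : 'cV_a1, inI I (M1 *m w) -> exists v, inI I (w - M0 *m v)) ->
  map_mx pi M0 = 0 -> (forall x, pi x = 0 -> exists y : 'rV_a1, I (x - (y *m M0) 0 0)) ->
  inI I (D1 *m D2) -> (forall y : 'rV_p2, inI I (y *m D2) -> exists z, inI I (y - z *m D1)) ->
  (forall y : 'rV_p3, inI I (y *m D3) -> exists z, inI I (y - z *m D2)) ->
  map_mx pi D2 = 0 -> map_mx pi D3 = 0 ->
  qrank pi (fun w : 'M_(a1, p1) => inS (kerD I D1) (M1 *m w))
    (fun w => exists v : 'M_(1, p1), inS (kerD I D1) (w - M0 *m v)) p3.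
Proof.
move=> MM exM M00 genM DD ex2 ex3 D20 D30.
have mI q r (M : 'M[A]_(q, r)) : map_mx pi M = 0 -> inI I (u *: M).
  by move=> /matrixP M0' i j; rewrite mxE mulrC; apply: mu; have := M0' i j; rewrite !mxE.
have socM q (s : 'rV[A]_q) : inI I (M0 *m s) -> exists b, inI I (s - u *: b).
  move=> Is; have /choice[b bE] (j : 'I_q) : exists b, I (s 0 j - b * u).
    apply: soc => a /genM[y Iy]; rewrite -(subrK ((y *m M0) 0 0) a) mulrDl.
    apply: idealD => //; first exact: ideal_mulr.
    have := inIMr idI y Is => /(_ 0 j); rewrite mulmxA mxE.
    by rewrite big_ord_recl big_ord0 addr0 ord1.
  by exists (\row_j b j) => i j; rewrite !mxE ord1 mulrC.
have exMm q (w : 'M[A]_(a1, q)) : inI I (M1 *m w) -> exists v, inI I (w - M0 *m v).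
  move=> Iw; have /choice[v vE] (j : 'I_q) : exists v, inI I (col j w - M0 *m v).
    by apply: exM => a b; rewrite colE mulmxA -colE mxE; apply: Iw.
  exists (\matrix_(a, b) v b a 0) => a b.
  have := vE b a 0; rewrite !mxE; congr (I (_ - _)).
  by apply: eq_bigr => l _; rewrite !mxE.
have ex2m q (w : 'M[A]_(q, p2)) : inI I (w *m D2) -> exists z, inI I (w - z *m D1).
  move=> Iw; apply/inS_imD => i; apply: ex2.
  by rewrite -row_mul; apply: (inI_row _ _).2.
(* The socle element [u *: b] is lifted back through [D2] to [v], and [M0 v] through [D1] to the
   cocycle [w]. *)
pose rel (b : 'rV[A]_p3) (w : 'M[A]_(a1, p1)) := exists v : 'rV_p2,
  inI I (w *m D1 - M0 *m v) /\ inI I (v *m D2 - u *: b).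
apply: (@qrank_transport _ _ _ _ _ _ _ _ _ rel) (qrank_free pi p3) => //.
- split; first by rewrite mulmx0; apply: (inS0 (kerD_submod idI D1)).
  move=> a x y Zx Zy; rewrite mulmxDr -scalemxAr.
  exact: (inSP (kerD_submod idI D1)).
- by exists 0; split; rewrite ?mul0mx ?mulmx0 ?scaler0 subrr; exact: (inI0 idI).
- move=> a x y x' y' [v [v1 v2]] [v' [v1' v2']]; exists (a *: v + v'); split.
    have := inID idI (inIZ idI a v1) v1'; move/inI_eq; apply.
    by rewrite mulmxDr mulmxDl -scalemxAr -scalemxAl; mxabel.
  have := inID idI (inIZ idI a v2) v2'; move/inI_eq; apply.
  by rewrite mulmxDl -scalemxAl; mxabel.
- move=> b _; have [|v Iv] := ex3 (u *: b).
    by rewrite -scalemxAl scalemxAr; exact: (inIMr idI b (mI _ _ _ D30)).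
  have [|w Iw] := ex2m _ (M0 *m v).
    rewrite -mulmxA.
    have := inIB idI (inIMl idI b (mI _ _ _ M00)) (inIMr idI M0 Iv).
    by move/inI_eq; apply; rewrite -scalemxAl mulmxBr -scalemxAr; mxabel.
  exists w; last by exists v; split; apply: inIBC.
  apply/inS_kerD; rewrite -mulmxA.
  have := inIB idI (inIMl idI v MM) (inIMr idI M1 Iw); move/inI_eq; apply.
  by rewrite mulmxBr !mulmxA; mxabel.
- move=> w /inS_kerD; rewrite -mulmxA => /exMm[v Iv].
  have [|b Ib] := socM _ (v *m D2).
    have := inIB idI (inIMr idI w DD) (inIMl idI D2 Iv); move/inI_eq; apply.
    by rewrite mulmxBl !mulmxA; mxabel.
  by exists b => //; exists v.
- move=> b w _ _ [v [v1 v2]]; split=> [b0|[v' /inS_kerD Iv']].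
    have [|v' Iv'] := ex2 v.
      have := inID idI v2 (inI_eq (mI _ _ _ b0) erefl); move/inI_eq; apply; mxabel.
    exists v'; apply/inS_kerD.
    have := inID idI v1 (inIMr idI M0 Iv'); move/inI_eq; apply.
    by rewrite mulmxBl mulmxBr !mulmxA; mxabel.
  have [|b' Ib'] := socM _ (v - v' *m D1).
    have := inIB idI Iv' v1; move/inI_eq; apply.
    by rewrite mulmxBl mulmxBr !mulmxA; mxabel.
  apply/matrixP => i j; rewrite !mxE; apply: uu.
  have : inI I (u *: b).
    have := inIB idI (inID idI (inIMl idI D2 Ib') (inIMr idI b' (mI _ _ _ D20))) v2.
    move/(inID idI)/(_ (inIMr idI v' DD)).
    move/inI_eq; apply.
    by rewrite !mulmxBl -!scalemxAl -!scalemxAr !mulmxA; mxabel.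
  by move=> /(_ i j); rewrite mxE mulrC.
Qed.

End LastStep.
End Ext.

(** * Independence of Ext of the resolution *)

Section Comparison.
Variable R : comNzRingType.

(** Projectivity speaks of surjections only, so the target is replaced by the image of [h]. *)
Lemma proj_lift (P X Y : lmodType R) (h : {linear X -> Y}) (f : {linear P -> Y}) :
  projective P -> (forall p, exists x, h x = f p) ->
  exists g : {linear P -> X}, forall p, h (g p) = f p.
Proof.
move=> prP fh.
have hI x : h x \in in_im h by apply/in_imP; exists x.
have fI p : f p \in in_im h by apply/in_imP; have [x <-] := fh p; exists x.
pose h' x : linear_image h := LinearImage (hI x).
pose f' p : linear_image h := LinearImage (fI p).
have lh' : linear h' by move=> a x y; apply: val_inj; apply: (linearP h).
have lf' : linear f' by move=> a x y; apply: val_inj; apply: (linearP f).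
pose hL : {linear X -> linear_image h} := HB.pack h' (GRing.isLinear.Build _ _ _ _ h' lh').
pose fL : {linear P -> linear_image h} := HB.pack f' (GRing.isLinear.Build _ _ _ _ f' lf').
have [y|g gE] := prP _ _ hL fL.
  case: y => y yI; have /in_imP[x xE] := yI; exists x.
  by apply: val_inj; rewrite /= -xE.
by exists g => p; have := congr1 val (gE p).
Qed.

Variable U : lmodType R.

Definition chain_map (P P' : proj_resolution U)
    (f : forall n, {linear pres_obj P n -> pres_obj P' n}) : Prop :=
  (forall x, pres_aug P' (f 0 x) = pres_aug P x) /\
  forall n x, pres_diff P' n (f n.+1 x) = f n (pres_diff P n x).

Lemma pres_dd (P : proj_resolution U) n x : pres_diff P n (pres_diff P n.+1 x) = 0.
Proof. by apply/pres_exactS; exists x. Qed.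

Lemma pres_augd (P : proj_resolution U) x : pres_aug P (pres_diff P 0 x) = 0.
Proof. by apply/pres_exact0; exists x. Qed.

Lemma chain_map_ex (P P' : proj_resolution U) : exists f, @chain_map P P' f.
Proof.
have /cid[f0 f0E] : exists f0 : {linear pres_obj P 0 -> pres_obj P' 0},
    forall x, pres_aug P' (f0 x) = pres_aug P x.
  by apply: proj_lift; [apply: pres_projective|move=> p; apply: pres_aug_surj].
have /cid[f1 f1E] : exists f1 : {linear pres_obj P 1 -> pres_obj P' 1},
    forall x, pres_diff P' 0 (f1 x) = f0 (pres_diff P 0 x).
  apply: (proj_lift (f := f0 \o pres_diff P 0)); first exact: pres_projective.
  by move=> x; apply/pres_exact0; rewrite /= f0E pres_augd.
(* Constructing the next map uses the commutation of the current one, so the recursion carries two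
   consecutive maps. *)
pose S n := {f : {linear pres_obj P n -> pres_obj P' n} *
                 {linear pres_obj P n.+1 -> pres_obj P' n.+1} |
             forall x, pres_diff P' n (f.2 x) = f.1 (pres_diff P n x)}.
have step n (s : S n) : {s' : S n.+1 | (sval s').1 = (sval s).2}.
  apply: cid; case: s => -[g g'] /= gE.
  have [|x|g'' g''E] := proj_lift (P := pres_obj P n.+2) (h := pres_diff P' n.+1)
    (f := g' \o pres_diff P n.+1); first exact: pres_projective.
    by apply/pres_exactS; rewrite /= gE pres_dd raddf0.
  by exists (exist _ (g', g'') g''E).
pose s0 : S 0%N := exist _ (f0, f1) f1E.
pose s := nat_rect S s0 (fun n sn => sval (step n sn)).
have sS n : (sval (s n.+1)).1 = (sval (s n)).2 by rewrite /s /=; case: (step n _).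
exists (fun n => (sval (s n)).1); split=> [x|n x]; first exact: f0E.
by rewrite sS; case: (s n).
Qed.

Section Homotopy.
Variables (P P' : proj_resolution U) (f g : forall n, {linear pres_obj P n -> pres_obj P' n}).
Hypotheses (cf : chain_map f) (cg : chain_map g).

(** The identity [f - g = d s + s d] is recorded only after composition with [d] on the source,
    where the second term drops out; the induction then carries a single map. *)
Lemma homotopy n : exists s : {linear pres_obj P n -> pres_obj P' n.+1},
  (forall x, pres_diff P' n (s (pres_diff P n x)) = f n (pres_diff P n x) - g n (pres_diff P n x)) /\
  forall (V : lmodType R) (h : {linear pres_obj P' n -> V}), cocycle h ->
    coboundary (P := P) (i := n) (fun x => h (f n x) - h (g n x)).
Proof.
elim: n => [|n [s [sE _]]].
  have [|x|s sE] := proj_lift (P := pres_obj P 0) (h := pres_diff P' 0) (f := f 0 \- g 0).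
  - exact: pres_projective.
  - by apply/pres_exact0; rewrite /= linearB /= cf.1 cg.1 subrr.
  exists s; split=> [x|V h hc x /=]; first exact: sE.
  by rewrite -raddfB; have := sE x => /= <-; apply: hc.
have [|x|s' s'E] := proj_lift (P := pres_obj P n.+1) (h := pres_diff P' n.+1)
  (f := (f n.+1 \- g n.+1) \- (s \o pres_diff P n)).
- exact: pres_projective.
- apply/pres_exactS; rewrite /= !raddfB /= cf.2 cg.2 sE.
  by rewrite subrr.
exists s'; split=> [x|V h hc]; first by rewrite s'E /= pres_dd raddf0 subr0.
exists (h \o s) => x; have := hc (s' x); rewrite s'E /= !raddfB /= => /eqP.
by rewrite subr_eq0 => /eqP.
Qed.

End Homotopy.

Section Coboundary.
Variables (V : lmodType R).

Lemma coboundaryP (P : proj_resolution U) i a (f g : pres_obj P i -> V) :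
  coboundary f -> coboundary g -> coboundary (fun x => a *: f x + g x).
Proof.
case: i f g => [|i] f g /=; first by move=> f0 g0 x; rewrite f0 g0 scaler0 addr0.
move=> [f' fE] [g' gE]; exists (a \*: f' \+ g') => x /=.
by rewrite fE gE.
Qed.

Lemma eq_coboundary (P : proj_resolution U) i (f g : pres_obj P i -> V) :
  f =1 g -> coboundary f -> coboundary g.
Proof.
case: i f g => [|i] f g fg /=; first by move=> f0 x; rewrite -fg.
by move=> [f' fE]; exists f' => x; rewrite -fg.
Qed.

Lemma coboundary0 (P : proj_resolution U) i : coboundary (fun x : pres_obj P i => 0 : V).
Proof. by case: i => [|i] //=; exists \0. Qed.

Lemma coboundary_sum (P : proj_resolution U) i n (c : 'I_n -> R) (f : 'I_n -> pres_obj P i -> V) :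
  (forall j, coboundary (f j)) -> coboundary (fun x => \sum_j c j *: f j x).
Proof.
elim: n c f => [|n IHn] c f cf.
  by apply: eq_coboundary (coboundary0 P i) => x; rewrite big_ord0.
apply: eq_coboundary (coboundaryP (c ord0) (cf ord0)
  (IHn (fun j => c (lift ord0 j)) (fun j => f (lift ord0 j)) _)) => [x|j].
  by rewrite big_ord_recl.
exact: cf.
Qed.

Lemma coboundary_comp (P P' : proj_resolution U) f i (h : pres_obj P' i -> V) :
  @chain_map P P' f -> coboundary h -> coboundary (fun x => h (f i x)).
Proof.
case: i h => [|i] h cf /=; first by move=> h0 x.
by move=> [h' hE]; exists (h' \o f i) => x; rewrite hE cf.2.
Qed.

Lemma cocycle_comp (P P' : proj_resolution U) f i (h : {linear pres_obj P' i -> V}) :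
  @chain_map P P' f -> cocycle h -> cocycle (h \o f i).
Proof. by move=> cf hc x /=; rewrite -cf.2. Qed.

Lemma chain_map_comp (P P' P'' : proj_resolution U) f g :
  @chain_map P P' f -> @chain_map P' P'' g -> @chain_map P P'' (fun n => g n \o f n).
Proof.
move=> [f0 fS] [g0 gS]; split=> [x|n x] /=; first by rewrite g0.
by rewrite gS fS.
Qed.

Lemma chain_map_id (P : proj_resolution U) : @chain_map P P (fun n => idfun).
Proof. by []. Qed.

(* Two resolutions compute the same Ext: the identity of [P] factors through
   [P'] up to homotopy. *)
Lemma comparison (P P' : proj_resolution U) : exists f g, [/\ @chain_map P P' f,
  @chain_map P' P g & forall i (h : {linear pres_obj P i -> V}), cocycle h ->
    coboundary (fun x => h x - h (g i (f i x)))].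
Proof.
have [f cf] := chain_map_ex P P'; have [g cg] := chain_map_ex P' P.
exists f, g; split=> // i h hc.
have [_ [_ H]] := homotopy (chain_map_id P) (chain_map_comp cf cg) i.
exact: H.
Qed.

Lemma ext_vanish_finite (P P' : proj_resolution U) d i (h : {linear pres_obj P i -> V}) :
  (forall n, (d < n)%N -> forall x : pres_obj P' n, x = 0) -> (d < i)%N ->
  cocycle h -> coboundary h.
Proof.
move=> P0 di hc; have [f [g [_ _ H]]] := comparison P P'.
apply: eq_coboundary (H i h hc) => x.
by rewrite (P0 i di (f i x)) (linear0 (g i)) (linear0 h) subr0.
Qed.

Section Rank.
Variables (k : fieldType) (pi : {rmorphism R -> k}).

(** Expressing each basis in the other gives matrices with [C C' = 1] over [k], because [g \o f]
    acts as the identity on Ext. *)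
Lemma has_ext_rank_leq (P P' : proj_resolution U) i n n' :
  has_ext_rank pi V P i n -> has_ext_rank pi V P' i n' -> (n <= n')%N.
Proof.
move=> [z [zc zgen zind]] [z' [z'c z'gen _]].
have [f [g [cf cg H]]] := comparison P P'.
have /choice[c cE] (j : 'I_n) : exists c : 'I_n' -> R,
    coboundary (fun x => z j (g i x) - \sum_l c l *: z' l x).
  by apply: (z'gen (z j \o g i)); apply: cocycle_comp.
have /choice[c' c'E] (l : 'I_n') : exists c' : 'I_n -> R,
    coboundary (fun x => z' l (f i x) - \sum_j c' j *: z j x).
  by apply: (zgen (z' l \o f i)); apply: cocycle_comp.
pose C : 'M[k]_(n, n') := \matrix_(j, l) pi (c j l).
pose C' : 'M[k]_(n', n) := \matrix_(l, j) pi (c' l j).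
suff CC' : C *m C' = 1%:M by apply: mulmx1_min CC'.
apply/matrixP => j j'.
have cob : coboundary (fun x => \sum_j' (\sum_l c j l * c' l j' - (j == j')%:R) *: z j' x).
  have E1 := coboundary_comp cf (cE j).
  have E2 := coboundary_sum (c j) c'E.
  have E3 := H i (z j) (zc j).
  have E12 := coboundaryP 1 E1 E2; have E123 := coboundaryP 1 E12 E3.
  have := coboundaryP (-1) E123 (coboundary0 P i); apply: eq_coboundary => x.
  rewrite addr0 !scale1r !scaleN1r.
  under [RHS]eq_bigr => l _ do rewrite scalerBl scaler_suml.
  rewrite sumrB exchange_big /=.
  have -> : \sum_j0 (j == j0)%:R *: z j0 x = z j x.
    rewrite (bigD1 j) //= eqxx scale1r big1 ?addr0 // => l lj.
    by rewrite eq_sym (negbTE lj) scale0r.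
  have -> : \sum_l c j l *: (z' l (f i x) - \sum_j0 c' l j0 *: z j0 x) =
      \sum_l c j l *: z' l (f i x) - \sum_l \sum_j0 (c j l * c' l j0) *: z j0 x.
    rewrite -sumrB; apply: eq_bigr => l _; rewrite scalerBr scaler_sumr.
    by congr (_ - _); apply: eq_bigr => j0 _; rewrite scalerA.
  move: (\sum_l c j l *: _) (\sum_l \sum__ _) => X Y.
  by rewrite (addrA (_ - X) X) subrK opprD !opprB addrA subrK.
have /eqP := zind _ cob j'; rewrite rmorphB rmorph_nat subr_eq0 => /eqP.
rewrite !mxE => <-; rewrite rmorph_sum; apply: eq_bigr => l _.
by rewrite rmorphM !mxE.
Qed.

Lemma ext_rankE (P : proj_resolution U) i n :
  has_ext_rank pi V P i n -> ext_rank pi i U V = n.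
Proof.
move=> Hn; rewrite /ext_rank; case: xgetP => [m _ [P' Hm]|/(_ n)[]]; last by exists P.
by apply/eqP; rewrite eqn_leq (has_ext_rank_leq Hm Hn) (has_ext_rank_leq Hn Hm).
Qed.

End Rank.
End Coboundary.
End Comparison.

Lemma free_projective (R : comNzRingType) p : projective 'rV[R]_p.
Proof.
move=> U V g f gS.
have /choice[x xE] (i : 'I_p) : exists x, g x = f (delta_mx 0 i) by apply: gS.
exists (row_map x) => y; apply: (@row_ext _ _ _ (g \o row_map x) f) => i /=.
by rewrite row_map_delta.
Qed.

(** * Projective resolutions from matrix complexes *)

Section Resolution.
Variables (A R : comNzRingType) (phi : {rmorphism A -> R}) (phiS : surjective phi).
Variables (I : A -> Prop) (kphi : forall a, phi a = 0 <-> I a).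

Lemma kphi_ideal : ideal I.
Proof.
split; first by apply/kphi; rewrite rmorph0.
  by move=> x y /kphi x0 /kphi y0; apply/kphi; rewrite rmorphD x0 y0 addr0.
by move=> a x /kphi x0; apply/kphi; rewrite rmorphM x0 mulr0.
Qed.

Lemma map_phi0 p q (M : 'M[A]_(p, q)) : map_mx phi M = 0 <-> inI I M.
Proof.
split=> [/matrixP M0 i j|IM]; first by apply/kphi; have := M0 i j; rewrite !mxE.
by apply/matrixP => i j; rewrite !mxE; apply/kphi.
Qed.

Lemma map_phiS p q (N : 'M[R]_(p, q)) : exists M : 'M[A]_(p, q), map_mx phi M = N.
Proof.
have [s sE] := choice phiS; exists (map_mx s N).
by apply/matrixP => i j; rewrite !mxE.
Qed.

Section Presented.
Variables (V : lmodType R) (p : nat) (g : 'I_p -> V).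

Definition ev (y : 'rV[A]_p) : V := row_map g (map_mx phi y).

(** [V] is the quotient [A^p / Y], with [A] acting through [phi]. *)
Definition presents (Y : 'rV[A]_p -> Prop) : Prop :=
  (forall v, exists y, ev y = v) /\ forall y, ev y = 0 <-> Y y.

Lemma evP a x y : ev (a *: x + y) = phi a *: ev x + ev y.
Proof. by rewrite /ev map_mxD map_mxZ linearP. Qed.
Lemma evB x y : ev (x - y) = ev x - ev y.
Proof.
have -> : x - y = -1 *: y + x by rewrite scaleN1r addrC.
by rewrite evP rmorphN1 scaleN1r addrC.
Qed.
Lemma ev0 : ev 0 = 0.
Proof. by rewrite -(subrr 0) evB subrr. Qed.

Definition mxmap q (w : 'M[A]_(q, p)) : {linear 'rV[R]_q -> V} :=
  row_map (fun i => ev (row i w)).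

Lemma mxmapE q (w : 'M[A]_(q, p)) y : mxmap w (map_mx phi y) = ev (y *m w).
Proof.
rewrite mulmx_sum_row /mxmap /= /row_map.
elim/big_rec2: _ => [|i x z _ ->]; first by rewrite ev0.
by rewrite evP mxE.
Qed.

Lemma mxmap_ex q (h : {linear 'rV[R]_q -> V}) Y : presents Y ->
  exists w : 'M[A]_(q, p), h =1 mxmap w.
Proof.
move=> [evS _]; have /choice[x xE] (i : 'I_q) := evS (h (delta_mx 0 i)).
exists (\matrix_i x i); apply: row_ext => i.
by rewrite /mxmap /= row_map_delta rowK xE.
Qed.

End Presented.

Variables (c : cpx A) (cc : complex I c).
Hypothesis ex : forall m, m <= - 2 -> exr I c m.

Lemma exr3_neg n : exr3 I c (- n.+2%:Z) (- n.+1%:Z) (- n%:Z).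
Proof.
have := ex (m := - n.+2%:Z); rewrite /exr.
have -> : - n.+2%:Z + 1 = - n.+1%:Z by lia.
have -> : - n.+1%:Z + 1 = - n%:Z by lia.
by apply; lia.
Qed.

Lemma cx3_neg n : inI I (diff c (- n.+2%:Z) (- n.+1%:Z) *m diff c (- n.+1%:Z) (- n%:Z)).
Proof.
have := @cc (- n.+2%:Z).
have -> : - n.+2%:Z + 1 = - n.+1%:Z by lia.
by have -> : - n.+1%:Z + 1 = - n%:Z by lia.
Qed.

Variables (M : lmodType R) (g : 'I_(mr (c (- 0%:Z))) -> M).
Hypothesis gM : presents g (imD I (diff c (- 1%:Z) (- 0%:Z))).

Definition mxdiff n : {linear 'rV[R]_(mr (c (- n.+1%:Z))) -> 'rV[R]_(mr (c (- n%:Z)))} :=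
  mulmxr (map_mx phi (diff c (- n.+1%:Z) (- n%:Z))).

Lemma mxdiffE n y : mxdiff n (map_mx phi y) = map_mx phi (y *m diff c (- n.+1%:Z) (- n%:Z)).
Proof. by rewrite /mxdiff /= map_mxM. Qed.

Lemma mxres_surj : surjective (row_map g).
Proof. by move=> x; have [y yE] := gM.1 x; exists (map_mx phi y). Qed.

Lemma mxres_exact0 x : row_map g x = 0 <-> exists y, mxdiff 0 y = x.
Proof.
have [x0 <-] := map_phiS x; apply: (iff_trans (gM.2 x0)).
split=> [[z Iz]|[y]].
  exists (map_mx phi z); rewrite mxdiffE; apply/eqP; rewrite eq_sym -subr_eq0 -map_mxB.
  exact/eqP/map_phi0.
have [y0 <-] := map_phiS y; rewrite mxdiffE => /eqP; rewrite eq_sym -subr_eq0 -map_mxB.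
by move=> /eqP/map_phi0 Iy; exists y0.
Qed.

Lemma mxres_exactS n x : mxdiff n x = 0 <-> exists y, mxdiff n.+1 y = x.
Proof.
have [x0 <-] := map_phiS x; split=> [|[y]].
  rewrite mxdiffE => /map_phi0/(@exr3_neg n)[z Iz].
  exists (map_mx phi z); rewrite mxdiffE; apply/eqP; rewrite eq_sym -subr_eq0 -map_mxB.
  exact/eqP/map_phi0.
have [y0 <-] := map_phiS y => <-; rewrite !mxdiffE; apply/map_phi0.
by rewrite -mulmxA; exact: (inIMr kphi_ideal y0 (@cx3_neg n)).
Qed.

Definition mxres : proj_resolution M :=
  @ProjResolution R M (fun n => 'rV[R]_(mr (c (- n%:Z))) : lmodType R) mxdiff (row_map g)
    (fun n => @free_projective R _) mxres_surj mxres_exact0 mxres_exactS.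

Section ExtRank.
Variables (k : fieldType) (pi : {rmorphism R -> k}).
Variables (V : lmodType R) (p : nat) (h : 'I_p -> V) (Y : 'rV[A]_p -> Prop).
Hypothesis hV : presents h Y.

Lemma cocycleE n (w : 'M[A]_(mr (c (- n%:Z)), p)) :
  cocycle (P := mxres) (i := n) (mxmap h w) <->
  inS Y (diff c (- n.+1%:Z) (- n%:Z) *m w).
Proof.
split=> [cw i|Yw x].
  have := cw (map_mx phi (delta_mx 0 i)).
  rewrite /= -map_mxM mxmapE -mulmxA -rowE => /hV.2; exact.
have [y <-] := map_phiS x; rewrite /= -map_mxM mxmapE -mulmxA.
apply/hV.2; rewrite mulmx_sum_row.
elim/big_ind: _ => [|a b /hV.2 a0 /hV.2 b0|i _].
- by apply/hV.2; rewrite ev0.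
- by apply/hV.2; rewrite -[a]scale1r evP a0 b0 scaler0 addr0.
- have /hV.2 r0 := Yw i; apply/hV.2.
  by rewrite -[_ *: _]addr0 evP r0 scaler0 ev0 addr0.
Qed.

Lemma coboundaryE n (w : 'M[A]_(mr (c (- n.+1%:Z)), p)) :
  coboundary (P := mxres) (i := n.+1) (mxmap h w) <->
  exists u, inS Y (w - diff c (- n.+1%:Z) (- n%:Z) *m u).
Proof.
split=> [[l lE]|[u Yu]].
  have [u uE] := mxmap_ex l hV; exists u => i; apply/hV.2.
  have := lE (map_mx phi (delta_mx 0 i)).
  rewrite uE /= -map_mxM !mxmapE -mulmxA -!rowE => E.
  by rewrite linearB /= evB E subrr.
exists (mxmap h u); apply: (@row_ext _ _ _ (mxmap h w) (mxmap h u \o mxdiff n)) => i /=.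
have -> : delta_mx 0 i = map_mx phi (delta_mx 0 i) :> 'rV[R]_(mr (c (- n.+1%:Z))).
  by rewrite map_delta_mx.
rewrite -map_mxM !mxmapE -mulmxA -!rowE; apply/eqP; rewrite -subr_eq0 -evB -linearB /=.
exact/eqP/hV.2.
Qed.

Lemma mxmap_sum q v (cf : 'I_v -> A) (z : 'I_v -> 'M[A]_(q, p)) x :
  mxmap h (\sum_j cf j *: z j) x = \sum_j phi (cf j) *: mxmap h (z j) x.
Proof.
have [y <-] := map_phiS x; rewrite mxmapE mulmx_sumr.
under [RHS]eq_bigr => j _ do rewrite mxmapE.
elim/big_rec2: _ => [|j a b _ E]; first by rewrite ev0.
by rewrite -scalemxAr evP E.
Qed.

Lemma mxmapB q (w w' : 'M[A]_(q, p)) x : mxmap h (w - w') x = mxmap h w x - mxmap h w' x.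
Proof.
have [y <-] := map_phiS x; rewrite !mxmapE mulmxBr; exact: evB.
Qed.

(** The degree is [- n.+2] because [extr] reads Ext one degree further, in [- n.+1]. *)
Lemma has_ext_rank_extr n v :
  extr (pi \o phi) c (- n.+2%:Z) Y v ->
  has_ext_rank pi V mxres n.+1 v.
Proof.
rewrite /extr /qrank /extZ /extB.
have -> : - n.+2%:Z + 1 = - n.+1%:Z by lia.
have -> : - n.+1%:Z + 1 = - n%:Z by lia.
move=> [z [Zz gen ind]].
exists (fun j => mxmap h (z j)); split=> [j|f fc|cf cob].
- exact/cocycleE.
- have [w wE] := mxmap_ex f hV.
  have [|a aE] := gen w.
    by apply/cocycleE => x; rewrite -wE.
  exists (fun j => phi (a j)).
  move/coboundaryE: aE; apply: eq_coboundary => x.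
  by rewrite mxmapB mxmap_sum wE.
- have [a aE] : exists a : 'I_v -> A, forall j, phi (a j) = cf j.
    by have [s sE] := choice phiS; exists (fun j => s (cf j)).
  move=> j; rewrite -aE; apply: (ind a); apply/coboundaryE.
  apply: eq_coboundary cob => x; rewrite mxmap_sum.
  by apply: eq_bigr => l _; rewrite aE.
Qed.

End ExtRank.
End Resolution.

(** * Dimensions of subquotients of vector spaces *)

Section FieldRank.
Variables (k : fieldType) (E : lmodType k).
Implicit Types Z B W : E -> Prop.

Definition frank Z B n := qrank (idfun : {rmorphism k -> k}) Z B n.

(** [G] has greatest rank among the matrices with row space inside [Y]; one more vector of [Y]
    cannot raise the rank. *)
Lemma subspace_mx n (Y : 'rV[k]_n -> Prop) : submod Y ->
  exists G : 'M[k]_n, forall y, Y y <-> (y <= G)%MS.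
Proof.
move=> sY; pose ok (G : 'M[k]_n) := forall y, (y <= G)%MS -> Y y.
have ex0 : exists r, `[< exists2 G : 'M[k]_n, ok G & \rank G = r >].
  exists 0%N; apply/asboolP; exists 0; rewrite ?mxrank0 // => y.
  by rewrite submx0 => /eqP ->; apply: submod0.
have bd r : `[< exists2 G : 'M[k]_n, ok G & \rank G = r >] -> (r <= n)%N.
  by move=> /asboolP[G _ <-]; apply: rank_leq_row.
case: (ex_maxnP ex0 bd) => r /asboolP[G okG <-] mx.
exists G => y; split=> [Yy|]; last exact: okG.
have okGy : ok (G + y)%MS.
  move=> x /sub_addsmxP[[a b] /= ->]; apply: (submodD sY).
    by apply: okG; apply: submxMl.
  by rewrite [b]mx11_scalar mul_scalar_mx; apply: (submodZ sY).
have /mx rG : `[< exists2 G' : 'M[k]_n, ok G' & \rank G' = \rank (G + y)%MS >].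
  by apply/asboolP; exists (G + y)%MS.
have := mxrank_leqif_sup (addsmxSl G y) => -[le2 eq2].
have : (G + y <= G)%MS by rewrite -eq2 eqn_leq le2.
by apply: submx_trans; apply: addsmxSr.
Qed.

Lemma frank0 Z B : submod B -> (forall x, Z x -> B x) -> frank Z B 0.
Proof.
move=> sB ZB; exists (fun j : 'I_0 => 0); split=> [[]|x Zx|c _ []] //.
by exists (fun=> 0); rewrite big_ord0 subr0; apply: ZB.
Qed.

Lemma frank0P Z B : frank Z B 0 -> forall x, Z x -> B x.
Proof. by move=> [z [_ gen _]] x /gen[c]; rewrite big_ord0 subr0. Qed.

Lemma frank_leq Z B n m : submod B -> frank Z B n -> frank Z B m -> (n <= m)%N.
Proof.
move=> sB [z [Zz gen ind]] [z' [Zz' gen' _]].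
have [c cE] := choice (fun j => gen' (z j) (Zz j)).
have [c' c'E] := choice (fun l => gen (z' l) (Zz' l)).
pose C : 'M[k]_(n, m) := \matrix_(j, l) c j l.
pose C' : 'M[k]_(m, n) := \matrix_(l, j) c' l j.
suff CC' : C *m C' = 1%:M by apply: mulmx1_min CC'.
apply/matrixP => j j'; rewrite !mxE.
apply/eqP; rewrite -subr_eq0; apply/eqP.
apply: (ind (fun j' => \sum_l C j l * C' l j' - (j == j')%:R) _ j').
have -> : \sum_j' (\sum_l C j l * C' l j' - (j == j')%:R) *: z j' =
   - (z j - \sum_l c j l *: z' l) - \sum_l c j l *: (z' l - \sum_j' c' l j' *: z j').
  under eq_bigr => l _ do rewrite scalerBl scaler_suml.
  rewrite sumrB exchange_big /=.
  have -> : \sum_j0 (j == j0)%:R *: z j0 = z j.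
    rewrite (bigD1 j) //= eqxx scale1r big1 ?addr0 // => l lj.
    by rewrite eq_sym (negbTE lj) scale0r.
  have -> : \sum_l c j l *: (z' l - \sum_j0 c' l j0 *: z j0) =
      \sum_l c j l *: z' l - \sum_l \sum_j0 (C j l * C' l j0) *: z j0.
    rewrite -sumrB; apply: eq_bigr => l _; rewrite scalerBr scaler_sumr.
    by congr (_ - _); apply: eq_bigr => j0 _; rewrite scalerA !mxE.
  move: (\sum_l c j l *: _) (\sum_l \sum__ _) => X Y.
  by rewrite !opprB [RHS]addrC addrA subrK.
apply: (submodB sB); first exact: (submodN sB (cE j)).
by apply: (submod_sum sB) => l _; apply: (submodZ sB); apply: c'E.
Qed.

Lemma frank_uniq Z B n m : submod B -> frank Z B n -> frank Z B m -> n = m.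
Proof. by move=> sB Hn Hm; apply/eqP; rewrite eqn_leq !(@frank_leq Z B). Qed.

(** In coordinates for [Z / B], the subspace [W] is the row space of some [G], and the complement of
    [G] gives a basis of [Z / W]. *)
Lemma frank_split Z B W n : submod B -> submod W -> submod Z ->
  (forall x, B x -> W x) -> (forall x, W x -> Z x) -> frank Z B n ->
  exists a b, [/\ n = (a + b)%N, frank W B a & frank Z W b].
Proof.
move=> sB sW sZ BW WZ [z [Zz gen ind]].
pose L (c : 'rV[k]_n) := \sum_i c 0 i *: z i.
have LP a c c' : L (a *: c + c') = a *: L c + L c'.
  rewrite /L scaler_sumr -big_split; apply: eq_bigr => i _.
  by rewrite !mxE scalerDl scalerA.
have L0 : L 0 = 0 by rewrite /L big1 // => i _; rewrite mxE scale0r.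
have LM m (d : 'rV_m) (R : 'M_(m, n)) : L (d *m R) = \sum_l d 0 l *: L (row l R).
  rewrite mulmx_sum_row; elim/big_rec2: _ => [|l x y _ <-]; first exact: L0.
  by rewrite LP.
have indL c : B (L c) -> c = 0.
  by move=> BL; apply/rowP => i; rewrite mxE; apply: (ind (fun i => c 0 i)).
have sY : submod (fun c => W (L c)).
  split; first by rewrite L0; apply: (submod0 sW).
  by move=> a x y Wx Wy; rewrite LP; apply: (submodP sW).
have ZL c : Z (L c) by apply: (submod_sum sZ) => i _; apply: (submodZ sZ).
have [G GE] := subspace_mx sY.
have rowW l : W (L (row l (row_base G))).
  by apply/GE; rewrite -(eq_row_base G); apply: row_sub.
exists (\rank G), (\rank (G^C)%MS); split.
- by have := mxrank_compl G; have := rank_leq_row G; lia.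
- exists (fun l => L (row l (row_base G))); split=> [//|x Wx|d].
    have [c cE] := gen x (WZ x Wx).
    have : W (L (\row_i c i)).
      have -> : L (\row_i c i) = \sum_i c i *: z i.
        by apply: eq_bigr => i _; rewrite mxE.
      by have /(submodB sW Wx) := BW _ cE; rewrite subKr.
    move=> /GE; rewrite -(eq_row_base G) => /submxP[d dE].
    exists (fun l => d 0 l); rewrite -LM -dE.
    by congr (B (x - _)): cE; apply: eq_bigr => i _; rewrite mxE.
  move=> BL l; have : (\row_l d l) *m row_base G = 0.
    apply: indL; rewrite LM; congr B: BL.
    by apply: eq_bigr => i _; rewrite mxE.
  move/eqP; rewrite mulmx_free_eq0 ?row_base_free // => /eqP/rowP/(_ l).
  by rewrite !mxE.
- exists (fun l => L (row l (row_base (G^C)%MS))); split=> [//|x Zx|d].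
    have [c cE] := gen x Zx.
    have : (\row_i c i <= G + G^C)%MS by apply: submx_full; apply: addsmx_compl_full.
    move=> /sub_addsmxP[[a b] /= abE].
    have : (b *m (G^C)%MS <= row_base (G^C)%MS)%MS by rewrite eq_row_base submxMl.
    move=> /submxP[d dE]; exists (fun l => d 0 l); rewrite -LM -dE.
    have WaG : W (L (a *m G)) by apply/GE; apply: submxMl.
    have := submodD sW (BW _ cE) WaG; congr (W _).
    have -> : \sum_j c j *: z j = L (a *m G) + L (b *m (G^C)%MS).
      rewrite -[L (a *m G)]scale1r -LP scale1r -abE.
      by apply: eq_bigr => i _; rewrite mxE.
    by rewrite opprD addrA addrAC subrK.
  move=> WL l; pose dr := \row_l d l.
  have dR : (dr *m row_base (G^C)%MS <= G)%MS.
    apply/GE; rewrite LM; congr W: WL.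
    by apply: eq_bigr => i _; rewrite mxE.
  have : (dr *m row_base (G^C)%MS <= G :&: G^C)%MS.
    rewrite sub_capmx dR /= -(eq_row_base (G^C)%MS); exact: submxMl.
  rewrite capmx_compl submx0 mulmx_free_eq0 ?row_base_free // => /eqP/rowP/(_ l).
  by rewrite !mxE.
Qed.

Lemma frank_eq Z B W n : submod B -> submod W -> submod Z ->
  (forall x, B x -> W x) -> (forall x, W x -> Z x) -> frank Z B n -> frank W B n ->
  forall x, Z x -> W x.
Proof.
move=> sB sW sZ BW WZ HZ HW.
have [a [b [nE Ha Hb]]] := frank_split sB sW sZ BW WZ HZ.
have b0 : b = 0%N by have := frank_uniq sB HW Ha; lia.
by apply: frank0P; rewrite b0 in Hb.
Qed.

End FieldRank.

(** * Hilbert's basis theorem for graded modules *)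

Section Families.
Variables (k : fieldType).

Definition le_fam (E : Type) (W W' : nat -> E -> Prop) := forall n x, W n x -> W' n x.

(* A graded module over the polynomial ring in the operators [X j], [j < c], of
   degree 2: its component of degree [n] is the subquotient [Z n / B n]. *)
Record gmod (E : lmodType k) (X : nat -> {linear E -> E}) (c : nat) (Z B : nat -> E -> Prop)
    : Prop := Gmod {
  gZ : forall n, submod (Z n);
  gB : forall n, submod (B n);
  gBZ : le_fam B Z;
  gXZ : forall j n x, (j < c)%N -> Z n x -> Z n.+2 (X j x);
  gXB : forall j n x, (j < c)%N -> B n x -> B n.+2 (X j x);
  gXC : forall i j n x, (i < c)%N -> (j < c)%N -> Z n x ->
    B n.+4 (X i (X j x) - X j (X i x))
}.

Record sf (E : lmodType k) (X : nat -> {linear E -> E}) (c : nat) (Z B : nat -> E -> Prop)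
    (W : nat -> E -> Prop) : Prop := Sf {
  sfS : forall n, submod (W n);
  sfB : le_fam B W;
  sfZ : le_fam W Z;
  sfX : forall j n x, (j < c)%N -> W n x -> W n.+2 (X j x)
}.

(** The maximum principle is imposed on the graded module itself, so it makes sense for operators
    that commute only modulo [B]. *)
Definition noeth (E : lmodType k) (X : nat -> {linear E -> E}) c (Z B : nat -> E -> Prop) :=
  forall S : (nat -> E -> Prop) -> Prop, (exists2 W, sf X c Z B W & S W) ->
  exists2 W, sf X c Z B W /\ S W &
    forall W', sf X c Z B W' -> S W' -> le_fam W W' -> le_fam W' W.

Lemma le_fam_trans (E : Type) (W1 W2 W3 : nat -> E -> Prop) :
  le_fam W1 W2 -> le_fam W2 W3 -> le_fam W1 W3.
Proof. by move=> H1 H2 n x /H1/H2. Qed.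

Section Transfer.
Variables (E E1 E2 : lmodType k) (X : nat -> {linear E -> E}) (X1 : nat -> {linear E1 -> E1})
  (X2 : nat -> {linear E2 -> E2}) (c c1 c2 : nat) (Z B : nat -> E -> Prop)
  (Z1 B1 : nat -> E1 -> Prop) (Z2 B2 : nat -> E2 -> Prop).
Variables (F1 : (nat -> E -> Prop) -> nat -> E1 -> Prop)
          (F2 : (nat -> E -> Prop) -> nat -> E2 -> Prop).
Hypotheses (sF1 : forall W, sf X c Z B W -> sf X1 c1 Z1 B1 (F1 W))
  (sF2 : forall W, sf X c Z B W -> sf X2 c2 Z2 B2 (F2 W))
  (mF1 : forall W W', sf X c Z B W -> sf X c Z B W' -> le_fam W W' -> le_fam (F1 W) (F1 W'))
  (mF2 : forall W W', sf X c Z B W -> sf X c Z B W' -> le_fam W W' -> le_fam (F2 W) (F2 W'))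
  (joint : forall W W', sf X c Z B W -> sf X c Z B W' -> le_fam W W' ->
     le_fam (F1 W') (F1 W) -> le_fam (F2 W') (F2 W) -> le_fam W' W).

(** [F1] and [F2] jointly detect strict inclusions: maximize [F1] first, then [F2] among the
    submodules above the maximal [F1]. *)
Lemma noeth_transfer : noeth X1 c1 Z1 B1 -> noeth X2 c2 Z2 B2 -> noeth X c Z B.
Proof.
move=> n1 n2 S [W sW SW].
have [|_ [_ [W0 [sW0 SW0] ->]] max1] := n1 (fun V => exists2 W, sf X c Z B W /\ S W & V = F1 W).
  by exists (F1 W); [apply: sF1|exists W].
have [|_ [_ [W1 [[sW1 SW1] le1] ->]] max2] := n2 (fun V =>
    exists2 W, (sf X c Z B W /\ S W) /\ le_fam (F1 W0) (F1 W) & V = F2 W).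
  by exists (F2 W0); [apply: sF2|exists W0 => //; split=> // n x].
exists W1 => // W' sW' SW' W1W'.
have F1W' := mF1 sW1 sW' W1W'.
apply: joint => //.
- apply: (le_fam_trans _ le1); apply: max1.
  + exact: sF1.
  + by exists W'.
  + exact: (le_fam_trans le1 F1W').
- apply: max2.
  + exact: sF2.
  + by exists W' => //; split=> //; apply: (le_fam_trans le1 F1W').
  + exact: mF2.
Qed.

End Transfer.

Section Extension.
Variables (E1 E E2 : lmodType k) (X1 : nat -> {linear E1 -> E1}) (X : nat -> {linear E -> E})
  (X2 : nat -> {linear E2 -> E2}) (c : nat) (Z1 B1 : nat -> E1 -> Prop)
  (Z B : nat -> E -> Prop) (Z2 B2 : nat -> E2 -> Prop).
Hypotheses (g1 : gmod X1 c Z1 B1) (g : gmod X c Z B) (g2 : gmod X2 c Z2 B2).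
Variables (f : {linear E1 -> E}) (p : {linear E -> E2}).
Hypotheses (fZ : forall n x, Z1 n x -> Z n (f x)) (fB : forall n x, B1 n x -> B n (f x))
  (fX : forall j n x, (j < c)%N -> Z1 n x -> B n.+2 (f (X1 j x) - X j (f x)))
  (pZ : forall n x, Z n x -> Z2 n (p x)) (pB : forall n x, B n x -> B2 n (p x))
  (pX : forall j n x, (j < c)%N -> Z n x -> B2 n.+2 (p (X j x) - X2 j (p x)))
  (ex : forall n x, Z n x -> B2 n (p x) -> exists2 y, Z1 n y & B n (x - f y)).

Lemma noeth_extension : noeth X1 c Z1 B1 -> noeth X2 c Z2 B2 -> noeth X c Z B.
Proof.
apply: (noeth_transfer (F1 := fun W n x => Z1 n x /\ W n (f x))
  (F2 := fun W n y => Z2 n y /\ exists2 x, W n x & B2 n (y - p x))).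
- move=> W sW; split.
  + move=> n; split; first by split; [apply: submod0 (gZ g1 n)|rewrite raddf0; apply: submod0 (sfS sW n)].
    move=> a x y [Zx Wx] [Zy Wy]; split; first exact: submodP (gZ g1 n) _ _ _ Zx Zy.
    by rewrite linearP; apply: submodP (sfS sW n) _ _ _ Wx Wy.
  + by move=> n x Bx; split; [apply: gBZ g1 _ _ Bx|apply: sfB sW _ _ _; apply: fB].
  + by move=> n x [].
  + move=> j n x jc [Zx Wx]; split; first exact: gXZ g1 _ _ _ jc Zx.
    have := sfX sW jc Wx; have := sfB sW (fX jc Zx).
    exact: (submod_addl (sfS sW _)).
- move=> W sW; split.
  + move=> n; split.
      split; first exact: submod0 (gZ g2 n).
      by exists 0; [apply: submod0 (sfS sW n)|rewrite raddf0 subr0; apply: submod0 (gB g2 n)].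
    move=> a x y [Zx [x' Wx Bx]] [Zy [y' Wy By]]; split; first exact: submodP (gZ g2 n) _ _ _ Zx Zy.
    exists (a *: x' + y'); first exact: submodP (sfS sW n) _ _ _ Wx Wy.
    by rewrite linearP opprD addrACA -scalerBr; apply: submodP (gB g2 n) _ _ _ Bx By.
  + move=> n x Bx; split; first exact: gBZ g2 _ _ Bx.
    by exists 0; [apply: submod0 (sfS sW n)|rewrite raddf0 subr0].
  + by move=> n x [].
  + move=> j n x jc [Zx [x' Wx Bx]]; split; first exact: gXZ g2 _ _ _ jc Zx.
    exists (X j x'); first exact: sfX sW _ _ _ jc Wx.
    have B1' := pX jc (sfZ sW Wx); have B2' := gXB g2 jc Bx.
    have := submodB (gB g2 _) B2' B1'; rewrite raddfB /= opprB addrA subrK.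
    exact.
- by move=> W W' _ _ WW' n x [Zx /WW'].
- by move=> W W' _ _ WW' n y [Zy [x /WW' Wx Bx]]; split=> //; exists x.
- move=> W W' sW sW' WW' le1 le2 n x W'x.
  have Zx := sfZ sW' W'x.
  have [|_ [w Ww Bw]] := le2 n (p x).
    split; first exact: pZ.
    by exists x => //; rewrite subrr; apply: submod0 (gB g2 n).
  have Zw := sfZ sW Ww.
  have [||y Zy By] := ex (n := n) (x := x - w).
  - exact: submodB (gZ g n) _ _ Zx Zw.
  - by rewrite raddfB.
  have W'xw : W' n (x - w) by apply: submodB (sfS sW' n) _ _ W'x (WW' _ _ Ww).
  have [|_ Wy] := le1 n y.
    split=> //; have := submodB (sfS sW' n) W'xw (sfB sW' By).
    by rewrite subKr.
  rewrite -(subrK w x); apply: submodD (sfS sW n) _ _ _ Ww.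
  by apply: submod_addl (sfS sW n) _ _ _ Wy; apply: sfB sW _ _ By.
Qed.

End Extension.
End Families.

Section HilbertBasis.
Variables (k : fieldType) (E : lmodType k) (X : nat -> {linear E -> E}).

Section OneModule.
Variables (c : nat) (Z B : nat -> E -> Prop) (g : gmod X c Z B).

Lemma noeth_finite (v : nat -> nat) N : (forall n, frank (Z n) (B n) (v n)) ->
  (forall n x, (N <= n)%N -> Z n x -> B n x) -> noeth X c Z B.
Proof.
move=> Hv ZB S [W sW SW].
have rP W' n : sf X c Z B W' -> exists2 a, frank (W' n) (B n) a & (a <= v n)%N.
  move=> sW'; have [a [b [vE Ha _]]] := frank_split (gB g n) (sfS sW' n) (gZ g n)
    (sfB sW' (n := n)) (sfZ sW' (n := n)) (Hv n).
  by exists a => //; rewrite vE leq_addr.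
pose r W' n := xget 0%N (fun a => frank (W' n) (B n) a).
have rE W' n : sf X c Z B W' -> frank (W' n) (B n) (r W' n) /\ (r W' n <= v n)%N.
  move=> sW'; have [a Ha av] := rP W' n sW'.
  rewrite /r; case: xgetP => [b _ Hb|/(_ a)//]; split=> //.
  by rewrite (frank_uniq (gB g n) Hb Ha).
pose sz W' := (\sum_(n < N) r W' n)%N.
have ex0 : exists m, `[< exists2 W', sf X c Z B W' /\ S W' & sz W' = m >].
  by exists (sz W); apply/asboolP; exists W.
have bd m : `[< exists2 W', sf X c Z B W' /\ S W' & sz W' = m >] -> (m <= \sum_(n < N) v n)%N.
  move=> /asboolP[W' [sW' _] <-]; apply: leq_sum => n _.
  by have [] := rE W' n sW'.
case: (ex_maxnP ex0 bd) => m /asboolP[W0 [sW0 SW0] mE] mx.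
exists W0 => // W' sW' SW' le0 n x W'x.
have [Nn|nN] := leqP N n.
  by apply: sfB sW0 _ _ _; apply: ZB => //; apply: sfZ sW' _ _ W'x.
have rle l : (r W0 l <= r W' l)%N.
  have [H0 _] := rE W0 l sW0; have [H' _] := rE W' l sW'.
  have [a [b [E0 Ha Hb]]] := frank_split (gB g l) (sfS sW0 l) (sfS sW' l)
    (sfB sW0 (n := l)) (le0 l) H'.
  by rewrite E0 (frank_uniq (gB g l) H0 Ha) leq_addr.
have sz' : (sz W' <= sz W0)%N by rewrite mE; apply: mx; apply/asboolP; exists W'.
have rn : r W' n = r W0 n.
  apply/eqP; rewrite eqn_leq rle andbT.
  move: sz'; rewrite /sz (bigD1 (Ordinal nN)) //= [X in (_ <= X)%N](bigD1 (Ordinal nN)) //=.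
  move=> le1; have le2 : (\sum_(i < N | i != Ordinal nN) r W0 i <=
      \sum_(i < N | i != Ordinal nN) r W' i)%N by apply: leq_sum => i _; apply: rle.
  rewrite -(leq_add2r (\sum_(i < N | i != Ordinal nN) r W0 i)).
  by apply: leq_trans le1; rewrite leq_add2l.
have [H0 _] := rE W0 n sW0; have [H' _] := rE W' n sW'; rewrite rn in H'.
exact: (frank_eq (gB g n) (sfS sW0 n) (sfS sW' n) (sfB sW0 (n := n)) (le0 n) H' H0).
Qed.

(** Without operators every cut [T N] of [Z] at a degree is a submodule, and the cuts have to become
    stationary. *)
Lemma noeth0_bounded : c = 0%N -> noeth X c Z B -> exists N, forall n x, (N <= n)%N -> Z n x -> B n x.
Proof.
move=> c0 nZ; pose T N n x := if (n < N)%N then Z n x else B n x.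
have sT N : sf X c Z B (T N).
  split; rewrite ?c0 //.
  - by move=> n; rewrite /T; case: (n < N)%N; [apply: (gZ g)|apply: (gB g)].
  - by move=> n x Bx; rewrite /T; case: ifP => // _; apply: (gBZ g).
  - by move=> n x; rewrite /T; case: ifP => // _; apply: (gBZ g).
have [|_ [_ [N ->]] mx] := nZ (fun W => exists N, W = T N).
  by exists (T 0%N) => //; exists 0%N.
exists N => n x Nn Zx.
suff : T N n x by rewrite /T ltnNge Nn.
apply: (mx (T n.+1)) => //; first by exists n.+1.
  move=> l y; rewrite /T; case: ifP => lN; case: ifP => // ln Ty; last exact: (gBZ g).
  by move: ln; rewrite ltnS (leq_trans (ltnW lN) Nn).
by rewrite /T ltnSn.
Qed.

(** The boundaries plus the image of one operator; in degrees 0 and 1 the image is zero because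
    nothing lies two degrees below. *)
Definition shiftZ (c0 : nat) n x :=
  exists2 y, B n (x - y) & if n is n'.+2 then exists2 z, Z n' z & y = X c0 z else y = 0.

Lemma shiftZ_submod c0 n : submod (shiftZ c0 n).
Proof.
split; first by exists 0; [rewrite subr0; apply: (submod0 (gB g n))|
  case: n => [|[|n]] //; exists 0; [apply: (submod0 (gZ g n))|rewrite raddf0]].
move=> a x y [x' Bx Hx] [y' By Hy]; exists (a *: x' + y').
  by rewrite opprD addrACA -scalerBr; apply: (submodP (gB g n)).
case: n x x' y y' Bx By Hx Hy => [|[|n]] x x' y y' _ _ /=.
- by move=> -> ->; rewrite scaler0 addr0.
- by move=> -> ->; rewrite scaler0 addr0.
- move=> [z Zz ->] [w Zw ->]; exists (a *: z + w); first exact: (submodP (gZ g n)).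
  by rewrite linearP.
Qed.

Lemma shiftZ_B c0 n x : B n x -> shiftZ c0 n x.
Proof.
move=> Bx; exists 0; first by rewrite subr0.
by case: n Bx => [|[|n]] // _; exists 0; [apply: (submod0 (gZ g n))|rewrite raddf0].
Qed.

End OneModule.

Section Last.
Variables (c : nat) (Z B : nat -> E -> Prop) (g : gmod X c.+1 Z B).
Local Notation Xc := (X c).
Local Notation B' := (shiftZ Z B c).

Lemma shiftZ_Z n x : B' n x -> Z n x.
Proof.
move=> [y Bxy Hy]; rewrite -(subrK y x); apply: (submodD (gZ g n)); first exact: (gBZ g).
case: n Bxy Hy => [|[|n]] _ /=; [by move=> ->; apply: (submod0 (gZ g _))..|].
by move=> [z Zz ->]; apply: (gXZ g).
Qed.

Lemma gmod_coker : gmod X c Z B'.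
Proof.
split.
- exact: (gZ g).
- exact: (shiftZ_submod g).
- exact: shiftZ_Z.
- by move=> j n x jc; apply: (gXZ g); apply: ltnW.
- move=> j n x jc [y Bxy Hy]; have jc' : (j < c.+1)%N by apply: ltnW.
  case: n Bxy Hy => [|[|n]] Bxy /=; [by move=> y0; apply: (shiftZ_B g);
    rewrite y0 subr0 in Bxy; apply: (gXB g)..|].
  move=> [z Zz yE]; exists (Xc (X j z)).
    have := submodD (gB g _) (gXB g jc' Bxy) (gXC g jc' (ltnSn c) Zz).
    by rewrite yE raddfB /= addrA subrK.
  by exists (X j z) => //; apply: (gXZ g).
- by move=> i j n x ic jc Zx; apply: (shiftZ_B g); apply: (gXC g) => //; apply: ltnW.
Qed.

Definition kerZ n x := Z n x /\ B n.+2 (Xc x).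

Lemma gmod_ker : gmod X c kerZ B.
Proof.
split.
- move=> n; split; first by split; [apply: (submod0 (gZ g n))|rewrite raddf0; apply: (submod0 (gB g _))].
  move=> a x y [Zx Bx] [Zy By]; split; first exact: (submodP (gZ g n)).
  by rewrite linearP; apply: (submodP (gB g _)).
- exact: (gB g).
- by move=> n x Bx; split; [apply: (gBZ g)|apply: (gXB g)].
- move=> j n x jc [Zx Bx]; have jc' : (j < c.+1)%N by apply: ltnW.
  split; first exact: (gXZ g).
  apply: (submod_addl (gB g _)) (gXB g jc' Bx).
  exact: (gXC g).
- by move=> j n x jc; apply: (gXB g); apply: ltnW.
- by move=> i j n x ic jc [Zx _]; apply: (gXC g) => //; apply: ltnW.
Qed.

Lemma noeth_ker : noeth X c.+1 Z B -> noeth X c kerZ B.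
Proof.
move=> nZ S [W sW SW].
have up W' : sf X c kerZ B W' -> sf X c.+1 Z B W'.
  move=> sW'; split; [exact: (sfS sW')|exact: (sfB sW')| |].
    by move=> n x /(sfZ sW')[].
  move=> j n x; rewrite ltnS leq_eqVlt => /orP[/eqP -> W'x|jc]; last exact: (sfX sW').
  by apply: (sfB sW'); have [] := sfZ sW' W'x.
have [|W0 [sW0 [sW0' SW0]] mx] := nZ (fun W => sf X c kerZ B W /\ S W).
  by exists W => //; apply: up.
by exists W0 => // W' sW' SW'; apply: mx => //; apply: up.
Qed.

Lemma noeth_coker : noeth X c.+1 Z B -> noeth X c Z B'.
Proof.
move=> nZ S [W sW SW].
have up W' : sf X c Z B' W' -> sf X c.+1 Z B W'.
  move=> sW'; split; [exact: (sfS sW')| |exact: (sfZ sW')|].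
    by move=> n x /(shiftZ_B g c)/(sfB sW').
  move=> j n x; rewrite ltnS leq_eqVlt => /orP[/eqP -> W'x|jc]; last exact: (sfX sW').
  apply: (sfB sW'); exists (Xc x); first by rewrite subrr; apply: (submod0 (gB g _)).
  by exists x => //; apply: (sfZ sW').
have [|W0 [sW0 [sW0' SW0]] mx] := nZ (fun W => sf X c Z B' W /\ S W).
  by exists W => //; apply: up.
by exists W0 => // W' sW' SW'; apply: mx => //; apply: up.
Qed.

Lemma iterZ i n x : Z n x -> Z (n + i.*2) (iter i Xc x).
Proof.
elim: i => [|i IHi] Zx; first by rewrite addn0.
by rewrite doubleS !addnS; apply: (gXZ g) => //; apply: IHi.
Qed.

Lemma iterW W i n x : sf X c.+1 Z B W -> W n x -> W (n + i.*2)%N (iter i Xc x).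
Proof.
move=> sW; elim: i => [|i IHi] Wx; first by rewrite addn0.
by rewrite doubleS !addnS; apply: (sfX sW) => //; apply: IHi.
Qed.

Lemma iterP i a x y : iter i Xc (a *: x + y) = a *: iter i Xc x + iter i Xc y.
Proof. by elim: i => //= i ->; rewrite linearP. Qed.
Lemma iterB i x y : iter i Xc (x - y) = iter i Xc x - iter i Xc y.
Proof. by elim: i => //= i ->; rewrite raddfB. Qed.

Lemma iterC j i n x : (j < c)%N -> Z n x ->
  B (n + i.*2).+2 (iter i Xc (X j x) - X j (iter i Xc x)).
Proof.
move=> jc Zx; have jc' : (j < c.+1)%N by apply: ltnW.
elim: i => [|i IHi]; first by rewrite subrr; apply: (submod0 (gB g _)).
rewrite doubleS !addnS /=.
have := submodD (gB g _) (gXB g (ltnSn c) IHi) (gXC g (ltnSn c) jc' (iterZ i Zx)).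
by rewrite raddfB /= addrA subrK.
Qed.

(* The leading coefficients, modulo [X c], of the elements of [W] divisible by
   the [i]-th power of [X c], as in the proof of Hilbert's basis theorem. *)
Definition lead W i n x := Z n x /\ exists2 y, B' n y & W (n + i.*2)%N (iter i Xc (x - y)).

Lemma lead_sf W i : sf X c.+1 Z B W -> sf X c Z B' (lead W i).
Proof.
move=> sW; split.
- move=> n; split.
    split; first exact: (submod0 (gZ g n)).
    exists 0; first exact: (submod0 (shiftZ_submod g c n)).
    by rewrite subrr -(subrr 0) iterB subrr; apply: (submod0 (sfS sW _)).
  move=> a x y [Zx [x' Bx Wx]] [Zy [y' By Wy]]; split; first exact: (submodP (gZ g n)).
  exists (a *: x' + y'); first exact: (submodP (shiftZ_submod g c n)).
  by rewrite opprD addrACA -scalerBr iterP; apply: (submodP (sfS sW _)).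
- move=> n x B'x; split; first exact: shiftZ_Z.
  by exists x => //; rewrite subrr -(subrr 0) iterB subrr; apply: (submod0 (sfS sW _)).
- by move=> n x [].
- move=> j n x jc [Zx [y By Wxy]]; have jc' : (j < c.+1)%N by apply: ltnW.
  split; first exact: (gXZ g).
  exists (X j y); first exact: (gXB gmod_coker).
  rewrite -raddfB addSn addSn.
  apply: (submod_addl (sfS sW _)) (sfX sW jc' Wxy).
  by apply: (sfB sW); apply: iterC => //; apply: (submodB (gZ g n)) => //; apply: shiftZ_Z.
Qed.

Lemma lead_mono W W' i : le_fam W W' -> le_fam (lead W i) (lead W' i).
Proof. by move=> WW' n x [Zx [y By /WW' Wxy]]; split=> //; exists y. Qed.

Lemma lead_step W i j : sf X c.+1 Z B W -> (i <= j)%N -> le_fam (lead W i) (lead W j).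
Proof.
move=> sW /subnK <-; elim: (j - i)%N => [|d IHd] n x //.
rewrite addSn => /IHd[Zx [y By Wxy]]; split=> //; exists y => //.
by rewrite doubleS !addnS; apply: (sfX sW).
Qed.

(** Induction on the degree [m]: an element of [W'] agrees with one of [W] up to a multiple of the
    last operator, whose cofactor has degree [m - 2] and is met with one more power. *)
Lemma lead_joint W W' : sf X c.+1 Z B W -> sf X c.+1 Z B W' -> le_fam W W' ->
  (forall i, le_fam (lead W' i) (lead W i)) -> le_fam W' W.
Proof.
move=> sW sW' WW' le n x W'x.
suff H m : forall i x, Z m x -> W' (m + i.*2)%N (iter i Xc x) -> W (m + i.*2)%N (iter i Xc x).
  by have := H n 0%N x; rewrite addn0; apply=> //; apply: (sfZ sW').
elim/ltn_ind: m => m IHm i {n W'x}x Zx W'x.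
have [|_ [y [y' Byy' Hy] Wxy]] := le i m x.
  split=> //; exists 0; first exact: (submod0 (shiftZ_submod g c m)).
  by rewrite subr0.
have Wy' : W (m + i.*2)%N (iter i Xc (y - y')) by apply: iterW => //; apply: (sfB sW).
suff Wy : W (m + i.*2)%N (iter i Xc y').
  have := submodD (sfS sW _) (submodD (sfS sW _) Wxy Wy') Wy.
  by rewrite !iterB addrA !subrK.
have W'y : W' (m + i.*2)%N (iter i Xc y').
  have := submodB (sfS sW' _) W'x (WW' _ _ (submodD (sfS sW _) Wxy Wy')).
  by rewrite !iterB addrA subrK subKr.
case: m IHm Hy W'y {Zx W'x Byy' Wxy Wy'} => [|[|m]] IHm /=.
- by move=> ->; rewrite -(subrr 0) iterB subrr => _; apply: (submod0 (sfS sW _)).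
- by move=> ->; rewrite -(subrr 0) iterB subrr => _; apply: (submod0 (sfS sW _)).
- move=> [z Zz ->]; rewrite -iterSr.
  have -> : (m.+2 + i.*2 = m + i.+1.*2)%N by rewrite doubleS; lia.
  exact: IHm.
Qed.

(** [lead] grows with both arguments. A maximal [lead W0 i0] settles all exponents from [i0] on; the
    finitely many smaller exponents are then maximized one after another above [W0]. *)
Lemma hilbert_basis : noeth X c Z B' -> noeth X c.+1 Z B.
Proof.
move=> nZ S [W sW SW].
have [|_ [_ [[W0 i0] [/= sW0 SW0] ->]] mx0] := nZ (fun V =>
    exists2 Wi : (nat -> E -> Prop) * nat, sf X c.+1 Z B Wi.1 /\ S Wi.1 & V = lead Wi.1 Wi.2).
  by exists (lead W 0); [apply: lead_sf|exists (W, 0%N)].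
have [W1 [sW1 SW1 le01] mx1] : exists2 W1, [/\ sf X c.+1 Z B W1, S W1 & le_fam W0 W1] &
    forall W', sf X c.+1 Z B W' -> S W' -> le_fam W1 W' ->
      forall i, (i < i0)%N -> le_fam (lead W' i) (lead W1 i).
  elim: i0 {mx0} => [|j [W1 [sW1 SW1 le01] IH]].
    by exists W0 => [|W' _ _ _ i] //; split=> // n x.
  have [|_ [_ [W2 [sW2 [SW2 le12]] ->]] mx2] := nZ (fun V => exists2 W2,
      sf X c.+1 Z B W2 /\ (S W2 /\ le_fam W1 W2) & V = lead W2 j).
    by exists (lead W1 j); [apply: lead_sf|exists W1 => //; split=> //; split=> // n x].
  exists W2; first by split=> //; exact: (le_fam_trans le01 le12).
  move=> W' sW' SW' le2 i; rewrite ltnS leq_eqVlt => /orP[/eqP ->|ij].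
    apply: mx2; first exact: lead_sf.
      by exists W' => //; split=> //; split=> //; apply: (le_fam_trans le12).
    exact: lead_mono.
  apply: (@le_fam_trans _ _ (lead W1 i) _ _ (lead_mono le12)); apply: IH => //.
  exact: (le_fam_trans le12 le2).
exists W1 => // W' sW' SW' le1; apply: lead_joint => // i.
have [ii0|i0i] := ltnP i i0; first exact: mx1.
apply: (@le_fam_trans _ _ (lead W0 i0)).
  apply: mx0; first exact: lead_sf.
    by exists (W', i).
  apply: (le_fam_trans (lead_step _ i0i)) => //.
  by apply: lead_mono; exact: (le_fam_trans le01 le1).
by apply: (le_fam_trans (lead_step _ i0i)) => //; apply: lead_mono.
Qed.

End Last.
End HilbertBasis.

(** * Eventually polynomial functions *)

Lemma poly_eq_nat (P Q : {poly rat}) N :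
  (forall j, (N <= j)%N -> P.[j%:R] = Q.[j%:R]) -> P = Q.
Proof.
move=> PQ; apply/eqP; rewrite -subr_eq0; apply/negP => /negP nz.
pose rs := [seq (j%:R : rat) | j <- iota N (size (P - Q))].
have : (size rs < size (P - Q)%R)%N.
  apply: max_poly_roots => //; last first.
    by rewrite map_inj_uniq ?iota_uniq // => i j /eqP; rewrite eqr_nat => /eqP.
  apply/allP => _ /mapP[j + ->]; rewrite mem_iota => /andP[Nj _].
  by rewrite /root hornerD hornerN PQ // subrr.
by rewrite size_map size_iota ltnn.
Qed.

(** Induction on the size: by the binomial formula, the difference of a suitable multiple of
    ['X^n.+1] removes the top coefficient. *)
Lemma antiderivative (P : {poly rat}) : exists Q : {poly rat}, forall x, Q.[x + 1] - Q.[x] = P.[x].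
Proof.
have [n sP] : exists n, (size P <= n)%N by exists (size P).
elim: n P sP => [|n IHn] P sP.
  by exists 0 => x; move: sP; rewrite leqn0 size_poly_eq0 => /eqP ->; rewrite !horner0 subr0.
pose c := P`_n / n.+1%:R.
pose D := \poly_(i < n.+1) (c *+ 'C(n.+1, i)).
have [|Q QP] := IHn (P - D).
  apply/leq_sizeP => j; rewrite leq_eqVlt => /orP[/eqP <-|nj]; rewrite coefB coef_poly.
    by rewrite ltnSn binSn /c -mulr_natr divfK ?subrr ?pnatr_eq0.
  by rewrite (leq_sizeP _ _ sP j nj) ltnS leqNgt nj subr0.
exists (Q + c *: 'X^(n.+1)) => x; rewrite !hornerD !hornerZ !hornerXn.
have -> : Q.[x + 1] + c * (x + 1) ^+ n.+1 - (Q.[x] + c * x ^+ n.+1) =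
  (Q.[x + 1] - Q.[x]) + c * ((x + 1) ^+ n.+1 - x ^+ n.+1) by ring.
have -> : (x + 1) ^+ n.+1 = \sum_(i < n.+1) x ^+ i *+ 'C(n.+1, i) + x ^+ n.+1.
  rewrite addrC exprDn big_ord_recr /= subnn expr0 mul1r binn mulr1n; congr (_ + _).
  by apply: eq_bigr => i _; rewrite expr1n mul1r.
rewrite QP hornerD hornerN horner_poly addrK mulr_sumr.
rewrite [X in _ + X](eq_bigr (fun i : 'I_n.+1 => c *+ 'C(n.+1, i) * x ^+ i)) ?subrK //.
by move=> i _; rewrite mulrnAr mulrnAl.
Qed.

Lemma coefXD (c : rat) i j : (('X + c%:P) ^+ i)`_j = c ^+ (i - j) *+ 'C(i, j).
Proof.
rewrite addrC exprDn (_ : \sum_(_ < _) _ = \poly_(l < i.+1) (c ^+ (i - l) *+ 'C(i, l))).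
  by rewrite coef_poly ltnS; case: leqP => // /bin_small ->.
by rewrite poly_def; apply: eq_bigr => l _; rewrite -rmorphXn /= mul_polyC scalerMnl.
Qed.

Definition shift_diff (c : rat) (P : {poly rat}) := P \Po ('X + c%:P) - P.

(** In the expansion of the translate the top terms cancel, and the next coefficient is [c] times
    the degree times the leading one. *)
Lemma size_shift_diff (c : rat) (P : {poly rat}) n : c != 0 -> size P = n.+2 ->
  size (shift_diff c P) = n.+1 /\ lead_coef (shift_diff c P) = c *+ n.+1 * lead_coef P.
Proof.
move=> c0 sP.
have E j : (shift_diff c P)`_j = \sum_(i < n.+2) P`_i * (c ^+ (i - j) *+ 'C(i, j)) - P`_j.
  by rewrite coefB coef_comp_poly sP; congr (_ - _); apply: eq_bigr => i _; rewrite coefXD.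
have En : (shift_diff c P)`_n = c *+ n.+1 * lead_coef P.
  rewrite E !big_ord_recr /= big1 => [|i _]; last by rewrite bin_small ?mulr0n ?mulr0.
  rewrite add0r subnn expr0 binn mulr1 subSnn expr1 binSn /lead_coef sP /=.
  by rewrite addrC addrK mulrC.
have nz : (shift_diff c P)`_n != 0.
  rewrite En mulf_neq0 ?lead_coef_eq0 -?size_poly_eq0 ?sP //.
  by rewrite -mulr_natr mulf_neq0 // pnatr_eq0.
have sQ : size (shift_diff c P) = n.+1.
  apply/eqP; rewrite eqn_leq; apply/andP; split.
    apply/leq_sizeP => j; rewrite leq_eqVlt => /orP[/eqP <-|nj]; rewrite E.
      rewrite !big_ord_recr /= big1 => [|i _]; last first.
        by rewrite bin_small ?mulr0n ?mulr0 // (leq_trans (ltn_ord i)).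
      by rewrite bin_small // subnn expr0 binn mulr0n mulr0 !add0r mulr1 subrr.
    rewrite big1 => [|i _]; last by rewrite bin_small ?mulr0n ?mulr0 // (leq_trans (ltn_ord i)).
    by rewrite nth_default ?subr0 // sP.
  by rewrite ltnNge; apply/negP => /leq_sizeP/(_ n (leqnn n)); apply/eqP.
by split=> //; rewrite {1}/lead_coef sQ.
Qed.

Lemma size_poly_shift (P : {poly rat}) c : size (P \Po ('X + c%:P)) = size P.
Proof. by rewrite size_comp_poly2 // size_XaddC. Qed.

Lemma lead_poly_shift (P : {poly rat}) c : lead_coef (P \Po ('X + c%:P)) = lead_coef P.
Proof. by rewrite lead_coef_comp ?size_XaddC // lead_coefXaddC expr1n mulr1. Qed.

Definition epoly (f : nat -> nat) (P : {poly rat}) :=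
  exists N, forall j, (N <= j)%N -> (f j)%:R = P.[j%:R].

Definition qpoly (v : nat -> nat) :=
  (exists P, epoly (fun j => v j.*2) P) /\ (exists P, epoly (fun j => v j.*2.+1) P).

(** The difference of [f] is eventually polynomial, so [f] is a discrete antiderivative up to the
    constant fixed at [N']. *)
Lemma epoly_rec (f a b : nat -> nat) N Pa Pb :
  (forall j, (N <= j)%N -> f j.+1 + a j = f j + b j.+1)%N -> epoly a Pa -> epoly b Pb ->
  exists P, epoly f P.
Proof.
move=> fab [Na aP] [Nb bP].
have [Q QP] := antiderivative (Pb \Po ('X + 1%:P) - Pa).
pose N' := (N + Na + Nb)%N.
exists (Q + ((f N')%:R - Q.[N'%:R])%:P); exists N' => j N'j.
rewrite hornerD hornerC -(subnK N'j); elim: (j - N')%N => [|d IHd].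
  by rewrite add0n addrC subrK.
rewrite addSn; set l := (d + N')%N in IHd *.
have lN : [/\ (N <= l)%N, (Na <= l)%N & (Nb <= l.+1)%N] by rewrite /l /N'; split; lia.
case: lN => lN lNa lNb.
have /(congr1 (fun n => n%:R : rat)) H := fab l lN.
rewrite !natrD (aP l lNa) (bP _ lNb) IHd in H.
have := QP l%:R; rewrite hornerD hornerN horner_comp hornerD hornerX hornerC.
by rewrite natr1; lra.
Qed.

Lemma qpoly_rec (v a b : nat -> nat) N :
  (forall n, (N <= n)%N -> v n.+2 + a n = v n + b n.+2)%N -> qpoly a -> qpoly b -> qpoly v.
Proof.
move=> vab [[P1 a1] [P2 a2]] [[Q1 b1] [Q2 b2]]; split.
  by apply: (epoly_rec (N := N) _ a1 b1) => j Nj; rewrite doubleS; apply: vab; lia.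
by apply: (epoly_rec (N := N) _ a2 b2) => j Nj; rewrite doubleS; apply: vab; lia.
Qed.

Section Operators.
Variables (k : fieldType) (E : lmodType k) (X : nat -> {linear E -> E}).

(** The exact sequence of the last operator, from its kernel to its cokernel, is a recurrence of
    step two, and both ends carry one operator less. *)
Lemma hilbert_serre c Z B v : gmod X c Z B -> (forall n, frank (Z n) (B n) (v n)) ->
  noeth X c Z B -> qpoly v.
Proof.
elim: c Z B v => [|c IHc] Z B v g Hv nZ.
  have [N NZ] := noeth0_bounded g erefl nZ.
  have v0 n : (N <= n)%N -> v n = 0%N.
    by move=> Nn; apply: (frank_uniq (gB g n) (Hv n)); apply: frank0; [apply: (gB g)|move=> x; apply: NZ].
  by split; exists 0; exists N => j Nj; rewrite horner0 v0 //; lia.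
have gk := gmod_ker g; have gc := gmod_coker g.
have /choice[ad adP] n : exists ad : nat * nat, [/\ v n = (ad.1 + ad.2)%N,
    frank (kerZ X c Z B n) (B n) ad.1 & frank (Z n) (kerZ X c Z B n) ad.2].
  have [a [d [E1 H1 H2]]] := frank_split (gB g n) (gZ gk n) (gZ g n) (gBZ gk (n := n))
    (fun x H => H.1) (Hv n).
  by exists (a, d).
have /choice[sb sbP] n : exists sb : nat * nat, [/\ v n = (sb.1 + sb.2)%N,
    frank (shiftZ X Z B c n) (B n) sb.1 & frank (Z n) (shiftZ X Z B c n) sb.2].
  have [a [d [E1 H1 H2]]] := frank_split (gB g n) (gB gc n) (gZ g n) (@shiftZ_B _ _ _ _ _ _ g c n)
    (gBZ gc (n := n)) (Hv n).
  by exists (a, d).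
(* The coimage of the operator in degree [n] is its image in degree [n + 2]. *)
have ds n : (ad n).2 = (sb n.+2).1.
  have [_ _ H1] := adP n; have [_ H2 _] := sbP n.+2.
  apply: (frank_uniq (gB g n.+2)) H2.
  apply: (qrank_transport (rel := fun x y => B n.+2 (y - X c x))) H1.
  - exact: (gZ g).
  - exact: (gB gc).
  - by rewrite raddf0 subr0; apply: (submod0 (gB g _)).
  - move=> a x y x' y' Bx By; rewrite linearP opprD addrACA -scalerBr.
    exact: (submodP (gB g _)).
  - move=> x Zx; exists (X c x); last by rewrite subrr; apply: (submod0 (gB g _)).
    by exists (X c x); [rewrite subrr; apply: (submod0 (gB g _))|exists x].
  - by move=> y [y' Byy' [z Zz E1]]; exists z => //; rewrite -E1.
  - move=> x y Zx _ Bxy; split=> [[_ Bx]|By].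
      by apply: (submod_addl (gB g _)) Bx; have := Bxy.
    by split=> //; have := submodB (gB g _) By Bxy; rewrite subKr.
apply: (@qpoly_rec v (fun n => (ad n).1) (fun n => (sb n).2) 0%N).
- by move=> n _; have [-> _ _] := adP n; have [-> _ _] := sbP n.+2; rewrite ds; lia.
- apply: (IHc _ _ _ gk _ (noeth_ker nZ)) => n; by have [] := adP n.
- apply: (IHc _ _ _ gc _ (noeth_coker g nZ)) => n; by have [] := sbP n.
Qed.

End Operators.

(** * Words in the operators *)

Inductive gop := GOne | GZero | GVar of nat | GMul of gop & gop | GAdd of gop & gop.

(** Half the degree of the operator. [GZero] gets degree one so that a word of positive degree
    exists even without variables. *)
Fixpoint gdeg g : nat :=
  match g with
  | GOne => 0 | GZero => 1 | GVar _ => 1 | GMul a b => gdeg a + gdeg b | GAdd a _ => gdeg a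
  end.

Fixpoint gwf c g : Prop :=
  match g with
  | GOne | GZero => True
  | GVar j => (j < c)%N
  | GMul a b => gwf c a /\ gwf c b
  | GAdd a b => [/\ gwf c a, gwf c b & gdeg a = gdeg b]
  end.

(** Transposition reverses products: on a dual complex the transpose of a word is the reversed
    word. *)
Fixpoint grev g :=
  match g with
  | GMul a b => GMul (grev b) (grev a) | GAdd a b => GAdd (grev a) (grev b) | _ => g
  end.

Lemma gdeg_rev g : gdeg (grev g) = gdeg g.
Proof. by elim: g => //= a -> b ->; rewrite addnC. Qed.

Lemma gwf_rev c g : gwf c g -> gwf c (grev g).
Proof. by elim: g => //= a IHa b IHb []; rewrite ?gdeg_rev; intuition. Qed.

Definition ggood c g := gwf c g /\ (0 < gdeg g)%N.
Definition gpow a n := iter n (GMul a) GOne.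
(** Powers equalize the two degrees, so the sum is homogeneous. *)
Definition gmix a b := GAdd (gpow a (gdeg b)) (gpow b (gdeg a)).

Lemma gdeg_pow a n : gdeg (gpow a n) = (gdeg a * n)%N.
Proof. by elim: n => [|n IHn] /=; rewrite ?muln0 // mulnS -IHn. Qed.

Lemma gwf_pow c a n : gwf c a -> gwf c (gpow a n).
Proof. by move=> wa; elim: n. Qed.

Lemma ggood_mul c a b : ggood c a -> ggood c b -> ggood c (GMul a b).
Proof. by move=> [wa da] [wb db]; split=> //=; rewrite addn_gt0 da. Qed.

Lemma ggood_mix c a b : ggood c a -> ggood c b -> ggood c (gmix a b).
Proof.
move=> [wa da] [wb db]; split; last by rewrite /= gdeg_pow muln_gt0 da.
by split; rewrite ?gdeg_pow 1?mulnC //; apply: gwf_pow.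
Qed.

Section Operators.
Variables (k : fieldType) (E : lmodType k) (X : nat -> {linear E -> E}).

(** Operators commute only modulo [B], so a word is evaluated as it is written; [gevC] restores
    commutativity in the subquotient. *)
Fixpoint gev g (x : E) : E :=
  match g with
  | GOne => x | GZero => 0 | GVar j => X j x
  | GMul a b => gev a (gev b x) | GAdd a b => gev a x + gev b x
  end.

Lemma gevP g a x y : gev g (a *: x + y) = a *: gev g x + gev g y.
Proof.
elim: g x y => [||j|g IHg h IHh|g IHg h IHh] x y //=; rewrite ?scaler0 ?addr0 ?linearP //.
  by rewrite IHh IHg.
by rewrite IHg IHh scalerDr addrACA.
Qed.
Lemma gev0 g : gev g 0 = 0.
Proof.
have /(congr1 (fun y => y - gev g 0)) := gevP g 1 0 0.
by rewrite !scale1r addr0 addrK subrr.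
Qed.
Lemma gevZ g a x : gev g (a *: x) = a *: gev g x.
Proof. by rewrite -[a *: x]addr0 gevP gev0 addr0. Qed.
Lemma gevD g x y : gev g (x + y) = gev g x + gev g y.
Proof. by rewrite -[x]scale1r gevP !scale1r. Qed.
Lemma gevB g x y : gev g (x - y) = gev g x - gev g y.
Proof. by rewrite -!scaleN1r gevD gevZ. Qed.

Section Module.
Variables (c : nat) (Z B : nat -> E -> Prop) (gm : gmod X c Z B).

Lemma gevW W g n x : sf X c Z B W -> gwf c g -> W n x -> W (n + (gdeg g).*2)%N (gev g x).
Proof.
move=> sW; elim: g n x => [||j|a IHa b IHb|a IHa b IHb] n x /=.
- by rewrite addn0.
- by move=> _ _; apply: (submod0 (sfS sW _)).
- by move=> jc Wx; rewrite !addnS addn0; apply: (sfX sW).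
- move=> [wa wb] Wx; rewrite [(_ + gdeg b)%N]addnC doubleD addnA.
  by apply: IHa => //; apply: IHb.
- move=> [wa wb dab] Wx; apply: (submodD (sfS sW _)); first exact: IHa.
  by rewrite dab; apply: IHb.
Qed.

Lemma sfZZ : sf X c Z B Z.
Proof. by split; [exact: (gZ gm)|exact: (gBZ gm)| |exact: (gXZ gm)]. Qed.
Lemma sfBB : sf X c Z B B.
Proof. by split; [exact: (gB gm)| |exact: (gBZ gm)|exact: (gXB gm)]. Qed.

Lemma gev_varC g j n x : gwf c g -> (j < c)%N -> Z n x ->
  B (n + (gdeg g).*2).+2 (X j (gev g x) - gev g (X j x)).
Proof.
move=> + jc; elim: g n x => [||i|a IHa b IHb|a IHa b IHb] n x /=.
- by move=> _ _; rewrite subrr; apply: (submod0 (gB gm _)).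
- by move=> _ _; rewrite raddf0 subr0; apply: (submod0 (gB gm _)).
- by move=> ic Zx; rewrite !addnS addn0; apply: (gXC gm).
- move=> [wa wb] Zx; rewrite [(_ + gdeg b)%N]addnC doubleD addnA.
  have := IHa _ _ wa (gevW sfZZ wb Zx); have := gevW sfBB wa (IHb _ _ wb Zx).
  rewrite gevB => B1 B2; have := submodD (gB gm _) B2 B1.
  by rewrite addrA subrK.
- move=> [wa wb dab] Zx; rewrite raddfD /= opprD addrACA.
  apply: (submodD (gB gm _)); first exact: IHa.
  by rewrite dab; apply: IHb.
Qed.

Lemma gevC a b n x : gwf c a -> gwf c b -> Z n x ->
  B (n + (gdeg a + gdeg b).*2)%N (gev a (gev b x) - gev b (gev a x)).
Proof.
elim: a n x => [||i|a IHa a' IHa'|a IHa a' IHa'] n x /=.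
- by move=> _ _ _; rewrite subrr; apply: (submod0 (gB gm _)).
- by move=> _ _ _; rewrite gev0 subr0; apply: (submod0 (gB gm _)).
- move=> ic wb Zx; rewrite add1n doubleS !addnS; exact: gev_varC.
- move=> [wa wa'] wb Zx.
  have := gevW sfBB wa (IHa' _ _ wa' wb Zx); have := IHa _ _ wa wb (gevW sfZZ wa' Zx).
  have -> : (n + (gdeg a').*2 + (gdeg a + gdeg b).*2 = n + (gdeg a + gdeg a' + gdeg b).*2)%N by lia.
  have -> : (n + (gdeg a' + gdeg b).*2 + (gdeg a).*2 = n + (gdeg a + gdeg a' + gdeg b).*2)%N by lia.
  rewrite gevB => B1 B2; have := submodD (gB gm _) B2 B1.
  by rewrite addrA subrK.
- move=> [wa wa' daa'] wb Zx; rewrite gevD opprD addrACA.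
  apply: (submodD (gB gm _)); first exact: IHa.
  by rewrite daa'; apply: IHa'.
Qed.

Lemma gev_rev g n x : gwf c g -> Z n x -> B (n + (gdeg g).*2)%N (gev (grev g) x - gev g x).
Proof.
elim: g n x => [||i|a IHa b IHb|a IHa b IHb] n x /=; try by move=> *; rewrite subrr; apply: (submod0 (gB gm _)).
- move=> [wa wb] Zx.
  have Zb := gevW sfZZ wb Zx; have Za := gevW sfZZ wa Zx.
  have Zra := gevW sfZZ (gwf_rev wa) Zx; rewrite gdeg_rev in Zra.
  have := IHb _ _ wb Zra; have := gevW sfBB wb (IHa _ _ wa Zx).
  have := gevC wb wa Zx; rewrite gevB [(gdeg b + _)%N]addnC doubleD addnA => B1 B2 B3.
  have := submodD (gB gm _) B3 (submodD (gB gm _) B2 B1).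
  by rewrite !addrA !subrK.
- move=> [wa wb dab] Zx; rewrite opprD addrACA.
  apply: (submodD (gB gm _)); first exact: IHa.
  by rewrite dab; apply: IHb.
Qed.

End Module.
End Operators.

(** * Associated primes of graded modules *)

Section Primes.
Variables (k : fieldType) (E : lmodType k) (X : nat -> {linear E -> E}).
Variables (c : nat) (Z B : nat -> E -> Prop) (gm : gmod X c Z B).
Local Notation gev := (gev X).
Local Notation sf := (sf X c Z B).

Definition ev_full (K : nat -> E -> Prop) := exists N, forall n x, (N <= n)%N -> Z n x -> K n x.

(** Kernels of words take the place of annihilators of elements: they are submodules of [Z], so
    [noeth] supplies maximal ones. *)
Definition colon (W : nat -> E -> Prop) h n x := Z n x /\ W (n + (gdeg h).*2)%N (gev h x).

Definition ev_injective (W : nat -> E -> Prop) g :=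
  exists N, forall n x, (N <= n)%N -> Z n x -> W (n + (gdeg g).*2)%N (gev g x) -> W n x.

Lemma colon_sf W h : sf W -> gwf c h -> sf (colon W h).
Proof.
move=> sW wh; split.
- move=> n; split.
    by split; [apply: (submod0 (gZ gm n))|rewrite gev0; apply: (submod0 (sfS sW _))].
  move=> a x y [Zx Wx] [Zy Wy]; split; first exact: (submodP (gZ gm n)).
  by rewrite gevP; apply: (submodP (sfS sW _)).
- move=> n x Bx; split; first exact: (gBZ gm).
  by apply: (gevW sW) => //; apply: (sfB sW).
- by move=> n x [].
- move=> j n x jc [Zx Wx]; split; first exact: (gXZ gm).
  have := sfB sW (gev_varC gm wh jc Zx); have := sfX sW jc Wx.
  move=> W1 W2; have := submodB (sfS sW _) W1 W2; by rewrite subKr !addSn.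
Qed.

Definition gen_add (W : nat -> E -> Prop) h n x := exists2 y, W n (x - y) &
  y = 0 \/ exists m z, [/\ n = (m + (gdeg h).*2)%N, Z m z & y = gev h z].

Lemma gen_add_sf W h : sf W -> gwf c h -> sf (gen_add W h).
Proof.
move=> sW wh; split.
- move=> n; split.
    by exists 0; [rewrite subr0; apply: (submod0 (sfS sW n))|left].
  move=> a x y [x' Wx Hx] [y' Wy Hy]; exists (a *: x' + y').
    by rewrite opprD addrACA -scalerBr; apply: (submodP (sfS sW n)).
  case: Hx => [->|[m [z [nm Zz ->]]]]; case: Hy => [->|[m' [z' [nm' Zz' ->]]]].
  + by left; rewrite scaler0 addr0.
  + by right; exists m', z'; rewrite scaler0 add0r.
  + right; exists m, (a *: z); rewrite addr0 gevZ; split=> //.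
    exact: (submodZ (gZ gm m)).
  + have mm' : m' = m by move: nm nm'; lia.
    right; exists m, (a *: z + z'); rewrite gevP; split=> //.
    by apply: (submodP (gZ gm m)) => //; rewrite -mm'.
- by move=> n x Bx; exists 0; [rewrite subr0; apply: (sfB sW)|left].
- move=> n x [y Wxy Hy]; rewrite -(subrK y x); apply: (submodD (gZ gm n)).
    exact: (sfZ sW).
  case: Hy => [->|[m [z [-> Zz ->]]]]; first exact: (submod0 (gZ gm n)).
  exact: (gevW (sfZZ gm)).
- move=> j n x jc [y Wxy Hy]; case: Hy Wxy => [->|[m [z [-> Zz ->]]]] Wxy.
    by exists 0; [rewrite -[0](raddf0 (X j)) -raddfB; apply: (sfX sW)|left].
  exists (gev h (X j z)).
    have := sfX sW jc Wxy; have := sfB sW (gev_varC gm wh jc Zz).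
    rewrite raddfB /= => W1 W2; have := submodD (sfS sW _) W2 W1.
    by rewrite addrA subrK.
  right; exists m.+2, (X j z); split=> //.
  exact: (gXZ gm).
Qed.

Section Prime.
Variables (W : nat -> E -> Prop) (h : gop).
Hypotheses (nZ : noeth X c Z B) (sW : sf W) (wh : gwf c h) (unb : ~ ev_full (colon W h))
  (mx : forall h', gwf c h' -> ~ ev_full (colon W h') ->
    le_fam (colon W h) (colon W h') -> le_fam (colon W h') (colon W h)).

(** The prime attached to a maximal [colon W h]: the words killing the image of [h] modulo [W] in
    all large degrees. *)
Let p g := ev_full (colon W (GMul g h)).

Let castW n n' x : W n x -> n = n' -> W n' x. Proof. by move=> Wx <-. Qed.

(** For a word [a] outside the prime, maximality forces the kernel of [a h] modulo [W] to be that of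
    [h]. *)
Lemma prime_cancel a n x : gwf c a -> ~ p a -> Z n x ->
  W (n + (gdeg h + gdeg a).*2)%N (gev a (gev h x)) -> W (n + (gdeg h).*2)%N (gev h x).
Proof.
move=> wa pa Zx Wx; have [||_ //] := @mx (GMul a h) (conj wa wh) pa _ n x.
  move=> l y [Zy Wy]; split=> //=.
  by apply: castW (gevW sW wa Wy) _; lia.
by split=> //=; apply: castW Wx _; lia.
Qed.

Lemma primeM a b : gwf c a -> gwf c b -> p (GMul a b) <-> p a \/ p b.
Proof.
move=> wa wb.
have swap n x : Z n x -> W (n + (gdeg h + gdeg b + gdeg a).*2)%N (gev a (gev b (gev h x))) <->
    W (n + (gdeg h + gdeg b + gdeg a).*2)%N (gev a (gev h (gev b x))).
  move=> Zx.
  have W1 : W (n + (gdeg h + gdeg b + gdeg a).*2)%N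
      (gev a (gev b (gev h x)) - gev a (gev h (gev b x))).
    rewrite -gevB; apply: castW (gevW sW wa (sfB sW (gevC gm wb wh Zx))) _; lia.
  split=> W2; last by have := submodD (sfS sW _) W1 W2; rewrite subrK.
  by have := submodB (sfS sW _) W2 W1; rewrite subKr.
split=> [[N bd]|[[N bd]|[N bd]]].
- have [pa|npa] := pselect (p a); first by left.
  right; exists N => n x Nn Zx; split=> //=.
  have [_ /= Wx] := bd n x Nn Zx.
  have {}Wx : W (n + (gdeg h + gdeg b + gdeg a).*2)%N (gev a (gev b (gev h x))).
    by apply: castW Wx _; lia.
  have Zb := gevW (sfZZ gm) wb Zx.
  have : W (n + (gdeg b).*2 + (gdeg h).*2)%N (gev h (gev b x)).
    apply: (prime_cancel wa) => //; apply: castW (proj1 (swap n x Zx) Wx) _; lia.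
  move/castW => /(_ (n + (gdeg b + gdeg h).*2)%N) H1.
  have := submodD (sfS sW _) (sfB sW (gevC gm wb wh Zx)) (H1 _).
  by rewrite subrK; apply; lia.
- exists N => n x Nn Zx; split=> //=.
  have Zb := gevW (sfZZ gm) wb Zx.
  have [|_ /= Wx] := bd _ _ _ Zb; first by lia.
  have {}Wx : W (n + (gdeg h + gdeg b + gdeg a).*2)%N (gev a (gev h (gev b x))).
    by apply: castW Wx _; lia.
  by apply: castW (proj2 (swap n x Zx) Wx) _; lia.
- exists N => n x Nn Zx; split=> //=.
  have [_ /= Wx] := bd _ _ Nn Zx.
  by apply: castW (gevW sW wa Wx) _; lia.
Qed.

Lemma prime_add a b : gdeg a = gdeg b -> p (GAdd a b) -> p a -> p b.
Proof.
move=> dab [N bd] [N' bd']; exists (N + N')%N => n x Nn Zx; split=> //=.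
have [|_ /= W1] := bd n x _ Zx; first by lia.
have [|_ /= W2] := bd' n x _ Zx; first by lia.
by have := submodB (sfS sW _) W1 W2; rewrite addrAC subrr add0r dab.
Qed.

Lemma prime_pow a n : gwf c a -> (0 < n)%N -> p (gpow a n) <-> p a.
Proof.
move=> wa; elim: n => // n IHn _; rewrite /= (primeM wa (gwf_pow n wa)).
split; last by left.
case=> //; case: n IHn => [|n] IHn; last by move/IHn; apply.
by move=> /unb.
Qed.

Lemma prime_hprime : hprime GMul gmix (ggood c) p.
Proof.
split.
- by move=> a b [wa _] [wb _]; apply: primeM.
- move=> a b [wa da] [wb db] pa npb pm; apply: npb; apply/(prime_pow wb da).
  apply: (prime_add _ pm); first by rewrite !gdeg_pow mulnC.
  exact/prime_pow.
- move=> a b [wa da] [wb db] npa pb [N bd]; apply: npa; apply/(prime_pow wa db).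
  have dE : gdeg (gpow b (gdeg a)) = gdeg (gpow a (gdeg b)) by rewrite !gdeg_pow mulnC.
  apply: (prime_add dE); last exact/prime_pow.
  exists N => n x Nn Zx; have [_ /= Wx] := bd n x Nn Zx; split=> //=.
  by rewrite dE addrC.
(* If all words were in [p], the variables would carry large degrees into [colon W h], so adding any
   finite stretch of such degrees would give a submodule. These submodules become stationary,
   against [unb]. *)
- apply: contrapT => no.
  have [N0 HN0] : exists N0, forall j n x, (j < c)%N -> (N0 <= n)%N -> Z n x ->
      colon W (GMul (GVar j) h) n x.
    have : forall j, exists N0, (j < c)%N -> forall n x, (N0 <= n)%N -> Z n x -> 
        colon W (GMul (GVar j) h) n x.
      move=> j; have [jc|jc] := pselect (j < c)%N; last by exists 0%N.
      have [[N0 H]|np] := pselect (p (GVar j)); first by exists N0.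
      by case: no; exists (GVar j).
    move=> /choice[N HN]; exists (\max_(j < c) N j)%N => j n x jc Nn; apply: HN => //.
    by apply: leq_trans Nn; apply: (leq_bigmax (Ordinal jc)).
  have sK := colon_sf sW wh.
  pose T N n x := Z n x /\ (colon W h n x \/ (N0 <= n < N)%N).
  have sT N : sf (T N).
    split.
    + move=> n; split; first by split; [apply: (submod0 (gZ gm n))|left; apply: (submod0 (sfS sK n))].
      move=> a x y [Zx Tx] [Zy Ty]; split; first exact: (submodP (gZ gm n)).
      case: Tx Ty => [Tx|]; [case=> [Ty|]|]; try by right.
      by left; apply: (submodP (sfS sK n)).
    + by move=> n x Bx; split; [apply: (gBZ gm)|left; apply: (sfB sK)].
    + by move=> n x [].
    + move=> j n x jc [Zx Tx]; split; first exact: (gXZ gm).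
      left; case: Tx => [|/andP[N0n _]]; first exact: (sfX sK).
      have [_ /= Wx] := HN0 j n x jc N0n Zx; split; first exact: (gXZ gm).
      have W1 := sfB sW (gev_varC gm wh jc Zx).
      have {Wx}/(castW Wx) W2 : (n + (1 + gdeg h).*2 = (n + (gdeg h).*2).+2)%N by lia.
      by have := submodB (sfS sW _) W2 W1; rewrite subKr !addSn.
  have [|_ [_ [N ->]] mxT] := nZ (S := fun V => exists N, V = T N).
    by exists (T 0%N) => //; exists 0%N.
  apply: unb; exists (N0 + N)%N => n x Nn Zx.
  have [||_ [//|/andP[_ nN]]] := mxT (T n.+1) (sT _) (ex_intro _ _ erefl) _ n x; last by lia.
    move=> l y [Zy [Ty|/andP[l1 l2]]]; split=> //; [by left|right].
    by apply/andP; split=> //; lia.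
  by split=> //; right; lia.
Qed.

End Prime.

(** Noetherian induction on [W]: a word is eventually injective modulo [W] if it is so modulo
    [W + h Z] and avoids the prime attached to [h]. *)
Lemma prime_list W : noeth X c Z B -> sf W ->
  exists2 L, all_prop (hprime GMul gmix (ggood c)) L &
    forall g, ggood c g -> all_prop (fun P => ~ P g) L -> ev_injective W g.
Proof.
move=> nZ sW; apply: contrapT => noL.
have [|{noL}{}W [{}sW noL] mx] := nZ (fun W => ~ exists2 L,
    all_prop (hprime GMul gmix (ggood c)) L &
    forall g, ggood c g -> all_prop (fun P => ~ P g) L -> ev_injective W g).
  by exists W.
apply: noL.
have [[N bd]|unb] := pselect (ev_full W).
  by exists [::] => // g _ _; exists N => n x Nn Zx _; apply: bd.
have [|_ [_ [h [wh unbh ->]]] mxh] := nZ (fun K => exists h,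
    [/\ gwf c h, ~ ev_full (colon W h) & K = colon W h]).
  exists (colon W GOne); first exact: colon_sf.
  exists GOne; split=> // -[N bd]; apply: unb; exists N => n x Nn Zx.
  by have [_ /=] := bd n x Nn Zx; rewrite addn0.
have {}mxh h' : gwf c h' -> ~ ev_full (colon W h') ->
    le_fam (colon W h) (colon W h') -> le_fam (colon W h') (colon W h).
  by move=> wh' unb'; apply: mxh; [apply: colon_sf|exists h'].
have [L HL inj] : exists2 L, all_prop (hprime GMul gmix (ggood c)) L &
    forall g, ggood c g -> all_prop (fun P => ~ P g) L -> ev_injective (gen_add W h) g.
  apply: contrapT => noL; apply: unbh; exists 0%N => n x _ Zx; split=> //.
  apply: (mx _ (gen_add_sf sW wh) noL).
    by move=> l y Wy; exists 0; [rewrite subr0|left].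
  exists (gev h x); first by rewrite subrr; apply: (submod0 (sfS sW _)).
  by right; exists n, x.
exists ((fun g => ev_full (colon W (GMul g h))) :: L).
  by split=> //; apply: prime_hprime.
move=> g gg /= [pg /(inj _ gg)[N HN]]; have [wg _] := gg.
exists N => n x Nn Zx Wx.
have [|y Wxy Hy] := HN n x Nn Zx; first by exists 0; [rewrite subr0|left].
case: Hy Wxy => [->|[m [z [nE Zz ->]]]] Wxy; first by rewrite subr0 in Wxy.
suff Wh : W n (gev h z) by have := submodD (sfS sW _) Wxy Wh; rewrite subrK.
rewrite nE; apply: (prime_cancel sW wh mxh wg pg Zz).
have := submodB (sfS sW _) Wx (gevW sW wg Wxy); rewrite gevB subKr nE.
by have -> : (m + (gdeg h).*2 + (gdeg g).*2 = m + (gdeg h + gdeg g).*2)%N by lia.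
Qed.

End Primes.

Section FamilyModule.
Variables (k : fieldType) (b : int -> nat).

(** All degrees are packed into one space because a [gmod] has a single carrier. *)
Definition fam := forall n : int, 'rV[k]_(b n).

HB.instance Definition _ := gen_eqMixin fam.
HB.instance Definition _ := gen_choiceMixin fam.

Let add (x y : fam) : fam := fun n => x n + y n.
Let opp (x : fam) : fam := fun n => - x n.
Let zero : fam := fun n => 0.
Let addA : associative add. Proof. by move=> x y z; apply: functional_extensionality_dep => n; apply: addrA. Qed.
Let addC : commutative add. Proof. by move=> x y; apply: functional_extensionality_dep => n; apply: addrC. Qed.
Let add0 : left_id zero add. Proof. by move=> x; apply: functional_extensionality_dep => n; apply: add0r. Qed.
Let addN : left_inverse zero opp add. Proof. by move=> x; apply: functional_extensionality_dep => n; apply: addNr. Qed.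
HB.instance Definition _ := GRing.isZmodule.Build fam addA addC add0 addN.

Let scale (a : k) (x : fam) : fam := fun n => a *: x n.
Let scaleA a a' x : scale a (scale a' x) = scale (a * a') x.
Proof. by apply: functional_extensionality_dep => n; apply: scalerA. Qed.
Let scale1 : left_id 1 scale.
Proof. by move=> x; apply: functional_extensionality_dep => n; apply: scale1r. Qed.
Let scaleDr : right_distributive scale +%R.
Proof. by move=> a x y; apply: functional_extensionality_dep => n; apply: scalerDr. Qed.
Let scaleDl x : {morph scale^~ x : a a' / a + a'}.
Proof. by move=> a a'; apply: functional_extensionality_dep => n; apply: scalerDl. Qed.
HB.instance Definition _ := GRing.Zmodule_isLmodule.Build k fam scaleA scale1 scaleDr scaleDl.

Lemma famP a (x y : fam) n : (a *: x + y) n = a *: x n + y n. Proof. by []. Qed.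
Lemma famB (x y : fam) n : (x - y) n = x n - y n. Proof. by []. Qed.

Definition spread n (y : 'rV[k]_(b n)) : fam := fun m => conform_mx 0 y.
Lemma spreadE n y : @spread n y n = y. Proof. exact: conform_mx_id. Qed.

End FamilyModule.

(** * Complexes of vector spaces with operators *)

Lemma trmxD (R : nmodType) n m (M N : 'M[R]_(n, m)) : (M + N)^T = M^T + N^T.
Proof. by apply/matrixP => i j; rewrite !mxE. Qed.

Lemma trmxB (R : zmodType) n m (M N : 'M[R]_(n, m)) : (M - N)^T = M^T - N^T.
Proof. by apply/matrixP => i j; rewrite !mxE. Qed.

Section KComplex.
Variable k : fieldType.

(* A complex of finite-dimensional vector spaces with operators [kT j] of degree
   2; the matrices [kD n m] and [kT j n m] matter only for [m = n + 1] and
   [m = n + 2] respectively. *)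
Record kd := Kd {
  kb : int -> nat;
  kD : forall n m, 'M[k]_(kb n, kb m);
  kT : nat -> forall n m, 'M[k]_(kb n, kb m)
}.

Record kdP c (K : kd) : Prop := KdP {
  kDD : forall n m p, m = n + 1 -> p = n + 2 -> kD K n m *m kD K m p = 0;
  kTD : forall j n m p q, (j < c)%N -> m = n + 1 -> p = n + 2 -> q = n + 3 ->
    kT K j n p *m kD K p q = kD K n m *m kT K j m q;
  kTT : forall i j n m p q r, (i < c)%N -> (j < c)%N -> m = n + 1 -> p = n + 2 -> q = n + 3 ->
    r = n + 4 -> exists G H, kT K i n p *m kT K j p r - kT K j n p *m kT K i p r =
      G *m kD K q r + kD K n m *m H
}.

Definition ktr (K : kd) : kd := @Kd (fun n => kb K (- n))
  (fun n m => (kD K (- m) (- n))^T) (fun j n m => (kT K j (- m) (- n))^T).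

Lemma ktrP c K : kdP c K -> kdP c (ktr K).
Proof.
move=> [DD TD TT]; split=> /=.
- by move=> n m p -> ->; rewrite -trmx_mul DD ?trmx0 //; lia.
- by move=> j n m p q jc -> -> ->; rewrite -!trmx_mul (TD j _ (- (n + 2))) //; lia.
- move=> i j n m p q r ic jc -> -> -> ->.
  have [||||G [H E]] := TT j i (- (n + 4)) (- (n + 3)) (- (n + 2)) (- (n + 1)) (- n) jc ic; try lia.
  exists H^T, G^T; rewrite -!trmx_mul -trmxB E trmxD !trmx_mul.
  exact: addrC.
Qed.

Definition kcycle K n (y : 'rV[k]_(kb K n)) := y *m kD K n (n + 1) = 0.
Definition kbound K n (y : 'rV[k]_(kb K n)) := exists w, y = w *m kD K (n - 1) n.

Lemma kcycleE K n m (y : 'rV[k]_(kb K n)) : m = n + 1 -> kcycle y <-> y *m kD K n m = 0.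
Proof. by move=> ->. Qed.
Lemma kboundE K n m (y : 'rV[k]_(kb K n)) : m = n - 1 ->
  kbound y <-> exists w, y = w *m kD K m n.
Proof. by move=> ->. Qed.

Lemma kcycle_submod K n : submod (@kcycle K n).
Proof.
split=> [|a x y]; first exact: mul0mx.
by rewrite /kcycle mulmxDl -scalemxAl => -> ->; rewrite scaler0 addr0.
Qed.

Lemma kbound_submod K n : submod (@kbound K n).
Proof.
split=> [|a _ _ [x ->] [y ->]]; first by exists 0; rewrite mul0mx.
by exists (a *: x + y); rewrite mulmxDl scalemxAl.
Qed.

Lemma kbound_cycle c K n y : kdP c K -> @kbound K n y -> kcycle y.
Proof.
move=> KP [w ->]; rewrite /kcycle -mulmxA (kDD KP) ?mulmx0 //; first by rewrite subrK.
by lia.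
Qed.

Definition kv K n := (kb K n - \rank (kD K n (n + 1)) - \rank (kD K (n - 1) n))%N.

Lemma frank_rowspace n m (G : 'M[k]_(m, n)) :
  frank (fun y : 'rV_n => (y <= G)%MS) (fun y => y = 0) (\rank G).
Proof.
exists (fun j => row j (row_base G)); split=> [j|x xG|d].
- by rewrite -(eq_row_base G) row_sub.
- have /submxP[d dE] : (x <= row_base G)%MS by rewrite eq_row_base.
  by exists (fun j => d 0 j); rewrite dE mulmx_sum_row subrr.
- have -> : \sum_j d j *: row j (row_base G) = (\row_j d j) *m row_base G.
    by rewrite mulmx_sum_row; apply: eq_bigr => j _; rewrite mxE.
  by move/eqP; rewrite mulmx_free_eq0 ?row_base_free // => /eqP/rowP + j => /(_ j); rewrite !mxE.
Qed.

Lemma submod_zero (V : lmodType k) : submod (fun y : V => y = 0).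
Proof. by split=> // a x y -> ->; rewrite scaler0 addr0. Qed.

Lemma submod_zero_sub (V : lmodType k) (Y : V -> Prop) : submod Y -> forall x, x = 0 -> Y x.
Proof. by move=> sY _ ->; apply: submod0. Qed.

Lemma kvP c K n : kdP c K -> frank (@kcycle K n) (@kbound K n) (kv K n) /\
  kb K n = (kv K n + \rank (kD K n (n + 1)) + \rank (kD K (n - 1) n))%N.
Proof.
move=> KP.
have H1 : frank (@kcycle K n) (fun y => y = 0) (kb K n - \rank (kD K n (n + 1))).
  rewrite -mxrank_ker; have := frank_rowspace (kermx (kD K n (n + 1))).
  by congr frank; apply/funext => y; apply/propext; rewrite /kcycle; split=> /sub_kermxP.
have H2 : frank (@kbound K n) (fun y => y = 0) (\rank (kD K (n - 1) n)).
  have := frank_rowspace (kD K (n - 1) n).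
  congr frank; apply/funext => y; apply/propext; split=> [/submxP[w ->]|[w ->]]; first by exists w.
  exact: submxMl.
have [a [b [E Ha Hb]]] := frank_split (submod_zero _) (kbound_submod K n) (kcycle_submod K n)
  (submod_zero_sub (kbound_submod K n))
  (fun x => kbound_cycle KP) H1.
have aE := frank_uniq (submod_zero _) Ha H2.
have bE : kv K n = b by rewrite /kv E aE addKn.
split; first by rewrite bE.
by rewrite bE; have := rank_leq_row (kD K n (n + 1)); rewrite -aE; move: E; lia.
Qed.

Lemma kv_tr K n : kv (ktr K) n = kv K (- n).
Proof.
rewrite /kv /= !mxrank_tr opprD opprB [1 - n]addrC.
by have -> : (kb K (- n) - \rank (kD K (- n - 1) (- n)) - \rank (kD K (- n) (- n + 1)) =
  kb K (- n) - \rank (kD K (- n) (- n + 1)) - \rank (kD K (- n - 1) (- n)))%N by lia.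
Qed.

Definition kX K j (e : fam k (kb K)) : fam k (kb K) := fun m => e (m - 2) *m kT K j (m - 2) m.
Lemma kX_linear K j : linear (@kX K j).
Proof.
by move=> a x y; apply: functional_extensionality_dep => m; rewrite /kX famP mulmxDl -scalemxAl.
Qed.
HB.instance Definition _ K j :=
  GRing.isLinear.Build k (fam k (kb K)) (fam k (kb K)) _ (@kX K j) (@kX_linear K j).

Definition kXl K j : {linear fam k (kb K) -> fam k (kb K)} := @kX K j.

Lemma kXlE K j e m : kXl K j e m = e (m - 2) *m kT K j (m - 2) m.
Proof. by []. Qed.

(** [n0] is where the naturally graded module starts inside a complex unbounded on both sides. *)
Definition kZ K n0 l (e : fam k (kb K)) := kcycle (e (n0 + l%:Z)).
Definition kB K n0 l (e : fam k (kb K)) := kbound (e (n0 + l%:Z)).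

Lemma kX_cycle c K j n (e : fam k (kb K)) : kdP c K -> (j < c)%N ->
  kcycle (e n) -> kcycle (kX j e (n + 2)).
Proof.
move=> KP jc H; have {H}: kcycle (e (n + 2 - 2)) by rewrite addrK.
move=> /(kcycleE _ (m := n + 1)) E; rewrite /kcycle /kX -mulmxA.
rewrite (kTD KP jc (m := n + 1)); [|lia..].
by rewrite mulmxA E ?mul0mx //; lia.
Qed.

Lemma kX_bound c K j n (e : fam k (kb K)) : kdP c K -> (j < c)%N ->
  kbound (e n) -> kbound (kX j e (n + 2)).
Proof.
move=> KP jc H; have {H}: kbound (e (n + 2 - 2)) by rewrite addrK.
move=> /(kboundE _ (m := n - 1))[|w E]; first lia.
rewrite /kX E -mulmxA -(kTD KP jc (p := n + 1)); [|lia..].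
by apply/(kboundE _ (m := n + 1)); [lia|exists (w *m kT K j (n - 1) (n + 1)); rewrite mulmxA].
Qed.

Lemma kX_comm c K i j n (e : fam k (kb K)) : kdP c K -> (i < c)%N -> (j < c)%N ->
  kcycle (e n) -> kbound ((kX i (kX j e) - kX j (kX i e)) (n + 4)).
Proof.
move=> KP ic jc H; have {H}: kcycle (e (n + 4 - 2 - 2)).
  by have -> : n + 4 - 2 - 2 = n by lia.
move=> /(kcycleE _ (m := n + 1)) E; rewrite famB /kX -!mulmxA -mulmxBr.
have [||||G [H ->]] := kTT KP jc ic (n := n + 4 - 2 - 2) (m := n + 1) (p := n + 4 - 2)
  (q := n + 3) (r := n + 4); try lia.
rewrite mulmxDr !mulmxA E ?mul0mx ?addr0; last by lia.
by apply/(kboundE _ (m := n + 3)); [lia|eexists].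
Qed.

Lemma kgmod c K n0 : kdP c K -> gmod (kXl K) c (@kZ K n0) (@kB K n0).
Proof.
move=> KP; have e2 (l : nat) : n0 + l.+2%:Z = n0 + l%:Z + 2 by lia.
have e4 (l : nat) : n0 + l.+4%:Z = n0 + l%:Z + 4 by lia.
split.
- move=> l; split=> [|a x y]; first exact: (submod0 (kcycle_submod K _)).
  exact: (submodP (kcycle_submod K _)).
- move=> l; split=> [|a x y]; first exact: (submod0 (kbound_submod K _)).
  exact: (submodP (kbound_submod K _)).
- by move=> l e; apply: (kbound_cycle KP).
- by move=> j l e jc Ze; rewrite /kZ e2; apply: (kX_cycle KP).
- by move=> j l e jc Be; rewrite /kB e2; apply: (kX_bound KP).
- by move=> i j l e ic jc Ze; rewrite /kB e4; apply: (kX_comm KP).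
Qed.

Lemma frank_spread c K n0 l : kdP c K -> frank (@kZ K n0 l) (@kB K n0 l) (kv K (n0 + l%:Z)).
Proof.
move=> KP; have [Hv _] := kvP (n0 + l%:Z) KP; have g := kgmod n0 KP.
apply: (qrank_transport (rel := fun y (e : fam k (kb K)) => e (n0 + l%:Z) = y)) Hv => //.
- exact: kcycle_submod.
- exact: (gZ g).
- by move=> a x y x' y' <- <-.
- by move=> y Zy; exists (spread y); rewrite /kZ spreadE.
- by move=> e Ze; exists (e (n0 + l%:Z)).
- by move=> _ e _ _ <-.
Qed.

End KComplex.

(** * Extensions of complexes and their long exact sequence *)

Section KernelBounded.
Variables (k : fieldType) (E E2 : lmodType k) (X : nat -> {linear E -> E})
  (X2 : nat -> {linear E2 -> E2}) (c : nat) (Z B : nat -> E -> Prop) (Z2 B2 : nat -> E2 -> Prop).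
Hypotheses (g : gmod X c Z B) (g2 : gmod X2 c Z2 B2).
Variables (p : {linear E -> E2}) (v : nat -> nat) (N : nat).
Hypotheses (pZ : forall n x, Z n x -> Z2 n (p x)) (pB : forall n x, B n x -> B2 n (p x))
  (pX : forall j n x, (j < c)%N -> Z n x -> B2 n.+2 (p (X j x) - X2 j (p x)))
  (ker : forall n x, (N <= n)%N -> Z n x -> B2 n (p x) -> B n x)
  (Hv : forall n, exists v, frank (Z n) (B n) v).

(** The kernel of [p] on homology lives in degrees below [N], hence has finite total dimension. *)
Lemma noeth_bounded_kernel : noeth X2 c Z2 B2 -> noeth X c Z B.
Proof.
pose K n x := Z n x /\ B2 n (p x).
have gK : gmod X c K B.
  split.
  - move=> n; split; first by split; [apply: (submod0 (gZ g n))|rewrite raddf0; apply: (submod0 (gB g2 n))].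
    move=> a x y [Zx Bx] [Zy By]; split; first exact: (submodP (gZ g n)).
    by rewrite linearP; apply: (submodP (gB g2 n)).
  - exact: (gB g).
  - by move=> n x Bx; split; [apply: (gBZ g)|apply: pB].
  - move=> j n x jc [Zx Bx]; split; first exact: (gXZ g).
    by have := submodD (gB g2 _) (pX jc Zx) (gXB g2 jc Bx); rewrite subrK.
  - exact: (gXB g).
  - by move=> i j n x ic jc [Zx _]; apply: (gXC g).
have /choice[w Hw] n : exists w, frank (K n) (B n) w.
  have [v' Hv'] := Hv n.
  have [a [b [_ Ha _]]] := frank_split (gB g n) (gZ gK n) (gZ g n) (gBZ gK (n := n)) (fun x H => H.1) Hv'.
  by exists a.
have nK : noeth X c K B by apply: (noeth_finite gK Hw (N := N)) => n x Nn [Zx Bx]; apply: ker.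
move=> n2; apply: (noeth_extension gK g g2 (f := idfun) (p := p)) nK n2 => //.
- by move=> j n x jc _; rewrite subrr; apply: (submod0 (gB g _)).
- by move=> n x Zx Bx; exists x; rewrite // subrr; apply: (submod0 (gB g _)).
Qed.

End KernelBounded.

Section KExtension.
Variable k : fieldType.

(* An extension of complexes 0 -> K1[s1] -> K -> K2[s2] -> 0, split in each
   degree, compatible with the operators, and with the differentials up to
   nonzero scalars. *)
Record kext c (s1 s2 : int) (K1 K K2 : kd k) := Kext {
  ki : forall n n1, 'M[k]_(kb K1 n1, kb K n);
  kr : forall n n1, 'M[k]_(kb K n, kb K1 n1);
  kp : forall n n2, 'M[k]_(kb K n, kb K2 n2);
  ks : forall n n2, 'M[k]_(kb K2 n2, kb K n);
  k1 : k;
  k2 : k;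
  k1_neq0 : k1 != 0;
  k2_neq0 : k2 != 0;
  kir : forall n n1, n1 = n + s1 -> ki n n1 *m kr n n1 = 1%:M;
  ksp : forall n n2, n2 = n + s2 -> ks n n2 *m kp n n2 = 1%:M;
  kri : forall n n1 n2, n1 = n + s1 -> n2 = n + s2 ->
    kr n n1 *m ki n n1 + kp n n2 *m ks n n2 = 1%:M;
  kiD : forall n n1 m m1, n1 = n + s1 -> m = n + 1 -> m1 = n + 1 + s1 ->
    ki n n1 *m kD K n m = k1 *: (kD K1 n1 m1 *m ki m m1);
  kDp : forall n n2 m m2, n2 = n + s2 -> m = n + 1 -> m2 = n + 1 + s2 ->
    kD K n m *m kp m m2 = k2 *: (kp n n2 *m kD K2 n2 m2);
  kiT : forall j n n1 m m1, (j < c)%N -> n1 = n + s1 -> m = n + 2 -> m1 = n + 2 + s1 ->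
    ki n n1 *m kT K j n m = kT K1 j n1 m1 *m ki m m1;
  kTp : forall j n n2 m m2, (j < c)%N -> n2 = n + s2 -> m = n + 2 -> m2 = n + 2 + s2 ->
    kT K j n m *m kp m m2 = kp n n2 *m kT K2 j n2 m2
}.

Definition kext_tr c s1 s2 K1 K K2 (x : kext c s1 s2 K1 K K2) :
  kext c (- s2) (- s1) (ktr K2) (ktr K) (ktr K1).
Proof.
apply: (@Kext c (- s2) (- s1) (ktr K2) (ktr K) (ktr K1)
  (fun n n1 => (kp x (- n) (- n1))^T) (fun n n1 => (ks x (- n) (- n1))^T)
  (fun n n2 => (ki x (- n) (- n2))^T) (fun n n2 => (kr x (- n) (- n2))^T) (k2 x) (k1 x)
  (k2_neq0 x) (k1_neq0 x)) => /=.
- by move=> n n1 ->; rewrite -trmx_mul ksp ?trmx1 //; lia.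
- by move=> n n1 ->; rewrite -trmx_mul kir ?trmx1 //; lia.
- move=> n n1 n2 -> ->; rewrite -!trmx_mul -trmxD.
  rewrite -[RHS]trmx1; congr trmx; apply: etrans (addrC _ _) (kri x _ _); lia.
- move=> n n1 m m1 -> -> ->; rewrite -!trmx_mul (kDp x (n2 := - (n + 1 - s2))); [|lia..].
  by apply/matrixP => i j; rewrite !mxE.
- move=> n n1 m m1 -> -> ->; rewrite -!trmx_mul (kiD x (m1 := - (n - s1))); [|lia..].
  by apply/matrixP => i j; rewrite !mxE.
- by move=> j n n1 m m1 jc -> -> ->; rewrite -!trmx_mul (kTp x (n2 := - (n + 2 - s2))) //; lia.
- by move=> j n n1 m m1 jc -> -> ->; rewrite -!trmx_mul (kiT x (m1 := - (n - s1))) //; lia.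
Defined.

Section Extension.
Variables (c : nat) (s1 s2 : int) (K1 K K2 : kd k) (x : kext c s1 s2 K1 K K2).
Local Notation ki := (ki x).
Local Notation kr := (kr x).
Local Notation kp := (kp x).
Local Notation ks := (ks x).
Local Notation k1 := (k1 x).
Local Notation k2 := (k2 x).

Lemma kip n n1 n2 : n1 = n + s1 -> n2 = n + s2 -> ki n n1 *m kp n n2 = 0.
Proof.
move=> e1 e2; have /(congr1 (fun M => ki n n1 *m M *m kp n n2)) := kri x e1 e2.
rewrite mulmxDr mulmx1 mulmxDl !mulmxA (kir x e1) mul1mx -[_ *m ks n n2 *m _]mulmxA (ksp x e2) mulmx1.
by move/eqP; rewrite -subr_eq0 addrK => /eqP.
Qed.

Lemma kriE n n1 n2 : n1 = n + s1 -> n2 = n + s2 ->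
  kr n n1 *m ki n n1 = 1%:M - kp n n2 *m ks n n2.
Proof. by move=> e1 e2; rewrite -(kri x e1 e2) addrK. Qed.

Lemma kpsE n n1 n2 : n1 = n + s1 -> n2 = n + s2 ->
  kp n n2 *m ks n n2 = 1%:M - kr n n1 *m ki n n1.
Proof. by move=> e1 e2; rewrite -(kri x e1 e2) [X in X - _]addrC addrK. Qed.

(* On cycles, the connecting homomorphism of the long exact sequence. *)
Definition kconn n2 n m m1 := ks n n2 *m kD K n m *m kr m m1.

Lemma ki_cycle n n1 (y : 'rV_(kb K1 n1)) : n1 = n + s1 -> kcycle (y *m ki n n1) <-> kcycle y.
Proof.
move=> e1; rewrite (kcycleE y (m := n + 1 + s1)); last by rewrite e1 addrAC.
rewrite /kcycle -mulmxA (kiD x (m1 := n + 1 + s1)) // -scalemxAr mulmxA.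
split=> [|->]; last by rewrite mul0mx scaler0.
move/(congr1 (fun M => k1^-1 *: M *m kr (n + 1) (n + 1 + s1))).
by rewrite scalerA mulVf ?k1_neq0 // scale1r -[_ *m ki _ _ *m _]mulmxA (kir x) // mulmx1 scaler0 mul0mx.
Qed.

Lemma kp_cycle n n2 (y : 'rV_(kb K n)) : n2 = n + s2 -> kcycle y -> kcycle (y *m kp n n2).
Proof.
move=> e2 Zy; apply/(kcycleE _ (m := n + 1 + s2)); first by rewrite e2 addrAC.
have := kDp x (n2 := n2) (m2 := n + 1 + s2) e2 erefl erefl.
move/(congr1 (fun M => k2^-1 *: (y *m M))); rewrite mulmxA Zy mul0mx scaler0.
by rewrite -scalemxAr scalerA mulVf ?k2_neq0 // scale1r mulmxA.
Qed.

Lemma ki_bound n n1 (y : 'rV_(kb K1 n1)) : n1 = n + s1 -> kbound y -> kbound (y *m ki n n1).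
Proof.
move=> e1 /(kboundE _ (m := n - 1 + s1))[|w ->]; first by rewrite e1 addrAC.
exists (k1^-1 *: (w *m ki (n - 1) (n - 1 + s1))).
rewrite -scalemxAl -[in RHS]mulmxA (kiD x (m1 := n1)) //; [|lia..].
by rewrite -scalemxAr scalerA mulVf ?k1_neq0 // scale1r mulmxA.
Qed.

Lemma kp_bound n n2 (y : 'rV_(kb K n)) : n2 = n + s2 -> kbound y -> kbound (y *m kp n n2).
Proof.
move=> e2 [w ->]; apply/(kboundE _ (m := n - 1 + s2)); first by rewrite e2 addrAC.
exists (k2 *: (w *m kp (n - 1) (n - 1 + s2))).
rewrite -mulmxA (kDp x (n2 := n - 1 + s2)) //; [|lia..].
by rewrite -scalemxAr -scalemxAl mulmxA.
Qed.

Lemma kp_bound_ex n n2 (y : 'rV_(kb K n)) : kdP c K -> n2 = n + s2 -> kcycle y -> kbound (y *m kp n n2) ->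
  exists2 w, kcycle w & kbound (y - w *m ki n (n + s1)).
Proof.
move=> KP e2 Zy /(kboundE _ (m := n - 1 + s2))[|u uE]; first by rewrite e2 addrAC.
pose b := k2^-1 *: (u *m ks (n - 1) (n - 1 + s2)) *m kD K (n - 1) n.
have Bb : kbound b by exists (k2^-1 *: (u *m ks (n - 1) (n - 1 + s2))).
have ybp : (y - b) *m kp n n2 = 0.
  rewrite mulmxBl uE /b -[_ *m kD K _ _ *m _]mulmxA (kDp x (n2 := n - 1 + s2)) //; [|lia..].
  rewrite -scalemxAr -scalemxAl scalerA mulfV ?k2_neq0 // scale1r -!mulmxA.
  by rewrite [ks _ _ *m _]mulmxA (ksp x) // mul1mx subrr.
exists ((y - b) *m kr n (n + s1)).
  apply/(ki_cycle _ (n := n)) => //; rewrite -mulmxA.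
  rewrite (kriE (n2 := n2)) //.
  rewrite mulmxBr mulmx1 mulmxA ybp mul0mx subr0.
  exact: (submodB (kcycle_submod K n) Zy (kbound_cycle KP Bb)).
by rewrite -mulmxA (kriE (n2 := n2)) // mulmxBr mulmx1 mulmxA ybp mul0mx subr0 subKr.
Qed.

Lemma kconn_cycle n2 n m m1 (z : 'rV_(kb K2 n2)) : n2 = n + s2 -> m = n + 1 -> m1 = n + 1 + s1 ->
  kcycle z -> kbound (z *m kconn n2 n m m1 *m ki m m1).
Proof.
move=> e2 em em1 Zz; apply/(kboundE _ (m := n)); first by rewrite em addrK.
exists (z *m ks n n2); rewrite /kconn !mulmxA -[_ *m kr _ _ *m _]mulmxA.
rewrite (kriE (n2 := n + 1 + s2)) ?em // -em mulmxBr mulmx1 mulmxA.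
have em2 : m + s2 = n + 1 + s2 by rewrite em.
rewrite -[_ *m kD K n m *m kp _ _]mulmxA (kDp x e2 em em2) -scalemxAr !mulmxA.
rewrite -[z *m ks n n2 *m kp _ _]mulmxA (ksp x) // mulmx1.
by move/(kcycleE _ (m := m + s2)): Zz => ->; rewrite ?scaler0 ?mul0mx ?subr0 // e2 em addrAC.
Qed.

Lemma ki_bound_ex m m1 n n2 (y : 'rV_(kb K1 m1)) : m = n + 1 -> m1 = n + 1 + s1 -> n2 = n + s2 ->
  kbound (y *m ki m m1) -> exists2 z, kcycle z & kbound (y - z *m kconn n2 n m m1).
Proof.
move=> em em1 e2 /(kboundE _ (m := n))[|w E]; first by rewrite em addrK.
exists (w *m kp n n2).
  apply/(kcycleE _ (m := n + 1 + s2)); first by rewrite e2 addrAC.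
  have := kDp x (n2 := n2) (m2 := n + 1 + s2) e2 em erefl.
  move/(congr1 (fun M => k2^-1 *: (w *m M))); rewrite mulmxA -E -mulmxA kip ?em //.
  by rewrite mulmx0 scaler0 -scalemxAr scalerA mulVf ?k2_neq0 // scale1r mulmxA => <-.
have yE : y = w *m kD K n m *m kr m m1.
  by rewrite -E -mulmxA (kir x) ?mulmx1 // em.
apply/(kboundE _ (m := n + s1)); first by rewrite em1; lia.
exists (k1 *: (w *m kr n (n + s1))).
rewrite yE /kconn !mulmxA -[w *m kp _ _ *m _]mulmxA.
rewrite (kpsE (n1 := n + s1)) //.
rewrite mulmxBr mulmx1 mulmxBl mulmxBl subKr mulmxA -2!mulmxA [ki _ _ *m _]mulmxA.
rewrite (kiD x (m1 := m1)) // -scalemxAl -!scalemxAr -scalemxAl.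
by rewrite -!mulmxA (kir x) ?mulmx1 // em.
Qed.

Lemma kconn_bound n2 n m m1 (z : 'rV_(kb K2 n2)) : kdP c K -> n2 = n + s2 -> m = n + 1 ->
  m1 = n + 1 + s1 -> kbound z -> kbound (z *m kconn n2 n m m1).
Proof.
move=> KP e2 em em1 /(kboundE _ (m := n - 1 + s2))[|w ->]; first by rewrite e2 addrAC.
apply/(kboundE _ (m := n + s1)); first by rewrite em1; lia.
exists (- (k1 *: (k2^-1 *: (w *m ks (n - 1) (n - 1 + s2) *m kD K (n - 1) n *m kr n (n + s1))))).
have -> : w *m kD K2 (n - 1 + s2) n2 =
    k2^-1 *: (w *m ks (n - 1) (n - 1 + s2) *m kD K (n - 1) n *m kp n n2).
  rewrite -[_ *m kD K _ _ *m _]mulmxA (kDp x (n2 := n - 1 + s2)) //; [|lia..].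
  rewrite -scalemxAr scalerA mulVf ?k2_neq0 // scale1r -!mulmxA.
  by rewrite [ks _ _ *m _]mulmxA (ksp x) // mul1mx.
rewrite /kconn !mulmxA -!scalemxAl -[_ *m kp _ _ *m _]mulmxA.
rewrite (kpsE (n1 := n + s1)) //.
rewrite mulmxBr mulmx1 mulmxBl -[_ *m kD K _ n *m kD K _ _]mulmxA (kDD KP) ?mulmx0 ?sub0r; [|lia..].
set Q := w *m ks _ _ *m kD K _ n.
rewrite mulmxA -[Q *m _ *m _ *m _]mulmxA (kiD x erefl em em1).
rewrite -scalemxAr !mulNmx scalerN -!scalemxAl !mulmxA -[_ *m ki _ _ *m _]mulmxA (kir x) ?em //.
by rewrite mulmx1 !scalerA mulrC.
Qed.

(** Connecting maps injective in two consecutive degrees cut the long exact sequence down to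
    [0 -> H(K2) -> H(K1) -> H(K) -> 0]. *)
Lemma kv_cone m n m1 n2 : kdP c K -> kdP c K1 -> kdP c K2 -> m = n + 1 -> m1 = m + s1 -> n2 = n + s2 ->
  (forall z : 'rV_(kb K2 n2), kcycle z -> kbound (z *m kconn n2 n m m1) -> kbound z) ->
  (forall z : 'rV_(kb K2 (m + s2)), kcycle z ->
     kbound (z *m kconn (m + s2) m (m + 1) (m + 1 + s1)) -> kbound z) ->
  (kv K m + kv K2 n2 = kv K1 m1)%N.
Proof.
move=> KP K1P K2P em em1 e2 inj0 inj1.
have em1' : m1 = n + 1 + s1 by rewrite em1 em.
have bp (y : 'rV_(kb K m)) : kcycle y -> kbound (y *m kp m (m + s2)).
  move=> Zy; apply: inj1; first exact: kp_cycle.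
  apply/(kboundE _ (m := m + s1)); first by lia.
  exists (- (k1 *: (y *m kr m (m + s1)))); rewrite /kconn !mulmxA.
  rewrite -[y *m _ *m _]mulmxA (kpsE (n1 := m + s1)) // mulmxBr mulmx1 mulmxBl Zy sub0r mulmxA -[_ *m kD K _ _]mulmxA.
  rewrite (kiD x (m1 := m + 1 + s1)) // !mulNmx -scalemxAr -!scalemxAl -!mulmxA (kir x) //.
  by rewrite mulmx1.
pose W (y : 'rV_(kb K1 m1)) := kcycle y /\ kbound (y *m ki m m1).
have sW : submod W.
  split; first by split; [apply: (submod0 (kcycle_submod _ _))|rewrite mul0mx; apply: (submod0 (kbound_submod _ _))].
  move=> a y z [Zy By] [Zz Bz]; split; first exact: (submodP (kcycle_submod _ _)).
  by rewrite mulmxDl -scalemxAl; apply: (submodP (kbound_submod _ _)).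
have [H1 _] := kvP m1 K1P; have [H _] := kvP m KP; have [H2 _] := kvP n2 K2P.
have [a [b [-> Ha Hb]]] := frank_split (kbound_submod K1 m1) sW (kcycle_submod K1 m1)
  (fun y By => conj (kbound_cycle K1P By) (ki_bound em1 By)) (fun y H => H.1) H1.
have aE : a = kv K2 n2.
  apply: (frank_uniq (kbound_submod K1 m1) Ha).
  apply: (qrank_transport (rel := fun z y => kbound (y - z *m kconn n2 n m m1))) H2.
  - exact: kcycle_submod.
  - exact: sW.
  - by rewrite mul0mx subr0; apply: (submod0 (kbound_submod _ _)).
  - move=> d y z y' z' By Bz; rewrite mulmxDl opprD addrACA -scalemxAl -scalerBr.
    exact: (submodP (kbound_submod _ _)).
  - move=> z Zz; exists (z *m kconn n2 n m m1); last by rewrite subrr; apply: (submod0 (kbound_submod _ _)).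
    have Bz := kconn_cycle e2 em em1' Zz; split=> //.
    by apply/(ki_cycle _ em1); apply: (kbound_cycle KP).
  - by move=> y [Zy By]; apply: (ki_bound_ex em em1' e2).
  - move=> z y Zz _ Byz; split=> [Bz|By]; last first.
      by apply: inj0 => //; have := submodB (kbound_submod _ _) By Byz; rewrite subKr.
    rewrite -(subrK (z *m kconn n2 n m m1) y); apply: (submodD (kbound_submod _ _)) => //.
    exact: kconn_bound Bz.
have bE : b = kv K m.
  apply: (frank_uniq sW Hb).
  apply: (qrank_transport (rel := fun y z => kbound (y - z *m ki m m1))) H.
  - exact: kcycle_submod.
  - exact: kcycle_submod.
  - by rewrite mul0mx subr0; apply: (submod0 (kbound_submod _ _)).
  - move=> d y z y' z' By Bz; rewrite mulmxDl opprD addrACA -scalemxAl -scalerBr.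
    exact: (submodP (kbound_submod _ _)).
  - by move=> y Zy; rewrite em1; apply: (kp_bound_ex KP erefl Zy); apply: bp.
  - move=> y Zy; exists (y *m ki m m1); first exact/ki_cycle.
    by rewrite subrr; apply: (submod0 (kbound_submod _ _)).
  - move=> y z Zy Zz Byz; split=> [By|[_ Bz]].
      by split=> //; have := submodB (kbound_submod _ _) By Byz; rewrite subKr.
    by have := submodD (kbound_submod _ _) Byz Bz; rewrite subrK.
by rewrite aE bE addnC.
Qed.

Definition kin (e : fam k (kb K1)) : fam k (kb K) := fun n => e (n + s1) *m ki n (n + s1).
Definition kout (e : fam k (kb K)) : fam k (kb K2) := fun m => e (m - s2) *m kp (m - s2) m.

Lemma kin_linear : linear kin.
Proof. by move=> a y z; apply: functional_extensionality_dep => m; rewrite /kin famP mulmxDl -scalemxAl. Qed.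
Lemma kout_linear : linear kout.
Proof. by move=> a y z; apply: functional_extensionality_dep => m; rewrite /kout famP mulmxDl -scalemxAl. Qed.
HB.instance Definition _ := GRing.isLinear.Build k (fam k (kb K1)) (fam k (kb K)) _ kin kin_linear.
HB.instance Definition _ := GRing.isLinear.Build k (fam k (kb K)) (fam k (kb K2)) _ kout kout_linear.

Definition kinl : {linear fam k (kb K1) -> fam k (kb K)} := kin.
Definition koutl : {linear fam k (kb K) -> fam k (kb K2)} := kout.
Lemma kinlE e n : kinl e n = e (n + s1) *m ki n (n + s1). Proof. by []. Qed.
Lemma koutlE e n : koutl e n = e (n - s2) *m kp (n - s2) n. Proof. by []. Qed.

Lemma kin_X j e : (j < c)%N -> kinl (kXl K1 j e) = kXl K j (kinl e).
Proof.
move=> jc; apply: functional_extensionality_dep => m; rewrite !kXlE !kinlE kXlE.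
have E : m + s1 - 2 = m - 2 + s1 by lia.
by rewrite E -!mulmxA (kiT x (m1 := m + s1)) //; lia.
Qed.

Lemma kout_X j e : (j < c)%N -> koutl (kXl K j e) = kXl K2 j (koutl e).
Proof.
move=> jc; apply: functional_extensionality_dep => m; rewrite !kXlE !koutlE kXlE.
have E : m - s2 - 2 = m - 2 - s2 by lia.
by rewrite E -!mulmxA (kTp x (n2 := m - 2)) //; lia.
Qed.

End Extension.

Lemma kZE (K : kd k) n0 l n e : n = n0 + l%:Z -> @kZ k K n0 l e <-> kcycle (e n).
Proof. by move=> ->. Qed.
Lemma kBE (K : kd k) n0 l n e : n = n0 + l%:Z -> @kB k K n0 l e <-> kbound (e n).
Proof. by move=> ->. Qed.

Lemma kZ_cycle (K : kd k) n0 l e n : @kZ k K n0 l e -> n = n0 + l%:Z -> kcycle (e n).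
Proof. by move=> Ze ->. Qed.
Lemma kB_bound (K : kd k) n0 l e n : @kB k K n0 l e -> n = n0 + l%:Z -> kbound (e n).
Proof. by move=> Be ->. Qed.

Definition noeth_all c (K : kd k) := forall n0, noeth (@kXl k K) c (@kZ k K n0) (@kB k K n0).

Lemma noeth_cone c s1 s2 K1 K K2 (x : kext c s1 s2 K1 K K2) : kdP c K1 -> kdP c K -> kdP c K2 ->
  noeth_all c K1 -> noeth_all c K2 -> noeth_all c K.
Proof.
move=> K1P KP K2P n1 n2 n0.
apply: (noeth_extension (kgmod (n0 + s1) K1P) (kgmod n0 KP) (kgmod (n0 + s2) K2P)
  (f := kinl x) (p := koutl x)) (n1 _) (n2 _).
- by move=> l e Be; rewrite /kB kinlE; apply: ki_bound => //; apply: (kB_bound Be); lia.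
- move=> j l e jc _; rewrite kin_X // subrr; exact: (submod0 (kbound_submod K _)).
- move=> l e Ze; apply/(kZE _ (n := n0 + l%:Z + s2)); first lia.
  by rewrite koutlE; apply: kp_cycle; rewrite ?addrK.
- move=> j l e jc _; rewrite kout_X // subrr; exact: (submod0 (kbound_submod K2 _)).
- move=> l e Ze Be; have : kbound (koutl x e (n0 + l%:Z + s2)) by apply: (kB_bound Be); lia.
  rewrite koutlE addrK => /(kp_bound_ex KP erefl Ze)[w Zw Bw].
  exists (spread w); first by apply/(kZE _ (n := n0 + l%:Z + s1)); [lia|rewrite spreadE].
  by rewrite /kB famB kinlE spreadE.
Qed.

(** The connecting map is the last operator up to the scalar [a], so the cokernel of that operator
    on H(T) embeds into H(G), which is noetherian over the remaining operators. The basis theorem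
    adds the last one. *)
Lemma noeth_tower c s1 s2 (T G : kd k) (x : kext c s1 s2 T G T) a : s1 = s2 + 1 -> a != 0 ->
  (forall n n2 m m1, n2 = n + s2 -> m = n + 1 -> m1 = n + 1 + s1 ->
    kconn x n2 n m m1 = a *: kT T c n2 m1) ->
  kdP c.+1 T -> kdP c G -> noeth_all c G -> noeth_all c.+1 T.
Proof.
move=> es a0 conn TP GP nG n0; have g := kgmod n0 TP; apply: (hilbert_basis g).
(* The bound is 2 because the truncation at [n0] loses the image of the operator in its first two
   degrees. *)
apply: (noeth_bounded_kernel (gmod_coker g) (kgmod (n0 - s1) GP) (p := kinl x) (N := 2)) (nG _).
- by move=> l e Ze; rewrite /kZ kinlE; apply/ki_cycle => //; apply: (kZ_cycle Ze); lia.
- move=> l e [y Bey Hy]; have -> : kinl x e = kinl x (e - y) + kinl x y by rewrite -raddfD subrK.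
  apply: (submodD (gB (kgmod (n0 - s1) GP) l)).
    by rewrite /kB kinlE; apply: ki_bound => //; apply: (kB_bound Bey); lia.
  case: l Hy {Bey} => [|[|l]]; [by move=> ->; rewrite raddf0; exact: (submod0 (gB (kgmod (n0 - s1) GP) _))..|].
  move=> [z Zz ->]; rewrite /kB kinlE kXlE; set n := n0 - s1 + _.
  have -> : kT T c (n + s1 - 2) (n + s1) = a^-1 *: kconn x (n + s1 - 2) (n - 1) n (n + s1).
    by rewrite conn ?scalerA ?mulVf ?scale1r //; lia.
  rewrite -scalemxAr -scalemxAl; apply: (submodZ (kbound_submod G _)).
  apply: kconn_cycle; [lia..|].
  by apply: (kZ_cycle Zz); rewrite /n; lia.
- move=> j l e jc _; rewrite kin_X // subrr; exact: (submod0 (kbound_submod G _)).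
- move=> [|[|l]] // e _ Ze Be.
  have : kbound (kinl x e (n0 + l.+2%:Z - s1)) by apply: (kB_bound Be); lia.
  rewrite kinlE subrK => B1.
  have [|||z Zz Bz] := ki_bound_ex (n := n0 + l.+2%:Z - s1 - 1) (n2 := n0 + l.+2%:Z - 2) _ _ _ B1; try lia.
  rewrite conn in Bz; [|lia..].
  exists (kXl T c (spread (a *: z))); last first.
    exists (spread (a *: z)) => //; apply/(kZE _ (n := n0 + l.+2%:Z - 2)); first lia.
    by rewrite spreadE; apply: (submodZ (kcycle_submod T _)).
  by rewrite /kB famB kXlE spreadE -scalemxAl scalemxAr.
- move=> l; have [a' [b [_ _ Hb]]] := frank_split (gB g l) (gB (gmod_coker g) l) (gZ g l)
    (@shiftZ_B _ _ _ _ _ _ g c l) (gBZ (gmod_coker g) (n := l)) (frank_spread n0 l TP).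
  by exists b.
Qed.

End KExtension.

(** * Matrices of words and block triangular extensions *)

Fixpoint gmx (R : pzRingType) (b : int -> nat) (T : nat -> forall n m, 'M[R]_(b n, b m)) g n m
    : 'M[R]_(b n, b m) :=
  match g with
  | GOne => pid_mx (b n) | GZero => 0 | GVar j => T j n m
  | GMul g h => gmx T h n (n + (gdeg h).*2%:Z) *m gmx T g (n + (gdeg h).*2%:Z) m
  | GAdd g h => gmx T g n m + gmx T h n m
  end.

Lemma map_gmx (R S : pzRingType) (pi : {rmorphism R -> S}) b T g n m :
  map_mx pi (@gmx R b T g n m) = @gmx S b (fun j n m => map_mx pi (T j n m)) g n m.
Proof.
elim: g n m => [||j|g IHg h IHh|g IHg h IHh] n m //=.
- exact: map_pid_mx.
- exact: map_mx0.
- by rewrite map_mxM IHg IHh.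
- by rewrite map_mxD IHg IHh.
Qed.

Lemma gev_gmx (k : fieldType) (K : kd k) c g e n m : gwf c g -> m = n + (gdeg g).*2%:Z ->
  gev (kXl K) g e m = e n *m gmx (kT K) g n m.
Proof.
elim: g e n m => [||j|g IHg h IHh|g IHg h IHh] e n m /=.
- by move=> _ ->; rewrite addr0 pid_mx_1 mulmx1.
- by rewrite mulmx0.
- by move=> _ E; rewrite kXlE; have -> : m - 2 = n by lia.
- move=> [wg wh] E; rewrite mulmxA -(IHh e n) // -IHg //; lia.
- by move=> [wg wh dE] E; rewrite mulmxDr -IHg // -IHh // -dE.
Qed.

Lemma gmx_tr (k : fieldType) (K : kd k) c g n m : gwf c g -> m = n + (gdeg g).*2%:Z ->
  gmx (kT (ktr K)) (grev g) n m = (gmx (kT K) g (- m) (- n))^T.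
Proof.
elim: g n m => [||j|g IHg h IHh|g IHg h IHh] n m //=.
- by move=> _ ->; rewrite addr0 !pid_mx_1 trmx1.
- by rewrite trmx0.
- move=> [wg wh] E; rewrite gdeg_rev IHg // IHh //; last by lia.
  by rewrite -trmx_mul; have -> : - m + (gdeg h).*2%:Z = - (n + (gdeg g).*2%:Z) by lia.
- by move=> [wg wh dE] E; rewrite IHg // IHh // -?dE // trmxD.
Qed.

Lemma neg1_neq0 (k : fieldType) : (-1 : k) != 0.
Proof. by rewrite oppr_eq0 oner_neq0. Qed.

Section BlockExtension.
Variables (k : fieldType) (c : nat) (K1 K2 : kd k) (u v : int -> int) (s1 s2 : int) (a1 a2 : k).
Hypotheses (uE : forall n, u n = n + s2) (vE : forall n, v n = n + s1) (a1_0 : a1 != 0) (a2_0 : a2 != 0).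
Local Notation b n := (kb K2 (u n) + kb K1 (v n))%N.
Variables (D : forall n m, 'M[k]_(b n, b m)) (T : nat -> forall n m, 'M[k]_(b n, b m)).
Variable g : forall n m, 'M[k]_(kb K2 n, kb K1 m).
Hypotheses (DE : forall n m, m = n + 1 ->
    D n m = block_mx (a2 *: kD K2 (u n) (u m)) (g (u n) (v m)) 0 (a1 *: kD K1 (v n) (v m)))
  (TE : forall j n m, (j < c)%N -> m = n + 2 -> exists w,
    T j n m = block_mx (kT K2 j (u n) (u m)) w 0 (kT K1 j (v n) (v m))).

Let uE' n n2 : n2 = n + s2 -> n2 = u n. Proof. by rewrite uE. Qed.
Let vE' n n1 : n1 = n + s1 -> n1 = v n. Proof. by rewrite vE. Qed.

Definition block_kext_map : kext c s1 s2 K1 (@Kd k (fun n => b n) D T) K2.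
Proof.
refine (@Kext k c s1 s2 K1 (@Kd k (fun n => b n) D T) K2
  (fun n n1 => row_mx 0 (pid_mx (kb K1 n1))) (fun n n1 => col_mx 0 (pid_mx (kb K1 (v n))))
  (fun n n2 => col_mx (pid_mx (kb K2 (u n))) 0) (fun n n2 => row_mx (pid_mx (kb K2 n2)) 0)
  a1 a2 a1_0 a2_0 _ _ _ _ _ _ _) => /=.
- by move=> n n1 /(@vE' _ _) ->; rewrite mul_row_col !pid_mx_1 ?mulmx0 ?mulmx1 ?add0r.
- by move=> n n2 /(@uE' _ _) ->; rewrite mul_row_col !pid_mx_1 ?mulmx0 ?mulmx1 ?addr0.
- move=> n n1 n2 /(@vE' _ _) -> /(@uE' _ _) ->; rewrite !mul_col_row !pid_mx_1 ?mulmx0 ?mul0mx ?mulmx1.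
  by rewrite add_block_mx ?addr0 ?add0r -scalar_mx_block.
- move=> n n1 m m1 /(@vE' _ _) -> em em1; rewrite -em in em1; rewrite (vE' em1) DE //.
  by rewrite mul_row_block !pid_mx_1 ?mul0mx ?mul1mx ?mulmx0 ?add0r mul_mx_row ?mulmx0 ?mulmx1 scale_row_mx ?scaler0.
- move=> n n2 m m2 /(@uE' _ _) -> em em2; rewrite -em in em2; rewrite (uE' em2) DE //.
  by rewrite mul_block_col !pid_mx_1 ?mulmx0 ?mul0mx ?mulmx1 ?addr0 mul_col_mx ?mul0mx ?mul1mx scale_col_mx ?scaler0.
- move=> j n n1 m m1 jc /(@vE' _ _) -> em em1; rewrite -em in em1; rewrite (vE' em1).
  have [w ->] := TE jc em.
  by rewrite mul_row_block !pid_mx_1 ?mul0mx ?mul1mx ?mulmx0 ?add0r mul_mx_row ?mulmx0 ?mulmx1.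
- move=> j n n2 m m2 jc /(@uE' _ _) -> em em2; rewrite -em in em2; rewrite (uE' em2).
  have [w ->] := TE jc em.
  by rewrite mul_block_col !pid_mx_1 ?mulmx0 ?mul0mx ?mulmx1 ?addr0 mul_col_mx ?mul0mx ?mul1mx.
Defined.

Lemma block_kconn n n2 m m1 : n2 = n + s2 -> m = n + 1 -> m1 = n + 1 + s1 ->
  kconn block_kext_map n2 n m m1 = g n2 m1.
Proof.
move=> e2 em em1; rewrite -em in em1.
have -> : n2 = u n by rewrite uE. have -> : m1 = v m by rewrite vE.
transitivity ((row_mx (pid_mx (kb K2 (u n))) 0 : 'M_(kb K2 (u n), b n)) *m D n m *m
  (col_mx 0 (pid_mx (kb K1 (v m))) : 'M_(b m, kb K1 (v m)))); first by [].
rewrite DE // mul_row_block !pid_mx_1 ?mul0mx ?mul1mx mul_row_col ?mulmx0 ?mulmx1.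
by rewrite ?addr0 ?add0r.
Qed.

End BlockExtension.

(** * Reduction of a complex to the residue field *)

Section ComplexReduction.
Variables (A : comNzRingType) (k : fieldType) (pi : {rmorphism A -> k}) (f : nat -> A) (mm : nat).
Hypotheses (reg : regular f mm) (fm : forall j, (j < mm)%N -> pi (f j) = 0).
Local Notation Id := (Id f).
Local Notation eis := (eis f).
Local Notation Gc := (Gc f).
Local Notation idI := (Id_ideal f _).
Implicit Types c : cpx A.

Definition eisg i c j n m : 'M[A]_(mr (c n), mr (c m)) := conform_mx 0 (eis i c n j).

Lemma eisg_eis i c j n : eisg i c j n (n + 1 + 1) = eis i c n j.
Proof. exact: conform_mx_id. Qed.

Lemma eisgP i c n m p : complex (Id i) c -> m = n + 1 -> p = n + 2 ->
  diff c n m *m diff c m p = \sum_(j < i) f j *: eisg i c j n p.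
Proof.
move=> cc -> ->; have -> : n + 2 = n + 1 + 1 by lia.
by rewrite (eisP n cc); apply: eq_bigr => j _; rewrite eisg_eis.
Qed.

Lemma Id_pi i p q (M : 'M_(p, q)) : (i <= mm)%N -> inI (Id i) M -> map_mx pi M = 0.
Proof.
move=> im /Id_mx[C ->]; apply/matrixP => a b; rewrite mxE summxE rmorph_sum mxE big1 // => j _.
by rewrite mxE rmorphM fm ?mul0r //; apply: leq_trans im.
Qed.

Lemma Id_pi_eq i p q (M N : 'M_(p, q)) : (i <= mm)%N -> inI (Id i) (M - N) ->
  map_mx pi M = map_mx pi N.
Proof. by move=> im /(Id_pi im)/eqP; rewrite map_mxB subr_eq0 => /eqP. Qed.

Lemma syzygy_eq i p q (C C' : nat -> 'M[A]_(p, q)) j : (i <= mm)%N -> (j < i)%N ->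
  \sum_(j < i) f j *: C j = \sum_(j < i) f j *: C' j -> inI (Id i) (C j - C' j).
Proof.
move=> im ji E; apply: (first_syzygies reg (C := fun j => C j - C' j) im) => //; apply/Id0.
under eq_bigr => l _ do rewrite scalerBr.
by rewrite sumrB E subrr.
Qed.

(** Two choices of coefficients differ by a relation of the [f j], whose coefficients lie in [Id i]
    and vanish over [k]. *)
Lemma eisg_uniq i c n m p j (C : nat -> 'M_(mr (c n), mr (c p))) : complex (Id i) c -> (i <= mm)%N ->
  (j < i)%N -> m = n + 1 -> p = n + 2 -> diff c n m *m diff c m p = \sum_(j < i) f j *: C j ->
  map_mx pi (eisg i c j n p) = map_mx pi (C j).
Proof.
move=> cc im ji em ep E; apply: (Id_pi_eq im).
by apply: (syzygy_eq (C := fun j => eisg i c j n p)) => //; rewrite -(eisgP cc em ep).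
Qed.

Lemma eisg_comm i c j n m p q : complex (Id i) c -> (i <= mm)%N -> (j < i)%N ->
  m = n + 1 -> p = n + 2 -> q = n + 3 ->
  inI (Id i) (eisg i c j n p *m diff c p q - diff c n m *m eisg i c j m q).
Proof.
move=> cc im ji em ep eq.
apply: (syzygy_eq (C := fun j => eisg i c j n p *m diff c p q)
  (C' := fun j => diff c n m *m eisg i c j m q)) => //.
have -> : \sum_(j < i) f j *: (eisg i c j n p *m diff c p q) = diff c n m *m diff c m p *m diff c p q.
  by rewrite (eisgP cc em ep) mulmx_suml; apply: eq_bigr => l _; rewrite scalemxAl.
rewrite -mulmxA (eisgP (p := q) cc); [|lia..].
by rewrite mulmx_sumr; apply: eq_bigr => l _; rewrite scalemxAr.
Qed.

Definition ckd i c : kd k := @Kd k (fun n => mr (c n)) (fun n m => map_mx pi (diff c n m))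
  (fun j n m => map_mx pi (eisg i c j n m)).

Lemma ckdP i c : (i <= mm)%N -> complex (Id i) c -> kdP i (ckd i c).
Proof.
move=> im cc; split=> /=.
- move=> n m p em ep; rewrite -map_mxM; apply: (Id_pi im); rewrite (eisgP cc em ep).
  by apply/Id_mx; exists (fun j => eisg i c j n p).
- move=> j n m p q ji em ep eq; rewrite -!map_mxM; apply: (Id_pi_eq im).
  exact: eisg_comm.
(* The commutator of [eisg a] with the square of the differential has two expansions: through all
   operators, and through the coefficients [u], [u'] of its failure to be a chain map. Comparing the
   coefficients of [f j] gives the homotopy. *)
- move=> a j n m p q r ai ji em ep eq er.
  have /Id_mx[u uE] := eisg_comm cc im ai em ep eq.
  have /Id_mx[u' u'E] : inI (Id i) (eisg i c a m q *m diff c q r - diff c m p *m eisg i c a p r).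
    by apply: (@eisg_comm i c a m p q r) => //; rewrite ?er ?eq ?ep ?em -?addrA.
  exists (map_mx pi (u j)), (map_mx pi (u' j)); rewrite -!map_mxM -map_mxB -map_mxD.
  apply: (Id_pi_eq im).
  apply: (syzygy_eq (C := fun j => eisg i c a n p *m eisg i c j p r - eisg i c j n p *m eisg i c a p r)
    (C' := fun j => u j *m diff c q r + diff c n m *m u' j)) => //.
  transitivity (eisg i c a n p *m (diff c p q *m diff c q r) - diff c n m *m diff c m p *m eisg i c a p r).
    rewrite (eisgP cc em ep) (eisgP (p := r) cc); [|lia..].
    rewrite mulmx_sumr mulmx_suml -sumrB; apply: eq_bigr => l _.
    by rewrite scalerBr scalemxAr scalemxAl.
  transitivity ((\sum_(l < i) f l *: u l) *m diff c q r + diff c n m *m (\sum_(l < i) f l *: u' l)).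
    by rewrite -uE -u'E mulmxBl mulmxBr !mulmxA; mxabel.
  rewrite mulmx_sumr mulmx_suml -big_split; apply: eq_bigr => l _.
  by rewrite scalerDr scalemxAl scalemxAr.
Qed.

Lemma sum_block_mx i p1 p2 q1 q2 (C1 : nat -> 'M[A]_(p1, q1)) (C2 : nat -> 'M_(p1, q2))
    (C4 : nat -> 'M_(p2, q2)) :
  \sum_(j < i) f j *: block_mx (C1 j) (C2 j) 0 (C4 j) =
  block_mx (\sum_(j < i) f j *: C1 j) (\sum_(j < i) f j *: C2 j) 0 (\sum_(j < i) f j *: C4 j).
Proof.
elim: i => [|i IHi]; first by rewrite !big_ord0 block_mx_const.
by rewrite !big_ord_recr /= IHi scale_block_mx add_block_mx scaler0 addr0.
Qed.

(* The maps T^(n+1) -> G^n -> T^n, and the k-linear operators they respect. *)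
Definition Gkext i c (im : (i < mm)%N) (cc : complex (Id i.+1) c) :
  { x : kext i 1 0 (ckd i.+1 c) (ckd i (Gc i c)) (ckd i.+1 c) |
    forall n n2 m m1, n2 = n + 0 -> m = n + 1 -> m1 = n + 1 + 1 ->
      kconn x n2 n m m1 = -1 *: kT (ckd i.+1 c) i n2 m1 }.
Proof.
have DE n m : m = n + 1 -> map_mx pi (diff (Gc i c) n m) =
    block_mx (1 *: kD (ckd i.+1 c) n m) (- 1 *: kT (ckd i.+1 c) i n (m + 1)) 0
      (-1 *: kD (ckd i.+1 c) (n + 1) (m + 1)).
  move=> ->; rewrite diff_Gc (map_block_mx pi) /= eisg_eis !scaleN1r scale1r !map_mxN.
  by rewrite map_scalar_mx /= fm // raddf0.
have TE j n m : (j < i)%N -> m = n + 2 -> exists w, map_mx pi (eisg i (Gc i c) j n m) =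
    block_mx (kT (ckd i.+1 c) j n m) w 0 (kT (ckd i.+1 c) j (n + 1) (m + 1)).
  move=> ji em; have gc := Gc_complex reg im cc.
  have /Id_mx[w wE] := eis_top_comm (n := n) reg im cc.
  have {}em : m = n + 1 + 1 by lia.
  subst m; exists (map_mx pi (- w j)).
  rewrite (eisg_uniq (c := Gc i c) (n := n) (m := n + 1) (p := n + 1 + 1) (C := fun j =>
    block_mx (eisg i.+1 c j n (n + 1 + 1)) (- w j) 0 (eisg i.+1 c j (n + 1) (n + 1 + 1 + 1)))) //.
  - by rewrite (map_block_mx pi) map_mx0.
  - exact: ltnW.
  - by rewrite -addrA.
  rewrite Gc_sq wE !(eisP _ cc) !big_ord_recr /= !addrK.
  apply: etrans (esym (sum_block_mx i (fun j => eisg i.+1 c j n (n + 1 + 1)) (fun j => - w j)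
    (fun j => eisg i.+1 c j (n + 1) (n + 1 + 1 + 1)))); congr block_mx.
  - by apply: eq_bigr => l _; rewrite eisg_eis.
  - by rewrite -sumrN; apply: eq_bigr => l _; rewrite scalerN.
  - by apply: eq_bigr => l _; rewrite eisg_eis.
exists (block_kext_map (k := k) (c := i) (K1 := ckd i.+1 c) (K2 := ckd i.+1 c) (u := id)
  (v := fun n => n + 1) (s1 := 1) (s2 := 0) (fun n => esym (addr0 n)) (fun n => erefl)
  (a1 := -1) (a2 := 1) (neg1_neq0 k) (oner_neq0 _) (g := fun n m => -1 *: kT (ckd i.+1 c) i n m) DE TE).
by move=> n n2 m m1 e2 em em1; apply: etrans (block_kconn _ _ _ _ _ _ e2 em em1) _.
Defined.

End ComplexReduction.

Section ConnectingInjective.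
Variables (k : fieldType) (c : nat) (s1 s2 : int) (K1 K K2 : kd k) (x : kext c s1 s2 K1 K K2).

(** Exactness of the long exact sequence at H(K2). *)
Lemma kconn_inj n n2 m m1 : n2 = n + s2 -> m = n + 1 -> m1 = n + 1 + s1 ->
  (forall y : 'rV_(kb K n), kcycle y -> kbound y) ->
  forall z : 'rV_(kb K2 n2), kcycle z -> kbound (z *m kconn x n2 n m m1) -> kbound z.
Proof.
move=> e2 em em1 VK z Zz /(kboundE _ (m := n + s1))[|y yE]; first by rewrite em1; lia.
pose t := z *m ks x n n2 - (k1 x)^-1 *: (y *m ki x n (n + s1)).
have tp : t *m kp x n n2 = z.
  by rewrite /t mulmxBl -scalemxAl -!mulmxA (ksp x) // (kip x) // mulmx0 scaler0 subr0 mulmx1.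
have em2 : m + s2 = n + 1 + s2 by rewrite em.
have em1' : m1 = m + s1 by rewrite em.
have tD : t *m kD K n m = 0.
  rewrite -[t *m _]mulmx1 -(kri x (n := m) em1' erefl) mulmxDr !mulmxA.
  rewrite -[t *m kD K n m *m kp _ _ _]mulmxA (kDp x e2 em em2) -scalemxAr mulmxA tp.
  move/(kcycleE _ (m := m + s2)): Zz => ->; last by rewrite e2 em; lia.
  rewrite scaler0 mul0mx addr0 /t mulmxBl -scalemxAl -[y *m _ *m _]mulmxA (kiD x erefl em em1).
  rewrite -scalemxAr scalerA mulVf ?k1_neq0 // scale1r mulmxBl mulmxA -[_ *m ki x m m1 *m kr x m m1]mulmxA.
  by rewrite (kir x em1') mulmx1 -yE /kconn !mulmxA subrr mul0mx.
have /VK/(kp_bound x e2) : kcycle t by apply/(kcycleE _ em).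
by rewrite tp.
Qed.

End ConnectingInjective.

(** * The mapping cone of a word *)

Section Cone.
Variables (A : comNzRingType) (k : fieldType) (pi : {rmorphism A -> k}) (f : nat -> A) (mm : nat).
Hypotheses (reg : regular f mm) (fm : forall j, (j < mm)%N -> pi (f j) = 0).
Local Notation Id := (Id f).
Local Notation eisg := (eisg f).
Local Notation ckd := (ckd pi f).
Local Notation idI := (Id_ideal f _).
Variables (i : nat) (im : (i <= mm)%N) (c : cpx A) (cc : complex (Id i) c).

Definition gA g n m : 'M[A]_(mr (c n), mr (c m)) := @gmx A (fun n => mr (c n)) (eisg i c) g n m.

(** Each operator is a chain map modulo [Id i], already before reduction to [k]; this is why the
    cone of a word is again a complex over the same ring. *)
Lemma gA_comm g n m p q : gwf i g -> m = n + 1 -> p = n + (gdeg g).*2%:Z -> q = p + 1 ->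
  inI (Id i) (gA g n p *m diff c p q - diff c n m *m gA g m q).
Proof.
elim: g n m p q => [||j|g IHg h IHh|g IHg h IHh] n m p q.
- move=> _ -> -> ->; rewrite addr0 /gA /= !pid_mx_1 mul1mx mulmx1 subrr; exact: (inI0 idI).
- by move=> _ _ _ _; rewrite /gA /= mul0mx mulmx0 subrr; exact: (inI0 idI).
- by move=> ji em ep eq; apply: (eisg_comm reg) => //; rewrite eq ep -addrA.
- move=> [wg wh] em ep eq; rewrite /gA /=.
  set n' := n + _; set m' := m + _.
  have em' : m' = n' + 1 by rewrite /m' em addrAC.
  have ep' : p = n' + (gdeg g).*2%:Z by rewrite ep /n' /=; lia.
  have := inIMr idI (gA h n n') (IHg n' m' p q wg em' ep' eq).
  have := inIMl idI (gA g m' q) (IHh n m n' m' wh em erefl em').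
  rewrite mulmxBl mulmxBr !mulmxA => J1 J2; have := inID idI J2 J1; move/inI_eq; apply.
  by rewrite /gA; mxabel.
- move=> [wg wh dE] em ep eq; rewrite /gA /=.
  have := inID idI (IHg n m p q wg em ep eq) (IHh n m p q wh em _ eq).
  rewrite -dE => /(_ ep); move/inI_eq; apply; rewrite /gA mulmxDl mulmxDr.
  by mxabel.
Qed.

Variables (g : gop) (wg : gwf i g).
Local Notation e2 := ((gdeg g).*2%:Z).

Definition cone : cpx A := fun n =>
  Mx (block_mx (diff c (n + 1) (n + 1 + 1)) (gA g (n + 1) (n + 1 + e2))
               0 (- diff c (n + e2) (n + 1 + e2))).

Lemma diff_cone n : diff cone n (n + 1) =
  block_mx (diff c (n + 1) (n + 1 + 1)) (gA g (n + 1) (n + 1 + e2))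
    0 (- diff c (n + e2) (n + 1 + e2)).
Proof. by rewrite /diff /= conform_mx_id. Qed.

Lemma cone_sq n : exists2 W, inI (Id i) W & diff cone n (n + 1) *m diff cone (n + 1) (n + 1 + 1) =
  block_mx (diff c (n + 1) (n + 1 + 1) *m diff c (n + 1 + 1) (n + 1 + 1 + 1)) W
    0 (diff c (n + e2) (n + 1 + e2) *m diff c (n + 1 + e2) (n + 1 + 1 + e2)).
Proof.
have J := @gA_comm g (n + 1) (n + 1 + 1) (n + 1 + e2) (n + 1 + 1 + e2) wg erefl erefl _.
have {J}/(inIBC idI) J : inI (Id i) _ := J (addrAC _ _ _).
refine (ex_intro2 _ _ _ J _).
rewrite !diff_cone mulmx_block !mul0mx !mulmx0 !addr0 !add0r mulmxN mulNmx mulmxN opprK.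
by [].
Qed.

Lemma cone_complex : complex (Id i) cone.
Proof.
move=> n; have [W IW ->] := cone_sq n; rewrite inI_block; do !split => //.
- exact: (inI0 idI).
- have := @cc (n + e2); have -> : n + e2 + 1 = n + 1 + e2 by rewrite addrAC.
  by have -> : n + 1 + e2 + 1 = n + 1 + 1 + e2 by rewrite addrAC.
Qed.

Lemma exr_at (I : A -> Prop) l m n : exr I c l -> m = l + 1 -> n = l + 2 -> exr3 I c l m n.
Proof. by move=> ex -> ->; have -> : l + 2 = l + 1 + 1 by rewrite -addrA. Qed.

Lemma cone_exr : (forall m, exr (Id i) c m) -> forall m, exr (Id i) cone m.
Proof.
move=> ex m y; rewrite diff_cone -[y]hsubmxK mul_row_block inI_row_mx mulmx0 addr0 mulmxN.
set a := lsubmx y; set b := rsubmx y => -[Ia Ib].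
have [x Ix] := ex (m + 1) a Ia.
have [|||w Iw] := exr_at (m := m + 1 + e2) (n := m + 1 + 1 + e2) (ex (m + e2)) _ _
    (y := b - x *m gA g (m + 1) (m + 1 + e2)); [lia|lia| |].
  have J := @gA_comm g (m + 1) (m + 1 + 1) (m + 1 + e2) (m + 1 + 1 + e2) wg erefl erefl (addrAC _ _ _).
  have J1 := inIMr idI x J; have J2 := inIMl idI (gA g (m + 1 + 1) (m + 1 + 1 + e2)) Ix.
  have := inID idI (inIN idI Ib) (inID idI J2 (inIN idI J1)); move/inI_eq; apply.
  by rewrite !mulmxBl !mulmxBr !mulmxA; mxabel.
exists (row_mx x (- w)); rewrite diff_cone mul_row_block opp_row_mx add_row_mx inI_row_mx.
rewrite mulmx0 addr0 mulNmx mulmxN opprK; split=> //.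
by move/inI_eq: Iw; apply; mxabel.
Qed.

Definition cone_kext : { x : kext i e2 1 (ckd i c) (ckd i cone) (ckd i c) |
    forall n n2 m m1, n2 = n + 1 -> m = n + 1 -> m1 = n + 1 + e2 ->
      kconn x n2 n m m1 = gmx (kT (ckd i c)) g n2 m1 }.
Proof.
have DE n m : m = n + 1 -> map_mx pi (diff cone n m) =
    block_mx (1 *: kD (ckd i c) (n + 1) (m + 1)) (gmx (kT (ckd i c)) g (n + 1) (m + e2)) 0
      (-1 *: kD (ckd i c) (n + e2) (m + e2)).
  move=> ->; rewrite diff_cone (map_block_mx pi) /= scaleN1r scale1r map_mxN map_mx0.
  by rewrite /gA map_gmx.
have TE j n m : (j < i)%N -> m = n + 2 -> exists w, map_mx pi (eisg i cone j n m) =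
    block_mx (kT (ckd i c) j (n + 1) (m + 1)) w 0 (kT (ckd i c) j (n + e2) (m + e2)).
  move=> ji em; have [W /Id_mx[w wE] sq] := cone_sq n.
  have {}em : m = n + 1 + 1 by lia.
  subst m; exists (map_mx pi (w j)).
  rewrite (eisg_uniq reg fm (c := cone) (n := n) (m := n + 1) (p := n + 1 + 1) (C := fun j =>
    block_mx (eisg i c j (n + 1) (n + 1 + 1 + 1)) (w j) 0 (eisg i c j (n + e2) (n + 1 + 1 + e2)))) //.
  - by rewrite (map_block_mx pi) map_mx0.
  - exact: cone_complex.
  - by rewrite -addrA.
  rewrite sq wE.
  apply: etrans (esym (sum_block_mx f i (fun j => eisg i c j (n + 1) (n + 1 + 1 + 1)) w
    (fun j => eisg i c j (n + e2) (n + 1 + 1 + e2)))); congr block_mx.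
  - by apply: eisgP => //; rewrite -addrA.
  - by apply: eisgP => //; lia.
exists (block_kext_map (k := k) (c := i) (K1 := ckd i c) (K2 := ckd i c) (u := fun n => n + 1)
  (v := fun n => n + e2) (s1 := e2) (s2 := 1) (fun n => erefl) (fun n => erefl)
  (a1 := -1) (a2 := 1) (neg1_neq0 k) (oner_neq0 _) (g := gmx (kT (ckd i c)) g) DE TE).
by move=> n n2 m m1 H1 H2 H3; apply: etrans (block_kconn _ _ _ _ _ _ H1 H2 H3) _.
Defined.

End Cone.

(** * Propagation of vanishing by Nakayama's lemma *)

Section Nakayama.
Variables (A : comNzRingType) (k : fieldType) (pi : {rmorphism A -> k}) (f : nat -> A) (mm : nat).
Hypotheses (fm : forall j, (j < mm)%N -> pi (f j) = 0) (piS : surjective pi)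
  (unitP : forall x, pi x != 0 -> exists y, x * y = 1).
Local Notation Id := (Id f).
Local Notation ckd := (ckd pi f).
Local Notation idI := (Id_ideal f _).

(** The identity is split into a part [Y] in the kernel of [D] and a part [U Q] through a
    complement, on which [D] has the right inverse [C]. *)
Lemma complement_mx n p (D : 'M[k]_(n, p)) :
  exists (Y : 'M_n) r (U : 'M_(n, r)) (Q : 'M_(r, n)) (C : 'M_(p, r)),
    [/\ Y *m D = 0, Y + U *m Q = 1%:M & Q *m D *m C = 1%:M].
Proof.
pose W := (kermx D)^C%MS; pose Q := row_base W.
have /sub_addsmxP[[Y U] /= YU] : (1%:M <= kermx D + W)%MS.
  by apply: submx_full; apply: addsmx_compl_full.
have /submxP[U' UE] : (U *m W <= Q)%MS by rewrite eq_row_base submxMl.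
have frQ : row_free (Q *m D).
  rewrite -kermx_eq0 -submx0; apply/rV_subP => y /sub_kermxP; rewrite mulmxA => yQ.
  have : (y *m Q <= kermx D :&: W)%MS.
    rewrite sub_capmx; apply/andP; split; first exact/sub_kermxP.
    by apply: submx_trans (submxMl _ _) _; rewrite eq_row_base.
  by rewrite capmx_compl !submx0 mulmx_free_eq0 // row_base_free.
exists (Y *m kermx D), _, U', Q, (pinvmx (Q *m D)); split.
- by rewrite -mulmxA mulmx_ker mulmx0.
- by rewrite -UE.
- exact: mulmxVp.
Qed.

(** The splitting of the reduced differential in degree [m + 2] lifts to [A]. A cycle over [k] lifts
    to [x] with boundary [z] in the maximal ideal; subtracting some [s], again in the maximal ideal,
    gives a true cycle, hence a boundary. *)
Lemma nakayama i c m : (i <= mm)%N -> complex (Id i) c -> kdP i (ckd i c) -> exr (Id i) c m ->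
  kv (ckd i c) (m + 1 + 1) = 0%N -> kv (ckd i c) (m + 1) = 0%N.
Proof.
move=> im cc KP ex v0; set n := m + 1.
have [H1 _] := kvP (n + 1) KP; rewrite v0 in H1; have {H1}V0 := frank0P H1.
have [H _] := kvP n KP; apply: (frank_uniq (kbound_submod _ _) H).
apply: frank0; first exact: kbound_submod.
move=> x0 Zx0.
have [Y [r [U [Q [C [YD YUQ QDC]]]]]] := complement_mx (map_mx pi (diff c (n + 1) (n + 1 + 1))).
have /choice[X XE] (a : 'I_(mr (c (n + 1)))) : exists X, row a Y = X *m map_mx pi (diff c n (n + 1)).
  have [|w wE] := V0 (row a Y).
    by rewrite /kcycle /= -row_mul YD row0.
  have /(kboundE _ (m := n))[|w' ->] : kbound (row a Y : 'rV_(kb (ckd i c) (n + 1))) by exists w.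
    by rewrite addrK.
  by exists w'.
have {}XE : Y = (\matrix_a X a) *m map_mx pi (diff c n (n + 1)).
  by apply/row_matrixP => a; rewrite XE row_mul rowK.
pose L p q := @map_mx k A (lft piS) p q.
pose X' := L _ _ (\matrix_a X a); pose U' := L _ _ U; pose Q' := L _ _ Q; pose C' := L _ _ C.
pose dn := diff c n (n + 1); pose dn1 := diff c (n + 1) (n + 1 + 1).
have [|F [FE _]] := inv_mx unitP (E := X' *m dn + U' *m Q').
  by rewrite map_mxD !map_mxM !lft_mx -XE.
have [|G [_ HG]] := inv_mx unitP (E := Q' *m dn1 *m C').
  by rewrite !map_mxM !lft_mx.
pose x := L _ _ x0; pose z := x *m dn.
have z0 : map_mx pi z = 0 by rewrite map_mxM lft_mx.
pose t := z *m F *m U'; pose s := z *m F *m X'.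
have zE : z = s *m dn + t *m Q'.
  by rewrite /s /t -!mulmxA -!mulmxDr FE mulmx1.
(* [t Q'] is the boundary of [x - s], so the next differential kills it modulo [Id i], while
   [Q' dn1] has a right inverse. *)
have It : inI (Id i) t.
  have -> : t = t *m Q' *m dn1 *m (C' *m G) by rewrite mulmxA -[t *m _ *m _]mulmxA -[t *m _ *m _]mulmxA -[t *m _ *m _]mulmxA HG mulmx1.
  apply: (inIMl idI); have := inIMr idI (x - s) (cc n); move/inI_eq; apply.
  have -> : t *m Q' = z - s *m dn by rewrite zE; mxabel.
  by rewrite /z mulmxA !mulmxBl.
have [|w Iw] := ex (x - s).
  have -> : (x - s) *m diff c (m + 1) (m + 1 + 1) = t *m Q'.
    by rewrite mulmxBl -/n -/dn -/z zE; mxabel.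
  exact: (inIMl idI).
apply/(kboundE _ (m := m)); first by rewrite /n addrK.
exists (map_mx pi w); rewrite /= -map_mxM -(Id_pi_eq fm im Iw) map_mxB lft_mx.
by rewrite /s -mulmxA map_mxM z0 mul0mx subr0.
Qed.

End Nakayama.

Lemma ev_injective_rev (k : fieldType) (E : lmodType k) (X : nat -> {linear E -> E}) c Z B
  (gm : gmod X c Z B) g : gwf c g -> ev_injective X Z B g -> ev_injective X Z B (grev g).
Proof.
move=> wg [N HN]; exists N => n x Nn Zx; rewrite gdeg_rev => Bx; apply: HN => //.
by have := submodB (gB gm _) Bx (gev_rev gm wg Zx); rewrite subKr.
Qed.

Lemma ev_injective_tail (k : fieldType) (K : kd k) c g : kdP c K -> gwf c g ->
  ev_injective (kXl K) (@kZ k K 0) (@kB k K 0) g ->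
  exists N : nat, forall n m : int, N%:Z <= n -> m = n + (gdeg g).*2%:Z ->
  forall z : 'rV_(kb K n), kcycle z -> kbound (z *m gmx (kT K) g n m) -> kbound z.
Proof.
move=> KP wg [N HN]; exists N => n m Nn em z Zz Bz.
have nE : n = 0 + `|n|%N%:Z by lia.
have HB : kB 0 `|n|%N (spread z).
  apply: HN; first by lia.
    by apply/(kZE _ nE); rewrite spreadE.
  apply/(kBE (n := m)); first by rewrite em; lia.
  by rewrite (gev_gmx _ wg em) spreadE.
by have := kB_bound HB nE; rewrite spreadE.
Qed.

Lemma kconn_tr (k : fieldType) c s1 s2 K1 K K2 (x : @kext k c s1 s2 K1 K K2) n2 n m m1 :
  kconn (kext_tr x) n2 n m m1 = (kconn x (- m1) (- m) (- n) (- n2))^T.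
Proof. by rewrite /kconn !trmx_mul mulmxA. Qed.

(** * Comparison of the two ends *)

Section SameLeading.
Variables (A : comNzRingType) (k : fieldType) (pi : {rmorphism A -> k}) (f : nat -> A) (mm : nat).
Hypotheses (reg : regular f mm) (fm : forall j, (j < mm)%N -> pi (f j) = 0)
  (piS : surjective pi) (unitP : forall x, pi x != 0 -> exists y, x * y = 1).
Local Notation Id := (Id f).
Local Notation ckd := (ckd pi f).
Variables (i : nat) (im : (i <= mm)%N).
Local Notation kvc c := (kv (ckd i c)).

Record good (c : cpx A) : Prop := Good {
  good_complex : complex (Id i) c;
  good_exr : forall m, exr (Id i) c m;
  good_rows : noeth_all i (ckd i c);
  good_cols : noeth_all i (ktr (ckd i c))
}.

Lemma good_kdP c : good c -> kdP i (ckd i c).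
Proof. by case=> cc _ _ _; apply: (ckdP reg fm). Qed.

Lemma good_cone c g : good c -> gwf i g -> good (cone f i c g).
Proof.
move=> gc wg; have KP := good_kdP gc; case: gc => cc ex nr nc.
have cc' := cone_complex reg im cc wg; have KP' := ckdP reg fm im cc'.
have [x _] := cone_kext reg fm im cc wg.
split=> //; first exact: (cone_exr reg im cc wg ex).
  exact: (noeth_cone x).
by apply: (noeth_cone (kext_tr x)); try apply: ktrP.
Qed.

(** Prime avoidance is applied to the primes of both ends at once; on the dual complex the word acts
    reversed. *)
Lemma good_regular c : good c -> exists2 g, ggood i g & exists N : nat,
  (forall n m : int, N%:Z <= n -> m = n + (gdeg g).*2%:Z -> forall z : 'rV_(kb (ckd i c) n),
    kcycle z -> kbound (z *m gmx (kT (ckd i c)) g n m) -> kbound z) /\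
  (forall n m : int, N%:Z <= n -> m = n + (gdeg g).*2%:Z -> forall z : 'rV_(kb (ktr (ckd i c)) n),
    kcycle z -> kbound (z *m gmx (kT (ktr (ckd i c))) (grev g) n m) -> kbound z).
Proof.
move=> gc; have KP := good_kdP gc; have KP' := ktrP KP.
have g1 := kgmod 0 KP; have g2 := kgmod 0 KP'.
have [L1 H1 inj1] := prime_list g1 (@good_rows _ gc 0) (sfBB g1).
have [L2 H2 inj2] := prime_list g2 (@good_cols _ gc 0) (sfBB g2).
have [||g gg] := prime_avoidance (@ggood_mul i) (@ggood_mix i) (L := L1 ++ L2).
- by exists GZero.
- by apply/all_prop_cat.
move=> /all_prop_cat[/(inj1 _ gg) e1 /(inj2 _ gg) e2].
exists g => //; have [wg _] := gg.
have [N1 HN1] := ev_injective_tail KP wg e1.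
have [N2 HN2] := ev_injective_tail KP' (gwf_rev wg) (ev_injective_rev g2 wg e2).
exists (N1 + N2)%N; split=> n m Nn em z Zz Bz; first by apply: (HN1 n m) => //; lia.
by apply: (HN2 n m) => //; rewrite ?gdeg_rev //; lia.
Qed.

Section ConeRank.
Variables (c : cpx A) (gc : good c) (g : gop) (wg : gwf i g).
Local Notation e2 := ((gdeg g).*2%:Z).
Local Notation C := (cone f i c g).

Lemma kv_cone_right m :
  (forall n m', n = m \/ n = m + 1 -> m' = n + e2 -> forall z : 'rV_(kb (ckd i c) n),
    kcycle z -> kbound (z *m gmx (kT (ckd i c)) g n m') -> kbound z) ->
  (kvc C m + kvc c m = kvc c (m + e2))%N.
Proof.
move=> inj; have KP := good_kdP gc; have KP' := good_kdP (good_cone gc wg).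
have [x xE] := cone_kext reg fm im (good_complex gc) wg.
apply: (kv_cone (x := x) (n := m - 1)) => //; try lia.
  by move=> z Zz; rewrite xE; [|lia..]; apply: inj => //; left.
by move=> z Zz; rewrite xE //; apply: inj => //; right.
Qed.

(** Injectivity of the reversed word on the dual means that [g] is surjective far to the left, where
    the cone measures its kernel, one degree lower. *)
Lemma kv_cone_left p :
  (forall n m', n = - p - 1 - e2 \/ n = - p - e2 -> m' = n + e2 ->
    forall z : 'rV_(kb (ktr (ckd i c)) n),
    kcycle z -> kbound (z *m gmx (kT (ktr (ckd i c))) (grev g) n m') -> kbound z) ->
  (kvc C p + kvc c (p + 1 + e2) = kvc c (p + 1))%N.
Proof.
move=> inj; have KP := ktrP (good_kdP gc); have KP' := ktrP (good_kdP (good_cone gc wg)).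
have [x xE] := cone_kext reg fm im (good_complex gc) wg.
have yE n2 n m m1 : n2 = n + - e2 -> m = n + 1 -> m1 = n + 1 + - 1 ->
    kconn (kext_tr x) n2 n m m1 = gmx (kT (ktr (ckd i c))) (grev g) n2 m1.
  by move=> h1 h2 h3; rewrite kconn_tr (gmx_tr _ wg) ?xE //; lia.
have := kv_cone (x := kext_tr x) (m := - p) (n := - p - 1) (m1 := - p - 1) (n2 := - p - 1 - e2)
  KP' KP KP.
rewrite !kv_tr => H.
have -> : p + 1 + e2 = - (- p - 1 - e2) by lia.
have -> : p + 1 = - (- p - 1) by lia.
rewrite -{1}[p]opprK; apply: H => //; try lia.
  by move=> z Zz; rewrite yE; [|lia..]; apply: inj => //; [left|lia].
by move=> z Zz; rewrite yE; [|lia..]; apply: inj => //; [right|]; lia.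
Qed.

Lemma kv_cone_zero : (forall n, kvc C n = 0%N) -> forall n, kvc c (n + e2) = kvc c n.
Proof.
move=> v0 n; have KP := good_kdP gc; have KP' := good_kdP (good_cone gc wg).
have [x xE] := cone_kext reg fm im (good_complex gc) wg.
rewrite -(kv_cone_right (m := n)) ?v0 // => l m' _ em z Zz.
have <- : kconn x l (l - 1) l m' = gmx (kT (ckd i c)) g l m' by rewrite xE //; lia.
apply: (kconn_inj (x := x)) => //; try lia.
move=> y; have [H _] := kvP (l - 1) KP'; rewrite v0 in H; exact: (frank0P H).
Qed.

End ConeRank.

Lemma kv_vanish c N : complex (Id i) c -> (forall m, exr (Id i) c m) -> (forall n : int, N <= n -> kvc c n = 0%N) -> forall n, kvc c n = 0%N.
Proof.
move=> cc ex v0 n; have [Nn|nN] := leP N n; first exact: v0.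
have [d nE] : exists d : nat, n = N - d%:Z by exists `|N - n|%N; lia.
rewrite {}nE; elim: d {nN} => [|d IHd]; first by apply: v0; rewrite subr0.
have := nakayama fm piS unitP im cc (ckdP reg fm im cc) (ex (N - d.+1%:Z - 1)).
have -> : N - d.+1%:Z - 1 + 1 + 1 = N - d%:Z by lia.
by rewrite subrK; apply.
Qed.

(** A periodic polynomial is constant, so two constants [s] and [t] are to be compared. For odd [w]
    both ends sum the same pairs; for even [w] the values in even degrees grow by [t - s] per step,
    which periodicity forbids unless [s = t]. *)
Lemma periodic_leading (v : int -> nat) (e : nat) (w : int) (Sp Sm : {poly rat}) N : (0 < e)%N ->
  (forall n, v (n + e.*2%:Z) = v n) ->
  (forall j, (N <= j)%N -> (v j.*2%:Z + v j.*2.+1%:Z)%N%:R = Sp.[j%:R]) ->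
  (forall j, (N <= j)%N -> (v (w - j.*2%:Z)%R + v (w - j.*2%:Z - 1)%R)%N%:R = Sm.[j%:R]) ->
  Sp = Sm.
Proof.
move=> e0 per HSp HSm.
have perM q n : v (n + (q * e).*2%:Z) = v n.
  elim: q => [|q IHq]; first by rewrite mul0n addr0.
  by rewrite mulSn -IHq -[RHS]per; congr v; lia.
have perC (P : {poly rat}) (u : int -> nat) (s : int) : (s = 1 \/ s = -1) ->
    (forall n, u (n + e.*2%:Z) = u n) ->
    (forall j, (N <= j)%N -> (u (s * j.*2%:Z))%:R = P.[j%:R]) -> P = (P.[0])%:P.
  move=> hs up HP.
  have PP : P \Po ('X + e%:R%:P) = P.
    apply: (@poly_eq_nat _ _ N) => j Nj; rewrite horner_comp hornerD hornerX hornerC -natrD.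
    have uE : u (s * (j + e).*2%:Z) = u (s * j.*2%:Z).
      case: hs => ->; first by rewrite !mul1r -[RHS]up; congr u; lia.
      by rewrite !mulN1r -[LHS]up; congr u; lia.
    by rewrite -!HP ?uE //; lia.
  have : (size P <= 1)%N.
    case sP : (size P) => [|[|n]] //.
    have [|+ _] := size_shift_diff (c := e%:R) (P := P) (n := n) _ sP; first by rewrite pnatr_eq0 -lt0n.
    by rewrite /shift_diff PP subrr size_poly0.
  by move/size1_polyC => ->; rewrite hornerC.
pose u1 n := (v n + v (n + 1)%R)%N.
pose u2 n := (v (w + n)%R + v (w + n - 1)%R)%N.
have SpC : Sp = (Sp.[0])%:P.
  apply: (perC Sp u1 1); first by left.
    by move=> n; rewrite /u1 per addrAC per.
  by move=> j Nj; rewrite mul1r -HSp // /u1; congr ((_ + v _)%N%:R); lia.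
have SmC : Sm = (Sm.[0])%:P.
  apply: (perC Sm u2 (-1)); first by right.
    by move=> n; congr (_ + _)%N; rewrite -[RHS]per; congr v; lia.
  by move=> j Nj; rewrite mulN1r -HSm.
move: SpC SmC HSp HSm => -> ->; set s := Sp.[0]; set t := Sm.[0] => HSp HSm.
have even x : (v (x * 2)%R + v (x * 2 + 1)%R)%N%:R = s :> rat.
  have -> : (v (x * 2)%R + v (x * 2 + 1)%R)%N = u1 (x * 2 + ((N + `|x|)%N * e).*2%:Z).
    by rewrite /u1 addrAC !perM.
  pose j := `|(x + ((N + `|x|)%N * e)%N%:Z)%R|%N.
  have le1 : (N + `|x| <= (N + `|x|)%N * e)%N by rewrite leq_pmulr.
  have := HSp j; rewrite hornerC => <-; last by rewrite /j; lia.
  by rewrite /u1; congr ((v _ + v _)%N%:R); rewrite /j; lia.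
have left x : (v (w + x * 2)%R + v (w + x * 2 - 1)%R)%N%:R = t :> rat.
  pose q := (N + `|x|)%N; have le1 : (q <= q * e)%N by rewrite leq_pmulr.
  have E y : v y = v (y - (q * e).*2%:Z) by rewrite -[LHS](perM q) -[RHS](perM q) subrK perM.
  pose j := `|((q * e)%N%:Z - x)%R|%N.
  have := HSm j; rewrite hornerC => <-; last by rewrite /j; lia.
  by rewrite [in LHS]E [X in (_ + X)%N]E; congr ((v _ + v _)%N%:R); rewrite /j; lia.
congr (_%:P).
have [y [wE|wE]] : exists y : int, w = y * 2 \/ w = y * 2 + 1.
  by exists (w %/ 2)%Z; have := divz_eq w 2; have := modz_ge0 w (d := 2); have := ltz_pmod w (d := 2); lia.
  have stp x : (v (x * 2 + 2))%:R = (v (x * 2))%:R + (t - s) :> rat.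
    have := even x; have := left (x + 1 - y); rewrite wE.
    have -> : y * 2 + (x + 1 - y) * 2 = x * 2 + 2 by lia.
    have -> : x * 2 + 2 - 1 = x * 2 + 1 by lia.
    by rewrite !natrD; lra.
  have : (v (0 + e.*2%:Z))%:R = (v 0)%:R + e%:R * (t - s) :> rat.
    elim: (e) => [|d IHd]; first by rewrite mul0r !addr0.
    have := stp d%:Z; have -> : d%:Z * 2 + 2 = 0 + d.+1.*2%:Z by lia.
    have -> : d%:Z * 2 = 0 + d.*2%:Z by lia.
    by move=> ->; rewrite IHd -natr1; lra.
  rewrite per => /eqP; rewrite -subr_eq0 opprD addrA subrr sub0r oppr_eq0 mulf_eq0 pnatr_eq0.
  by rewrite -[e == 0%N]negbK -lt0n e0 /= subr_eq0 => /eqP ->.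
have := even y; have := left 0; rewrite mul0r addr0 wE addrK => <- <-.
by rewrite addnC.
Qed.

(** The cone replaces [Sp] by its difference of step [e] and [Sm] by minus its difference of step
    [- e], which scales both leading coefficients alike. The displacement by one degree on the left
    is absorbed in [w]. *)
Lemma same_leading c (w : int) (Sp Sm : {poly rat}) N : good c ->
  (forall j, (N <= j)%N -> (kvc c j.*2%:Z + kvc c j.*2.+1%:Z)%N%:R = Sp.[j%:R]) ->
  (forall j, (N <= j)%N -> (kvc c (w - j.*2%:Z) + kvc c (w - j.*2%:Z - 1))%N%:R = Sm.[j%:R]) ->
  size Sp = size Sm /\ lead_coef Sp = lead_coef Sm.
Proof.
have [s] := ubnP (size Sp); elim: s c w Sp Sm N => // s IHs c w Sp Sm N sS gc HSp HSm.
have [g [wg dg] [N' [injr injc]]] := good_regular gc.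
pose e := gdeg g; pose C := cone f i c g; have gC : good C := good_cone gc wg.
have right m : N'%:Z <= m -> (kvc C m + kvc c m = kvc c (m + e.*2%:Z))%N.
  by move=> Nm; apply: kv_cone_right => // n m' nE; apply: injr; case: nE => ->; lia.
have left p : p <= - N'%:Z - e.*2%:Z - 1 -> (kvc C p + kvc c (p + 1 + e.*2%:Z) = kvc c (p + 1))%N.
  by move=> Np; apply: kv_cone_left => // n m' nE; apply: injc; case: nE => ->; rewrite /e in Np *; lia.
have HSpC j : (N + N' <= j)%N -> (kvc C j.*2%:Z + kvc C j.*2.+1%:Z)%N%:R = (shift_diff e%:R Sp).[j%:R].
  move=> Nj; rewrite hornerD hornerN horner_comp hornerD hornerX hornerC -natrD.
  rewrite -!HSp; [|lia..].
  have := right j.*2%:Z _; have := right j.*2.+1%:Z _.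
  have -> : j.*2%:Z + e.*2%:Z = (j + e).*2%:Z by lia.
  have -> : j.*2.+1%:Z + e.*2%:Z = (j + e).*2.+1%:Z by lia.
  move=> /(_ ltac:(lia)) <- /(_ ltac:(lia)) <-; rewrite !natrD; ring.
have e0 : e%:R != 0 :> rat by rewrite pnatr_eq0 -lt0n.
(* A constant [Sp] makes the cone vanish far to the right, hence everywhere, and the ranks of [c]
   periodic. *)
have [Sp1|Sp2] := leqP (size Sp) 1.
  suff SS : Sp = Sm by rewrite SS.
  apply: (periodic_leading (v := kvc c) (e := e) (w := w) (N := N)) => //.
  apply: kv_cone_zero => //; apply: (kv_vanish (N := (N + N').*2.+2%:Z) (good_complex gC) (good_exr gC)) => m Nm.
  have [j [Nj mE]] : exists j, (N + N' <= j)%N /\ (m = j.*2%:Z \/ m = j.*2.+1%:Z).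
    exists (`|m|./2)%N; have := odd_double_half `|m|%N; split; first by lia.
    by case: (odd `|m|) H => /= H; [right|left]; lia.
  have := HSpC j Nj; rewrite (size1_polyC Sp1) /shift_diff comp_polyC subrr horner0 => /eqP.
  by rewrite pnatr_eq0 addn_eq0 => /andP[/eqP v0 /eqP v1]; case: mE => ->.
have [n sSp] : exists n, size Sp = n.+2 by exists (size Sp).-2; lia.
have [sSC lSC] := size_shift_diff e0 sSp.
  have HSmC j : (N + N' + e + `|w| <= j)%N ->
      (kvc C (w - 1 - j.*2%:Z) + kvc C (w - 1 - j.*2%:Z - 1))%N%:R = (- shift_diff (- e%:R) Sm).[j%:R].
    move=> Nj; rewrite hornerN hornerD hornerN horner_comp hornerD hornerX hornerC -natrB; last lia.
    rewrite -!HSm; [|lia..].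
    have := left (w - 1 - j.*2%:Z) _; have := left (w - 1 - j.*2%:Z - 1) _.
    have -> : w - 1 - j.*2%:Z + 1 + e.*2%:Z = w - (j - e).*2%:Z by lia.
    have -> : w - 1 - j.*2%:Z - 1 + 1 + e.*2%:Z = w - (j - e).*2%:Z - 1 by lia.
    have -> : w - 1 - j.*2%:Z - 1 + 1 = w - j.*2%:Z - 1 by lia.
    have -> : w - 1 - j.*2%:Z + 1 = w - j.*2%:Z by lia.
    move=> /(_ ltac:(lia)) <- /(_ ltac:(lia)) <-; rewrite !natrD; ring.
  have [||sE lE] := IHs C (w - 1) (shift_diff e%:R Sp) (- shift_diff (- e%:R) Sm) (N + N' + e + `|w|)%N _ gC _ HSmC.
  + by rewrite sSC; move: sS; rewrite sSp.
  + by move=> j Nj; apply: HSpC; lia.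
  move: sE lE; rewrite sSC lSC size_polyN lead_coefN sSp.
  (* The difference of a constant [Sm] would be zero, while that of [Sp] has positive size. *)
  case sSm : (size Sm) => [|[|n']].
  + by move/eqP: sSm; rewrite size_poly_eq0 => /eqP ->; rewrite /shift_diff comp_poly0 subrr size_poly0.
  + have /size1_polyC -> : (size Sm <= 1)%N by rewrite sSm.
    by rewrite /shift_diff comp_polyC subrr size_poly0.
  have [|-> ->] := size_shift_diff (c := - e%:R) _ sSm; first by rewrite oppr_eq0.
  case=> -> lE; split=> //.
  have n0 : e%:R *+ n'.+1 != 0 :> rat by rewrite mulrn_eq0.
  by apply: (mulfI n0); rewrite lE mulNrn mulNr opprK.
Qed.

End SameLeading.

(** * The tower of complexes down to [A] *)

Lemma noeth_zero (k : fieldType) (K : kd k) : kdP 0 K -> (forall n, kv K n = 0%N) -> noeth_all 0 K.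
Proof.
move=> KP v0 n0; apply: (noeth_finite (kgmod n0 KP) (v := fun l => kv K (n0 + l%:Z)) (N := 0)).
  by move=> l; exact: (frank_spread n0 l KP).
by move=> l x _; have := frank_spread n0 l KP; rewrite v0 => H; apply: (frank0P H).
Qed.

Section Tower.
Variables (A : comNzRingType) (k : fieldType) (pi : {rmorphism A -> k}) (f : nat -> A) (mm : nat).
Hypotheses (reg : regular f mm) (fm : forall j, (j < mm)%N -> pi (f j) = 0)
  (piS : surjective pi) (unitP : forall x, pi x != 0 -> exists y, x * y = 1).
Local Notation Id := (Id f).
Local Notation ckd := (ckd pi f).
Local Notation Gc := (Gc f).

Fixpoint tower i (c : cpx A) : cpx A := if i is j.+1 then tower j (Gc j c) else c.

Lemma tower_complex i c : (i <= mm)%N -> complex (Id i) c -> complex (Id 0) (tower i c).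
Proof. by elim: i c => // i IHi c im cc; apply: IHi; [apply: ltnW|apply: (Gc_complex reg)]. Qed.

Lemma tower_exr i c N : (i <= mm)%N -> complex (Id i) c ->
  (forall m : int, m <= N -> exr (Id i) c m) -> forall m, m <= N -> exr (Id 0) (tower i c) m.
Proof.
elim: i c => // i IHi c im cc ex; apply: IHi; first exact: ltnW.
  exact: (Gc_complex reg).
by move=> m mN; apply: (Gc_exr reg) => //; apply: ex.
Qed.

Lemma Gc_local i c c' n : c n = c' n -> c (n + 1) = c' (n + 1) ->
  c (n + 1 + 1) = c' (n + 1 + 1) -> Gc i c n = Gc i c' n.
Proof. by move=> e0 e1 e2; rewrite /Gc /eis /diff e0 e1 e2. Qed.

(** Each [Gc] reads two more degrees to the right, whence the loss of [i.*2]. *)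
Lemma tower_local i c c' (N : int) : (forall z, z <= N -> c z = c' z) ->
  forall z, z <= N - i.*2%:Z -> tower i c z = tower i c' z.
Proof.
elim: i c c' N => [|i IHi] c c' N E z zN; first by apply: E; lia.
apply: (IHi _ _ (N - 2)); last by lia.
by move=> y yN; apply: Gc_local; apply: E; lia.
Qed.

Lemma kv_local c c' n : (forall z, z <= n + 1 -> c z = c' z) ->
  kv (ckd 0 c) n = kv (ckd 0 c') n.
Proof. by move=> E; rewrite /kv /= /diff !E //; lia. Qed.

(** At the bottom no operator is left and the homology is zero; every step up adds one operator by
    [noeth_tower], on the complex and on its dual. *)
Lemma tower_noeth i c : (i <= mm)%N -> complex (Id i) c ->
  (forall n, kv (ckd 0 (tower i c)) n = 0%N) ->
  noeth_all i (ckd i c) /\ noeth_all i (ktr (ckd i c)).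
Proof.
elim: i c => [|i IHi] c im cc v0.
  have KP := ckdP reg fm im cc; split; first exact: noeth_zero.
  by apply: noeth_zero; [apply: ktrP|move=> n; rewrite kv_tr].
have cG := Gc_complex reg im cc; have [nr nc] := IHi _ (ltnW im) cG v0.
have KP := ckdP reg fm im cc; have KPG := ckdP reg fm (ltnW im) cG.
have [x xE] := Gkext reg fm im cc.
split; first by apply: (noeth_tower (x := x) _ (neg1_neq0 k) xE).
apply: (noeth_tower (x := kext_tr x) (a := -1) _ (neg1_neq0 k)) => //; try exact: ktrP.
move=> n n2 m m1 e2 em em1; rewrite kconn_tr xE; [|lia..].
by rewrite !scaleN1r; apply/matrixP => a b; rewrite !mxE.
Qed.

Lemma kv_tc c n : kv (ckd 0 (tc c)) n = kv (ckd 0 c) (- n).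
Proof.
rewrite /kv /= diff_tc // diff_tc ?subrK // -!map_trmx !mxrank_tr opprD opprB [1 - n]addrC.
by have -> : (mr (c (- n)) - \rank (map_mx pi (diff c (- n - 1) (- n))) -
  \rank (map_mx pi (diff c (- n) (- n + 1))) = mr (c (- n)) -
  \rank (map_mx pi (diff c (- n) (- n + 1))) - \rank (map_mx pi (diff c (- n - 1) (- n))))%N by lia.
Qed.

(** [kv_vanish] spreads vanishing from right to left, so it is applied to the dual, whose rows are
    exact by [van]. *)
Lemma kv_vanish_left del c N : ext_vanish (Id 0) del -> complex (Id 0) c ->
  (forall m, exr (Id 0) c m) -> (forall n : int, n <= N -> kv (ckd 0 c) n = 0%N) ->
  forall n, kv (ckd 0 c) n = 0%N.
Proof.
move=> van cc ex v0 n; rewrite -[n]opprK -kv_tc.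
apply: (kv_vanish reg fm piS unitP (leq0n mm) (complex_tc cc) (N := - N)) => [m|m Nm].
  by apply/exr_tc; apply: (van c cc) => l _; apply: ex.
by rewrite kv_tc v0 //; lia.
Qed.

Section Presentation.
Variable V : lmodType A.

Definition presented I (c : cpx A) := exists g : 'I_(mr (c (- 0%:Z))) -> V,
  presents (idfun : {rmorphism A -> A}) g (imD I (diff c (- 1%:Z) (- 0%:Z))).

(** In degree zero the second block is empty, and the block [f i] adds exactly the relations by
    which [Id i.+1] exceeds [Id i]. *)
Lemma Gc_presented i c : mr (c 1) = 0%N -> presented (Id i.+1) c -> presented (Id i) (Gc i c).
Proof.
move=> c1 [g [gS gE]].
pose g' (j : 'I_(mr (c (- 0%:Z)) + mr (c (- 0%:Z + 1)))) := match split j with inl l => g l | inr _ => 0 end.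
have evE (y : 'rV_(mr (c (- 0%:Z)) + mr (c (- 0%:Z + 1)))) :
    ev (idfun : {rmorphism A -> A}) g' y = ev (idfun : {rmorphism A -> A}) g (lsubmx y).
  rewrite /ev /row_map big_split_ord /= [X in _ + X]big1 ?addr0; last first.
    by move=> j _; rewrite /g' (unsplitK (inr j)) scaler0.
  by apply: eq_bigr => j _; rewrite /g' (unsplitK (inl j)) !mxE.
exists g'; split=> [x|y].
  have [y yE] := gS x; exists (row_mx y 0).
  by apply: etrans (evE _) _; rewrite row_mxKl.
apply: iff_trans (iff_trans (_ : _ <-> ev (idfun : {rmorphism A -> A}) g (lsubmx y) = 0) (gE _)) _.
  by rewrite -evE.
have DE : diff (Gc i c) (- 1%:Z) (- 0%:Z) = block_mx (diff c (- 1%:Z) (- 0%:Z)) (- eis f i.+1 c (- 1%:Z) i)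
    (f i)%:M (- diff c (- 0%:Z) (- 0%:Z + 1)) by exact: (diff_Gc f i c (- 1)).
have triv (M : 'rV[A]_(mr (c (- 0%:Z + 1)))) : inI (Id i) M.
  by move=> a b; suff: (b < 0)%N by []; rewrite -[X in (_ < X)%N]c1; apply: ltn_ord.
rewrite /imD DE; split=> [[z /IdS[w Iw]]|[z]].
  exists (row_mx z w); rewrite -[y]hsubmxK mul_row_block opp_row_mx add_row_mx.
  apply/inI_row_mx; split; last exact: triv.
  by move/inI_eq: Iw; apply; rewrite mul_mx_scalar opprD addrA.
rewrite -[z]hsubmxK -{1}[y]hsubmxK mul_row_block opp_row_mx add_row_mx => /inI_row_mx[Iz _].
exists (lsubmx z); apply/IdS; exists (rsubmx z).
by move/inI_eq: Iz; apply; rewrite mul_mx_scalar opprD addrA.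
Qed.

Lemma tower_presented i c : (forall z : int, 0 < z -> mr (c z) = 0%N) -> presented (Id i) c ->
  presented (Id 0) (tower i c).
Proof.
elim: i c => // i IHi c c0 pc; apply: IHi; last by apply: Gc_presented => //; apply: c0.
by move=> z z0; rewrite /= !c0 //; lia.
Qed.

Lemma Id0_eq0 (a : A) : (idfun : {rmorphism A -> A}) a = 0 <-> Id 0 a.
Proof. by split=> [/= ->|[C ->]]; [apply: ideal0 (Id_ideal f 0)|rewrite big_ord0]. Qed.

(** The dual of the reduced complex computes Ext into the residue field, which a resolution of
    length [d] kills beyond [d]. *)
Lemma kv_finite_resolution c (P : proj_resolution V) d : complex (Id 0) c ->
  (forall m, m <= - 2 -> exr (Id 0) c m) -> presented (Id 0) c ->
  (forall n, (d < n)%N -> forall x : pres_obj P n, x = 0) ->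
  forall n : int, n < - d%:Z -> kv (ckd 0 c) n = 0%N.
Proof.
move=> cc ex [g gV] P0 n nd.
have [n' nE] : exists n' : nat, n = - n'.+1%:Z by exists `|(n + 1)%R|%N; lia.
have idS : surjective (idfun : {rmorphism A -> A}) by move=> x; exists x.
pose W : lmodType A := restr pi k^o.
have hW : presents (idfun : {rmorphism A -> A}) (fun _ : 'I_1 => (1 : k) : W)
    (fun y : 'rV[A]_1 => pi (y 0 0) = 0).
  have E (y : 'rV[A]_1) : ev (idfun : {rmorphism A -> A}) (fun _ : 'I_1 => (1 : k) : W) y = pi (y 0 0).
    by rewrite /ev /row_map big_ord1 mxE; apply: mulr1.
  split=> [x|y]; last by rewrite E.
  by have [a aE] := piS x; exists a%:M; rewrite E mxE eqxx mulr1n.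
have KP := ckdP reg fm (leq0n mm) cc.
have -> : kv (ckd 0 c) n = kv (ktr (ckd 0 c)) n'.+1%:Z by rewrite kv_tr nE.
have [H _] := kvP n'.+1%:Z (ktrP KP); apply: (frank_uniq (kbound_submod _ _) H).
apply: frank0; first exact: kbound_submod.
move=> y Zy; pose w : 'M[A]_(mr (c (- n'.+1%:Z)), 1) := (map_mx (lft piS) y)^T.
have cw := cocycleE idS Id0_eq0 cc ex gV hW w.
have bw := coboundaryE idS Id0_eq0 cc ex gV hW w.
have zw : cocycle (P := mxres idS Id0_eq0 cc ex gV) (i := n'.+1)
    (mxmap (idfun : {rmorphism A -> A}) (fun _ : 'I_1 => (1 : k) : W) w).
  apply/cw => a; rewrite mxE.
  have : map_mx pi (diff c (- n'.+2%:Z) (- n'.+1%:Z) *m w) = 0.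
    apply: (can_inj (@trmxK _ _ _)); rewrite trmx0 map_mxM trmx_mul.
    rewrite /w -map_trmx trmxK lft_mx; apply: (proj1 (kcycleE _ _) Zy); lia.
  by move/matrixP/(_ a 0); rewrite !mxE.
have dn : (d < n'.+1)%N by lia.
have [u Yu] := bw.1 (ext_vanish_finite P0 dn zw).
apply/(kboundE _ (m := n'%:Z)); first by lia.
exists (map_mx pi u)^T; rewrite /= -trmx_mul -map_mxM.
apply: (can_inj (@trmxK _ _ _)); rewrite trmxK.
have -> : y^T = map_mx pi w by rewrite /w -map_trmx lft_mx.
apply/eqP; rewrite -subr_eq0 -map_mxB; apply/eqP/matrixP => a b; rewrite ord1 [LHS]mxE [RHS]mxE.
by have := Yu a; rewrite mxE.
Qed.

End Presentation.
End Tower.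

Section Presentations.
Variables (A B : comNzRingType) (phi : {rmorphism A -> B}) (nA : noetherian A) (phiS : surjective phi).
Variables (I : A -> Prop) (kphi : forall a, phi a = 0 <-> I a).

Lemma presentation_ex (M : lmodType B) : finitely_generated M ->
  exists p w (K : 'M[A]_(w, p)) (g : 'I_p -> M), presents phi g (imD I K).
Proof.
move=> [p [g gS]].
have sX : submod (fun y : 'rV[A]_p => ev phi g y = 0).
  by split=> [|a x y x0 y0]; [rewrite ev0|rewrite evP x0 y0 scaler0 addr0].
have [w [K HK]] := submod_fg nA sX.
exists p, w, K, g; split=> [x|y].
  have [c ->] := gS x; have [c' c'E] := choice (fun i => phiS (c i)).
  exists (\row_i c' i); rewrite /ev /row_map; apply: eq_bigr => i _.
  by rewrite !mxE c'E.
split=> [/HK[z zE]|[z Iz]].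
  by exists z; rewrite zE subrr; apply: (inI0 (kphi_ideal kphi)).
rewrite -(subrK (z *m K) y) -[_ - _]scale1r evP.
have -> : ev phi g (z *m K) = 0 by apply/HK; exists z.
rewrite /ev; have /(map_phi0 kphi) -> := Iz.
by rewrite (_ : row_map g 0 = 0) ?scaler0 ?addr0 // raddf0.
Qed.

Lemma presents_restr (M : lmodType B) p (g : 'I_p -> M) Y : presents phi g Y ->
  presents (V := (restr phi M : lmodType A)) (idfun : {rmorphism A -> A}) g Y.
Proof.
have E y : ev (V := (restr phi M : lmodType A)) (idfun : {rmorphism A -> A}) g y = ev phi g y.
  by rewrite /ev /row_map; apply: eq_bigr => i _; rewrite !mxE.
by move=> [gS gE]; split=> [x|y]; [have [y <-] := gS x; exists y; rewrite E|rewrite E].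
Qed.

End Presentations.

Lemma presents_field (A B : comNzRingType) (k : fieldType) (phi : {rmorphism A -> B})
  (pi : {rmorphism B -> k}) : surjective phi -> surjective pi ->
  presents (V := (restr pi k^o : lmodType B)) phi (fun _ : 'I_1 => (1 : k))
    (fun y : 'rV[A]_1 => (pi \o phi) (y 0 0) = 0).
Proof.
move=> phiS piS.
have E (y : 'rV[A]_1) : ev (V := (restr pi k^o : lmodType B)) phi (fun _ : 'I_1 => (1 : k)) y = pi (phi (y 0 0)).
  by rewrite /ev /row_map big_ord1 mxE; apply: mulr1.
split=> [x|y]; last by rewrite E.
have [b <-] := piS x; have [a <-] := phiS b.
by exists a%:M; rewrite E mxE eqxx mulr1n.
Qed.

(** * Complete resolutions *)

Section TwoSided.
Variables (A B : comNzRingType) (k : fieldType) (phi : {rmorphism A -> B}) (pi0 : {rmorphism B -> k}).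
Local Notation pi := (pi0 \o phi : {rmorphism A -> k}).
Variables (f : nat -> A) (mm c0 : nat).
Hypotheses (nA : noetherian A) (phiS : surjective phi) (pi0S : surjective pi0)
  (unitP : forall x, pi x != 0 -> exists y, x * y = 1)
  (reg : regular f mm) (fm : forall j, (j < mm)%N -> pi (f j) = 0) (cm : (c0 <= mm)%N)
  (kphi : forall a, phi a = 0 <-> Id f c0 a).
Variables (del : nat) (van0 : ext_vanish (Id f 0) del).
Local Notation Id := (Id f).
Local Notation idI := (Id_ideal f c0).
Local Notation onec := (onec nA unitP idI).
Local Notation rightc := (rightc nA unitP idI).

Let piS : surjective pi.
Proof. by move=> x; have [b <-] := pi0S x; have [a <-] := phiS b; exists a. Qed.

Let van : ext_vanish (Id c0) del. Proof. exact: (ext_vanish_Id reg cm van0). Qed.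

Variables (M : lmodType B) (p w : nat) (K0 : 'M[A]_(w, p)) (g : 'I_p -> M).
Hypothesis gM : presents phi g (imD (Id c0) K0).
Local Notation kap := (onec (Mx K0)).
Local Notation n0 := (- del.+1%:Z).

(* A complete resolution: the minimal free resolution of [M] over [B], cut in
   degree [n0] and continued to the right. *)
Definition twosided : cpx A := rightc kap n0.

Lemma twosided_left z : z < n0 -> twosided z = kap z.
Proof. exact: rightc_lt. Qed.

Lemma twosided_complex : complex (Id c0) twosided.
Proof. by apply: rightc_complex; [apply: onec_wf|apply: onec_complex]. Qed.

(** Trading rows for columns costs [del] degrees of the resolution, and [n0] lies to the left of
    them. All columns of the continued complex, hence all rows, are then exact. *)
Lemma twosided_exr m : exr (Id c0) twosided m.
Proof.
apply: (exc_exr van twosided_complex) => {}m; apply: rightc_exc; first exact: onec_wf.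
move=> n nn; apply: (van _); first exact: onec_complex.
by move=> l ln; apply: onec_exr; lia.
Qed.

Lemma kap_presents : presents phi (g : 'I_(mr (kap (- 0%:Z))) -> M)
  (imD (Id c0) (diff kap (- 1%:Z) (- 0%:Z))).
Proof.
have -> : diff kap (- 1%:Z) (- 0%:Z) = K0 by apply: conform_mx_id.
exact: gM.
Qed.

(** Far to the left the tower over the complete resolution is the tower over the resolution of [M],
    that is a free resolution over [A], whose reduction vanishes there by finite projective
    dimension. *)
Lemma twosided_good : finite_proj_dim (restr phi M) -> good pi f c0 twosided.
Proof.
move=> [P [d P0]]; have ct := tower_complex reg cm twosided_complex.
have v0 n : kv (ckd pi f 0 (tower f c0 twosided)) n = 0%N; last first.
  have [nr nc] := tower_noeth reg fm cm twosided_complex v0.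
  by split=> //; [apply: twosided_complex|apply: twosided_exr].
apply: (kv_vanish_left reg fm piS unitP van0 ct (N := n0 - c0.*2%:Z - d%:Z - 2)) => {n} [m|n].
  by apply: (tower_exr reg cm twosided_complex (N := m)) => // l _; apply: twosided_exr.
have ck : complex (Id c0) kap by apply: onec_complex.
move=> nd; have -> : kv (ckd pi f 0 (tower f c0 twosided)) n = kv (ckd pi f 0 (tower f c0 kap)) n.
  apply: kv_local => z zn; apply: (@tower_local _ f c0 twosided kap (n0 - 1)) => [y yn|].
    by apply: twosided_left; lia.
    by lia.
apply: (kv_finite_resolution reg fm piS (P := P) (d := d)) => //.
- exact: (tower_complex reg cm ck).
- by apply: (tower_exr reg cm ck) => m m2; apply: onec_exr.
- apply: tower_presented; first by move=> z z0; rewrite onec_pos.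
  by exists g; apply: presents_restr; apply: kap_presents.
- lia.
Qed.

Lemma twosided_min_left z : z < n0 - 3 -> map_mx pi (diff twosided z (z + 1)) = 0.
Proof.
move=> zn; rewrite /diff !twosided_left; [|lia..].
by apply: (onec_min nA unitP idI); lia.
Qed.

Lemma twosided_min_right z : n0 < z -> map_mx pi (diff twosided z (z + 1)) = 0.
Proof.
move=> zn; have e : z - 2 + 1 + 1 = z by lia.
suff : map_mx pi (diff twosided (z - 2 + 1 + 1) (z - 2 + 1 + 1 + 1)) = 0 by rewrite e.
have H y : n0 <= y + 1 -> twosided (y + 1) = rnext nA unitP idI (twosided y) by apply: rightcS.
by apply: (min_rnext (H (z - 2) _) (H _ _) (H _ _)); lia.
Qed.

Lemma kv_min i (c : cpx A) n : map_mx pi (diff c (n - 1) n) = 0 -> map_mx pi (diff c n (n + 1)) = 0 ->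
  kv (ckd pi f i c) n = mr (c n).
Proof. by move=> d0 d1; rewrite /kv /= d0 d1 !mxrank0 !subn0. Qed.

(** The margin keeps away from the seam at [n0], around which minimality is not known. *)
Lemma kv_twosided z : `|n0| + 4 <= `|z| -> kv (ckd pi f c0 twosided) z = mr (twosided z).
Proof.
move=> zn; apply: kv_min.
  have [z0|z0] := leP 0 z.
    by have := @twosided_min_right (z - 1); rewrite subrK; apply; lia.
  by have := @twosided_min_left (z - 1); rewrite subrK; apply; lia.
have [z0|z0] := leP 0 z; first by apply: twosided_min_right; lia.
by apply: twosided_min_left; lia.
Qed.

(** Both differentials next to degree [- n] vanish over [k], so the unit columns form a basis of
    Ext. *)
Lemma betti_twosided n : (del + 3 < n)%N -> betti pi0 M n = mr (twosided (- n%:Z)).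
Proof.
case: n => // n nd; have ck : complex (Id c0) kap by apply: onec_complex.
have ex m : m <= - 2 -> exr (Id c0) kap m by move=> m2; apply: onec_exr.
rewrite twosided_left; last by lia.
apply: (ext_rankE (P := mxres phiS kphi ck ex kap_presents)).
apply: (has_ext_rank_extr phiS kphi ck ex kap_presents (presents_field phiS pi0S)).
have d1 : map_mx pi (diff kap (- n.+2%:Z) (- n.+2%:Z + 1)) = 0 by apply: (onec_min nA unitP idI); lia.
have d2 : map_mx pi (diff kap (- n.+2%:Z + 1) (- n.+2%:Z + 1 + 1)) = 0 by apply: (onec_min nA unitP idI); lia.
rewrite /extr; have -> : mr (kap (- n.+1%:Z)) = mr (kap (- n.+2%:Z + 1)) by congr (mr (kap _)); lia.
exists (fun j => delta_mx j 0); split.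
- move=> j a; rewrite mxE.
  have : map_mx pi (diff kap (- n.+2%:Z) (- n.+2%:Z + 1) *m delta_mx j (0 : 'I_1)) = 0.
    by rewrite map_mxM d1 mul0mx.
  by move/matrixP/(_ a 0); rewrite !mxE.
- move=> x _; exists (fun j => x j 0); exists 0; rewrite mulmx0 subr0.
  have xE : x = \sum_j x j 0 *: delta_mx j 0.
    by rewrite {1}(matrix_sum_delta x); apply: eq_bigr => j _; rewrite big_ord1.
  by rewrite [X in _ - X](_ : _ = x) ?subrr // => a; rewrite !mxE rmorph0.
- move=> cf [u Yu] j.
  have SE : \sum_l cf l *: delta_mx l (0 : 'I_1) = \col_l cf l.
    by rewrite [RHS]matrix_sum_delta; apply: eq_bigr => l _; rewrite big_ord1 mxE.
  have : map_mx pi (diff kap (- n.+2%:Z + 1) (- n.+2%:Z + 1 + 1) *m u) = 0 by rewrite map_mxM d2 mul0mx.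
  rewrite SE in Yu; move: Yu; move: (_ *m u) => Q Yu /matrixP/(_ j 0).
  rewrite [LHS]mxE [RHS]mxE => Q0.
  by have := Yu j; rewrite !mxE rmorphB Q0 subr0.
Qed.

End TwoSided.

(** * Bass numbers from a complete resolution *)

Section ExtChains.
Variables (A : comNzRingType) (k : fieldType) (pi : {rmorphism A -> k}) (f : nat -> A) (mm : nat).
Hypotheses (reg : regular f mm).
Local Notation Id := (Id f).
Local Notation idI := (Id_ideal f _).

Lemma extr_iff (c : cpx A) m p (Y Y' : 'rV[A]_p -> Prop) v : (forall y, Y y <-> Y' y) ->
  extr pi c m Y v <-> extr pi c m Y' v.
Proof. by move=> E; have -> : Y = Y' by apply/funext => y; apply/propext. Qed.

Lemma imD_kerD (I : A -> Prop) (T : cpx A) j y : ideal I -> complex I T -> exr I T j ->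
  imD I (diff T j (j + 1)) y <-> kerD I (diff T (j + 1) (j + 1 + 1)) y.
Proof.
move=> idI cT eT; split=> [[z Iz]|]; last exact: eT.
have := inIMl idI (diff T (j + 1) (j + 1 + 1)) Iz; rewrite mulmxBl -mulmxA => J.
exact: (inI_addl idI J (inIMr idI z (cT j))).
Qed.

(** Iterated [ext_shift]: by exactness of [T], the kernel of a differential is the image of the
    previous one, so each step passes to the next syzygy. *)
Lemma shift_chain (I : A -> Prop) (c T : cpx A) m j r v : ideal I -> complex I c -> complex I T ->
  (forall l, l < j -> exr I T l) -> (forall l, l <= m -> exc I c l) ->
  extr pi c m (imD I (diff T j (j + 1))) v <->
  extr pi c (m - r%:Z) (imD I (diff T (j - r%:Z) (j - r%:Z + 1))) v.
Proof.
move=> idI cc cT eT ec; elim: r => [|r IHr]; first by rewrite !subr0.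
apply: (iff_trans IHr) => {IHr}.
have -> : m - r%:Z = m - r.+1%:Z + 1 by lia.
have -> : j - r%:Z = j - r.+1%:Z + 1 by lia.
have e0 : exc I c (m - r.+1%:Z) by apply: ec; lia.
have e1 : exc I c (m - r.+1%:Z + 1) by apply: ec; lia.
apply: (iff_trans (ext_shift pi idI cc _ v e0 e1)).
by apply: extr_iff => y; apply: iff_sym; apply: imD_kerD => //; apply: eT; lia.
Qed.

(** Exactness in all degrees survives reduction modulo the regular element [f j]: if [y D = f j w],
    then [w] is a cycle, hence a boundary [v D], and [y - f j *: v] is a cycle modulo [Id j]. *)
Lemma exr_Id i i' (T : cpx A) : (i <= i')%N -> (i' <= mm)%N -> complex (Id i) T ->
  (forall m, exr (Id i) T m) -> forall m, exr (Id i') T m.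
Proof.
move=> /subnK <-; elim: (i' - i)%N => // d IHd; rewrite addSn; set j := (d + i)%N => jm cT ex m y.
have {}IHd := IHd (ltnW jm) cT ex.
have cTj : complex (Id j) T by move=> l; apply: inId_leq (cT l); rewrite leq_addl.
move=> /IdS[w Iw].
have Jw : inI (Id j) (w *m diff T (m + 1 + 1) (m + 1 + 1 + 1)).
  apply: (reg_mx reg) => //.
  have := inIB idI (inIMr idI y (cTj (m + 1))) (inIMl idI (diff T (m + 1 + 1) (m + 1 + 1 + 1)) Iw).
  by move/inI_eq; apply; rewrite mulmxBl -scalemxAl mulmxA; mxabel.
have [v Iv] := IHd (m + 1) w Jw.
have [|z Iz] := IHd m (y - f j *: v).
  have := inID idI Iw (inIZ idI (f j) Iv); move/inI_eq; apply.
  by rewrite mulmxBl -scalemxAl scalerBr; mxabel.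
by exists z; apply/IdS; exists v; move/inI_eq: Iz; apply; mxabel.
Qed.

Fixpoint gtow d i (c : cpx A) : cpx A := if d is e.+1 then gtow e i (Gc f (i + e) c) else c.

Lemma gtow_complex d i c : (i + d <= mm)%N -> complex (Id (i + d)) c -> complex (Id i) (gtow d i c).
Proof.
elim: d c => [|d IHd] c; first by rewrite addn0.
by rewrite addnS => im cc; apply: IHd; [apply: ltnW|apply: (Gc_complex reg)].
Qed.

Lemma gtow_exr d i c N : (i + d <= mm)%N -> complex (Id (i + d)) c ->
  (forall m : int, m <= N -> exr (Id (i + d)) c m) -> forall m, m <= N -> exr (Id i) (gtow d i c) m.
Proof.
elim: d c => [|d IHd] c; first by rewrite addn0.
rewrite addnS => im cc ex; apply: IHd; first exact: ltnW.
  exact: (Gc_complex reg).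
by move=> m mN; apply: (Gc_exr reg) => //; apply: ex.
Qed.

Lemma gtow_presented d i c (V : lmodType A) : (forall z : int, 0 < z -> mr (c z) = 0%N) ->
  presented V (Id (i + d)) c -> presented V (Id i) (gtow d i c).
Proof.
elim: d c => [|d IHd] c c0; first by rewrite addn0.
rewrite addnS => pc; apply: IHd; last by apply: Gc_presented => //; apply: c0.
by move=> z z0; rewrite /= !c0 //; lia.
Qed.

(** Rees' shift repeated for the last [d] elements; they are regular on an image of a differential
    of [T] since it lies in a free module. *)
Lemma rees_chain d i c (T : cpx A) m j v : (i + d <= mm)%N -> complex (Id (i + d)) c ->
  complex (Id i) T -> (forall i', (i <= i' <= mm)%N -> exr (Id i') T j) ->
  extr pi (gtow d i c) m (imD (Id i) (diff T j (j + 1))) v <->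
  extr pi c (m + d%:Z) (imD (Id (i + d)) (diff T j (j + 1))) v.
Proof.
elim: d c => [|d IHd] c; first by rewrite addn0 addr0.
rewrite addnS => im cc cT eT; set i' := (i + d)%N.
apply: (iff_trans (IHd (Gc f i' c) (ltnW im) (Gc_complex reg im cc) cT eT)).
have cT' : complex (Id i') T by move=> l; apply: inId_leq (cT l); rewrite leq_addr.
have eT' : exr (Id i') T j by apply: eT; rewrite leq_addr ltnW.
have -> : m + d.+1%:Z = m + d%:Z + 1 by lia.
apply: iff_sym; apply: (iff_trans (_ : _ <-> extr pi c (m + d%:Z + 1) (addS (f i') (imD (Id i') (diff T j (j + 1)))) v)); last first.
  apply: (@ext_rees A k pi f mm i' c (m + d%:Z) _ (imD (Id i') (diff T j (j + 1))) v) => //.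
  - exact: (imD_submod idI).
  - by move=> y Iy; exists 0; rewrite mul0mx subr0.
  - move=> y Hy; apply: (imD_kerD y idI cT' eT').2.
    have := (imD_kerD _ idI cT' eT').1 Hy; rewrite /kerD -scalemxAl; exact: (reg_mx reg im).
- apply: extr_iff => y; split=> [[z /IdS[w Iw]]|[w [z Iz]]].
    by exists w, z; move/inI_eq: Iw; apply; mxabel.
  by exists z; apply/IdS; exists w; move/inI_eq: Iz; apply; mxabel.
Qed.

End ExtChains.

Section Bass.
Variables (A B : comNzRingType) (k : fieldType) (phi : {rmorphism A -> B}) (pi0 : {rmorphism B -> k}).
Local Notation pi := (pi0 \o phi : {rmorphism A -> k}).
Variables (f : nat -> A) (mm c0 : nat).
Hypotheses (nA : noetherian A) (phiS : surjective phi) (pi0S : surjective pi0)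
  (unitP : forall x, pi x != 0 -> exists y, x * y = 1)
  (reg : regular f mm) (fm : forall j, (j < mm)%N -> pi (f j) = 0) (cm : (c0 <= mm)%N)
  (kphi : forall a, phi a = 0 <-> Id f c0 a).
Variables (del : nat) (van0 : ext_vanish (Id f 0) del).
Variable (u : A).
Hypotheses (nIu : ~ Id f mm u) (mu : forall a, pi a = 0 -> Id f mm (a * u)).
Local Notation Id := (Id f).
Local Notation idI i := (Id_ideal f i).

Let piS : surjective pi.
Proof. by move=> x; have [b <-] := pi0S x; have [a <-] := phiS b; exists a. Qed.

Let Im x : Id mm x -> pi x = 0.
Proof.
move=> Ix; have : map_mx pi (x%:M : 'M_1) = 0.
  by apply: (Id_pi fm (leqnn mm)) => i j; rewrite !ord1 mxE eqxx.
by move/matrixP/(_ 0 0); rewrite !mxE eqxx.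
Qed.

Variables (w0 : nat) (M0 : 'M[A]_(w0, 1)).
Hypotheses (M00 : map_mx pi M0 = 0)
  (genM : forall x, pi x = 0 -> exists y : 'rV_w0, Id mm (x - (y *m M0) 0 0)).
Local Notation kk := (onec nA unitP (idI mm) (Mx M0)).
Local Notation d := (mm - c0)%N.
Local Notation kkc := (gtow f d c0 kk).

Let cd : (c0 + d)%N = mm. Proof. by rewrite subnKC. Qed.

Lemma kk_presented : presented (restr pi k^o) (Id mm) kk.
Proof.
exists (fun _ : 'I_1 => (1 : k)).
have E (y : 'rV[A]_1) : ev (V := (restr pi k^o : lmodType A)) (idfun : {rmorphism A -> A})
    (fun _ : 'I_1 => (1 : k)) y = pi (y 0 0).
  by rewrite /ev /row_map big_ord1 mxE; apply: mulr1.
split=> [x|y].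
  by have [a aE] := piS x; exists a%:M; rewrite E mxE eqxx mulr1n.
have -> : diff kk (- 1%:Z) (- 0%:Z) = M0 by apply: conform_mx_id.
rewrite E; split=> [/genM[z Iz]|[z Iz]].
  by exists z => a b; rewrite !ord1 !mxE; move: Iz; rewrite mxE.
have := Im (Iz 0 0); rewrite [X in pi X]mxE [X in pi (_ + X)]mxE rmorphB => /eqP.
have : map_mx pi (z *m M0) = 0 by rewrite map_mxM M00 mulmx0.
by move/matrixP/(_ 0 0); rewrite [LHS]mxE [RHS]mxE => ->; rewrite subr0 => /eqP.
Qed.

Let kk_complex : complex (Id mm) kk. Proof. exact: onec_complex. Qed.

Lemma kkc_complex : complex (Id c0) kkc.
Proof. by apply: (gtow_complex reg); rewrite cd. Qed.

Lemma kkc_exr m : m <= - 2 -> exr (Id c0) kkc m.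
Proof.
apply: (gtow_exr reg (N := -2)); rewrite cd // => l l2; exact: onec_exr.
Qed.

Lemma kkc_presents : exists g : 'I_(mr (kkc (- 0%:Z))) -> restr pi0 k^o,
  presents phi g (imD (Id c0) (diff kkc (- 1%:Z) (- 0%:Z))).
Proof.
have pk : presented (restr pi k^o) (Id (c0 + d)) kk by rewrite cd; apply: kk_presented.
have [g [gS gE]] : presented (restr pi k^o) (Id c0) kkc.
  by apply: gtow_presented pk => z z0; rewrite onec_pos.
have E y : ev (V := (restr pi k^o : lmodType A)) (idfun : {rmorphism A -> A}) g y =
    ev (V := (restr pi0 k^o : lmodType B)) phi g y.
  by rewrite /ev /row_map; apply: eq_bigr => i _; rewrite !mxE.
by exists g; split=> [x|y]; [have [y <-] := gS x; exists y; rewrite E|rewrite -E].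
Qed.

Let vanm : ext_vanish (Id mm) del. Proof. exact: (ext_vanish_Id reg (leqnn mm) van0). Qed.

(** Modulo the maximal regular sequence no degree is lost, so the chain of shifts can descend to
    Ext^1. *)
Lemma kk_exc m : m <= - 2 -> exc (Id mm) kk m.
Proof.
apply: (self_injective nA piS unitP (idI mm) vanm nIu mu (m := -2)) => //; first exact: onec_wf.
by move=> l l2; apply: onec_exr.
Qed.

Lemma kkc_exc m : m <= - del%:Z - 2 -> exc (Id c0) kkc m.
Proof.
move=> ml; apply: (ext_vanish_Id reg cm van0 kkc_complex) => l ll; apply: kkc_exr; lia.
Qed.

Variables (T : cpx A) (cT : complex (Id c0) T)
  (exT : forall i, (c0 <= i <= mm)%N -> forall m, exr (Id i) T m).

Lemma extr_last j : map_mx pi (diff T (j + 1 + 1) (j + 1 + 1 + 1)) = 0 ->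
  map_mx pi (diff T (j + 1 + 1 + 1) (j + 1 + 1 + 1 + 1)) = 0 ->
  extr pi kk (- 2) (imD (Id mm) (diff T j (j + 1))) (mr (T (j + 1 + 1 + 1))).
Proof.
move=> m2 m3; have cTm : complex (Id mm) T by move=> l; exact: (inId_leq cm (@cT l)).
have eTm m : exr (Id mm) T m by apply: exT; rewrite cm leqnn.
apply/(extr_iff pi kk (- 2) (mr (T (j + 1 + 1 + 1))) (fun y => imD_kerD y (idI mm) cTm (eTm j))).
have soc := socle_gen nA piS unitP (idI mm) vanm nIu mu.
have uu a : Id mm (a * u) -> pi a = 0 by rewrite mulrC; apply: (socle_coef unitP (idI mm) nIu).
have dM0 : diff kk (- 2 + 1) (- 2 + 1 + 1) = M0 by apply: conform_mx_id.
apply: (@ext1_minimal A k pi (Id mm) (idI mm) u uu mu soc _ _ _ _ _ _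
  (diff kk (- 2) (- 2 + 1)) (diff kk (- 2 + 1) (- 2 + 1 + 1)) (diff T (j + 1) (j + 1 + 1))
  (diff T (j + 1 + 1) (j + 1 + 1 + 1)) (diff T (j + 1 + 1 + 1) (j + 1 + 1 + 1 + 1))) => //.
- exact: (kk_exc (m := - 2)).
- by rewrite dM0.
- by move=> x /genM[y Iy]; exists y; rewrite dM0.
- exact: (eTm (j + 1)).
- exact: (eTm (j + 1 + 1)).
Qed.

Variables (M : lmodType B) (kap : cpx A) (n0 : int) (g : 'I_(mr (kap (- 0%:Z))) -> M).
Hypotheses (ck : complex (Id c0) kap) (ek : forall m, m <= - 2 -> exr (Id c0) kap m)
  (gM : presents phi g (imD (Id c0) (diff kap (- 1%:Z) (- 0%:Z))))
  (Tk : forall z, z < n0 -> T z = kap z)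
  (minT : forall z, n0 < z -> map_mx pi (diff T z (z + 1)) = 0).

(** [M] is replaced by a syzygy so far left that [T] and its resolution agree; the last [d] regular
    elements are divided out; then the shift is run back to the right along [T] until Ext^1 over the
    ring of depth zero is left. *)
Lemma bass_complete n : n0 + mm%:Z < n%:Z -> (del + mm + 3 < n)%N ->
  bass pi0 M n = mr (T (n%:Z - d%:Z + 1)).
Proof.
case: n => // n nn nd; have [h hk] := kkc_presents.
apply: (ext_rankE (P := mxres phiS kphi kkc_complex kkc_exr hk)).
apply: (has_ext_rank_extr phiS kphi kkc_complex kkc_exr hk gM).
(* [r] reaches below [n0], [q] leaves cohomological degree one, and [j] is the degree then reached
   in [T], three below the rank read off by [extr_last]. *)
pose r := (`|n0| + 3)%N; pose q := (n + r - d)%N; pose j : int := n.+1%:Z - d%:Z - 2.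
have e1' l : l < - 1%:Z -> exr (Id c0) kap l by move=> l1; apply: ek; lia.
have e2' l : l <= - n.+2%:Z -> exc (Id c0) kkc l by move=> ll; apply: kkc_exc; lia.
have S1 := shift_chain pi r (mr (T (n.+1%:Z - d%:Z + 1))) (idI c0) kkc_complex ck e1' e2'.
have E0 : - 1%:Z + 1 = - 0%:Z :> int by [].
rewrite E0 in S1; apply/S1 => {S1 e1' e2'}.
rewrite /diff -!Tk; [|rewrite /r; lia..]; rewrite -/(diff T _ _).
apply/(@rees_chain A k pi f mm reg d c0 kk T (- n.+2%:Z - r%:Z) (- 1%:Z - r%:Z)) => //; try by rewrite cd.
  by move=> i' ii'; apply: exT.
rewrite cd.
have cTm : complex (Id mm) T by move=> l; exact: (inId_leq cm (@cT l)).
have H := @shift_chain A k pi (Id mm) kk T (- 2) j q (mr (T (j + 1 + 1 + 1))) (idI mm) kk_complex cTm.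
have eTm l : l < j -> exr (Id mm) T l by move=> _; apply: exT; rewrite cm leqnn.
have {}H := H eTm kk_exc.
have e1 : - 2 - q%:Z = - n.+2%:Z - r%:Z + d%:Z by rewrite /q /r; lia.
have e2 : j - q%:Z = - 1%:Z - r%:Z by rewrite /j /q /r; lia.
have e3 : n.+1%:Z - d%:Z + 1 = j + 1 + 1 + 1 by rewrite /j; lia.
rewrite e3 -e1 -e2; apply/H.
by apply: extr_last; apply: minT; rewrite /j; lia.
Qed.

End Bass.

(** * Leading terms of sums and of rescaled polynomials *)

Definition same_lead (P Q : {poly rat}) := size P = size Q /\ lead_coef P = lead_coef Q.

(** Far to the right a polynomial has the sign of its leading coefficient; nonnegativity excludes
    cancellation in the sums below. *)
Lemma lead_coef_ge0 (P : {poly rat}) (v : nat -> nat) : epoly v P -> 0 <= lead_coef P.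
Proof.
move=> [N vP]; rewrite leNgt; apply/negP => l0.
have mP : (lead_coef P)^-1 *: P \is monic by rewrite monicE lead_coefZ mulVf // lt_eqF.
have [b Hb] := monic_Cauchy_bound mP.
pose j := (N + Num.bound `|b|)%N.
have jb : b <= j%:R.
  apply: le_trans (ler_norm b) _; apply: ltW; apply: lt_le_trans (archi_boundP (normr_ge0 b)) _.
  by rewrite ler_nat leq_addl.
have := Hb j%:R jb; rewrite hornerZ -vP ?leq_addr // => H.
have : (lead_coef P)^-1 * (v j)%:R <= 0 by apply: mulr_le0_ge0; [rewrite invr_le0 ltW|rewrite ler0n].
by rewrite leNgt H.
Qed.

Lemma size_lead_add (P Q : {poly rat}) : 0 <= lead_coef P -> 0 <= lead_coef Q ->
  size (P + Q) = maxn (size P) (size Q) /\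
  lead_coef (P + Q) = (if (size P < size Q)%N then lead_coef Q else
                       if (size Q < size P)%N then lead_coef P else lead_coef P + lead_coef Q).
Proof.
move=> P0 Q0; case: ltngtP => [PQ|QP|PQ].
- by rewrite addrC size_polyDl ?lead_coefDl // (maxn_idPr (ltnW PQ)).
- by rewrite size_polyDl ?lead_coefDl // (maxn_idPl (ltnW QP)).
case sP : (size P) => [|n].
  have /eqP -> : P == 0 by rewrite -size_poly_eq0 sP.
  have /eqP -> : Q == 0 by rewrite -size_poly_eq0 -PQ sP.
  by rewrite addr0 size_poly0 lead_coef0 addr0.
have lPQ : (P + Q)`_n = lead_coef P + lead_coef Q by rewrite coefD !lead_coefE -PQ sP.
have l0 : (P + Q)`_n != 0.
  rewrite lPQ gt_eqF // ltr_wpDr // lt_neqAle P0 andbT eq_sym lead_coef_eq0.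
  by rewrite -size_poly_eq0 sP.
have sPQ : size (P + Q) = n.+1.
  apply/eqP; rewrite eqn_leq; apply/andP; split.
    by apply: leq_trans (size_polyD _ _) _; rewrite -PQ sP maxnn.
  by rewrite ltnNge; apply/negP => /leq_sizeP/(_ n (leqnn n)); apply/eqP.
by rewrite sPQ; split=> //; rewrite lead_coefE sPQ.
Qed.

Lemma same_lead_add P P' Q Q' : 0 <= lead_coef P -> 0 <= lead_coef Q ->
  same_lead P P' -> same_lead Q Q' -> same_lead (P + Q) (P' + Q').
Proof.
move=> P0 Q0 [sP lP] [sQ lQ]; have [s1 l1] := size_lead_add P0 Q0.
rewrite lP in P0; rewrite lQ in Q0; have [s2 l2] := size_lead_add P0 Q0.
by split; rewrite ?s1 ?s2 ?l1 ?l2 sP sQ ?lP ?lQ.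
Qed.

(** Without cancellation each sum has the size of its summands and twice their leading
    coefficient. *)
Lemma same_lead_half P P' Q Q' : 0 <= lead_coef P -> 0 <= lead_coef Q ->
  same_lead P P' -> same_lead Q Q' -> same_lead (P + P') (Q + Q') -> same_lead P Q.
Proof.
move=> P0 Q0 [sP lP] [sQ lQ].
have P0' : 0 <= lead_coef P' by rewrite -lP. have Q0' : 0 <= lead_coef Q' by rewrite -lQ.
have [s1 l1] := size_lead_add P0 P0'; have [s2 l2] := size_lead_add Q0 Q0'.
rewrite /same_lead s1 s2 l1 l2 -sP -sQ !maxnn !ltnn -lP -lQ => -[-> ll]; split=> //.
by lra.
Qed.

(** Passes from the index [j] in a parity class to the degree [n]: [j] is [n/2] for even and
    [n/2 - 1/2] for odd [n]. *)
Definition halve (P : {poly rat}) c := P \Po ((2^-1)%:P * 'X + c%:P).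

Lemma halveE P c x : (halve P c).[x] = P.[2^-1 * x + c].
Proof. by rewrite horner_comp !hornerE. Qed.

Lemma size_halve P c : size (halve P c) = size P /\
  lead_coef (halve P c) = lead_coef P * 2^-1 ^+ (size P).-1.
Proof.
have s2 : size ((2^-1)%:P * 'X + c%:P : {poly rat}) = 2%N.
  by rewrite size_MXaddC polyC_eq0 invr_eq0 pnatr_eq0 /= size_polyC invr_eq0 pnatr_eq0.
split; first by rewrite size_comp_poly2.
rewrite lead_coef_comp ?s2 //; congr (_ * _ ^+ _).
by rewrite lead_coefE s2 /= coefD coefMX !coefC /= addr0.
Qed.

Lemma same_lead_halve P Q c c' : same_lead P Q -> same_lead (halve P c) (halve Q c').
Proof.
move=> [sPQ lPQ]; have [s1 l1] := size_halve P c; have [s2 l2] := size_halve Q c'.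
by split; rewrite ?s1 ?s2 ?l1 ?l2 ?lPQ ?sPQ.
Qed.

Lemma same_lead_shift P Q c : same_lead P Q -> same_lead (P \Po ('X + c%:P)) (Q \Po ('X + c%:P)).
Proof. by move=> [sPQ lPQ]; rewrite /same_lead !size_poly_shift !lead_poly_shift. Qed.

Lemma quasi_poly_parity (v : nat -> nat) Pe Po N :
  (forall j, (N <= j)%N -> (v j.*2)%:R = Pe.[j%:R]) ->
  (forall j, (N <= j)%N -> (v j.*2.+1)%:R = Po.[j%:R]) ->
  forall i, (N.*2.+1 <= i)%N ->
    (v i)%:R = (if odd i then halve Po (- 2^-1) else halve Pe 0).[i%:R].
Proof.
move=> He Ho i Ni; have iE := odd_double_half i; have Nh : (N <= i./2)%N by lia.
have E : i%:R = (odd i)%:R + i./2%:R * 2 :> rat by rewrite -[in LHS]iE natrD -muln2 natrM.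
have vE : v i = v (odd i + i./2.*2)%N by rewrite iE.
rewrite vE; case: (odd i) E => /= E; rewrite halveE E.
  by rewrite add1n Ho //; congr (_.[_]); lra.
by rewrite add0n He //; congr (_.[_]); lra.
Qed.

(** Bass numbers are read at [i.+1 - d]: the polynomials are translated by [1 - d], and the parities
    are exchanged when [d] is even. *)
Lemma quasi_poly_models (v v' bet bas : nat -> nat) d Pe Po Qe Qo N :
  (forall j, (N <= j)%N -> (v j.*2)%:R = Pe.[j%:R]) ->
  (forall j, (N <= j)%N -> (v j.*2.+1)%:R = Po.[j%:R]) ->
  (forall j, (N <= j)%N -> (v' j.*2)%:R = Qe.[j%:R]) ->
  (forall j, (N <= j)%N -> (v' j.*2.+1)%:R = Qo.[j%:R]) ->
  same_lead Pe Po -> same_lead Qe Qo -> same_lead (Pe + Po) (Qe + Qo) ->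
  (forall i, (N <= i)%N -> bet i = v' i) -> (forall i, (N <= i)%N -> bas i = v (i.+1 - d)%N) ->
  exists qbetti qbass : quasi_poly2, [/\ eventually_modeled bet qbetti,
    eventually_modeled bas qbass & leading_term qbetti = leading_term qbass].
Proof.
move=> Pe1 Po1 Qe1 Qo1 sP sQ sPQ betE basE.
have lPe : 0 <= lead_coef Pe by apply: (lead_coef_ge0 (v := fun j => v j.*2)); exists N.
have lQe : 0 <= lead_coef Qe by apply: (lead_coef_ge0 (v := fun j => v' j.*2)); exists N.
have PQ := same_lead_half lPe lQe sP sQ sPQ.
have [s1 l1] := same_lead_halve 0 (- 2^-1) sQ.
pose q1 := QuasiPoly2 s1 l1.
pose R0 := halve Pe 0; pose R1 := halve Po (- 2^-1).
have sR : same_lead R0 R1 := same_lead_halve 0 (- 2^-1) sP.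
have sR' : same_lead R1 R0 by case: sR => *; split.
pose X' : {poly rat} := 'X + (1 - d%:R)%:P.
pose S0 := (if odd d then R0 else R1) \Po X'; pose S1 := (if odd d then R1 else R0) \Po X'.
have [s2 l2] : same_lead S0 S1 by apply: same_lead_shift; case: (odd d).
pose q2 := QuasiPoly2 s2 l2.
have [sS lS] : same_lead S0 (halve Qe 0).
  have : same_lead (if odd d then R0 else R1) (halve Qe 0).
    case: (odd d); first exact: same_lead_halve.
    by case: sR => s3 l3; have [s4 l4] := same_lead_halve 0 0 PQ; rewrite /same_lead -s3 -l3.
  by rewrite /same_lead size_poly_shift lead_poly_shift.
exists q1, q2; split.
- exists (N + N.*2.+1)%N => i Ni; rewrite betE ?(leq_trans (leq_addr _ _) Ni) //.
  by rewrite (quasi_poly_parity Qe1 Qo1) ?(leq_trans (leq_addl _ _) Ni) //=; case: (odd i).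
- exists (N + N.*2.+1 + d)%N => i Ni; rewrite basE; last by lia.
  rewrite (quasi_poly_parity Pe1 Po1); last by lia.
  have -> : odd (i.+1 - d) = (odd i == odd d) by rewrite oddB /=; [case: (odd i); case: (odd d)|lia].
  have -> : (i.+1 - d)%N%:R = i%:R + (1 - d%:R) :> rat by rewrite natrB ?natr1 -?natr1 ?addrA //; lia.
  rewrite /q2 /= /S0 /S1 /R0 /R1; case: (odd i); case: (odd d) => /=;
    by rewrite [RHS]horner_comp /X' hornerD hornerX hornerC.
- by rewrite /leading_term /= sS lS.
Qed.

(** Here [a] is the length of an image and [l * b] that of a free module. Odd ranks come from the
    even part of [a] and even ranks from its translate, each added to the odd part of [a];
    translation keeps the leading term. *)
Lemma same_lead_lengths (a b : nat -> nat) l Pe Po N : (0 < l)%N ->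
  (forall n, (N <= n)%N -> a n + a n.+1 = l * b n.+1)%N ->
  (forall j, (N <= j)%N -> (b j.*2)%:R = Pe.[j%:R]) ->
  (forall j, (N <= j)%N -> (b j.*2.+1)%:R = Po.[j%:R]) -> same_lead Pe Po.
Proof.
move=> l0 ab He Ho.
have [Ae [N' AeE]] : exists P, epoly (fun j => a j.*2) P.
  apply: (@epoly_rec (fun j => a j.*2) (fun j => l * b j.*2.+1)%N (fun j => l * b j.*2)%N N
    (l%:R *: Po) (l%:R *: Pe)).
  - move=> j Nj; rewrite doubleS; have := ab j.*2 _; have := ab j.*2.+1 _; lia.
  - by exists N => j Nj; rewrite natrM Ho // hornerZ.
  - by exists N => j Nj; rewrite natrM He // hornerZ.
pose Ao := l%:R *: Po - Ae.
have AoE : epoly (fun j => a j.*2.+1) Ao.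
  exists (N + N')%N => j Nj; rewrite hornerD hornerN hornerZ -Ho -?AeE; [|lia..].
  have := ab j.*2 _; move=> /(_ ltac:(lia))/(congr1 (fun n => n%:R : rat)).
  by rewrite natrD natrM => <-; rewrite addrAC subrr add0r.
have lAe : 0 <= lead_coef Ae by apply: (lead_coef_ge0 (v := fun j => a j.*2)); exists N'.
have lAo := lead_coef_ge0 AoE.
have E1 : l%:R *: Po = Ao + Ae by rewrite subrK.
have E2 : l%:R *: (Pe \Po ('X + 1%:P)) = Ao + (Ae \Po ('X + 1%:P)).
  apply: (@poly_eq_nat _ _ (N + N')) => j Nj.
  rewrite /Ao !(hornerD, hornerN, hornerZ, horner_comp, hornerX, hornerC).
  rewrite natr1 -He -?Ho -?AeE; [|lia..].
  have := ab j.*2 _; move=> /(_ ltac:(lia))/(congr1 (fun n => n%:R : rat)).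
  have := ab j.*2.+1 _; move=> /(_ ltac:(lia))/(congr1 (fun n => n%:R : rat)).
  by rewrite doubleS !natrD !natrM; lra.
have sA : same_lead Ae (Ae \Po ('X + 1%:P)) by rewrite /same_lead size_poly_shift lead_poly_shift.
have [sE lE] := same_lead_add lAo lAe (conj erefl erefl : same_lead Ao Ao) sA.
have ln0 : l%:R != 0 :> rat by rewrite pnatr_eq0 -lt0n.
move: sE lE; rewrite -E1 -E2 !size_scale // !lead_coefZ size_poly_shift lead_poly_shift => sE /(mulfI ln0) lE.
by split; rewrite ?sE ?lE.
Qed.

(** * Assembly *)

Lemma betti_bass_models (A B : comNzRingType) (k : fieldType) (phi : {rmorphism A -> B})
    (pi : {rmorphism B -> k}) (f : nat -> A) (mm c0 : nat) (u : A) (del : nat) (M : lmodType B) :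
  noetherian A -> surjective phi -> surjective pi ->
  (forall x, pi (phi x) != 0 -> exists y, x * y = 1) ->
  regular f mm -> (forall j, (j < mm)%N -> pi (phi (f j)) = 0) -> (c0 <= mm)%N ->
  ~ Id f mm u -> (forall a, pi (phi a) = 0 -> Id f mm (a * u)) ->
  (forall a, phi a = 0 <-> Id f c0 a) -> ~ Id f c0 1 -> ext_vanish (Id f 0) del ->
  finitely_generated M -> finite_proj_dim (restr phi M) ->
  exists qbetti qbass : quasi_poly2, [/\ eventually_modeled (betti pi M) qbetti,
    eventually_modeled (bass pi M) qbass & leading_term qbetti = leading_term qbass].
Proof.
move=> nA phiS piS unitP reg fm cm nIu mu kphi I1 van0 fgM pdM.
pose p0 : {rmorphism A -> k} := pi \o phi.
have p0S : surjective p0 by move=> x; have [b <-] := piS x; have [a <-] := phiS b; exists a.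
have {}fm : forall j, (j < mm)%N -> p0 (f j) = 0 by exact: fm.
have {}unitP : forall x, p0 x != 0 -> exists y, x * y = 1 by exact: unitP.
have {}mu : forall a, p0 a = 0 -> Id f mm (a * u) by exact: mu.
have Im x : Id f mm x -> p0 x = 0.
  move=> Ix; have : map_mx p0 (x%:M : 'M_1) = 0.
    by apply: (Id_pi fm (leqnn mm)) => // i j; rewrite !ord1 mxE eqxx.
  by move/matrixP/(_ 0 0); rewrite !mxE eqxx.
have [p [w [K0 [g gM]]]] := presentation_ex nA phiS kphi fgM.
have [w0 [M0 [M00 genM]]] := res_field_ex p0 nA (Id_ideal f mm).
pose T := twosided f c0 nA unitP del K0.
have gT : good p0 f c0 T := twosided_good nA phiS piS unitP reg fm cm van0 gM pdM.
have [cT eT nr nc] := gT; have KP := good_kdP reg fm cm gT.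
have exT i : (c0 <= i <= mm)%N -> forall m, exr (Id f i) T m.
  by move=> /andP[ci im]; apply: (exr_Id reg ci im cT eT).
have [bE baE] : (forall n, (del + 3 < n)%N -> betti pi M n = mr (T (- n%:Z))) /\
    (forall n : nat, - del.+1%:Z + mm%:Z < n%:Z -> (del + mm + 3 < n)%N ->
       bass pi M n = mr (T (n%:Z - (mm - c0)%N%:Z + 1))).
  split=> n; first exact: (betti_twosided nA phiS piS unitP cm kphi gM).
  apply: (bass_complete nA phiS piS unitP reg fm cm kphi van0 nIu mu M00 genM cT exT
    (kap := onec nA unitP (Id_ideal f c0) (Mx K0))).
  - exact: onec_complex.
  - by move=> m m2; apply: onec_exr.
  - exact: (kap_presents nA unitP gM).
  - by move=> z zn; apply: twosided_left.
  - by move=> z zn; apply: (twosided_min_right f nA unitP cm K0).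
have kvT z : `|(- del.+1%:Z : int)| + 4 <= `|z| -> kv (ckd p0 f c0 T) z = mr (T z).
  by move=> zn; apply: (kv_twosided f nA unitP cm K0).
have [[Pe [N1 HPe]] [Po [N2 HPo]]] := hilbert_serre (kgmod 0 KP) (fun l => frank_spread 0 l KP) (@nr 0).
have KP' := ktrP KP.
have [[Qe [N3 HQe]] [Qo [N4 HQo]]] := hilbert_serre (kgmod 0 KP') (fun l => frank_spread 0 l KP') (@nc 0).
pose N := (N1 + N2 + N3 + N4 + del + mm + 9)%N.
pose v l := mr (T l%:Z); pose v' l := mr (T (- l%:Z)).
have Pe1 j : (N <= j)%N -> (v j.*2)%:R = Pe.[j%:R].
  by move=> Nj; rewrite -HPe ?add0r ?kvT //; lia.
have Po1 j : (N <= j)%N -> (v j.*2.+1)%:R = Po.[j%:R].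
  by move=> Nj; rewrite -HPo ?add0r ?kvT //; lia.
have Qe1 j : (N <= j)%N -> (v' j.*2)%:R = Qe.[j%:R].
  by move=> Nj; rewrite -HQe ?add0r ?kv_tr ?kvT //; lia.
have Qo1 j : (N <= j)%N -> (v' j.*2.+1)%:R = Qo.[j%:R].
  by move=> Nj; rewrite -HQo ?add0r ?kv_tr ?kvT //; lia.
have [l l0 [lam Hlam]] := rank_function nA (Id_ideal f c0) I1.
(* The length at a minimal prime of the image of the differential leaving degree [z]; by exactness
   the cokernel of that differential has length [a (z + 1)]. *)
pose a z := lam _ (fun y : 'rV_(mr (T z)) => inI (Id f c0) (y *m diff T z (z + 1))).
have aE z : (a z + a (z + 1)%R = l * mr (T (z + 1)%R))%N.
  rewrite -(Hlam _ _ (diff T z (z + 1))); congr (_ + lam _ _)%N.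
  apply/funext => y; apply/propext; apply: iff_sym.
  exact: (imD_kerD y (Id_ideal f c0) cT (eT z)).
have sP : same_lead Pe Po.
  apply: (same_lead_lengths (a := fun n => a n%:Z) (b := v) l0 (N := N)) => // n Nn.
  have -> : n.+1%:Z = n%:Z + 1 by lia.
  by rewrite aE /v; congr (_ * mr (T _))%N; lia.
have sQ : same_lead Qe Qo.
  apply: (same_lead_lengths (a := fun n => a (- n%:Z + 1 - 1 - 1)) (b := fun n => v' n) l0 (N := N)) => // n Nn.
  have := aE (- n.+1%:Z - 1); rewrite subrK /v' => <-; rewrite addnC; congr (a _ + a _)%N; lia.
have sPQ : same_lead (Pe + Po) (Qe + Qo).
  (* With [w = 0] the pairs on the left are the degrees [- 2j] and [- 2j - 1], the Betti numbers of
     index [2j] and [2j + 1]. *)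
  apply: (same_leading reg fm p0S unitP cm (w := 0) (N := N) gT) => j Nj; rewrite hornerD natrD.
    by rewrite -Pe1 // -Po1 // !kvT //; lia.
  rewrite -Qe1 // -Qo1 // !kvT /v'; [|lia..].
  by congr ((mr (T _))%:R + (mr (T _))%:R); lia.
apply: (quasi_poly_models (v := v) (v' := v') (d := (mm - c0)%N) (N := N) Pe1 Po1 Qe1 Qo1 sP sQ sPQ) => i Ni.
  by rewrite bE //; lia.
by rewrite baE /v; [congr (mr (T _)); lia|lia..].
Qed.

Theorem corollary2 (A B : comNzRingType) (k : fieldType)
    (phi : {rmorphism A -> B}) (pi : {rmorphism B -> k})
    (M : lmodType B) (s : seq A) :
  noetherian A -> local_ring A ->
  noetherian B -> local_ring B ->
  surjective phi -> surjective pi ->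
  regular_sequence s ->
  (forall a : A, phi a = 0%R <-> in_ideal_gen s a) ->
  finitely_generated M ->
  finite_proj_dim (restr phi M) ->
  gorenstein_local A ->
  exists qbetti qbass : quasi_poly2,
    [/\ eventually_modeled (betti pi M) qbetti,
        eventually_modeled (bass pi M) qbass
      & leading_term qbetti = leading_term qbass].
Proof.
move=> nA lA _ _ phiS piS regs kphi fgM pdM [_ _ [E [del E0]]].
pose p0 : {rmorphism A -> k} := pi \o phi.
have p0S : surjective p0 by move=> x; have [b <-] := piS x; have [a <-] := phiS b; exists a.
have unitP : forall x, p0 x != 0 -> exists y, x * y = 1 := local_unit nA lA p0S.
(* The first [size s] members of the maximal regular sequence generate the kernel of [phi]; the
   others serve to reach depth zero. *)
have [f [mm [cm fs reg fm [u nIu mu]]]] := maximal_regular nA lA p0S regs.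
have IdE a : in_ideal_gen s a <-> Id f (size s) a.
  apply: (iff_trans (in_ideal_genE s a)); split; apply: Id_ext => j js; last exact: fs.
  by rewrite fs.
have Id00 : Id f 0 = Id (fun=> 0) 0.
  apply/funext => x; apply/propext; split=> -[C ->]; exists C; by rewrite !big_ord0.
apply: (betti_bass_models (f := f) (mm := mm) (c0 := size s) (u := u) (del := del)) => //.
- by move=> a; apply: iff_trans (kphi a) (IdE a).
- by move=> /IdE; case: regs.
- by rewrite Id00; apply: (ext_vanish_injdim E0).
Qed.
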